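(* Let $0<\sigma<\alpha+1$, $\alpha\ge-1/2$, $a\ge 1$ and $1\le p,q,s\le\infty$. Define $u_j(r)=r^{aj}$ for $r\in(0,\infty)$, $j=0,1,\dots$. Then there exists a constant $C$ depending only on $\sigma$ and $\alpha$ such that $$\Big\|\Big(\sum_{j=0}^\infty|u_j(L_{\alpha+aj})^{-\sigma}(u_j^{-1}f_j)|^s\Big)^{1/s}\Big\|_{L^q((0,\infty),d\mu_\alpha)}\le C\Big\|\Big(\sum_{j=0}^\infty|f_j|^s\Big)^{1/s}\Big\|_{L^p((0,\infty),d\mu_\alpha)}$$ for all $f_j\in L^p((0,\infty),d\mu_\alpha)$, if and only if $p$ and $q$ satisfy $$\frac1p-\frac{\sigma}{\alpha+1}\le\frac1q<\frac1p+\frac{\sigma}{\alpha+1},$$ with exclusion of the cases $p=1$ and $q=\frac{\alpha+1}{\alpha+1-\sigma}$, and $p=\frac{\alpha+1}{\sigma}$ and $q=\infty$.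
   Context: For $s=\infty$ the $\ell^s$ sum is replaced by the supremum over $j$; $1/\infty=0$. For $\beta\ge-1/2$ put $d\mu_\beta(r)=r^{2\beta+1}dr$ on $(0,\infty)$. The Laguerre functions of convolution type are $$\psi_k^\beta(r)=\Big(\frac{2\Gamma(k+1)}{\Gamma(k+\beta+1)}\Big)^{1/2}L_k^\beta(r^2)e^{-r^2/2},\qquad r>0,\ k=0,1,2,\dots,$$ where $L_k^\beta$ is the Laguerre polynomial of degree $k$ and order $\beta$. They form an orthonormal basis of $L^2((0,\infty),d\mu_\beta)$ and are eigenfunctions of $L_\beta=-\frac{d^2}{dr^2}+r^2-\frac{2\beta+1}{r}\frac{d}{dr}$ with eigenvalues $4k+2\beta+2$. For $\sigma>0$ the fractional integral is $$(L_\beta)^{-\sigma}f=\sum_{m=0}^\infty(4m+2\beta+2)^{-\sigma}\Big(\int_0^\infty f\psi_m^\beta\,d\mu_\beta\Big)\psi_m^\beta.$$ It coincides on $L^2((0,\infty),d\mu_\beta)$ with the integral operator $f\mapsto\int_0^\infty\mathcal{H}_{\beta,\sigma}(r,s)f(s)\,d\mu_\beta(s)$, where $$\mathcal{H}_{\beta,\sigma}(r,s)=\frac1{\Gamma(\sigma)}\int_0^\infty G_{\beta,t}(r,s)t^{\sigma-1}dt,\qquad G_{\beta,t}(r,s)=\sum_{m=0}^\infty e^{-t(4m+2\beta+2)}\psi_m^\beta(r)\psi_m^\beta(s),$$ and on functions outside $L^2$ the operator $(L_\beta)^{-\sigma}$ is understood as this integral operator.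
   Formalization: The constant C may depend on p and q as well as on σ and α (it is uniform in a, s and f_j); a C depending only on σ and α is impossible, as letting p tend to 1 on the line 1/q = 1/p − σ/(α+1) would give the excluded endpoint. *)

(* Defs.v *)
From HB Require Import structures.
From mathcomp Require Import all_boot all_order all_algebra.
From mathcomp Require Import all_classical all_reals all_analysis.
From mathcomp Require Import measurable_realfun.

Set Implicit Arguments.
Unset Strict Implicit.
Unset Printing Implicit Defensive.

Import Order.TTheory GRing.Theory Num.Theory.
Import numFieldNormedType.Exports.

Local Open Scope classical_set_scope.
Local Open Scope ring_scope.

(* dmu_b(r) = r^(2b+1) dr on (0,+oo), seen as a measure on the whole line that
   vanishes on (-oo,0]; values of functions outside (0,+oo) are thus
   immaterial below. *)
Definition mu_lag {R : realType} (b : R) : set R -> \bar R := fun A =>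
  (\int[lebesgue_measure]_(r in A `&` `]0%R, +oo[) (r `^ (2 * b + 1))%:E)%E.

Section mu_lag_measure.
Context {R : realType}.
Variable b : R.

Let mu_lag0 : mu_lag b set0 = 0%E.
Proof. by rewrite /mu_lag set0I integral_set0. Qed.

Let mu_lag_ge0 A : (0 <= mu_lag b A)%E.
Proof. by apply: integral_ge0 => x _; rewrite lee_fin powR_ge0. Qed.

Let mu_lag_sigma_additive : semi_sigma_additive (mu_lag b).
Proof.
move=> F mF tF mUF; rewrite /mu_lag setI_bigcupl ge0_integral_bigcup//=.
- apply: is_cvg_ereal_nneg_natsum_cond => n _ _.
  by apply: integral_ge0 => x _; rewrite lee_fin powR_ge0.
- by move=> k; apply: measurableI => //; exact: mF.
- by apply/measurable_EFinP; apply: measurable_funTS; exact: measurable_powR.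
- by move=> x _; rewrite lee_fin powR_ge0.
- move=> i j _ _ [x [[Fix _] [Fjx _]]].
  by apply: tF => //; exists x.
Qed.

HB.instance Definition _ := isMeasure.Build _ _ _ (mu_lag b)
  mu_lag0 mu_lag_ge0 mu_lag_sigma_additive.

End mu_lag_measure.

Section laguerre.
Context {R : realType}.
Implicit Types (b sigma t r s : R) (k m n : nat) (f g : R -> R).

(* Euler's integral, used for arguments > 0 only *)
Definition Gamma (x : R) : R :=
  \int[lebesgue_measure]_(t in `]0, +oo[) (t `^ (x - 1) * expR (- t)).

(* x (x - 1) ... (x - n + 1) / n! *)
Definition gbinom (x : R) n : R := (\prod_(l < n) (x - l%:R)) / n`!%:R.

Definition laguerre b k : {poly R} :=
  \poly_(i < k.+1) ((-1) ^+ i * gbinom (k%:R + b) (k - i) / i`!%:R).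

Definition psi b k r : R :=
  Num.sqrt (2 * Gamma (k%:R + 1) / Gamma (k%:R + b + 1))
  * (laguerre b k).[r ^+ 2] * expR (- (r ^+ 2 / 2)).

Definition eigen b k : R := 4 * k%:R + 2 * b + 2.

Definition heat_kernel b t r s : R :=
  limn (series (fun m => expR (- t * eigen b m) * psi b m r * psi b m s)).

(* extended-real valued: it is +oo on the diagonal when sigma <= 1/2 *)
Definition potential_kernel b sigma r s : \bar R :=
  (((Gamma sigma)^-1)%:E * \int[lebesgue_measure]_(t in `]0%R, +oo[)
     (heat_kernel b t r s * t `^ (sigma - 1))%:E)%E.

Definition potential_op b sigma f r : \bar R :=
  (\int[mu_lag b]_s (potential_kernel b sigma r s * (f s)%:E))%E.

Definition spectral_sum b sigma f n r : R :=
  \sum_(m < n) eigen b m `^ (- sigma)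
    * (\int[mu_lag b]_s (f s * psi b m s)) * psi b m r.

(* A representative of the sum of the spectral series in L^2(dmu_b) *)
Definition spectral_op b sigma f : R -> R :=
  xget (cst 0) [set g | g \in Lfun (mu_lag b) 2%:E /\
    ('N[mu_lag b]_2%:E[EFin \o (g \- spectral_sum b sigma f n)%R])%E
      @[n --> \oo] --> 0%E].

(* (L_b)^(-sigma): the spectral series on L^2(dmu_b), the integral operator
   elsewhere. When the integral does not converge absolutely its value is
   +oo or -oo, so that its absolute value is +oo. *)
Definition frac_int b sigma f : R -> \bar R :=
  if f \in Lfun (mu_lag b) 2%:E then EFin \o spectral_op b sigma f
  else potential_op b sigma f.

Definition lnorm (s : \bar R) (x : nat -> \bar R) : \bar R :=
  match s with
  | s0%:E => ((\sum_(0 <= j <oo) `|x j| `^ s0) `^ s0^-1)%E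
  | _ => ereal_sup (range (fun j => `|x j|%E))
  end.

Definition upow (a : R) (j : nat) (r : R) : R := r `^ (a * j%:R).

Definition vector_bound (sigma alpha a : R) (p q s : \bar R) (C : R) : Prop :=
  forall f : nat -> R -> R,
    (forall j, f j \in Lfun (mu_lag alpha) p) ->
    ('N[mu_lag alpha]_q[(fun r => lnorm s (fun j =>
        (upow a j r)%:E * frac_int (alpha + a * j%:R) sigma
                            (fun t => (upow a j t)^-1 * f j t)%R r))]
     <= C%:E * 'N[mu_lag alpha]_p[(fun r => lnorm s (fun j => (f j r)%:E))])%E.

Definition admissible (sigma alpha : R) (p q : \bar R) : Prop :=
  [/\ (p^-1 - (sigma / (alpha + 1))%:E <= q^-1)%E,
      (q^-1 < p^-1 + (sigma / (alpha + 1))%:E)%E,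
      ~ (p = 1%E /\ q = ((alpha + 1) / (alpha + 1 - sigma))%:E) &
      ~ (p = ((alpha + 1) / sigma)%:E /\ q = +oo%E)].

End laguerre.

(* Main.v *)
Require Import Defs.
From HB Require Import structures.
From mathcomp Require Import all_boot all_order all_algebra.
From mathcomp Require Import all_classical all_reals all_analysis.
From mathcomp Require Import measurable_realfun ess_sup_inf ring lra.

Set Implicit Arguments.
Unset Strict Implicit.
Unset Printing Implicit Defensive.

Import Order.TTheory GRing.Theory Num.Theory.
Import numFieldNormedType.Exports.
Import HBNNSimple.

Local Open Scope classical_set_scope.
Local Open Scope ring_scope.

(** Write N = alpha + 1. The argument compares all the operators with one, the
    potential of order alpha acting on positive functions.

    The Hille-Hardy formula [hille_hardy] gives the heat kernel in closed form,
    G_(b,t) (r,s) = W (r,s) exp (- kap t (r^2 + s^2)) at time tau t = sinh (2 t), where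
    W is the heat kernel of the Bessel operator: symmetric, of mass 1 and at most a
    multiple of t^(-b-1) ([integral_Wker], [Wker_small]). Up to common factors,
    (r s)^mu G_(b+mu,t) (r,s) is the modified Bessel function I_(b+mu) at the
    argument where G_(b,t) has I_b, and I_(b+mu) <= 12 I_b for b >= -1/2 when mu = 0 or
    mu >= 1 ([bessJ_dom]). The exponents mu = a j are of this kind because a >= 1, so
    |u_j L_(alpha+aj)^(-sigma) (u_j^-1 f_j)| <= 12 L_alpha^(-sigma) |f_j| almost everywhere
    ([conjugated_potential_le]), and Minkowski's inequality for the positive kernel of
    order alpha ([lnorm_integral]) bounds the l^s norm of the left-hand sides by the
    potential of the l^s norm of the f_j. This holds with one constant for all a and s.

    It remains to bound the potential of order alpha from L^p to L^q
    ([potential_Lp_Lq]). By duality this is a bound for its bilinear form on functions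
    phi^(1/p) and gam^(1-1/q), with densities phi and gam of mass at most 1
    ([bilinear_bound]). At a fixed time, convexity inequalities between phi, gam and W
    give a bound of order t^(-|N (1/p - 1/q)|) for t <= 1, and exponential decay for
    t >= 1. This is integrable against t^(sigma-1) dt inside the strip
    |1/p - 1/q| < sigma/N. On the line 1/p - 1/q = sigma/N the exponents 1/p and 1 - 1/q
    lie in (0,1) and add up to more than 1; splitting phi^(1/p) gam^(1-1/q) at the
    levels where phi and gam reach t^(-N) makes the time integral converge pointwise
    ([mean_crit], [integral_mixpow]).

    On L^2 the operator is given by the spectral series. It agrees with the integral
    operator because the quadratic form of the potential at f >= 0 is
    sum_m lambda_m^(-sigma) c_m(f)^2 ([pker_quadratic]): by polarisation this gives all
    the pairings of the potential, and then the convergence of the series to it in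
    L^2 ([spectral_remainder], [spectral_op_potential]).

    For the converse, take f_j = 0 for j > 0, so that the scalar bound must hold. The
    kernel is at least a multiple of max (r,s)^(2 sigma - 2 N) near the origin
    ([pker_ge_local]); indicators of (0,e] then force 1/p - 1/q <= sigma/N and, as does
    r^(-2 sigma) on (e,1], exclude the two endpoints. Far from the origin the
    potential of a decreasing g is at least a multiple of r^(-2 sigma) g (c r), because
    the second moment of W is known ([Wker_markov], [potential_ge_far]); the functions
    (1 + r^2)^(-N/p) cut off at S then exclude 1/q >= 1/p + sigma/N. *)

(** * The measures r^(2b+1) dr *)

Section mu_lag_density.
Context {R : realType}.
Implicit Types b : R.

Lemma measurable_lag_density b :
  measurable_fun setT (fun x : R => (x `^ (2 * b + 1))%:E).
Proof. by apply/measurable_EFinP; exact: measurable_powR. Qed.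

(** The monotone class argument: true for indicators by definition of
    [mu_lag], hence for simple functions and their increasing limits. *)
Lemma integral_mu_lag b (f : R -> \bar R) :
  (forall x, 0 <= f x)%E -> measurable_fun setT f ->
  (\int[mu_lag b]_x f x =
   \int[lebesgue_measure]_(x in `]0%R, +oo[) (f x * (x `^ (2 * b + 1))%:E))%E.
Proof.
move=> f0 mf; set g := fun x : R => (x `^ (2 * b + 1))%:E.
have g0 x : (0 <= g x)%E by rewrite lee_fin powR_ge0.
have mg : measurable_fun setT g by exact: measurable_lag_density.
pose h := nnsfun_approx (@measurableT _ R) mf.
have mh n : measurable_fun setT (h n) by exact: measurable_funPT.
have ndh (x : R) (i j : nat) : (i <= j)%N -> h i x <= h j x.
  by move=> ij; exact/lefP/nd_nnsfun_approx.
have -> : (\int[mu_lag b]_x f x =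
    lim (\int[mu_lag b]_x (EFin \o h n) x @[n --> \oo]))%E.
  have fE x : f x = lim ((EFin \o h n) x @[n --> \oo]).
    by apply/esym/cvg_lim => //; exact: cvg_nnsfun_approx.
  under eq_integral => x _ do rewrite fE.
  apply: monotone_convergence => //.
  - by move=> n; apply/measurable_EFinP/measurable_funP.
  - by move=> n x _ //=; rewrite lee_fin.
  - by move=> x _ a c ac; rewrite lee_fin; exact: ndh.
have -> : (\int[lebesgue_measure]_(x in `]0%R, +oo[) (f x * g x) =
    lim (\int[lebesgue_measure]_(x in `]0%R, +oo[) ((EFin \o h n) x * g x)
      @[n --> \oo]))%E.
  have fg x : (f x * g x)%E = lim ((EFin \o h n) x * g x @[n --> \oo])%E.
    by apply/esym/cvg_lim => //; apply: cvgeZr => //; exact: cvg_nnsfun_approx.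
  under eq_integral => x _ do rewrite fg.
  apply: monotone_convergence => //.
  - move=> n; apply/measurable_funTS/emeasurable_funM => //.
    by apply/measurable_EFinP; exact: mh.
  - by move=> n x _; apply: mule_ge0 => //=; rewrite lee_fin.
  - move=> x _ a c ac; apply: lee_wpmul2r => //=; rewrite lee_fin.
    exact: ndh.
suff suf n : (\int[mu_lag b]_x (EFin \o h n) x =
    \int[lebesgue_measure]_(x in `]0%R, +oo[) ((EFin \o h n) x * g x))%E.
  by under eq_fun do rewrite suf.
transitivity (\int[mu_lag b]_x
   (\sum_(y \in range (h n)) (y * \1_(h n @^-1` [set y]) x)%:E))%E.
  by apply: eq_integral => t _; rewrite /= fimfunE -fsumEFin.
have hE x : h n x = \sum_(y \in range (h n)) (y * \1_(h n @^-1` [set y]) x).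
  exact: fimfunE.
have indich r : measurable_fun setT
    (fun x => (r * \1_(h n @^-1` [set r]) x)%:E).
  by apply/measurable_EFinP; exact: measurable_funM.
have indic1 r : measurable_fun setT
    (fun x => (\1_(h n @^-1` [set r]) x : R)%:E).
  by apply/measurable_EFinP.
rewrite ge0_integral_fsum//; last by move=> y x _; exact: nnfun_muleindic_ge0.
transitivity (\int[lebesgue_measure]_(x in `]0%R, +oo[)
    (\sum_(y \in range (h n)) (y * \1_(h n @^-1` [set y]) x)%:E * g x))%E;
  last first.
  apply: eq_integral => x xE.
  rewrite -ge0_mule_fsuml => [|y]; last exact: nnfun_muleindic_ge0.
  congr (_ * _)%E; rewrite fsumEFin//=; congr EFin. exact: esym (hE _).
rewrite ge0_integral_fsum//; last 2 first.
  - move=> y; apply/measurable_funTS/emeasurable_funM => //; exact: indich.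
  - by move=> y x _; rewrite mule_ge0// nnfun_muleindic_ge0.
apply: eq_fsbigr => r rhn.
under eq_integral do rewrite EFinM.
rewrite integralZl_indic_nnsfun//.
under [RHS]eq_integral do rewrite EFinM -muleA.
rewrite [RHS]ge0_integralZl//.
- rewrite integral_indic// setIT; congr (_ * _)%E; transitivity
    (\int[lebesgue_measure]_(x in `]0%R, +oo[ `&` (h n @^-1` [set r])) g x)%E.
    by rewrite setIC.
  rewrite integral_mkcondr; apply: eq_integral => x _.
  by rewrite epatch_indic muleC.
- apply/measurable_funTS/emeasurable_funM => //; exact: indic1.
- by move=> t _; rewrite mule_ge0// lee_fin.
- by move: rhn; rewrite inE => -[t _ <-]; rewrite lee_fin.
Qed.

Let measurable_le0 : measurable [set x : R | x <= 0].
Proof.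
have -> : [set x : R | x <= 0] = `]-oo, 0]%classic.
  by apply/seteqP; split => x /=; rewrite in_itv.
exact: measurable_itv.
Qed.

Lemma mu_lag_le0 b : mu_lag b [set x : R | x <= 0] = 0%E.
Proof.
rewrite /mu_lag (_ : _ `&` _ = set0) ?integral_set0//.
apply/seteqP; split => // x /= [x0]; rewrite in_itv/= andbT => /(le_lt_trans x0).
by rewrite ltxx.
Qed.

Lemma ae_mu_lag_gt0 b : {ae mu_lag b, forall x : R, 0 < x}.
Proof.
exists [set x : R | x <= 0]; split.
- exact: measurable_le0.
- exact: mu_lag_le0.
- by move=> x /= /negP; rewrite -leNgt.
Qed.

(** The densities are positive on the half-line, so all these measures have the
    null sets of Lebesgue measure there. *)
Lemma mu_lag_null b (A : set R) : measurable A ->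
  mu_lag b A = 0%E <-> lebesgue_measure (A `&` `]0, +oo[) = 0%E.
Proof.
move=> mA; split; last first.
  move=> A0; rewrite /mu_lag null_set_integral//=; first exact: measurableI.
  by apply: measurable_funTS; exact: measurable_lag_density.
move=> A0; have mD : measurable (A `&` `]0, +oo[) by exact: measurableI.
have mf : measurable_fun (A `&` `]0, +oo[)
    (fun x : R => (x `^ (2 * b + 1))%:E).
  by apply: measurable_funTS; exact: measurable_lag_density.
have : (\int[lebesgue_measure]_(x in A `&` `]0%R, +oo[)
    `|(x `^ (2 * b + 1))%:E| = 0)%E.
  rewrite -[RHS]A0 /mu_lag; apply: eq_integral => x _.
  by rewrite gee0_abs// lee_fin powR_ge0.
move/(ae_eq_integral_abs lebesgue_measure mD mf) => [N [mN N0 sN]]; rewrite /= in sN.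
apply/eqP; rewrite eq_le measure_ge0 andbT -[leRHS]N0; apply: le_measure.
- by rewrite inE.
- by rewrite inE.
move=> x /= Ax; apply: sN => /= /(_ Ax) /eqP; rewrite eqe powR_eq0.
by case: Ax => _; rewrite in_itv/= andbT => /gt_eqF ->.
Qed.

Lemma mu_lag_ae b b' (P : R -> Prop) :
  {ae mu_lag b, forall x, P x} -> {ae mu_lag b', forall x, P x}.
Proof.
move=> [N [mN N0 sN]]; exists N; split => //.
by apply/(mu_lag_null _ mN); exact/(mu_lag_null b mN).
Qed.

Lemma mu_lag_setT_gt0 b : (0 < mu_lag b setT)%E.
Proof.
rewrite lt_neqAle measure_ge0 andbT eq_sym; apply/eqP.
move/(mu_lag_null _ measurableT); rewrite setTI.
by rewrite lebesgue_measure_itv/= ltry.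
Qed.

Let mu_lag_sigma_finite b : sigma_finite setT (mu_lag b).
Proof.
pose A := [set x : R | x <= 0].
pose I (n : nat) : set R := `[n.+1%:R^-1, n.+1%:R]%classic.
pose F (n : nat) : set R := A `|` I n.
have mle0 := measurable_le0.
exists F.
  apply/seteqP; split => // x _.
  have [x0|x0] := leP x 0; first by exists 0%N => //; left.
  exists (maxn (Num.truncn x) (Num.truncn x^-1)) => //; right.
  rewrite /I /= in_itv/=; apply/andP; split.
    rewrite -[leRHS]invrK lef_pV2 ?posrE ?invr_gt0//.
    apply/ltW/(lt_le_trans (Num.Theory.truncnS_gt _)).
    by rewrite ler_nat ltnS leq_maxr.
  apply/ltW/(lt_le_trans (Num.Theory.truncnS_gt _)).
  by rewrite ler_nat ltnS leq_maxl.
move=> n; have mI : measurable (I n) by exact: measurable_itv.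
split; first exact: measurableU.
apply: (@le_lt_trans _ _ (mu_lag b A + mu_lag b (I n))%E).
  exact: measureU2.
rewrite mu_lag_le0 add0e /mu_lag.
pose M : R := n.+1%:R `^ `|2 * b + 1|.
apply: (@le_lt_trans _ _ (\int[lebesgue_measure]_(r in
    I n `&` `]0%R, +oo[) M%:E)%E).
  apply: ge0_le_integral => //.
  - exact: measurableI.
  - by move=> x _; rewrite lee_fin powR_ge0.
  - by apply: measurable_funTS; exact: measurable_lag_density.
  - move=> x [] /=; rewrite /I /= !in_itv/= => /andP[xl xr] /andP[x0 _].
    rewrite lee_fin /M; have [s0|s0] := leP 0 (2 * b + 1).
      by rewrite ger0_norm// ge0_ler_powR// nnegrE ltW.
    rewrite ltr0_norm//.
    have -> : x `^ (2 * b + 1) = x^-1 `^ (- (2 * b + 1)).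
      by rewrite -powR_inv1 ?(ltW x0)// -powRrM mulN1r opprK.
    rewrite ge0_ler_powR ?oppr_ge0 ?nnegrE ?invr_ge0 ?(ltW x0) ?(ltW s0)//.
    by rewrite -[leRHS]invrK lef_pV2 ?posrE ?invr_gt0.
rewrite integral_cst; last exact: measurableI.
rewrite lte_mul_pinfty// ?lee_fin ?powR_ge0//.
apply: (@le_lt_trans _ _ (lebesgue_measure (I n))).
  by apply: le_measure; rewrite ?inE; [exact: measurableI|by []|exact: subIsetl].
by rewrite /I lebesgue_measure_itv/=; case: ifP => // _; rewrite ltry.
Qed.

HB.instance Definition _ b :=
  Measure_isSigmaFinite.Build _ _ _ (mu_lag b) (mu_lag_sigma_finite b).

End mu_lag_density.

(** * Power and Gamma integrals *)

Section power_integrals.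
Context {R : realType}.
Implicit Types a b c d x t T : R.

Lemma powR_continuous a x : 0 < x -> {for x, continuous (@powR R ^~ a)}.
Proof.
move=> x0; apply: differentiable_continuous; apply/derivable1_diffP.
by apply: derivable_powR; rewrite in_itv/= x0.
Qed.

Lemma cvg_at_right0 (u : nat -> R) : (forall n, 0 < u n) ->
  u n @[n --> \oo] --> 0 -> u n @[n --> \oo] --> 0^'+.
Proof.
move=> u0 ucvg A [e /= e0 eA].
have /cvgrPdist_lt/(_ e e0) := ucvg.
by apply: filterS => n un; apply: eA => //; exact: u0.
Qed.

Lemma powR_cvgy0 x : x < 0 -> t `^ x @[t --> +oo] --> (0 : R).
Proof.
move=> x0; rewrite -[x]opprK; apply/cvgrPdist_lt => e e0.
near=> t; have t0 : 0 < t by near: t; exact: nbhs_pinfty_gt.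
rewrite sub0r normrN ger0_norm ?powR_ge0// powRN.
rewrite invf_plt ?posrE ?powR_gt0//.
have y0 : 0 < - x by rewrite oppr_gt0.
have -> : e^-1 = (e^-1 `^ (- x)^-1) `^ (- x).
  by rewrite -powRrM mulVf ?gt_eqF// powRr1 ?invr_ge0 ?ltW.
rewrite gt0_ltr_powR ?nnegrE ?powR_ge0 ?(ltW t0)//.
Unshelve. all: by end_near. Qed.

(** The measure [mu_lag (x / 2 - 1)] is t^(x-1) dt. *)
Lemma integral_pow x (f : R -> \bar R) :
  (forall t, 0 <= f t)%E -> measurable_fun setT f ->
  (\int[mu_lag (x / 2 - 1)]_t f t =
   \int[lebesgue_measure]_(t in `]0%R, +oo[) (f t * (t `^ (x - 1))%:E))%E.
Proof.
move=> f0 mf; apply: (etrans (integral_mu_lag _ f0 mf)); apply: eq_integral => t _.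
by rewrite (_ : 2 * (x / 2 - 1) + 1 = x - 1)//; field.
Qed.

Lemma mu_pow_itv x (A : set R) : measurable A ->
  mu_lag (x / 2 - 1) A =
  (\int[lebesgue_measure]_(t in A `&` `]0%R, +oo[) (t `^ (x - 1))%:E)%E.
Proof.
move=> mA; rewrite /mu_lag; apply: eq_integral => t _.
by congr (_ `^ _)%:E; field.
Qed.

Lemma mu_pow_below x T : 0 < x -> 0 < T ->
  mu_lag (x / 2 - 1) `]-oo, T] = (T `^ x / x)%:E.
Proof.
move=> x0 T0; rewrite mu_pow_itv//.
pose A n : set R := `[T / n.+2%:R, T]%classic.
have -> : `]-oo, T] `&` `]0, +oo[ = \bigcup_n A n.
  apply/seteqP; split => t; rewrite /A /=.
    rewrite !in_itv/= andbT => -[tT t0]; exists (Num.truncn (T / t)) => //.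
    rewrite /= in_itv/= tT andbT ler_pdivrMr// mulrC -ler_pdivrMr//.
    apply/ltW/(lt_trans (Num.Theory.truncnS_gt _)).
    by rewrite ltr_nat.
  move=> [n _]; rewrite /= !in_itv/= andbT => /andP[Tt ->]; split => //.
  by apply: lt_le_trans Tt; rewrite divr_gt0.
have mA n : measurable (A n) by exact: measurable_itv.
have ndA : nondecreasing_seq A.
  apply/nondecreasing_seqP => n; rewrite subsetEset => t.
  rewrite /A /= !in_itv/= => /andP[Tt ->]; rewrite andbT.
  apply: le_trans Tt; rewrite ler_pM2l// lef_pV2 ?posrE// ler_nat.
  exact: leqnSn.
have mf n : measurable_fun (A n) (fun t : R => (t `^ (x - 1))%:E).
  by apply/measurable_EFinP/measurable_funTS; exact: measurable_powR.
have H : (\int[lebesgue_measure]_(t in A n) (t `^ (x - 1))%:E @[n --> \oo] -->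
    \int[lebesgue_measure]_(t in \bigcup_n A n) (t `^ (x - 1))%:E)%E.
  apply: ge0_nondecreasing_set_cvg_integral => // n t _.
  by rewrite lee_fin powR_ge0.
rewrite -(cvg_lim _ H)//.
apply/cvg_lim => //.
pose F t := t `^ x / x.
have dF t : 0 < t -> is_derive t (1:R) F (t `^ (x - 1)).
  move=> t0; have := is_derive1_powR x t0 => dx.
  apply: is_derive_eq; rewrite scaler0 add0r.
  by rewrite scalerA mulVf ?gt_eqF// scale1r.
have cF t : 0 < t -> {for t, continuous F}.
  move=> t0; apply: differentiable_continuous; apply/derivable1_diffP.
  by have := dF t t0; case.
have intA n : (\int[lebesgue_measure]_(t in A n) (t `^ (x - 1))%:E =
    (F T - F (T / n.+2%:R))%:E)%E.
  have a0 : 0 < T / n.+2%:R by rewrite divr_gt0.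
  have aT : T / n.+2%:R < T.
    by rewrite ltr_pdivrMr// ltr_pMr// ltr1n.
  rewrite EFinB (@continuous_FTC2 _ _ F)//.
  - apply/continuous_within_itvP => //; split.
    + move=> t; rewrite in_itv/= => /andP[/(lt_trans a0) t0 _].
      exact: powR_continuous.
    + by apply: cvg_at_right_filter; exact: powR_continuous.
    + by apply: cvg_at_left_filter; exact: powR_continuous.
  - split.
    + move=> t; rewrite in_itv/= => /andP[/(lt_trans a0) t0 _].
      by have := dF t t0; case.
    + by apply: cvg_at_right_filter; exact: cF.
    + by apply: cvg_at_left_filter; exact: cF.
  - move=> t; rewrite in_itv/= => /andP[/(lt_trans a0) t0 _].
    by rewrite derive1E; have := dF t t0; case.
under eq_fun do rewrite intA.
apply: cvg_EFin; first by apply: nearW.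
rewrite -[X in _ --> X]subr0; apply: cvgB; first exact: cvg_cst.
rewrite -(mul0r x^-1); apply: cvgMl.
apply: (cvg_comp (fun n : nat => T / n.+2%:R) (@powR R ^~ x) (G := 0^'+));
  last exact: powR_cvg0.
apply: cvg_at_right0; first by move=> n; rewrite divr_gt0.
rewrite -(mulr0 T); apply: cvgMr; 
by have := @cvg_harmonic R; rewrite -cvg_shiftS.
Qed.

Lemma mu_pow_above x T : x < 0 -> 0 < T ->
  mu_lag (x / 2 - 1) `[T, +oo[ = (T `^ x / (- x))%:E.
Proof.
move=> x0 T0; rewrite mu_pow_itv//.
have -> : `[T, +oo[ `&` `]0, +oo[ = `[T, +oo[%classic.
  apply/seteqP; split => t; rewrite /= !in_itv/= !andbT; first by case.
  by move=> Tt; split => //; exact: lt_le_trans Tt.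
pose F t := t `^ x / x.
have dF t : 0 < t -> is_derive t (1:R) F (t `^ (x - 1)).
  move=> t0; have := is_derive1_powR x t0 => dx.
  apply: is_derive_eq; rewrite scaler0 add0r.
  by rewrite scalerA mulVf ?lt_eqF// scale1r.
rewrite (@ge0_continuous_FTC2y _ _ F T 0)//.
- by rewrite sub0e -EFinN /F -mulrN -invrN.
- by move=> t _; exact: powR_ge0.
- apply/continuous_within_itvcyP; split.
    by move=> t; rewrite in_itv/= andbT => /(lt_trans T0) t0;
      exact: powR_continuous.
  by apply: cvg_at_right_filter; exact: powR_continuous.
- rewrite -(mul0r x^-1); apply: cvgMl; exact: powR_cvgy0.
- by move=> t /(lt_trans T0) t0; have := dF t t0; case.
- apply: cvg_at_right_filter.
  apply: differentiable_continuous; apply/derivable1_diffP.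
  by have := dF T T0; case.
- move=> t; rewrite in_itv/= andbT => /(lt_trans T0) t0.
  by rewrite derive1E; have := dF t t0; case.
Qed.

End power_integrals.

Lemma powRDp {R : realType} (x r s : R) : 0 < x -> x `^ (r + s) = x `^ r * x `^ s.
Proof. by move=> x0; rewrite powRD// (gt_eqF x0) implybT. Qed.

Section tonelli.
Context d1 d2 (T1 : measurableType d1) (T2 : measurableType d2) (R : realType).
Variables (m1 : {sigma_finite_measure set T1 -> \bar R}).
Variables (m2 : {sigma_finite_measure set T2 -> \bar R}).

Lemma tonelli (f : T1 -> T2 -> \bar R) :
  measurable_fun setT (fun z : T1 * T2 => f z.1 z.2) ->
  (forall x y, 0 <= f x y)%E ->
  (\int[m1]_x \int[m2]_y f x y = \int[m2]_y \int[m1]_x f x y)%E.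
Proof. by move=> mf f0; exact: (@fubini_tonelli _ _ _ _ _ m1 m2 (fun z => f z.1 z.2)). Qed.

Lemma measurable_tonelli1 (f : T1 -> T2 -> \bar R) :
  measurable_fun setT (fun z : T1 * T2 => f z.1 z.2) ->
  (forall x y, 0 <= f x y)%E ->
  measurable_fun setT (fun x => \int[m2]_y f x y)%E.
Proof.
move=> mf f0.
exact: (@measurable_fun_fubini_tonelli_F _ _ _ _ _ m2 (fun z => f z.1 z.2)).
Qed.

Lemma measurable_tonelli2 (f : T1 -> T2 -> \bar R) :
  measurable_fun setT (fun z : T1 * T2 => f z.1 z.2) ->
  (forall x y, 0 <= f x y)%E ->
  measurable_fun setT (fun y => \int[m1]_x f x y)%E.
Proof.
move=> mf f0.
exact: (@measurable_fun_fubini_tonelli_G _ _ _ _ _ m1 (fun z => f z.1 z.2)).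
Qed.

End tonelli.

Section slices.
Context d1 d2 d3 (T1 : measurableType d1) (T2 : measurableType d2)
  (T3 : measurableType d3).
Variables (f : T1 -> T2 -> T3).
Hypothesis mf : measurable_fun setT (fun z : T1 * T2 => f z.1 z.2).

Lemma measurable_slice1 x : measurable_fun setT (f x).
Proof. by have := measurableT_comp mf (pair1_measurable x). Qed.

Lemma measurable_slice2 y : measurable_fun setT (f ^~ y).
Proof. by have := measurableT_comp mf (pair2_measurable y). Qed.

End slices.

Section gamma.
Context {R : realType}.
Implicit Types a b c d x t : R.

Let EGamma x : \bar R := (\int[mu_lag (x / 2 - 1)]_t (expR (- t))%:E)%E.

Let mexpN : measurable_fun setT (fun t : R => expR (- t)).
Proof. by apply: measurableT_comp => //; exact: measurable_oppr. Qed.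

Let EGammaE x : EGamma x = (\int[lebesgue_measure]_(t in `]0%R, +oo[)
  (t `^ (x - 1) * expR (- t))%:E)%E.
Proof.
rewrite /EGamma integral_pow.
- by apply: eq_integral => t _; rewrite -EFinM mulrC.
- by move=> t; rewrite lee_fin expR_ge0.
- exact/measurable_EFinP.
Qed.

Let expR_tail (u : R) :
  (\int[lebesgue_measure]_(t in `[u, +oo[) (expR (- t))%:E = (expR (- u))%:E)%E.
Proof.
have dF (t : R) : is_derive t (1:R) (fun t => - expR (- t)) (expR (- t)).
  rewrite -[X in is_derive _ _ _ X]opprK; apply: is_deriveN.
  by apply: is_derive_eq; rewrite /GRing.scale/= mulrN1.
rewrite (@ge0_continuous_FTC2y _ _ (fun t => - expR (- t)) u 0)//.
- by rewrite sub0e -EFinN opprK.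
- apply: continuous_subspaceT => t.
  apply: (@continuous_comp _ _ _ -%R); first exact: opp_continuous.
  exact: continuous_expR.
- rewrite -[X in _ --> X]oppr0; apply: cvgN; exact: cvgr_expR.
- apply: cvg_at_right_filter.
  have : {for u, continuous (fun t => - expR (- t))}; last by [].
  apply: differentiable_continuous; apply/derivable1_diffP.
  by have := dF u; case.
- by move=> t _; rewrite derive1E; have := dF t; case.
Qed.

(** Writing t^x as x times the mass of (0,t], the functional equation is an
    exchange of integrals. *)
Let EGammaS x : 0 < x -> EGamma (x + 1) = (x%:E * EGamma x)%E.
Proof.
move=> x0.
pose f (t u : R) : \bar R := (expR (- t) * \1_[set z : R * R | z.2 <= z.1] (t, u))%:E.
have fE t u : f t u = (expR (- t) * (u <= t)%R%:R)%:E.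
  rewrite /f indicE (_ : ((t, u) \in _) = (u <= t))//.
  by apply/idP/idP => [/set_mem|ut]; [|exact/mem_set].
have f0 t u : (0 <= f t u)%E by rewrite lee_fin mulr_ge0 ?expR_ge0.
have mE : measurable [set z : R * R | z.2 <= z.1].
  rewrite -[X in measurable X]setTI.
  exact: measurable_fun_le.
have mf : measurable_fun setT (fun z : R * R => f z.1 z.2).
  apply/measurable_EFinP; apply: measurable_funM => /=.
    exact: (measurableT_comp mexpN measurable_fst).
  rewrite (_ : (fun _ => _) = \1_[set z : R * R | z.2 <= z.1]); first by [].
  by apply/funext => -[].
have <- : (\int[mu_lag (x / 2 - 1)]_u \int[mu_lag (1 / 2 - 1)]_t f t u =
    EGamma x)%E.
  apply: ge0_ae_eq_integral => //.
  - exact: measurable_tonelli2.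
  - by apply/measurable_EFinP.
  - by move=> u _; apply: integral_ge0.
  apply: filterS (ae_mu_lag_gt0 (x / 2 - 1)) => u u0 _.
  rewrite integral_pow//; last exact: (measurable_slice2 mf u).
  rewrite -expR_tail integral_mkcond [RHS]integral_mkcond.
  apply: eq_integral => t _; rewrite !patchE fE.
  rewrite (_ : 1 - 1 = 0) ?subrr// powRr0 mule1.
  rewrite !mem_setE !in_itv/= !andbT.
  have [t0|t0] := ltP 0 t; last by rewrite leNgt (le_lt_trans t0).
  by case: ifPn => _; rewrite ?mulr1 ?mulr0.
rewrite -(tonelli (mu_lag (1 / 2 - 1)) (mu_lag (x / 2 - 1)) mf f0).
pose g t := (\int[mu_lag (x / 2 - 1)]_u f t u)%E.
have mg : measurable_fun setT g by exact: measurable_tonelli1.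
have g0 t : (0 <= g t)%E by apply: integral_ge0.
transitivity (\int[mu_lag (1 / 2 - 1)]_t (x%:E * g t))%E; last first.
  by rewrite ge0_integralZl// lee_fin ltW.
rewrite EGammaE.
transitivity (\int[mu_lag (1 / 2 - 1)]_t (t `^ x * expR (- t))%:E)%E.
  rewrite integral_pow.
  - by apply: eq_integral => t _; rewrite subrr powRr0 mule1 addrK.
  - by move=> t; rewrite lee_fin mulr_ge0 ?powR_ge0 ?expR_ge0.
  - by apply/measurable_EFinP; apply: measurable_funM => //; exact: measurable_powR.
apply: ge0_ae_eq_integral => //.
- by apply/measurable_EFinP; apply: measurable_funM => //; exact: measurable_powR.
- exact: measurable_funeM.
- by move=> t _; rewrite lee_fin mulr_ge0 ?powR_ge0 ?expR_ge0.
- by move=> t _; rewrite mule_ge0 ?lee_fin ?(ltW x0).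
apply: filterS (ae_mu_lag_gt0 (1 / 2 - 1)) => t t0 _.
rewrite /g /f; under eq_integral do rewrite EFinM.
rewrite ge0_integralZl//; last first.
  apply/measurable_EFinP.
  have mI := measurable_indic mE.
  exact: (measurableT_comp (mI R setT) (pair1_measurable t)).
have -> : (\int[mu_lag (x / 2 - 1)]_u (\1_[set z : R * R | z.2 <= z.1] (t, u))%:E
    = mu_lag (x / 2 - 1) `]-oo, t])%E.
  rewrite -[X in _ = mu_lag _ X]setIT -integral_indic//.
rewrite mu_pow_below// -!EFinM; congr EFin.
by rewrite mulrCA [_ * (_ / _)]mulrC divfK ?gt_eqF// mulrC.
Qed.

Let mpow_exp y : measurable_fun setT (fun t : R => (t `^ y * expR (- t))%:E).
Proof.
by apply/measurable_EFinP; apply: measurable_funM => //; exact: measurable_powR.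
Qed.

Let EGamma1 : EGamma 1 = 1%E.
Proof.
rewrite EGammaE integral_itv_obnd_cbnd; last first.
  by apply: measurable_funTS; exact: mpow_exp.
rewrite -expR0 -[X in expR X]oppr0 -expR_tail; apply: eq_integral => t _.
by rewrite subrr powRr0 mul1r.
Qed.

Let EGamma_itv x : 0 < x -> (0 < EGamma x < +oo)%E.
Proof.
move=> x0; apply/andP; split.
  apply: (@lt_le_trans _ _ (\int[mu_lag (x / 2 - 1)]_(t in `]-oo, 1%R]) (expR (- 1))%:E)%E).
    rewrite integral_cst//= mu_pow_below// powR1 -EFinM lte_fin.
    by rewrite mulr_gt0 ?expR_gt0// divr_gt0.
  apply: (@le_trans _ _ (\int[mu_lag (x / 2 - 1)]_(t in `]-oo, 1%R]) (expR (- t))%:E)%E).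
    apply: ge0_le_integral => //.
    - by apply/measurable_EFinP; apply: measurable_funTS.
    - by move=> t /=; rewrite in_itv/= lee_fin ler_expR lerN2.
  by apply: ge0_subset_integral => //; exact/measurable_EFinP.
have mp := mpow_exp; have E1 := EGamma1.
have En n : (EGamma n.+1%:R < +oo)%E.
  elim: n => [|n IH]; first by rewrite E1 ltry.
  rewrite -addn1 natrD EGammaS ?ltr0n//.
  by rewrite lte_mul_pinfty// ?lee_fin.
have : (x%:E * EGamma x < +oo)%E.
  rewrite -EGammaS//; set n := Num.truncn x.
  have xn : x <= n.+1%:R by apply/ltW/Num.Theory.truncnS_gt.
  apply: (@le_lt_trans _ _ (EGamma 1 + EGamma n.+2%:R)%E); last first.
    by rewrite lte_add_pinfty ?E1 ?ltry.
  rewrite !EGammaE -ge0_integralD//; last 4 first.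
  - by move=> t _; rewrite lee_fin mulr_ge0 ?powR_ge0 ?expR_ge0.
  - by apply: measurable_funTS; exact: mp.
  - by move=> t _; rewrite lee_fin mulr_ge0 ?powR_ge0 ?expR_ge0.
  - by apply: measurable_funTS; exact: mp.
  apply: ge0_le_integral => //.
  - by move=> t _; rewrite lee_fin mulr_ge0 ?powR_ge0 ?expR_ge0.
  - by apply: measurable_funTS; exact: mp.
  - apply: measurable_funTS; apply: emeasurable_funD; exact: mp.
  move=> t /=; rewrite in_itv/= andbT => t0.
  rewrite -EFinD lee_fin -mulrDl ler_wpM2r ?expR_ge0//.
  rewrite subrr powRr0 addrK -natr1 addrK.
  have [t1|t1] := leP 1 t.
    by apply: ler_wpDl => //; exact: ler_powR.
  apply: ler_wpDr; first exact: powR_ge0.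
  have -> : 1 = 1 `^ x :> R by rewrite powR1.
  by rewrite ge0_ler_powR ?nnegrE ?ltW.
by case: (EGamma x) => [r| |]//=; rewrite ?ltry// gt0_muley// lte_fin.
Qed.

Lemma integral_expN_pow x : 0 < x ->
  (\int[mu_lag (x / 2 - 1)]_t (expR (- t))%:E = (Gamma x)%:E)%E.
Proof.
move=> x0; rewrite -/(EGamma x) /Gamma /Rintegral -EGammaE fineK//.
have /andP[E0 Ey] := EGamma_itv x0.
by rewrite ge0_fin_numE// ltW.
Qed.

Lemma Gamma1 : Gamma 1 = 1 :> R.
Proof. by apply: EFin_inj; rewrite -integral_expN_pow// -/(EGamma 1) EGamma1. Qed.

Lemma Gamma_gt0 x : 0 < x -> 0 < Gamma x.
Proof.
move=> x0; rewrite -lte_fin -integral_expN_pow//.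
by have /andP[] := EGamma_itv x0.
Qed.

Lemma GammaS x : 0 < x -> Gamma (x + 1) = x * Gamma x.
Proof.
move=> x0; apply: EFin_inj; rewrite EFinM -!integral_expN_pow ?addr_gt0//.
exact: EGammaS.
Qed.

(** The substitution y = A t^k turns Euler's integral into
    \int y^(d-1) exp(-(y/A)^(1/k)) dy, up to constants. *)
Lemma integral_expN_powk (A d k : R) : 0 < A -> 0 < d -> 0 < k -> k <= 1 ->
  (\int[mu_lag (d / 2 - 1)]_y (expR (- ((y / A) `^ k^-1)))%:E =
   (k * A `^ d * Gamma (d * k))%:E)%E.
Proof.
move=> A0 d0 k0 k1.
pose G y := y `^ (d - 1) * expR (- ((y / A) `^ k^-1)).
pose F t := A * t `^ k.
have G0 y : 0 <= G y by rewrite mulr_ge0 ?powR_ge0 ?expR_ge0.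
have mG : measurable_fun setT G.
  apply: measurable_funM; first exact: measurable_powR.
  apply: (measurableT_comp mexpN).
  have mA : measurable_fun setT (fun y : R => y / A) by exact: measurable_funM.
  exact: (measurableT_comp (measurable_powR _) mA).
have dF t : 0 < t -> is_derive t (1:R) F (A * (k * t `^ (k - 1))).
  move=> t0; have := is_derive1_powR k t0 => dk.
  exact: is_deriveZ.
have F'E t : 0 < t -> derive1 F t = A * (k * t `^ (k - 1)).
  by move=> /dF[] _ <-; rewrite derive1E.
have cF t : 0 < t -> {for t, continuous F}.
  move=> t0; apply: differentiable_continuous; apply/derivable1_diffP.
  by have := dF t t0; case.
have cF' t : 0 < t -> {for t, continuous (derive1 F)}.
  move=> t0; rewrite /prop_for /continuous_at F'E//.
  apply: (@cvg_trans _ (A * (k * u `^ (k - 1)) @[u --> t])).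
    apply: near_eq_cvg; near=> u; rewrite F'E; first by [].
    by near: u; exact: lt_nbhsr.
  have cp : (u `^ (k - 1)) @[u --> t] --> t `^ (k - 1) by exact: powR_continuous.
  exact: cvgMr (cvgMr cp).
have cF'y : cvg (derive1 F t @[t --> +oo]).
  move: k1; rewrite le_eqVlt => /predU1P[kE|k1'].
    apply/cvg_ex; exists A; apply: (@cvg_trans _ (A @[t --> +oo])); last exact: cvg_cst.
    apply: near_eq_cvg; near=> t; rewrite F'E; last by near: t; exact: nbhs_pinfty_gt.
    by rewrite kE subrr powRr0 mul1r mulr1.
  apply/cvg_ex; exists (A * (k * 0)).
  apply: (@cvg_trans _ (A * (k * t `^ (k - 1)) @[t --> +oo])).
    apply: near_eq_cvg; near=> t; rewrite F'E; first by [].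
    by near: t; exact: nbhs_pinfty_gt.
  have cp : (t `^ (k - 1)) @[t --> +oo] --> (0 : R).
    by apply: powR_cvgy0; rewrite subr_lt0.
  exact: cvgMr (cvgMr cp).
have Fy : F t @[t --> +oo] --> +oo.
  apply/cvgryPge => M; near=> t.
  have t0 : 0 < t by near: t; exact: nbhs_pinfty_gt.
  have tM : `|A^-1 * M| `^ k^-1 <= t by near: t; exact: nbhs_pinfty_ge.
  rewrite /F -ler_pdivrMl//; apply: (le_trans (ler_norm _)).
  have -> : `|A^-1 * M| = (`|A^-1 * M| `^ k^-1) `^ k.
    by rewrite -powRrM mulVf ?gt_eqF// powRr1.
  by rewrite ge0_ler_powR ?nnegrE ?powR_ge0 ?(ltW k0) ?(ltW t0).
have cG y : 0 < y -> {for y, continuous G}.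
  move=> y0; apply: continuousM; first exact: powR_continuous.
  apply: continuous_comp; last exact: continuous_expR.
  apply: continuousN.
  have c1 : z / A @[z --> y] --> y / A by apply: cvgMl; exact: cvg_id.
  apply: (cvg_comp (fun z : R => z / A) (@powR R ^~ k^-1) c1).
  by apply: powR_continuous; rewrite divr_gt0.
pose a n : R := n.+1%:R^-1.
have a0 n : 0 < a n by rewrite invr_gt0.
have Fa0 n : 0 < F (a n) by rewrite mulr_gt0// powR_gt0.
have cvga : a n @[n --> \oo] --> (0 : R) by exact: cvg_harmonic.
have cvgset (H : R -> R) (u : nat -> R) : measurable_fun setT H ->
    (forall t, 0 <= H t) -> (forall n, 0 < u n) ->
    {homo u : m n / (m <= n)%N >-> n <= m} -> u n @[n --> \oo] --> (0:R) ->
    (\int[lebesgue_measure]_(t in `[u n, +oo[) (H t)%:E @[n --> \oo] -->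
     \int[lebesgue_measure]_(t in `]0%R, +oo[) (H t)%:E)%E.
  move=> mH H0 u0 ndu cu.
  have -> : `]0, +oo[%classic = \bigcup_n `[u n, +oo[%classic.
    apply/seteqP; split => t /=; rewrite in_itv/= andbT.
      move=> t0; have /cvgrPdist_lt/(_ t t0) [n _ /(_ n (leqnn n))] := cu.
      rewrite /= sub0r normrN gtr0_norm// => un.
      by exists n => //=; rewrite in_itv/= andbT ltW.
    by move=> [n _]; rewrite /= in_itv/= andbT; exact: lt_le_trans.
  apply: ge0_nondecreasing_set_cvg_integral.
  - move=> m n mn; rewrite subsetEset => t /=; rewrite !in_itv/= !andbT.
    by apply: le_trans; exact: ndu.
  - by move=> n; exact: measurable_itv.
  - by move=> n; apply/measurable_EFinP; apply: measurable_funTS.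
  - by move=> n t _; rewrite lee_fin.
pose H t := k * A `^ d * (t `^ (d * k - 1) * expR (- t)).
have mH : measurable_fun setT H.
  by apply: measurable_funM => //; apply: measurable_funM.
have H0 t : 0 <= H t.
  by rewrite !mulr_ge0 ?powR_ge0 ?expR_ge0// ltW.
have HE t : 0 < t -> H t = G (F t) * (A * (k * t `^ (k - 1))).
  move=> t0; have E1 : A * t `^ k / A = t `^ k.
    by rewrite mulrAC divff ?gt_eqF// mul1r.
  have E2 : (A * t `^ k / A) `^ k^-1 = t.
    by rewrite E1 -powRrM divff ?gt_eqF// powRr1 ?(ltW t0).
  have E3 : (A * t `^ k) `^ (d - 1) = A `^ (d - 1) * t `^ (k * (d - 1)).
    by rewrite powRM ?powR_ge0 ?(ltW A0)// -powRrM.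
  rewrite /G /F /H E2 E3 -(mulr_powRB1 (ltW A0) d0).
  have -> : t `^ (d * k - 1) = t `^ (k * (d - 1)) * t `^ (k - 1).
    by rewrite -powRDp//; congr powR; ring.
  ring.
have FaE n : (\int[lebesgue_measure]_(y in `[F (a n), +oo[) (G y)%:E =
    \int[lebesgue_measure]_(t in `[a n, +oo[) (H t)%:E)%E.
  rewrite (@increasing_ge0_integration_by_substitutiony _ F G (a n)).
  - apply: eq_integral => t; rewrite inE/= in_itv/= andbT => ant.
    have t0 : 0 < t by exact: lt_le_trans ant.
    by rewrite HE// fctE/= F'E.
  - move=> t u; rewrite !in_itv/= !andbT => at_ au tu.
    have t0 : 0 < t by exact: lt_le_trans at_.
    rewrite ltr_pM2l// gt0_ltr_powR// nnegrE ltW//.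
    exact: lt_trans tu.
  - by move=> t; rewrite in_itv/= andbT => /(lt_trans (a0 n)); exact: cF'.
  - apply/cvg_ex; exists (derive1 F (a n)); apply: cvg_at_right_filter; exact: cF'.
  - exact: cF'y.
  - split; last by apply: cvg_at_right_filter; exact: cF.
    move=> t; rewrite in_itv/= andbT => /(lt_trans (a0 n)) t0.
    by have := dF t t0; case.
  - exact: Fy.
  - apply/continuous_within_itvcyP; split.
      by move=> t; rewrite in_itv/= andbT => /(lt_trans (Fa0 n)); exact: cG.
    by apply: cvg_at_right_filter; exact: cG.
  - by move=> t _; exact: G0.
have nda : {homo a : m n / (m <= n)%N >-> n <= m}.
  by move=> m n mn; rewrite lef_pV2 ?posrE// ler_nat.
have ndFa : {homo (F \o a) : m n / (m <= n)%N >-> n <= m}.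
  move=> m n mn; rewrite /= ler_pM2l// ge0_ler_powR ?nnegrE ?(ltW k0) ?(ltW (a0 _))//.
  exact: nda.
have cvgFa : (F \o a) n @[n --> \oo] --> (0:R).
  rewrite -(mulr0 A); apply: cvgMr.
  apply: (cvg_comp a (@powR R ^~ k) (G := 0^'+)); last exact: powR_cvg0.
  exact: cvg_at_right0.
have GH : (\int[lebesgue_measure]_(y in `]0%R, +oo[) (G y)%:E =
    \int[lebesgue_measure]_(t in `]0%R, +oo[) (H t)%:E)%E.
  rewrite -(cvg_lim _ (cvgset G _ mG G0 Fa0 ndFa cvgFa))//.
  rewrite -(cvg_lim _ (cvgset H _ mH H0 a0 nda cvga))//.
  by under eq_fun do rewrite FaE.
rewrite integral_pow; last 2 first.
- by move=> y; rewrite lee_fin expR_ge0.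
- apply/measurable_EFinP; apply: (measurableT_comp mexpN).
  have mA : measurable_fun setT (fun y : R => y / A) by exact: measurable_funM.
  exact: (measurableT_comp (measurable_powR _) mA).
transitivity (\int[lebesgue_measure]_(y in `]0%R, +oo[) (G y)%:E)%E.
  by apply: eq_integral => y _; rewrite -EFinM mulrC.
have dk0 : 0 < d * k by rewrite mulr_gt0.
rewrite GH EFinM -integral_expN_pow// -/(EGamma _) EGammaE.
rewrite -ge0_integralZl//.
- by apply: measurable_funTS; apply/measurable_EFinP; apply: measurable_funM => //;
    exact: measurable_powR.
- by move=> t _; rewrite lee_fin mulr_ge0 ?powR_ge0 ?expR_ge0.
- by rewrite lee_fin mulr_ge0 ?powR_ge0 ?ltW.
Unshelve. all: by end_near. Qed.

(** Exponential moments: Euler's integral rescaled. *)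
Lemma integral_exp_pow c lam : 0 < c -> 0 < lam ->
  (\int[mu_lag (c / 2 - 1)]_t (expR (- (lam * t)))%:E =
   (lam `^ (- c) * Gamma c)%:E)%E.
Proof.
move=> c0 l0; have li0 : 0 < lam^-1 by rewrite invr_gt0.
have := integral_expN_powk li0 c0 ltr01 (lexx 1).
have -> : lam^-1 `^ c = lam `^ (- c).
  by rewrite -(powR_inv1 (ltW l0)) -powRrM mulN1r.
rewrite mulr1 mul1r => <-.
apply: ge0_ae_eq_integral => //.
- by apply/measurable_EFinP; apply: (measurableT_comp mexpN); exact: measurable_funM.
- apply/measurable_EFinP; apply: (measurableT_comp mexpN); rewrite invr1.
  apply: (measurableT_comp (measurable_powR _)); exact: measurable_funM.
apply: filterS (ae_mu_lag_gt0 (c / 2 - 1)) => t t0 _.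
by rewrite invr1 invrK powRr1 ?mulr_ge0 ?ltW// mulrC.
Qed.

(** Gaussian moments: the same after the substitution of r^2 / (2 tau). *)
Lemma integral_gauss_pow c tau : 0 < c -> 0 < tau ->
  (\int[mu_lag (c - 1)]_r (expR (- (r ^+ 2 / (2 * tau))))%:E =
   (2^-1 * (2 * tau) `^ c * Gamma c)%:E)%E.
Proof.
move=> c0 tau0; have A0 : 0 < (2 * tau) `^ 2^-1 by rewrite powR_gt0 ?mulr_gt0.
have d0 : 0 < 2 * c by rewrite mulr_gt0.
have h0 : 0 < 2^-1 :> R by rewrite invr_gt0.
have h1 : 2^-1 <= 1 :> R by rewrite invf_le1 ?ler1n.
have := integral_expN_powk A0 d0 h0 h1.
rewrite [2 * c]mulrC mulfK// -powRrM mulrCA mulVf// mulr1 => <-.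
apply: ge0_ae_eq_integral => //.
- apply/measurable_EFinP; apply: (measurableT_comp mexpN).
  by apply: measurable_funM => //; exact: measurable_funX.
- apply/measurable_EFinP; apply: (measurableT_comp mexpN); rewrite invrK.
  apply: (measurableT_comp (measurable_powR _)); exact: measurable_funM.
apply: filterS (ae_mu_lag_gt0 (c - 1)) => r r0 _.
rewrite invrK powR_mulrn ?divr_ge0 ?(ltW r0) ?(ltW A0)// exprMn exprVn.
rewrite -[in RHS](@powR_mulrn _ ((2 * tau) `^ _)) ?(ltW A0)//.
by rewrite -powRrM mulVf// powRr1// mulr_ge0 ?ltW.
Qed.

End gamma.

(** * Absolutely convergent double series *)

Section sums.
Context {R : realType}.
Implicit Types (u v : nat -> R) (S : R).

(** A relation rather than the total [limn], so that convergence is carried along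
    with the value. *)
Definition sums u S := series u n @[n --> \oo] --> S.

Lemma sums_unique u S S' : sums u S -> sums u S' -> S = S'.
Proof. by move=> uS uS'; rewrite -(cvg_lim _ uS)// -(cvg_lim _ uS'). Qed.

Lemma sums_lim u S : sums u S -> limn (series u) = S.
Proof. by move=> uS; exact: cvg_lim. Qed.

Lemma eq_sums u v S : u =1 v -> sums u S -> sums v S.
Proof. by move=> /funext ->. Qed.

Lemma sumsD u v S S' : sums u S -> sums v S' -> sums (fun n => u n + v n) (S + S').
Proof.
move=> uS vS; rewrite /sums (_ : series _ = series u \+ series v); first exact: cvgD.
by apply/funext => n; rewrite /series/= big_split.
Qed.

Lemma sumsZ k u S : sums u S -> sums (fun n => k * u n) (k * S).
Proof.
move=> uS; rewrite /sums (_ : series _ = (fun n => k * series u n)); first exact: cvgMr.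
by apply/funext => n; rewrite /series/= mulr_sumr.
Qed.

Lemma sumsB u v S S' : sums u S -> sums v S' -> sums (fun n => u n - v n) (S - S').
Proof.
move=> uS vS; have := sumsD uS (sumsZ (k := -1) vS).
by rewrite mulN1r; apply: eq_sums => n; rewrite mulN1r.
Qed.

Lemma sums0 : sums (fun=> 0) 0.
Proof.
rewrite /sums (_ : series _ = cst 0); first exact: cvg_cst.
by apply/funext => n; rewrite /series/= big1.
Qed.

Lemma sums_sum (I : Type) (r : seq I) (u : I -> nat -> R) (S : I -> R) :
  (forall i, sums (u i) (S i)) ->
  sums (fun n => \sum_(i <- r) u i n) (\sum_(i <- r) S i).
Proof.
move=> uS; elim: r => [|i r IH].
  by rewrite big_nil; apply: eq_sums sums0 => n; rewrite big_nil.
rewrite big_cons; apply: eq_sums (sumsD (uS i) IH) => n.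
by rewrite big_cons.
Qed.

Lemma sums_shift u S : sums (fun n => u n.+1) S -> sums u (u 0%N + S).
Proof.
move=> uS; rewrite /sums -cvg_shiftS.
rewrite (_ : [sequence _]_n = (fun n => u 0%N + series (fun n => u n.+1) n)).
  by apply: cvgD => //; exact: cvg_cst.
by apply/funext => n; rewrite /series/= big_nat_recl.
Qed.

Lemma sums_shiftn k u S : (forall n, (n < k)%N -> u n = 0) ->
  sums (fun n => u (n + k)%N) S -> sums u S.
Proof.
elim: k u => [u _|k IH u u0 uS]; first by apply: eq_sums => n; rewrite addn0.
rewrite -[S]add0r -(u0 0%N)//; apply: sums_shift; apply: IH => [n nk|].
  by rewrite u0.
by apply: eq_sums uS => n; rewrite addnS.
Qed.

Lemma sums_fin k u : (forall n, (k <= n)%N -> u n = 0) ->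
  sums u (\sum_(n < k) u n).
Proof.
elim: k u => [u u0|k IH u u0].
  by rewrite big_ord0; apply: eq_sums sums0 => n; rewrite u0.
rewrite big_ord_recl; apply: sums_shift; apply: (IH (fun n => u n.+1)) => n kn.
exact: u0.
Qed.

Lemma sums_nneseries u S : (forall n, 0 <= u n) -> sums u S ->
  (\sum_(n <oo) (u n)%:E = S%:E)%E.
Proof.
move=> u0 uS; apply/cvg_lim => //.
rewrite (_ : (fun _ => _) = EFin \o series u).
  by apply: cvg_EFin => //; exact: nearW.
by apply/funext => n; rewrite /= /series/= sumEFin.
Qed.

Lemma nneseries_sums u : (forall n, 0 <= u n) ->
  (\sum_(n <oo) (u n)%:E < +oo)%E -> sums u (fine (\sum_(n <oo) (u n)%:E)%E).
Proof.
move=> u0 uy; set l := (\sum_(n <oo) _)%E in uy *.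
have l0 : (0 <= l)%E by apply: nneseries_ge0 => n _ _; rewrite lee_fin.
have lE : l = (fine l)%:E by rewrite fineK// ge0_fin_numE.
have : (\sum_(0 <= k < n) (u k)%:E @[n --> \oo] --> (fine l)%:E)%E.
  by rewrite -lE; apply: is_cvg_nneseries => n _ _; rewrite lee_fin.
move=> /fine_cvg; apply: cvg_trans; apply: near_eq_cvg; apply: nearW => n /=.
by rewrite /series/= sumEFin.
Qed.

Lemma sums_ge0 u S : (forall n, 0 <= u n) -> sums u S -> 0 <= S.
Proof.
move=> u0 uS; rewrite -lee_fin -(sums_nneseries u0 uS).
by apply: nneseries_ge0 => n _ _; rewrite lee_fin.
Qed.

Lemma le_sums u v S S' : (forall n, u n <= v n) -> sums u S -> sums v S' -> S <= S'.
Proof.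
move=> uv uS vS; rewrite -subr_ge0; apply: (sums_ge0 _ (sumsB vS uS)) => n.
by rewrite subr_ge0.
Qed.

Lemma sums_ge_term u S n : (forall n, 0 <= u n) -> sums u S -> u n <= S.
Proof.
move=> u0 uS; apply: (le_sums (u := fun k => if k == n then u n else 0) _ _ uS).
  by move=> k; case: eqP => [->|].
have := @sums_fin n.+1 (fun k => if k == n then u n else 0).
rewrite big_ord_recr/= eqxx big1 => [|i _]; last by rewrite ltn_eqF.
by rewrite add0r; apply => k nk; rewrite gtn_eqF.
Qed.

Lemma sums_absolute u : (\sum_(n <oo) `|u n|%:E < +oo)%E ->
  exists S, sums u S.
Proof.
move=> uy.
have hp n : 0 <= `|u n| + u n by have := ler_norm (- u n); rewrite normrN; lra.
have /nneseries_sums : (\sum_(n <oo) (`|u n| + u n)%:E < +oo)%E.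
  apply: (@le_lt_trans _ _ (\sum_(n <oo) (2 * `|u n|)%:E)%E).
    apply: lee_nneseries => n _; rewrite lee_fin// mulr2n mulrDl mul1r lerD2l.
    exact: ler_norm.
  under eq_eseriesr do rewrite EFinM.
  rewrite nneseriesZl; last by move=> n _; rewrite lee_fin.
  by rewrite lte_mul_pinfty// lee_fin.
move=> /(_ hp) s1; have s2 := nneseries_sums (fun n => normr_ge0 (u n)) uy.
eexists; apply: eq_sums (sumsB s1 s2) => n.
by rewrite addrAC subrr add0r.
Qed.

Let sums_pn (a : nat -> nat -> R) (r : nat -> R) :
  (\sum_(m <oo) \sum_(i <oo) `|a m i|%:E < +oo)%E ->
  (forall m, sums (a m) (r m)) ->
  sums r (fine (\sum_(m <oo) \sum_(i <oo) (Num.max (a m i) 0)%:E)%E -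
          fine (\sum_(m <oo) \sum_(i <oo) (Num.max (- a m i) 0)%:E)%E).
Proof.
move=> ay ar.
have step (b : nat -> nat -> R) : (forall m i, 0 <= b m i <= `|a m i|) ->
    (forall m, sums (b m) (fine (\sum_(i <oo) (b m i)%:E)%E)) /\
    sums (fun m => fine (\sum_(i <oo) (b m i)%:E)%E)
      (fine (\sum_(m <oo) \sum_(i <oo) (b m i)%:E)%E).
  move=> b0.
  have b0' m i : 0 <= b m i by have /andP[] := b0 m i.
  have by_ : (\sum_(m <oo) \sum_(i <oo) (b m i)%:E < +oo)%E.
    apply: le_lt_trans ay; apply: lee_nneseries => [m _ _|m _].
      by apply: nneseries_ge0 => i _ _; rewrite lee_fin.
    apply: lee_nneseries => [i _ _|i _]; rewrite lee_fin//.
    by have /andP[] := b0 m i.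
  have bm m : (\sum_(i <oo) (b m i)%:E < +oo)%E.
    apply: le_lt_trans by_.
    have c0 k : (0 <= \sum_(i <oo) (b k i)%:E)%E.
      by apply: nneseries_ge0 => i _ _; rewrite lee_fin.
    have := @nneseries_lim_ge R (fun k => \sum_(i <oo) (b k i)%:E)%E xpredT 0 m.+1.
    move=> /(_ (fun k _ _ => c0 k)); rewrite big_nat_recr//=; apply: le_trans.
    by rewrite leeDr// sume_ge0.
  have fE m : ((fine (\sum_(i <oo) (b m i)%:E))%:E = \sum_(i <oo) (b m i)%:E)%E.
    rewrite fineK// ge0_fin_numE//.
    by apply: nneseries_ge0 => i _ _; rewrite lee_fin.
  split; first by move=> m; exact: nneseries_sums.
  have sE : (\sum_(m <oo) (fine (\sum_(i <oo) (b m i)%:E))%:E =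
      \sum_(m <oo) \sum_(i <oo) (b m i)%:E)%E.
    by apply: eq_eseriesr => m _; exact: fE.
  rewrite -sE; apply: nneseries_sums; last by rewrite sE.
  move=> m; rewrite fine_ge0//.
  by apply: nneseries_ge0 => i _ _; rewrite lee_fin.
have [|p1 p2] := step (fun m i => Num.max (a m i) 0).
  by move=> m i; rewrite le_max lexx orbT ge_max ler_norm normr_ge0.
have [|n1 n2] := step (fun m i => Num.max (- a m i) 0).
  by move=> m i; rewrite le_max lexx orbT ge_max -normrN ler_norm normr_ge0.
apply: eq_sums (sumsB p2 n2) => m.
apply: (sums_unique (sumsB (p1 m) (n1 m))); apply: eq_sums (ar m) => i.
have [ai|ai] := leP 0 (a m i).
  by rewrite max_r ?oppr_le0// subr0.
by rewrite max_l ?oppr_ge0 ?ltW// sub0r opprK.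
Qed.

(** Fubini for double series: both iterated sums are the difference of the
    iterated sums of positive and negative parts. *)
Lemma sums_swap (a : nat -> nat -> R) (r c : nat -> R) S :
  (\sum_(m <oo) \sum_(i <oo) `|a m i|%:E < +oo)%E ->
  (forall m, sums (a m) (r m)) -> (forall i, sums (a^~ i) (c i)) ->
  sums r S -> sums c S.
Proof.
move=> ay ar ac rS; have rS' := sums_pn ay ar.
have ay' : (\sum_(i <oo) \sum_(m <oo) `|a m i|%:E < +oo)%E.
  by rewrite nneseries_interchange.
have := sums_pn ay' ac.
rewrite [X in fine X - _]nneseries_interchange; last first.
  by move=> i j; rewrite lee_fin le_max lexx orbT.
rewrite [X in _ - fine X]nneseries_interchange; last first.
  by move=> i j; rewrite lee_fin le_max lexx orbT.
by rewrite -(sums_unique rS rS').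
Qed.

(** The form in which absolute convergence is checked: the rows are dominated
    by the terms of a convergent series. *)
Lemma abs_double_lty (a : nat -> nat -> R) (b B : nat -> R) S :
  (forall m, sums (fun i => `|a m i|) (b m)) -> (forall m, b m <= B m) ->
  sums B S -> (\sum_(m <oo) \sum_(i <oo) `|a m i|%:E < +oo)%E.
Proof.
move=> ab bB BS.
have b0 m : 0 <= b m by apply: sums_ge0 (ab m) => i.
have rowE m : (\sum_(i <oo) `|a m i|%:E = (b m)%:E)%E by exact: sums_nneseries.
under eq_eseriesr do rewrite rowE.
apply: (@le_lt_trans _ _ (\sum_(m <oo) (B m)%:E)%E).
  by apply: lee_nneseries => m _; rewrite lee_fin.
rewrite (sums_nneseries _ BS) ?ltry// => m; exact: le_trans (bB m).
Qed.

End sums.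

(** * Series of Gamma type *)

Section pochhammer.
Context {R : realType}.
Implicit Types (c w z y : R) (m n i j k : nat).

(** The rising factorial c (c + 1) ... (c + n - 1). *)
Definition poch c n := \prod_(l < n) (c + l%:R).

Lemma poch0 c : poch c 0 = 1. Proof. by rewrite /poch big_ord0. Qed.

Lemma pochS c n : poch c n.+1 = poch c n * (c + n%:R).
Proof. by rewrite /poch big_ord_recr. Qed.

Lemma pochSl c n : poch c n.+1 = c * poch (c + 1) n.
Proof.
rewrite /poch big_ord_recl addr0; congr (_ * _); apply: eq_bigr => l _.
by rewrite -addrA -natr1 [_ + 1]addrC.
Qed.

Lemma poch_gt0 c n : 0 < c -> 0 < poch c n.
Proof. by move=> c0; apply: prodr_gt0 => l _; rewrite ltr_wpDr. Qed.

Lemma poch_neq0 c n : 0 < c -> poch c n != 0.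
Proof. by move=> c0; rewrite gt_eqF ?poch_gt0. Qed.

Lemma le_poch c c' n : 0 < c -> c <= c' -> poch c n <= poch c' n.
Proof.
move=> c0 cc'; apply: ler_prod => l _.
by rewrite lerD2r cc' ltW ?ltr_wpDr.
Qed.

Lemma poch1 n : poch 1 n = n`!%:R.
Proof.
elim: n => [|n IH]; first by rewrite poch0.
by rewrite pochS IH nat1r factS natrM mulrC.
Qed.

Lemma Gamma_poch c n : 0 < c -> Gamma (c + n%:R) = poch c n * Gamma c.
Proof.
move=> c0; elim: n => [|n IH]; first by rewrite addr0 poch0 mul1r.
have cn0 : 0 < c + n%:R by apply: ltr_wpDr.
by rewrite -natr1 addrA (GammaS cn0) IH pochS mulrA [_ * poch c n]mulrC.
Qed.

Lemma fact_neq0 n : n`!%:R != 0 :> R.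
Proof. by rewrite pnatr_eq0 -lt0n fact_gt0. Qed.

Lemma fact_gt0R n : 0 < n`!%:R :> R.
Proof. by rewrite ltr0n fact_gt0. Qed.

Lemma sums_exp y : sums (fun n => y ^+ n / n`!%:R) (expR y).
Proof.
have := is_cvg_series_exp_coeff y; rewrite /sums.
by rewrite (_ : series _ = series (exp_coeff y)).
Qed.

(** Shifting the exponent of Euler's integral. *)
Lemma integral_expN_powX c m : 0 < c ->
  (\int[mu_lag (c / 2 - 1)]_u ((`|u| ^+ m * expR (- u))%:E) =
   (poch c m * Gamma c)%:E)%E.
Proof.
move=> c0; have cm0 : 0 < c + m%:R by apply: ltr_wpDr.
have mexpN : measurable_fun setT (fun t : R => expR (- t)).
  by apply: measurableT_comp => //; exact: measurable_oppr.
rewrite -(Gamma_poch m c0) -(integral_expN_pow cm0) !integral_pow.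
- apply: eq_integral => u; rewrite inE/= in_itv/= andbT => u0.
  rewrite -!EFinM; congr EFin.
  rewrite gtr0_norm// mulrAC mulrC; congr (_ * _).
  have -> : c + m%:R - 1 = m%:R + (c - 1) by ring.
  by rewrite [in RHS]powRDp// powR_mulrn ?(ltW u0).
- by move=> u; rewrite lee_fin expR_ge0.
- exact/measurable_EFinP.
- by move=> u; rewrite lee_fin mulr_ge0 ?expR_ge0 ?exprn_ge0.
- apply/measurable_EFinP; apply: measurable_funM => //.
  by apply: measurable_funX; exact: normr_measurable.
Qed.

(** Integrating the exponential series of u w against u^(c-1) e^-u. *)
Lemma sums_binomial c w : 0 < c -> 0 <= w -> w < 1 ->
  sums (fun m => poch c m / m`!%:R * w ^+ m) ((1 - w) `^ (- c)).
Proof.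
move=> c0 w0 w1.
have u0 m : 0 <= poch c m / m`!%:R * w ^+ m.
  by rewrite mulr_ge0 ?exprn_ge0// divr_ge0// ltW// poch_gt0.
suff H : (\sum_(m <oo) (poch c m / m`!%:R * w ^+ m)%:E = ((1 - w) `^ (- c))%:E)%E.
  by have := nneseries_sums u0; rewrite H/=; apply; rewrite ltry.
have G0 := Gamma_gt0 c0.
suff H : ((Gamma c)%:E * \sum_(m <oo) (poch c m / m`!%:R * w ^+ m)%:E =
    (Gamma c)%:E * ((1 - w) `^ (- c))%:E)%E.
  move: H => /(congr1 (fun x => ((Gamma c)^-1)%:E * x)%E).
  by rewrite !muleA -EFinM mulVf ?gt_eqF// !mul1e.
rewrite -EFinM [RHS](_ : _ = ((1 - w) `^ (- c) * Gamma c)%:E); last by rewrite mulrC.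
rewrite -integral_exp_pow ?subr_gt0// -nneseriesZl; last by move=> m _; rewrite lee_fin.
pose f m u : \bar R := ((w ^+ m / m`!%:R)%:E * (`|u| ^+ m * expR (- u))%:E)%E.
have mexpN : measurable_fun setT (fun t : R => expR (- t)).
  by apply: measurableT_comp => //; exact: measurable_oppr.
have mg m : measurable_fun setT (fun u : R => (`|u| ^+ m * expR (- u))%:E).
  apply/measurable_EFinP; apply: measurable_funM => //.
  by apply: measurable_funX; exact: normr_measurable.
have g0 m (u : R) : (0 <= (`|u| ^+ m * expR (- u))%:E)%E.
  by rewrite lee_fin mulr_ge0 ?expR_ge0 ?exprn_ge0.
have k0 m : 0 <= w ^+ m / m`!%:R by rewrite divr_ge0 ?exprn_ge0.
have mf m : measurable_fun setT (f m) by exact: measurable_funeM.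
have f0 m u : (0 <= f m u)%E by rewrite mule_ge0// lee_fin.
transitivity (\int[mu_lag (c / 2 - 1)]_u (\sum_(m <oo) f m u))%E; last first.
  apply: ge0_ae_eq_integral => //.
  - exact: ge0_emeasurable_sum.
  - apply/measurable_EFinP; apply: (measurableT_comp (@measurable_expR R)).
    by apply: measurableT_comp => //; exact: measurable_funM.
  - by move=> u _; apply: nneseries_ge0.
  apply: filterS (ae_mu_lag_gt0 (c / 2 - 1)) => u up _.
  have -> : - ((1 - w) * u) = w * u - u by ring.
  rewrite expRD; apply: sums_nneseries.
    by move=> m; rewrite mulr_ge0 ?k0// mulr_ge0 ?expR_ge0 ?exprn_ge0.
  rewrite mulrC; apply: eq_sums (sumsZ (k := expR (- u)) (@sums_exp (w * u))) => m.
  rewrite gtr0_norm// exprMn; ring.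
rewrite integral_nneseries//; apply: eq_eseriesr => m _.
rewrite /f ge0_integralZl// ?lee_fin// integral_expN_powX// -!EFinM.
by congr EFin; field; exact: fact_neq0.
Qed.

(** The coefficients of the shifted exponential series y^k e^y. *)
Definition ifact k i : R := if (k <= i)%N then (i - k)`!%:R^-1 else 0.

Lemma ifact_ge0 k i : 0 <= ifact k i.
Proof. by rewrite /ifact; case: ifP => // _; rewrite invr_ge0. Qed.

Lemma ifactnn k : ifact k k = 1.
Proof. by rewrite /ifact leqnn subnn fact0 invr1. Qed.

Lemma ifact0 i : ifact 0 i = i`!%:R^-1.
Proof. by rewrite /ifact leq0n subn0. Qed.

Lemma ifact_gt k i : (i < k)%N -> ifact k i = 0.
Proof. by rewrite /ifact ltnNge => /negbTE ->. Qed.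

Lemma ifactSS k i : ifact k.+1 i.+1 = ifact k i.
Proof. by rewrite /ifact ltnS subSS. Qed.

Lemma ifactS k i : (k <= i)%N -> (i.+1%:R - k%:R) * ifact k i.+1 = ifact k i.
Proof.
move=> ki; rewrite /ifact ki (leqW ki) subSn// factS natrM invfM mulrA.
by rewrite -natrB ?leqW// subSn// divff ?mul1r// pnatr_eq0.
Qed.

Lemma sums_ifact k y : sums (fun i => y ^+ i * ifact k i) (y ^+ k * expR y).
Proof.
apply: (@sums_shiftn _ k).
  by move=> n nk; rewrite ifact_gt// mulr0.
have := sumsZ (k := y ^+ k) (@sums_exp y); apply: eq_sums => n.
by rewrite /ifact leq_addl addnK exprD; ring.
Qed.


(** The Laguerre polynomial in a sign-free normalisation: n!/(c)_n L_n^(c-1)(x)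
    is [lagP c n (- x)]. *)
Definition lagP c m z := \sum_(i < m.+1) 'C(m, i)%:R * z ^+ i / poch c i.

Lemma sums_lagP c m z : sums (fun i => 'C(m, i)%:R * z ^+ i / poch c i) (lagP c m z).
Proof.
by apply: sums_fin => n mn; rewrite bin_small// mul0r mul0r.
Qed.

Lemma lagP_ge0 c m z : 0 < c -> 0 <= z -> 0 <= lagP c m z.
Proof.
move=> c0 z0; apply: sumr_ge0 => i _; rewrite divr_ge0 ?mulr_ge0 ?exprn_ge0//.
exact/ltW/poch_gt0.
Qed.

Lemma le_norm_lagP c m z : 0 < c -> `|lagP c m z| <= lagP c m `|z|.
Proof.
move=> c0; apply: (le_trans (ler_norm_sum _ _ _)); apply: ler_sum => i _.
by rewrite !normrM normrV ?unitfE ?poch_neq0// normrX normr_nat (gtr0_norm (poch_gt0 i c0)).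
Qed.

(** Subexponential growth: C(m,i) d^i sums to (1+d)^m, and y^i/(c)_i is
    bounded for y = z/d. *)
Lemma lagP_growth c z d : 0 < c -> 0 <= z -> 0 < d ->
  exists M, 0 < M /\ forall m, lagP c m z <= M * (1 + d) ^+ m.
Proof.
move=> c0 z0 d0; pose y := z / d.
have y0 : 0 <= y by rewrite divr_ge0// ltW.
pose M := 1 + y / c * expR y.
have M0 : 0 <= y / c * expR y.
  by rewrite mulr_ge0 ?expR_ge0// divr_ge0// ltW.
have yc0 : 0 <= y / c by rewrite mulr_ge0// invr_ge0 ltW.
have bound i : y ^+ i / poch c i <= M.
  case: i => [|i]; first by rewrite expr0 poch0 divr1 lerDl.
  apply: (@le_trans _ _ (y / c * (y ^+ i / i`!%:R))); last first.
    apply: (@le_trans _ _ (y / c * expR y)); last by rewrite lerDr.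
    rewrite ler_wpM2l//.
    have := sums_ge_term i _ (@sums_exp y); apply => n.
    by rewrite divr_ge0// exprn_ge0.
  rewrite exprS pochSl invfM mulrACA ler_wpM2l//.
  rewrite ler_wpM2l ?exprn_ge0// lef_pV2 ?posrE ?poch_gt0 ?fact_gt0R ?addr_gt0//.
  by rewrite -poch1 le_poch// lerDr ltW.
exists M; split; first by rewrite /M; lra.
move=> m; rewrite exprDn mulr_sumr; apply: ler_sum => i _.
rewrite expr1n mul1r -[X in _ <= _ * X]mulr_natl.
have -> : 'C(m, i)%:R * z ^+ i / poch c i = 'C(m, i)%:R * d ^+ i * (y ^+ i / poch c i).
  by rewrite /y expr_div_n; field; rewrite poch_neq0// expf_neq0// gt_eqF.
by rewrite [M * _]mulrC ler_wpM2l// mulr_ge0// exprn_ge0// ltW.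
Qed.

(** The generating coefficients sum_m (c)_m/m! w^m C(m,i) C(m,j), by induction
    on i through the recursion of the binomial coefficients, which shifts c. *)
Definition genB c w i j : R := (1 - w) `^ (- c) * (w / (1 - w)) ^+ (i + j) *
  \sum_(k < i.+1) w ^- k * poch c i * poch c j / (poch c k * k`!%:R) *
    ifact k i * ifact k j.

(** The identity C(m, i + 1) = m / (i + 1) C(m - 1, i) turns the weight (c)_m / m!
    into c (c + 1)_(m-1) / (m - 1)!, and C(m, j) is then split by Pascal's rule. *)
Lemma genB_rec c w i j : 0 < c -> 0 < w -> w < 1 ->
  c * w / i.+1%:R * (genB (c + 1) w i j + (if j is j'.+1 then genB (c + 1) w i j' else 0)) =
  genB c w i.+1 j.
Proof.
move=> c0 w0 w1; have W0 : 1 - w != 0 by rewrite subr_eq0 gt_eqF.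
have wn0 : w != 0 by rewrite gt_eqF.
have cn0 : c != 0 by rewrite gt_eqF.
have ck0 k : c + k%:R != 0 by rewrite gt_eqF// ltr_wpDr.
have i0 : i.+1%:R != 0 :> R by rewrite pnatr_eq0.
have pn0 k : poch c k != 0 by exact: poch_neq0.
have nat0 k : 1 + k%:R != 0 :> R by rewrite nat1r pnatr_eq0.
have hp k l : (if l is l'.+1 then ifact k l' else 0) = (l%:R - k%:R) * ifact k l.
  case: l => [|l].
    by case: k => [|k]; [rewrite subrr mul0r|rewrite (@ifact_gt k.+1 0)// mulr0].
  have [kl|kl] := leqP k l; first by rewrite -ifactS.
  rewrite ifact_gt//; move: kl; rewrite leq_eqVlt => /predU1P[<-|kl].
    by rewrite subrr mul0r.
  by rewrite (@ifact_gt k l.+1)// mulr0.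
have pochc n : poch (c + 1) n = poch c n * (c + n%:R) / c.
  by rewrite -pochS pochSl mulrAC divff// mul1r.
pose G k := w ^- k / (poch c k * k`!%:R).
have GS k : w^-1 * (G k / (c + k%:R)) = k.+1%:R * G k.+1.
  rewrite /G pochS factS natrM exprS; field.
  by rewrite fact_neq0 nat0 ck0 pn0 expf_neq0.
have W1 : (1 - w) `^ (- (c + 1)) = (1 - w) `^ (- c) / (1 - w).
  by rewrite opprD powRDp ?subr_gt0// powR_inv1 ?subr_ge0 ?ltW.
set Pc := (1 - w) `^ (- c) * (w / (1 - w)) ^+ (i.+1 + j) * poch c i.+1 * poch c j.
have E0 : genB c w i.+1 j = Pc * \sum_(k < i.+2) G k * ifact k i.+1 * ifact k j.
  rewrite /genB /Pc -!mulrA; congr (_ * (_ * _)); rewrite !mulr_sumr.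
  apply: eq_bigr => k _; rewrite /G; field.
  by rewrite pn0 fact_neq0 expf_neq0.
have E1 : c * w / i.+1%:R * genB (c + 1) w i j = Pc / i.+1%:R *
    \sum_(k < i.+1) G k / (c + k%:R) * ifact k i * ((c + j%:R) * ifact k j).
  rewrite /genB /Pc !mulr_sumr; apply: eq_bigr => k _.
  rewrite /G W1 !pochc pochS addSn exprS; field.
  by rewrite pn0 fact_neq0 expf_neq0// ?ck0 ?cn0 ?W0 ?nat0 ?wn0.
have E2 : c * w / i.+1%:R * (if j is j'.+1 then genB (c + 1) w i j' else 0) =
    Pc / i.+1%:R * \sum_(k < i.+1) (w^-1 - 1) * (G k / (c + k%:R)) * ifact k i *
      ((j%:R - k%:R) * ifact k j).
  case: j @Pc {E0 E1} => [|j] Pc.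
    rewrite mulr0 big1 ?mulr0// => k _.
    by case: (k : nat) => [|l]; [rewrite subrr mul0r mulr0|rewrite (@ifact_gt l.+1 0)// !mulr0].
  rewrite /genB /Pc !mulr_sumr; apply: eq_bigr => k _.
  rewrite -(hp k j.+1) /G W1 !pochc !pochS addnS addSn !exprS; field.
  by rewrite pn0 fact_neq0 expf_neq0// ?ck0 ?cn0 ?W0 ?wn0 ?nat0.
rewrite mulrDr E1 E2 E0 -mulrDr -mulrA; congr (_ * _).
apply: (mulfI i0); rewrite mulrA divff// mul1r -big_split/=.
have -> : \sum_(k < i.+1) (G k / (c + k%:R) * ifact k i * ((c + j%:R) * ifact k j) +
    (w^-1 - 1) * (G k / (c + k%:R)) * ifact k i * ((j%:R - k%:R) * ifact k j)) =
    \sum_(k < i.+1) G k * ifact k i * ifact k j +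
    \sum_(k < i.+1) k.+1%:R * G k.+1 * ifact k i * ((j%:R - k%:R) * ifact k j).
  rewrite -big_split/=; apply: eq_bigr => k _; rewrite -GS; field.
  by rewrite ck0 wn0.
have -> : \sum_(k < i.+1) k.+1%:R * G k.+1 * ifact k i * ((j%:R - k%:R) * ifact k j) =
    \sum_(k < i.+2) k%:R * G k * ifact k i.+1 * ifact k j.
  rewrite [RHS]big_ord_recl !mul0r add0r; apply: eq_bigr => k _.
  rewrite -hp /= /bump add1n -(ifactSS k i); congr (_ * _).
  by case: j {Pc E0 E1 E2} => [|j]; [rewrite ifact_gt|rewrite ifactSS].
have -> : \sum_(k < i.+1) G k * ifact k i * ifact k j =
    \sum_(k < i.+2) G k * ifact k i * ifact k j.
  by rewrite [RHS]big_ord_recr/= (@ifact_gt i.+1 i)// mulr0 mul0r addr0.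
rewrite -big_split mulr_sumr/=; apply: eq_bigr => k _.
by rewrite (hp k i.+1); ring.
Qed.

Lemma sums_genB c w i j : 0 < c -> 0 < w -> w < 1 ->
  sums (fun m => poch c m / m`!%:R * w ^+ m * 'C(m, i)%:R * 'C(m, j)%:R)
    (genB c w i j).
Proof.
move=> c0 w0 w1; elim: i c c0 j => [c c0 j|i IH c c0 j].
  elim: j c c0 => [c c0|j IH c c0].
    rewrite /genB expr0 mulr1 big_ord_recl big_ord0 addr0 !poch0 ifactnn expr0 fact0 invr1 !mulr1.
    rewrite divr1 mulr1.
    by apply: eq_sums (sums_binomial c0 (ltW w0) w1) => m; rewrite !bin0 !mulr1.
  have -> : genB c w 0 j.+1 = 0 + c * w / j.+1%:R * genB (c + 1) w 0 j.
    rewrite add0r /genB !big_ord_recl !big_ord0 !addr0 !poch0 expr0 invr1 fact0.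
    rewrite !ifact0 factS natrM !add0n exprS pochSl opprD powRDp ?subr_gt0// powR_inv1 ?subr_ge0 ?ltW//.
    have W0 : 1 - w != 0 by rewrite subr_eq0 gt_eqF.
    have nat0 k : 1 + k%:R != 0 :> R by rewrite nat1r pnatr_eq0.
    by field; rewrite ?fact_neq0 ?nat0 ?W0.
  have <- : poch c 0 / 0`!%:R * w ^+ 0 * 'C(0, 0)%:R * 'C(0, j.+1)%:R = 0.
    by rewrite bin0n mulr0.
  apply: sums_shift; have c10 : 0 < c + 1 by rewrite addr_gt0.
  have := sumsZ (k := c * w / j.+1%:R) (IH (c + 1) c10); apply: eq_sums => m.
  rewrite !bin0 pochSl factS natrM exprS !mulr1.
  have : j.+1%:R * 'C(m.+1, j.+1)%:R = m.+1%:R * 'C(m, j)%:R :> R.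
    by rewrite -!natrM mul_bin_diag.
  move=> E; have j0 : j.+1%:R != 0 :> R by rewrite pnatr_eq0.
  have m0 : m.+1%:R != 0 :> R by rewrite pnatr_eq0.
  have -> : 'C(m, j)%:R = j.+1%:R * 'C(m.+1, j.+1)%:R / m.+1%:R :> R.
    by rewrite E mulrAC divff// mul1r.
  by field; rewrite fact_neq0 !nat1r j0 m0.
have Z : poch c 0 / 0`!%:R * w ^+ 0 * 'C(0, i.+1)%:R * 'C(0, j)%:R = 0.
  by rewrite bin0n mulr0 mul0r.
rewrite -genB_rec// -[X in sums _ X]add0r -[X in sums _ (X + _)]Z {Z}.
apply: sums_shift; have c10 : 0 < c + 1 by rewrite addr_gt0.
have E m : i.+1%:R * 'C(m.+1, i.+1)%:R = m.+1%:R * 'C(m, i)%:R :> R.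
  by rewrite -!natrM mul_bin_diag.
have i0 : i.+1%:R != 0 :> R by rewrite pnatr_eq0.
have m0 m : m.+1%:R != 0 :> R by rewrite pnatr_eq0.
have Em m : 'C(m, i)%:R = i.+1%:R * 'C(m.+1, i.+1)%:R / m.+1%:R :> R.
  by rewrite E mulrAC divff// mul1r.
case: j => [|j].
  rewrite addr0; have := sumsZ (k := c * w / i.+1%:R) (IH (c + 1) c10 0%N).
  apply: eq_sums => m; rewrite !bin0 pochSl factS natrM exprS !mulr1 Em.
  by field; rewrite fact_neq0 !nat1r i0 m0.
have := sumsZ (k := c * w / i.+1%:R)
  (sumsD (IH (c + 1) c10 j.+1) (IH (c + 1) c10 j)).
apply: eq_sums => m; rewrite (binS m j) natrD pochSl factS natrM exprS Em.
by field; rewrite fact_neq0 !nat1r i0 m0.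
Qed.


(** The Bessel-type series; z^(nu/2) bessK (nu+1) (z/4) is, up to constants,
    the modified Bessel function I_nu(sqrt z). *)
Definition bessK c z := limn (series (fun k => z ^+ k / (poch c k * k`!%:R))).

Lemma sums_bessK c z : 0 < c -> sums (fun k => z ^+ k / (poch c k * k`!%:R)) (bessK c z).
Proof.
move=> c0.
suff [S /[dup] HS /sums_lim SE] : exists S,
    sums (fun k => z ^+ k / (poch c k * k`!%:R)) S by rewrite /bessK SE.
apply: sums_absolute.
have hp k : (poch c k)^-1 <= 1 + c^-1.
  case: k => [|k]; first by rewrite poch0 invr1 lerDl invr_ge0 ltW.
  apply: (@le_trans _ _ c^-1); last by rewrite lerDr.
  rewrite lef_pV2 ?posrE ?poch_gt0// pochSl ler_peMr ?(ltW c0)//.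
  apply: (@le_trans _ _ (poch 1 k)); last by rewrite le_poch// lerDr ltW.
  by rewrite poch1 ler1n fact_gt0.
apply: (@le_lt_trans _ _ (\sum_(k <oo) ((1 + c^-1) * (`|z| ^+ k / k`!%:R))%:E)%E).
  apply: lee_nneseries => k _; rewrite lee_fin//.
  rewrite normrM normrX normrV ?unitfE ?mulf_neq0 ?poch_neq0 ?fact_neq0//.
  rewrite normrM normr_nat (gtr0_norm (poch_gt0 k c0)) invfM mulrCA.
  by rewrite ler_wpM2r// divr_ge0// exprn_ge0.
rewrite (sums_nneseries _ (sumsZ (k := 1 + c^-1) (@sums_exp `|z|))) ?ltry// => k.
by rewrite mulr_ge0// ?divr_ge0 ?exprn_ge0// addr_ge0// invr_ge0 ltW.
Qed.

(** Every rearrangement below is dominated by this double series. *)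
Lemma lagP_double_growth c w z z' : 0 < c -> 0 < w -> w < 1 -> 0 <= z -> 0 <= z' ->
  exists B S, [/\ forall m, poch c m / m`!%:R * w ^+ m * lagP c m z * lagP c m z' <= B m
    & sums B S].
Proof.
move=> c0 w0 w1 z0 z'0.
pose q := (1 + w^-1) / 2.
have q1 : 1 < q by rewrite /q ltr_pdivlMr// mul1r -[2]/(1 + 1) ltrD2l invf_gt1.
pose d := Num.sqrt q - 1.
have d0 : 0 < d by rewrite subr_gt0 -[ltLHS]sqrtr1 ltr_sqrt// (lt_trans _ q1).
have dq : (1 + d) ^+ 2 = q.
  by rewrite /d addrC subrK sqr_sqrtr// ltW// (lt_trans _ q1).
have wq0 : 0 <= w * q by rewrite mulr_ge0 ?ltW// (lt_trans _ q1).
have wq1 : w * q < 1.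
  rewrite /q mulrA ltr_pdivrMr// mulrDr divff ?gt_eqF// mulr1 mul1r; lra.
have [M [M0 HM]] := lagP_growth c0 z0 d0.
have [M' [M'0 HM']] := lagP_growth c0 z'0 d0.
exists (fun m => M * M' * (poch c m / m`!%:R * (w * q) ^+ m)); eexists; split; last first.
  exact: sumsZ (sums_binomial c0 wq0 wq1).
move=> m; rewrite exprMn -dq -exprM mulnC exprM.
have -> : M * M' * (poch c m / m`!%:R * (w ^+ m * ((1 + d) ^+ m) ^+ 2)) =
   poch c m / m`!%:R * w ^+ m * ((M * (1 + d) ^+ m) * (M' * (1 + d) ^+ m)) by ring.
rewrite -mulrA ler_wpM2l//.
  by rewrite mulr_ge0 ?exprn_ge0 ?(ltW w0)// divr_ge0// ltW ?poch_gt0.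
by rewrite ler_pM ?lagP_ge0.
Qed.

(** All terms of the polynomial are positive at 1, and the j-th one is C(m, j) up
    to (c)_j. *)
Lemma bin_le_lagP c m j : 0 < c -> 'C(m, j)%:R <= poch c j * lagP c m 1.
Proof.
move=> c0; have p0 : 0 < poch c j by exact: poch_gt0.
rewrite -ler_pdivrMl// mulrC.
have := sums_ge_term j _ (@sums_lagP c m 1); rewrite expr1n mulr1; apply => n.
by rewrite divr_ge0 ?mulr_ge0 ?exprn_ge0// ltW// poch_gt0.
Qed.

(** The weight C(m, j) makes this w^j / j! times the j-th derivative of the
    generating function (1 - w)^-c exp (z w / (1 - w)); it is computed by expanding
    the polynomial and summing over m first, with [sums_genB]. *)
Lemma sums_lagP_bin c w z j : 0 < c -> 0 < w -> w < 1 ->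
  sums (fun m => poch c m / m`!%:R * w ^+ m * lagP c m z * 'C(m, j)%:R)
    ((1 - w) `^ (- c) * (w / (1 - w)) ^+ j * poch c j * expR (w / (1 - w) * z) *
     \sum_(k < j.+1) (z / (1 - w)) ^+ k / (poch c k * k`!%:R) * ifact k j).
Proof.
move=> c0 w0 w1; set v := w / (1 - w).
have W0 : 1 - w != 0 by rewrite subr_eq0 gt_eqF.
have wn0 : w != 0 by rewrite gt_eqF.
have u0 m : 0 <= poch c m / m`!%:R * w ^+ m.
  by rewrite mulr_ge0 ?exprn_ge0 ?(ltW w0)// divr_ge0// ltW// poch_gt0.
pose a i m := poch c m / m`!%:R * w ^+ m * 'C(m, j)%:R * ('C(m, i)%:R * z ^+ i / poch c i).
have rowS m : sums (a^~ m) (poch c m / m`!%:R * w ^+ m * lagP c m z * 'C(m, j)%:R).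
  rewrite mulrAC.
  exact: (sumsZ (k := poch c m / m`!%:R * w ^+ m * 'C(m, j)%:R) (@sums_lagP c m z)).
have colS i : sums (a i) (z ^+ i / poch c i * genB c w i j).
  have := sumsZ (k := z ^+ i / poch c i) (@sums_genB c w i j c0 w0 w1).
  by apply: eq_sums => m; rewrite /a; ring.
have absS : (\sum_(m <oo) \sum_(i <oo) `|a i m|%:E < +oo)%E.
  have [B [S [HB BS]]] := lagP_double_growth c0 w0 w1 (normr_ge0 z) ler01.
  apply: (abs_double_lty (b := fun m => poch c m / m`!%:R * w ^+ m * 'C(m, j)%:R * lagP c m `|z|)
    (B := fun m => poch c j * B m) (S := poch c j * S)) => [m|m|].
  - have := sumsZ (k := poch c m / m`!%:R * w ^+ m * 'C(m, j)%:R) (@sums_lagP c m `|z|).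
    apply: eq_sums => i; rewrite /a normrM (ger0_norm (mulr_ge0 (u0 m) (ler0n _ _))).
    by rewrite !normrM normrV ?unitfE ?poch_neq0// normrX normr_nat (gtr0_norm (poch_gt0 i c0)).
  - apply: (@le_trans _ _ (poch c j * (poch c m / m`!%:R * w ^+ m * lagP c m `|z| * lagP c m 1))).
      have -> : poch c j * (poch c m / m`!%:R * w ^+ m * lagP c m `|z| * lagP c m 1) =
        (poch c m / m`!%:R * w ^+ m * lagP c m `|z|) * (poch c j * lagP c m 1) by ring.
      rewrite mulrAC ler_wpM2l ?bin_le_lagP//.
      by rewrite mulr_ge0// lagP_ge0.
    by rewrite ler_wpM2l// ltW// poch_gt0.
  - exact: sumsZ.
pose Pc := (1 - w) `^ (- c) * v ^+ j * poch c j.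
pose T := expR (v * z) * \sum_(k < j.+1) (z / (1 - w)) ^+ k / (poch c k * k`!%:R) * ifact k j.
have rS : sums (fun i => z ^+ i / poch c i * genB c w i j) (Pc * T).
  rewrite /T mulr_sumr mulr_sumr.
  pose g (k : 'I_j.+1) := Pc * (w ^- k / (poch c k * k`!%:R) * ifact k j).
  have := @sums_sum _ _ (index_enum 'I_j.+1) (fun (k : 'I_j.+1) i => g k * ((v * z) ^+ i * ifact k i))
    (fun k : 'I_j.+1 => g k * ((v * z) ^+ k * expR (v * z))) (fun k : 'I_j.+1 => sumsZ (k := g k) (@sums_ifact k (v * z))).
  move=> H; rewrite (eq_bigr (fun k : 'I_j.+1 => g k * ((v * z) ^+ k * expR (v * z)))); last first.
    move=> k _; rewrite /g.
    have -> : z / (1 - w) = v * z / w by rewrite /v; field; rewrite W0 wn0.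
    by rewrite expr_div_n; field; rewrite fact_neq0 poch_neq0// expf_neq0.
  apply: eq_sums H => i; rewrite /genB -/v.
  have -> : \sum_(k < i.+1) w ^- k * poch c i * poch c j / (poch c k * k`!%:R) * ifact k i * ifact k j =
     \sum_(k < j.+1) w ^- k * poch c i * poch c j / (poch c k * k`!%:R) * ifact k i * ifact k j.
    pose h k := w ^- k * poch c i * poch c j / (poch c k * k`!%:R) * ifact k i * ifact k j.
    have h0 k : (i < k)%N || (j < k)%N -> h k = 0.
      by rewrite /h => /orP[ik|jk]; [rewrite (ifact_gt ik) mulr0 mul0r|rewrite (ifact_gt jk) mulr0].
    have hmin n : (minn i j <= n)%N -> \sum_(k < n.+1) h k = \sum_(k < (minn i j).+1) h k.
      move=> mn; rewrite [RHS](big_ord_widen n.+1 h) ?ltnS//.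
      rewrite [LHS](bigID (fun k : 'I_n.+1 => (k < (minn i j).+1)%N))/= [X in _ + X]big1 ?addr0//.
      move=> k; rewrite -leqNgt => mk; apply: h0.
      by rewrite -gtn_min.
    by rewrite -/(h _) [LHS](hmin i) ?geq_minl// [RHS](hmin j) ?geq_minr.
  rewrite mulr_sumr mulr_sumr; apply: eq_bigr => k _; rewrite /g /Pc.
  rewrite [(v * z) ^+ i]exprMn [v ^+ (i + j)]exprD.
  have := poch_neq0 i c0; set X := w ^- k / _; move=> pi0.
  rewrite -[w ^- k * poch c i * poch c j / _](_ : X * (poch c i * poch c j) = _);
    last by rewrite /X; ring.
  by clearbody v; field.
have -> : (1 - w) `^ (- c) * v ^+ j * poch c j * expR (v * z) *
    (\sum_(k < j.+1) (z / (1 - w)) ^+ k / (poch c k * k`!%:R) * ifact k j) = Pc * T.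
  by rewrite /Pc /T !mulrA.
apply: (sums_swap (a := a) _ colS rowS rS).
by rewrite nneseries_interchange.
Qed.

(** The Hille-Hardy formula: expand the second polynomial, sum over m with
    [sums_lagP_bin], and exchange the remaining sums over k <= j; the sum over j is
    an exponential and the one over k is the Bessel series. *)
Theorem hille_hardy c w z z' : 0 < c -> 0 < w -> w < 1 ->
  sums (fun m => poch c m / m`!%:R * w ^+ m * lagP c m z * lagP c m z')
    ((1 - w) `^ (- c) * expR (w / (1 - w) * (z + z')) *
     bessK c (z * z' * w / (1 - w) ^+ 2)).
Proof.
move=> c0 w0 w1; set v := w / (1 - w).
have W0 : 1 - w != 0 by rewrite subr_eq0 gt_eqF.
have wn0 : w != 0 by rewrite gt_eqF.
have u0 m : 0 <= poch c m / m`!%:R * w ^+ m.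
  by rewrite mulr_ge0 ?exprn_ge0 ?(ltW w0)// divr_ge0// ltW// poch_gt0.
pose a m j := poch c m / m`!%:R * w ^+ m * lagP c m z * ('C(m, j)%:R * z' ^+ j / poch c j).
have rowS m : sums (a m) (poch c m / m`!%:R * w ^+ m * lagP c m z * lagP c m z').
  exact: sumsZ (@sums_lagP c m z').
pose q j := (1 - w) `^ (- c) * v ^+ j * poch c j * expR (v * z) *
     \sum_(k < j.+1) (z / (1 - w)) ^+ k / (poch c k * k`!%:R) * ifact k j.
have colS j : sums (a^~ j) (z' ^+ j / poch c j * q j).
  have := sumsZ (k := z' ^+ j / poch c j) (@sums_lagP_bin c w z j c0 w0 w1).
  by apply: eq_sums => m; rewrite /a; ring.
have absS : (\sum_(m <oo) \sum_(i <oo) `|a m i|%:E < +oo)%E.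
  have [B [S [HB BS]]] := lagP_double_growth c0 w0 w1 (normr_ge0 z) (normr_ge0 z').
  apply: (abs_double_lty (b := fun m => `|poch c m / m`!%:R * w ^+ m * lagP c m z| * lagP c m `|z'|)
    (B := B) (S := S)) => // m.
    have := sumsZ (k := `|poch c m / m`!%:R * w ^+ m * lagP c m z|) (@sums_lagP c m `|z'|).
    apply: eq_sums => j; rewrite /a [in RHS]normrM; congr (_ * _).
    by rewrite !normrM normrV ?unitfE ?poch_neq0// normrX normr_nat (gtr0_norm (poch_gt0 j c0)).
  apply: le_trans (HB m); rewrite ler_wpM2r ?lagP_ge0//.
  by rewrite normrM (ger0_norm (u0 m)) ler_wpM2l// le_norm_lagP.
pose Pc := (1 - w) `^ (- c) * expR (v * z).
pose g k := (z / (1 - w)) ^+ k / (poch c k * k`!%:R).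
pose b k j := Pc * (g k * ((v * z') ^+ j * ifact k j)).
have rowb k : sums (b k) (Pc * (g k * ((v * z') ^+ k * expR (v * z')))).
  exact: sumsZ (sumsZ (@sums_ifact k (v * z'))).
have colb j : sums (b^~ j) (z' ^+ j / poch c j * q j).
  have -> : z' ^+ j / poch c j * q j = \sum_(k < j.+1) b k j.
    rewrite /q !mulr_sumr; apply: eq_bigr => k _; rewrite /b /g /Pc [(v * z') ^+ j]exprMn; field.
    by rewrite ?poch_neq0// fact_neq0.
  by apply: sums_fin => k jk; rewrite /b ifact_gt// !mulr0.
have KE k : Pc * (g k * ((v * z') ^+ k * expR (v * z'))) =
    Pc * expR (v * z') * ((z * z' * w / (1 - w) ^+ 2) ^+ k / (poch c k * k`!%:R)).
  have -> : z * z' * w / (1 - w) ^+ 2 = (z / (1 - w)) * (v * z') by rewrite /v; field.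
  rewrite /g; set A := z / (1 - w); set B := v * z'.
  by rewrite [(A * B) ^+ k]exprMn; ring.
have absb : (\sum_(k <oo) \sum_(j <oo) `|b k j|%:E < +oo)%E.
  apply: (abs_double_lty (b := fun k => `|Pc * g k| * (`|v * z'| ^+ k * expR `|v * z'|))
    (B := fun k => `|Pc| * expR `|v * z'| *
       ((`|z / (1 - w)| * `|v * z'|) ^+ k / (poch c k * k`!%:R)))) => [k|k|].
  - have := sumsZ (k := `|Pc * g k|) (@sums_ifact k `|v * z'|).
    apply: eq_sums => j; rewrite /b [in RHS]mulrA [in RHS]normrM; congr (_ * _).
    by rewrite [in RHS]normrM normrX (ger0_norm (ifact_ge0 _ _)).
  - rewrite le_eqVlt; apply/orP; left; apply/eqP.
    have D0 : 0 < (poch c k * k`!%:R)^-1.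
      by rewrite invr_gt0 mulr_gt0 ?poch_gt0 ?fact_gt0R.
    have gE : `|g k| = `|z / (1 - w)| ^+ k / (poch c k * k`!%:R).
      by rewrite /g normrM (gtr0_norm D0) normrX.
    rewrite [`|Pc * _|]normrM gE [(`|z / (1 - w)| * _) ^+ k]exprMn.
    set A := `|z / (1 - w)|; set B := `|v * z'|; ring.
  - exact: (sumsZ (@sums_bessK c (`|z / (1 - w)| * `|v * z'|) c0)).
have bS := sumsZ (k := Pc * expR (v * z')) (@sums_bessK c (z * z' * w / (1 - w) ^+ 2) c0).
have qS := sums_swap absb rowb colb (eq_sums (fun k => esym (KE k)) bS).
have : (1 - w) `^ (- c) * expR (v * (z + z')) * bessK c (z * z' * w / (1 - w) ^+ 2) =
  Pc * expR (v * z') * bessK c (z * z' * w / (1 - w) ^+ 2).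
  by rewrite /Pc mulrDr expRD; ring.
move=> ->; apply: (sums_swap (a := fun j m => a m j) _ colS rowS qS).
by rewrite nneseries_interchange.
Qed.

End pochhammer.

(** * Laguerre functions and their heat kernel *)

Section laguerre_functions.
Context {R : realType}.
Implicit Types (b c t r s x w : R) (k m n i j : nat).

Lemma gbinom_poch b k i : (i <= k)%N -> 0 < b + 1 ->
  gbinom (k%:R + b) (k - i) = poch (b + 1) k / (poch (b + 1) i * (k - i)`!%:R).
Proof.
move=> ik c0; rewrite /gbinom -[in RHS](subnKC ik) addKn -[in LHS](subnKC ik).
rewrite addKn; set n := (k - i)%N => {ik}.
have -> : poch (b + 1) (i + n) = poch (b + 1) i * \prod_(l < n) ((i + n)%:R + b - l%:R).
  elim: n => [|n IH]; first by rewrite addn0 big_ord0 mulr1.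
  rewrite addnS pochS IH big_ord_recl mulrAC -mulrA; congr (_ * _).
  rewrite subr0; congr (_ * _); first by rewrite -natr1; ring.
  by apply: eq_bigr => l _; rewrite /= /bump add1n -!natr1; ring.
by field; rewrite fact_neq0 poch_neq0.
Qed.

Lemma laguerreE b k x : 0 < b + 1 ->
  (laguerre b k).[x] = poch (b + 1) k / k`!%:R * lagP (b + 1) k (- x).
Proof.
move=> c0; rewrite /laguerre horner_poly /lagP mulr_sumr; apply: eq_bigr => i _.
have ik : (i <= k)%N by rewrite -ltnS.
rewrite gbinom_poch// [(- x) ^+ i]exprNn.
have -> : 'C(k, i)%:R = k`!%:R / (i`!%:R * (k - i)`!%:R) :> R.
  by rewrite -(bin_fact ik) natrM natrM mulfK// mulf_neq0// fact_neq0.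
by field; rewrite !fact_neq0 poch_neq0.
Qed.

(** The normalising factor, with the Gamma functions reduced to rising factorials. *)
Definition psi_norm b k := Num.sqrt (2 * k`!%:R / (poch (b + 1) k * Gamma (b + 1))).

Lemma psi_norm_sqr b k : 0 < b + 1 ->
  psi_norm b k ^+ 2 = 2 * k`!%:R / (poch (b + 1) k * Gamma (b + 1)).
Proof.
move=> c0; rewrite sqr_sqrtr// divr_ge0// mulr_ge0// ltW//.
  exact: poch_gt0.
exact: Gamma_gt0.
Qed.

Lemma psiE b k r : 0 < b + 1 ->
  psi b k r = psi_norm b k * (poch (b + 1) k / k`!%:R) *
    lagP (b + 1) k (- r ^+ 2) * expR (- (r ^+ 2 / 2)).
Proof.
move=> c0; rewrite /psi laguerreE// !mulrA; congr (_ * _ * _ * _ * _).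
rewrite /psi_norm (_ : k%:R + 1 = 1 + k%:R); last exact: addrC.
rewrite (_ : k%:R + b + 1 = b + 1 + k%:R); last by ring.
by rewrite !Gamma_poch// Gamma1 mulr1 poch1.
Qed.

Lemma psi_mul b k r s : 0 < b + 1 ->
  psi b k r * psi b k s = 2 / Gamma (b + 1) * expR (- ((r ^+ 2 + s ^+ 2) / 2)) *
    (poch (b + 1) k / k`!%:R * lagP (b + 1) k (- r ^+ 2) * lagP (b + 1) k (- s ^+ 2)).
Proof.
move=> c0; have p0 := poch_neq0 k c0; have G0 := gt_eqF (Gamma_gt0 c0).
have -> : - ((r ^+ 2 + s ^+ 2) / 2) = - (r ^+ 2 / 2) + - (s ^+ 2 / 2) by ring.
rewrite expRD !psiE//.
have := psi_norm_sqr k c0; rewrite expr2; set N := psi_norm b k; set e := expR _.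
set e' := expR _; set l := lagP _ _ _; set l' := lagP _ _ _ => NN.
transitivity ((N * N) * (poch (b + 1) k / k`!%:R) ^+ 2 * (l * l') * (e * e')); first by ring.
by rewrite NN; field; rewrite fact_neq0 p0 G0.
Qed.

(** Hyperbolic time sinh (2 t), and tanh (t) / 2: with q = e^(-2t) the exponents
    of Mehler's formula are 1/2 + q^2/(1-q^2) = 1/(2 tau) + kap. *)
Definition tau t := (expR (2 * t) - expR (- (2 * t))) / 2.
Definition kap t := (1 - expR (- (2 * t))) / (2 * (1 + expR (- (2 * t)))).

(** The heat kernel of the Bessel operator, at time tau. *)
Definition Wker c (u : R) r s := 2 / Gamma c * (2 * u) `^ (- c) *
  expR (- ((r ^+ 2 + s ^+ 2) / (2 * u))) * bessK c ((r * s / (2 * u)) ^+ 2).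

Lemma tau_gt0 t : 0 < t -> 0 < tau t.
Proof. by move=> t0; rewrite divr_gt0// subr_gt0 ltr_expR; lra. Qed.

Lemma kap_gt0 t : 0 < t -> 0 < kap t.
Proof.
move=> t0; apply: divr_gt0.
  by rewrite subr_gt0 -[ltRHS]expR0 ltr_expR; lra.
by rewrite mulr_gt0// addr_gt0// expR_gt0.
Qed.

(** [hille_hardy] at w = exp (- 4 t), with the exponential factors collected. *)
Lemma sums_heat_kernel b t r s : 0 < b + 1 -> 0 < t ->
  sums (fun m => expR (- t * eigen b m) * psi b m r * psi b m s)
    (Wker (b + 1) (tau t) r s * expR (- (kap t * (r ^+ 2 + s ^+ 2)))).
Proof.
move=> c0 t0; set c := b + 1; set q := expR (- (2 * t)).
have q0 : 0 < q by exact: expR_gt0.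
have q1 : q < 1 by rewrite -[ltRHS]expR0 ltr_expR; lra.
have Q : expR (2 * t) = q^-1 by rewrite /q expRN invrK.
pose w := q ^+ 2.
have w0 : 0 < w by rewrite exprn_gt0.
have w1 : w < 1 by rewrite exprn_ilt1// ltW.
have := @hille_hardy R c w (- r ^+ 2) (- s ^+ 2) c0 w0 w1 => /(sumsZ (k :=
  2 / Gamma c * expR (- ((r ^+ 2 + s ^+ 2) / 2)) * expR (- (t * (2 * c))))).
have q1' : 1 - q ^+ 2 != 0 by rewrite subr_eq0 gt_eqF.
have q2' : 1 + q != 0 by rewrite gt_eqF// addr_gt0.
have -> : 2 / Gamma c * expR (- ((r ^+ 2 + s ^+ 2) / 2)) * expR (- (t * (2 * c))) *
   ((1 - w) `^ (- c) * expR (w / (1 - w) * (- r ^+ 2 - s ^+ 2)) *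
    bessK c (- r ^+ 2 * - s ^+ 2 * w / (1 - w) ^+ 2)) =
  Wker c (tau t) r s * expR (- (kap t * (r ^+ 2 + s ^+ 2))).
  rewrite /Wker.
  have tE : 2 * tau t = (1 - w) / q.
    by rewrite /tau Q -/q /w; field; rewrite gt_eqF.
  have -> : (2 * tau t) `^ (- c) = expR (- (t * (2 * c))) * (1 - w) `^ (- c).
    rewrite tE powRM ?subr_ge0 ?invr_ge0 ?(ltW w1) ?(ltW q0)// mulrC; congr (_ * _).
    rewrite -Q /powR gt_eqF ?expR_gt0// expRK; congr expR; ring.
  have -> : - r ^+ 2 * - s ^+ 2 * w / (1 - w) ^+ 2 = (r * s / (2 * tau t)) ^+ 2.
    by rewrite tE /w; field; rewrite q1' gt_eqF.
  have EE : expR (- ((r ^+ 2 + s ^+ 2) / 2)) * expR (w / (1 - w) * (- r ^+ 2 - s ^+ 2)) =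
     expR (- ((r ^+ 2 + s ^+ 2) / (2 * tau t))) * expR (- (kap t * (r ^+ 2 + s ^+ 2))).
    rewrite -!expRD; congr expR; rewrite tE /kap -/q /w; field.
    by rewrite q1' q2' gt_eqF.
  move: EE; set e1 := expR (- (_ / 2)); set e2 := expR (w / _ * _); set e3 := expR (- (_ / (2 * tau t))).
  set e4 := expR (- (kap t * _)); set W := (1 - w) `^ _; set E0 := expR (- (t * _)); set B := bessK _ _ => EE.
  by transitivity (2 / Gamma c * E0 * W * B * (e1 * e2)); [ring|rewrite EE; ring].
apply: eq_sums => m; rewrite -[RHS]mulrA psi_mul// -/c.
have -> : expR (- t * eigen b m) = expR (- (t * (2 * c))) * w ^+ m.
  rewrite /w -exprM /q -expRM_natl -expRD; congr expR.
  by rewrite /eigen natrM /c; ring.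
by ring.
Qed.

Lemma heat_kernelE b t r s : 0 < b + 1 -> 0 < t ->
  heat_kernel b t r s =
  Wker (b + 1) (tau t) r s * expR (- (kap t * (r ^+ 2 + s ^+ 2))).
Proof. by move=> c0 t0; exact: sums_lim (@sums_heat_kernel b t r s c0 t0). Qed.

(** * Orthonormality *)

(** Finite differences: the m-th difference of l -> (c + l)_j, a polynomial of
    degree j. *)
Definition pochdiff c m j := \sum_(i < m.+1) 'C(m, i)%:R * (-1) ^+ i * poch (c + i%:R) j.

Lemma pochdiffS c m j : pochdiff c m.+1 j = pochdiff c m j - pochdiff (c + 1) m j.
Proof.
rewrite /pochdiff.
have -> : \sum_(i < m.+1) 'C(m, i)%:R * (-1) ^+ i * poch (c + i%:R) j =
   \sum_(i < m.+2) 'C(m, i)%:R * (-1) ^+ i * poch (c + i%:R) j.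
  by rewrite [RHS]big_ord_recr/= bin_small// !mul0r addr0.
rewrite -sumrN big_ord_recl [in RHS]big_ord_recl/= !bin0 -addrA; congr (_ + _).
rewrite -big_split/=; apply: eq_bigr => i _; rewrite /bump add1n binS natrD.
have -> : c + i.+1%:R = c + 1 + i%:R by rewrite -natr1; ring.
by rewrite exprS; ring.
Qed.

Lemma pochdiff_lower c m j : pochdiff c m.+1 j.+1 = - j.+1%:R * pochdiff (c + 1) m j.
Proof.
rewrite pochdiffS /pochdiff -sumrB mulr_sumr; apply: eq_bigr => i _.
rewrite -mulrBr [RHS]mulrCA; congr (_ * _).
have -> : c + 1 + i%:R = (c + i%:R) + 1 by ring.
set d := c + _; rewrite pochSl pochS -natr1; ring.
Qed.

Lemma pochdiff_lt c m j : (j < m)%N -> pochdiff c m j = 0.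
Proof.
elim: m c j => [//|m IH] c [_|j jm]; last by rewrite pochdiff_lower IH// mulr0.
rewrite pochdiffS /pochdiff; under eq_bigr do rewrite poch0.
by under [X in _ - X]eq_bigr do rewrite poch0; rewrite subrr.
Qed.

Lemma pochdiff_eq c m : pochdiff c m m = (-1) ^+ m * m`!%:R.
Proof.
elim: m c => [|m IH] c.
  by rewrite /pochdiff big_ord_recl big_ord0 poch0 bin0 expr0 fact0 addr0 !mulr1.
by rewrite pochdiff_lower IH factS natrM exprS; ring.
Qed.

(** The Gaussian moments make the Laguerre polynomials orthogonal: against
    x^j with j < m the moment functional is an m-th difference. *)
Lemma lagP_orthogonal c m n : 0 < c -> (n <= m)%N ->
  \sum_(j < n.+1) \sum_(i < m.+1) ('C(m, i)%:R * (-1) ^+ i / poch c i) *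
    ('C(n, j)%:R * (-1) ^+ j / poch c j) * poch c (i + j) =
  (n == m)%:R * (n`!%:R / poch c n).
Proof.
move=> c0 nm.
have pD i j : poch c (i + j) = poch c i * poch (c + i%:R) j.
  elim: j => [|j IH]; first by rewrite addn0 poch0 mulr1.
  by rewrite addnS !pochS IH natrD -!mulrA addrA.
have E j : \sum_(i < m.+1) ('C(m, i)%:R * (-1) ^+ i / poch c i) *
    ('C(n, j)%:R * (-1) ^+ j / poch c j) * poch c (i + j) =
   ('C(n, j)%:R * (-1) ^+ j / poch c j) * pochdiff c m j.
  rewrite mulr_sumr; apply: eq_bigr => i _; rewrite pD; field.
  by rewrite !poch_neq0.
under eq_bigr do rewrite E.
have [->|nm'] := eqVneq n m.
  rewrite big_ord_recr/= big1 => [|j _]; last by rewrite pochdiff_lt ?mulr0.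
  rewrite add0r pochdiff_eq binn !mul1r mulrACA mulrA -expr2 sqrr_sign mul1r; ring.
rewrite mul0r big1// => j _; rewrite pochdiff_lt ?mulr0//.
by rewrite (leq_trans (ltn_ord j))// ltn_neqAle nm' nm.
Qed.

End laguerre_functions.

Section orthonormality.
Context {R : realType}.
Implicit Types (b c t r s x w : R) (k m n i j : nat).

Lemma mu_lag_shift b n (f : R -> \bar R) : (forall x, 0 <= f x)%E -> measurable_fun setT f ->
  (\int[mu_lag b]_r (((r ^+ 2) ^+ n)%:E * f r) = \int[mu_lag (b + n%:R)]_r f r)%E.
Proof.
move=> f0 mf; rewrite !integral_mu_lag//.
- apply: eq_integral => r; rewrite inE/= in_itv/= andbT => r0.
  rewrite muleAC -EFinM muleC; congr (_ * _%:E)%E.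
  rewrite -exprM mulnC exprM.
  have -> : 2 * (b + n%:R) + 1 = (n * 2)%:R + (2 * b + 1) by rewrite natrM; ring.
  by rewrite [in RHS]powRDp// powR_mulrn ?(ltW r0)// -exprM.
- by move=> r; rewrite mule_ge0// lee_fin exprn_ge0// sqr_ge0.
- apply: emeasurable_funM => //; apply/measurable_EFinP.
  by apply: measurable_funX; exact: measurable_funX.
Qed.

Lemma measurable_gauss (a : R) : measurable_fun setT (fun r : R => expR (- (r ^+ 2 / a))).
Proof.
apply: (measurableT_comp (@measurable_expR R)); apply: measurableT_comp => //.
by apply: measurable_funM => //; exact: measurable_funX.
Qed.

Lemma integral_gaussX b n (u : R) : 0 < b + 1 -> 0 < u ->
  (\int[mu_lag b]_r ((r ^+ 2) ^+ n * expR (- (r ^+ 2 / (2 * u))))%:E =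
   (2^-1 * (2 * u) `^ (b + 1 + n%:R) * (poch (b + 1) n * Gamma (b + 1)))%:E)%E.
Proof.
move=> c0 u0; under eq_integral do rewrite EFinM.
rewrite mu_lag_shift; last 2 first.
- by move=> r; rewrite lee_fin expR_ge0.
- by apply/measurable_EFinP; exact: measurable_gauss.
have -> : b + n%:R = b + 1 + n%:R - 1 by ring.
have cn0 : 0 < b + 1 + n%:R by exact: ltr_wpDr.
by rewrite integral_gauss_pow// Gamma_poch.
Qed.

Lemma measurable_lagP c k : measurable_fun setT (fun r => lagP c k (- r ^+ 2)).
Proof.
apply: measurable_sum => i; apply: measurable_funM => //; apply: measurable_funM => //.
by apply: measurable_funX; apply: measurableT_comp => //; exact: measurable_funX.
Qed.

Lemma measurable_psi b k : 0 < b + 1 -> measurable_fun setT (psi b k).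
Proof.
move=> c0; rewrite (_ : psi b k = fun r => psi_norm b k * (poch (b + 1) k / k`!%:R) *
    lagP (b + 1) k (- r ^+ 2) * expR (- (r ^+ 2 / 2))); last first.
  by apply/funext => r; rewrite psiE.
apply: measurable_funM; last exact: measurable_gauss.
by apply: measurable_funM => //; exact: measurable_lagP.
Qed.

Let coef b m i : R := 'C(m, i)%:R * (-1) ^+ i / poch (b + 1) i.

Let psi_prod b m n r : 0 < b + 1 -> psi b m r * psi b n r =
  \sum_(j < n.+1) \sum_(i < m.+1) psi_norm b m * psi_norm b n *
    (poch (b + 1) m / m`!%:R * (poch (b + 1) n / n`!%:R)) * (coef b m i * coef b n j) *
    ((r ^+ 2) ^+ (i + j) * expR (- (r ^+ 2 / (2 * 2^-1)))).
Proof.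
move=> c0; rewrite !psiE// divff// divr1.
have -> : expR (- r ^+ 2) = expR (- (r ^+ 2 / 2)) * expR (- (r ^+ 2 / 2)).
  by rewrite -expRD; congr expR; field.
set e := expR _; set N := psi_norm b m; set N' := psi_norm b n.
set p := poch _ m / _; set p' := poch _ n / _.
transitivity (N * N' * (p * p') * (e * e) * (lagP (b + 1) n (- r ^+ 2) * lagP (b + 1) m (- r ^+ 2))).
  by ring.
rewrite /lagP mulr_suml mulr_sumr; apply: eq_bigr => j _.
rewrite mulr_sumr mulr_sumr; apply: eq_bigr => i _.
rewrite /coef -[- r ^+ 2]mulN1r [(-1 * _) ^+ j]exprMn [(-1 * _) ^+ i]exprMn exprD; ring.
Qed.

Let mom_int1 b i j : 0 < b + 1 -> (mu_lag b).-integrable setT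
  (fun r => ((r ^+ 2) ^+ (i + j) * expR (- (r ^+ 2 / (2 * 2^-1))))%:E).
Proof.
move=> c0; apply/integrableP; split.
  apply/measurable_EFinP; apply: measurable_funM; last exact: measurable_gauss.
  by apply: measurable_funX; exact: measurable_funX.
rewrite (eq_integral (fun r => ((r ^+ 2) ^+ (i + j) * expR (- (r ^+ 2 / (2 * 2^-1))))%:E)).
  by rewrite integral_gaussX// ltry.
by move=> r _; rewrite gee0_abs// lee_fin mulr_ge0 ?expR_ge0// exprn_ge0// sqr_ge0.
Qed.

Let mom_int b i j (a : R) : 0 < b + 1 -> (mu_lag b).-integrable setT
  (fun r => (a * ((r ^+ 2) ^+ (i + j) * expR (- (r ^+ 2 / (2 * 2^-1)))))%:E).
Proof.
by move=> c0; under eq_fun do rewrite EFinM; apply: integrableZl => //; exact: mom_int1.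
Qed.

Lemma psi_integrable b m n : 0 < b + 1 ->
  (mu_lag b).-integrable setT (fun r => (psi b m r * psi b n r)%:E).
Proof.
move=> c0; under eq_fun do rewrite psi_prod// -sumEFin.
apply: integrable_sum => // j _; under eq_fun do rewrite -sumEFin.
by apply: integrable_sum => // i _; exact: mom_int.
Qed.

(** Products of Laguerre functions are combinations of Gaussian moments, for which
    the claim is the identity [lagP_orthogonal]. *)
Lemma psi_orthonormal b m n : 0 < b + 1 ->
  (\int[mu_lag b]_r (psi b m r * psi b n r)%:E = (m == n)%:R%:E)%E.
Proof.
move=> c0; wlog nm : m n / (n <= m)%N.
  move=> H; have [|/ltnW] := leqP n m; first exact: H.
  by move=> /H; rewrite eq_sym => <-; apply: eq_integral => r _; rewrite mulrC.
under eq_integral do rewrite psi_prod// -sumEFin.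
rewrite integral_sum//; last first.
  move=> j; under eq_fun do rewrite -sumEFin.
  by apply: integrable_sum => // i _; exact: mom_int.
pose K := psi_norm b m * psi_norm b n *
    (poch (b + 1) m / m`!%:R * (poch (b + 1) n / n`!%:R)).
have G0 := Gamma_gt0 c0.
transitivity (\sum_(j < n.+1) \sum_(i < m.+1) K * 2^-1 * Gamma (b + 1) *
   (coef b m i * coef b n j * poch (b + 1) (i + j)))%:E.
  rewrite -sumEFin; apply: eq_bigr => j _.
  under eq_integral do rewrite -sumEFin.
  rewrite integral_sum//; last by move=> i; exact: mom_int.
  rewrite -sumEFin; apply: eq_bigr => i _.
  under eq_integral do rewrite EFinM.
  rewrite integralZl//; last exact: mom_int1.
  rewrite integral_gaussX// divff// powR1 -EFinM; congr EFin.
  by rewrite -/K; ring.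
congr EFin; under eq_bigr do rewrite -mulr_sumr.
rewrite -mulr_sumr lagP_orthogonal//.
rewrite [in RHS]eq_sym {}/K; have [->|_] := eqVneq n m; last by rewrite mul0r mulr0.
rewrite -expr2 psi_norm_sqr//; field.
by rewrite poch_neq0// fact_neq0 gt_eqF.
Qed.

End orthonormality.

(** * Comparing integrals on the half-line *)

Section mu_lag_integrals.
Context {R : realType}.
Implicit Types (b : R) (f g : R -> \bar R).

Lemma mu_lag_le b f g : (forall x, 0 <= f x)%E -> (forall x, 0 <= g x)%E ->
  measurable_fun setT f -> measurable_fun setT g -> (forall x, 0 < x -> (f x <= g x)%E) ->
  (\int[mu_lag b]_x f x <= \int[mu_lag b]_x g x)%E.
Proof.
move=> f0 g0 mf mg fg; apply: ae_ge0_le_integral => //.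
by apply: filterS (ae_mu_lag_gt0 b) => x x0 _; exact: fg.
Qed.

Lemma mu_lag_eq b f g : (forall x, 0 <= f x)%E -> (forall x, 0 <= g x)%E ->
  measurable_fun setT f -> measurable_fun setT g -> (forall x, 0 < x -> f x = g x) ->
  (\int[mu_lag b]_x f x = \int[mu_lag b]_x g x)%E.
Proof.
by move=> f0 g0 mf mg fg; apply/eqP; rewrite eq_le; apply/andP; split;
  apply: mu_lag_le => // x /fg ->.
Qed.

End mu_lag_integrals.

(** * Bounds for the Bessel series *)

Section bessel_bounds.
Context {R : realType}.
Implicit Types (b c t r s x z u : R) (k m n i j : nat).

Lemma sums_unshift (v : nat -> R) S : sums v S -> sums (fun n => v n.+1) (S - v 0%N).
Proof.
move=> vS; have : series v n.+1 @[n --> \oo] --> S by rewrite cvg_shiftS.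
rewrite /sums (_ : series (fun n => v n.+1) = (fun n => series v n.+1 - v 0%N)).
  by move=> H; apply: cvgB => //; exact: cvg_cst.
by apply/funext => n; rewrite /series/= big_nat_recl// addrAC subrr add0r.
Qed.

Lemma sums_le (v : nat -> R) S M : (forall n, series v n <= M) -> sums v S -> S <= M.
Proof.
move=> vM vS; rewrite -(cvg_lim _ vS)//; apply: limr_le.
  by apply/cvg_ex; exists S.
by apply: nearW.
Qed.

Lemma powR_leD (a a' X Y M : R) : 0 <= a -> 0 <= a' -> 0 <= X <= M -> 0 <= Y <= M ->
  X `^ a * Y `^ a' <= M `^ (a + a').
Proof.
move=> a0 a'0 /andP[X0 XM] /andP[Y0 YM]; have M0 : 0 <= M by exact: le_trans XM.
have [E|aa'] := eqVneq (a + a') 0.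
  have /eqP := E; rewrite paddr_eq0// => /andP[/eqP -> /eqP ->].
  by rewrite addr0 !powRr0 mulr1.
rewrite powRD ?(negbTE aa')//; apply: ler_pM; rewrite ?powR_ge0//.
  by rewrite ge0_ler_powR ?nnegrE.
by rewrite ge0_ler_powR ?nnegrE.
Qed.

Lemma powR2_le_add (a a' X Y : R) : 0 <= a -> 0 <= a' -> a + a' = 1 -> 0 <= X -> 0 <= Y ->
  X `^ a * Y `^ a' <= X + Y.
Proof.
move=> a0 a'0 aa' X0 Y0; have := @powR_leD a a' X Y (X + Y) a0 a'0.
rewrite aa' powRr1 ?addr_ge0//; apply; first by rewrite X0 lerDl.
by rewrite Y0 lerDr.
Qed.

Lemma mu_lag_shiftp b (e : R) (f : R -> \bar R) : (forall x, 0 <= f x)%E -> measurable_fun setT f ->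
  (\int[mu_lag b]_r ((r `^ (2 * e))%:E * f r) = \int[mu_lag (b + e)]_r f r)%E.
Proof.
move=> f0 mf; rewrite !integral_mu_lag//.
- apply: eq_integral => r; rewrite inE/= in_itv/= andbT => r0.
  rewrite muleAC -EFinM muleC; congr (_ * _%:E)%E.
  have -> : 2 * (b + e) + 1 = 2 * e + (2 * b + 1) by ring.
  by rewrite [in RHS]powRDp.
- by move=> r; rewrite mule_ge0// lee_fin powR_ge0.
- apply: emeasurable_funM => //; apply/measurable_EFinP; exact: measurable_powR.
Qed.

(** Log-convexity of Gamma in its crudest form: u^(1-th) x^th <= u + x under
    Euler's integral. *)
Lemma Gamma_interp x (th : R) : 1 <= x -> 0 <= th <= 1 -> x `^ th * Gamma x <= 3 * Gamma (x + th).
Proof.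
move=> x1 /andP[th0 th1]; have x0 : 0 < x by exact: lt_le_trans x1.
have y0 : 0 < x + th by exact: ltr_wpDr.
have me : measurable_fun setT (fun v : R => (expR (- v))%:E).
  by apply/measurable_EFinP; apply: (measurableT_comp (@measurable_expR R)).
have e0 v : (0 <= (expR (- v) : R)%:E)%E by rewrite lee_fin expR_ge0.
have shift (z d : R) : 0 < z -> 0 < z + d ->
    (\int[mu_lag (z / 2 - 1)]_v ((v `^ d)%:E * (expR (- v))%:E) = (Gamma (z + d))%:E)%E.
  move=> z0 zd; rewrite -(integral_expN_pow zd).
  have := @mu_lag_shiftp (z / 2 - 1) (d / 2) _ e0 me.
  have -> : 2 * (d / 2) = d by field.
  by have -> : z / 2 - 1 + d / 2 = (z + d) / 2 - 1 by field.
have : ((x `^ th)%:E * (Gamma (x + 1))%:E <= (Gamma (x + th + 1))%:E + x%:E * (Gamma (x + th))%:E)%E.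
  have y1 : 0 < x + th + 1 by rewrite addr_gt0.
  rewrite -(shift _ _ y0 y1) -(integral_expN_pow y0).
  have -> : (Gamma (x + 1))%:E = (\int[mu_lag ((x + th) / 2 - 1)]_v ((v `^ (1 - th))%:E * (expR (- v))%:E))%E.
    rewrite shift; first by congr (Gamma _)%:E; ring.
      by [].
    by rewrite (_ : x + th + (1 - th) = x + 1) ?addr_gt0//; ring.
  have mM (d : R) : measurable_fun setT (fun v : R => (v `^ d)%:E * (expR (- v))%:E)%E.
    by apply: emeasurable_funM => //; apply/measurable_EFinP; exact: measurable_powR.
  have M0 (d v : R) : (0 <= (v `^ d)%:E * (expR (- v))%:E)%E.
    by rewrite mule_ge0// lee_fin powR_ge0.
  rewrite -ge0_integralZl ?lee_fin ?powR_ge0//.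
  rewrite -ge0_integralZl ?lee_fin ?(ltW x0)//.
  rewrite -ge0_integralD//; last 2 first.
  - by move=> v _; rewrite mule_ge0// lee_fin ltW.
  - exact: measurable_funeM.
  apply: mu_lag_le => //.
  - by move=> v; rewrite mule_ge0// lee_fin powR_ge0.
  - by move=> v; rewrite adde_ge0// mule_ge0// lee_fin ltW.
  - exact: measurable_funeM.
  - by apply: emeasurable_funD => //; exact: measurable_funeM.
  move=> v v0.
  rewrite muleA -ge0_muleDl ?lee_fin ?powR_ge0 ?(ltW x0)//.
  rewrite ler_wpM2r ?expR_ge0//.
  rewrite [v `^ 1]powRr1 ?(ltW v0)// mulrC powR2_le_add ?subr_ge0 ?(ltW v0) ?(ltW x0)//.
  by rewrite subrK.
rewrite -!EFinM -EFinD lee_fin !GammaS// => H.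
rewrite -(ler_pM2l x0) mulrCA; apply: (le_trans H).
rewrite -mulrDl mulrA ler_wpM2r ?(ltW (Gamma_gt0 y0))//; lra.
Qed.

(** In the normalisation of the modified Bessel functions,
    J mu = (z^mu / Gamma (c + mu)) K_(c+mu)(z^2). *)
Definition bessJ c (mu : R) z := z `^ mu * bessK (c + mu) (z ^+ 2) / Gamma (c + mu).

Definition bessT c (mu : R) z k := z `^ (mu + (2 * k)%:R) / (Gamma (c + mu + k%:R) * k`!%:R).

Lemma sums_bessJ c mu z : 0 < c + mu -> 0 < z -> sums (bessT c mu z) (bessJ c mu z).
Proof.
move=> c0 z0; rewrite /bessJ mulrAC.
have := sumsZ (k := z `^ mu / Gamma (c + mu)) (@sums_bessK R (c + mu) (z ^+ 2) c0).
apply: eq_sums => k; rewrite /bessT Gamma_poch// powRDp// powR_mulrn ?(ltW z0)// exprM.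
field; rewrite fact_neq0 poch_neq0//=.
by rewrite gt_eqF ?Gamma_gt0.
Qed.

Lemma bessT_ge0 c mu z k : 0 < c + mu -> 0 <= bessT c mu z k.
Proof.
move=> c0; rewrite divr_ge0 ?powR_ge0// mulr_ge0 ?ltW ?fact_gt0R//.
by rewrite Gamma_gt0// ltr_wpDr.
Qed.

(** The k-th term of J (mu + 1) is the geometric mean of the terms k and k + 1 of
    J mu, up to the factor sqrt ((k + 1) / (c + mu + k)) <= ka. *)
Lemma bessJ_step c mu z (ka : R) : 0 < c + mu -> 0 < z -> 1 <= ka -> 1 <= ka ^+ 2 * (c + mu) ->
  bessJ c (mu + 1) z <= ka * bessJ c mu z.
Proof.
move=> c0 z0 ka1 kac; have ka0 : 0 < ka by exact: lt_le_trans ka1.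
have c10 : 0 < c + (mu + 1) by rewrite addrA addr_gt0.
have s1 := sums_bessJ c0 z0; have s2 := sums_unshift s1.
have T0 := bessT_ge0 z 0 c0.
apply: (@le_trans _ _ (ka / 2 * (bessJ c mu z + (bessJ c mu z - bessT c mu z 0)))).
  apply: (le_sums _ (sums_bessJ c10 z0) (sumsZ (k := ka / 2) (sumsD s1 s2))) => k.
  have xk : 0 < c + mu + k%:R by rewrite ltr_wpDr.
  have G0 := Gamma_gt0 xk.
  have k0 : 0 < k.+1%:R :> R by rewrite ltr0n.
  have z2 n : z `^ (mu + n%:R) = z `^ mu * z ^+ n.
    by rewrite powRDp// powR_mulrn// ltW.
  have -> : bessT c (mu + 1) z k = bessT c mu z k * (z / (c + mu + k%:R)).
    rewrite /bessT; have -> : c + (mu + 1) + k%:R = c + mu + k%:R + 1 by ring.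
    rewrite GammaS// -addrA nat1r !z2 exprS; field.
    by rewrite fact_neq0 !gt_eqF.
  have -> : bessT c mu z k.+1 = bessT c mu z k * (z ^+ 2 / (k.+1%:R * (c + mu + k%:R))).
    rewrite /bessT -natr1 addrA GammaS// natr1 !z2 factS natrM mulnS exprD; field.
    by rewrite fact_neq0 !gt_eqF//= nat1r pnatr_eq0.
  rewrite -[X in _ <= _ * (X + _)]mulr1 -mulrDr [leRHS]mulrCA ler_wpM2l ?bessT_ge0//.
  set x := c + mu + k%:R in xk *.
  have kx : k.+1%:R <= ka ^+ 2 * x.
    rewrite /x mulrDr -nat1r lerD// ler_peMl//.
    by rewrite exprn_ege1.
  have L : z / x <= ka / 2 * (1 + (z / (ka * x)) ^+ 2).
    have : 0 <= (1 - z / (ka * x)) ^+ 2 by exact: sqr_ge0.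
    have -> : z / x = ka * (z / (ka * x)) by field; rewrite !gt_eqF.
    set y := z / (ka * x); move=> y2; rewrite -mulrA ler_wpM2l ?(ltW ka0)//.
    rewrite -[leRHS]mulrC ler_pdivlMr//; nra.
  apply: (le_trans L); rewrite ler_wpM2l ?divr_ge0 ?(ltW ka0)// lerD2l.
  rewrite exprMn ler_wpM2l ?sqr_ge0// exprVn lef_pV2 ?posrE ?mulr_gt0// ?exprn_gt0 ?mulr_gt0//.
  by rewrite exprMn [x ^+ 2]expr2 mulrA ler_wpM2r ?(ltW xk).
rewrite mulrAC ler_pdivrMr// -mulrA ler_wpM2l ?(ltW ka0)//; lra.
Qed.

Lemma bessJ_ge0 c mu z : 0 < c + mu -> 0 < z -> 0 <= bessJ c mu z.
Proof.
by move=> c0 z0; apply: sums_ge0 (sums_bessJ c0 z0) => k; exact: bessT_ge0.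
Qed.

(** The first step, from order 0, loses a constant since c may be below 1; from
    order 1 on c + mu >= 1, and the step has constant 1. *)
Lemma bessJ_nat c n z : 1 / 2 <= c -> 0 < z -> bessJ c n%:R z <= 2 * bessJ c 0 z.
Proof.
move=> c0 z0; have cn k : 0 < c + k%:R.
  by apply: (@lt_le_trans _ _ c); [lra|rewrite lerDl].
have [->|] := posnP n.
  by rewrite ler_peMl ?ler1n// bessJ_ge0// ; have := cn 0%N.
elim: n => [//|[_ _|n IH _]].
  rewrite -[1%:R]add0r; apply: bessJ_step => //; first by have := cn 0%N.
    by rewrite ler1n.
  by rewrite addr0 expr2; lra.
rewrite -natr1; apply: le_trans (IH isT).
rewrite -[leRHS]mul1r; apply: bessJ_step => //.
by rewrite expr1n mul1r -nat1r addrCA lerDl; exact/ltW/cn.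
Qed.

(** A real order between n and n + 1 is dominated by the sum of these two, by
    [Gamma_interp]. The constant does not depend on the order: this is what reduces
    the vector-valued estimate to a single kernel. *)
Lemma bessJ_dom c mu z : 1 / 2 <= c -> mu = 0 \/ 1 <= mu -> 0 < z ->
  bessJ c mu z <= 12 * bessJ c 0 z.
Proof.
move=> c12 mu1 z0; have cn k : 0 < c + k%:R.
  by apply: (@lt_le_trans _ _ c); [lra|rewrite lerDl].
have J0 : 0 <= bessJ c 0 z by apply: bessJ_ge0 => //; have := cn 0%N.
case: mu1 => [->|mu1]; first by rewrite ler_peMl// ler1n.
pose n := Num.truncn mu; pose th := mu - n%:R.
have mu0 : 0 <= mu by exact: le_trans mu1.
have nmu : n%:R <= mu by have /andP[] := Num.Theory.truncn_itv mu0.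
have mun : mu < n.+1%:R by exact: Num.Theory.truncnS_gt.
have n1 : (0 < n)%N by rewrite /n Num.Theory.truncn_gt0.
have th01 : 0 <= th <= 1.
  by rewrite /th subr_ge0 nmu lerBlDl natr1 ltW.
have muE : mu = n%:R + th by rewrite /th addrC subrK.
have cm : 0 < c + mu by apply: (lt_le_trans (cn n)); rewrite lerD2l.
clearbody n th; suff : bessJ c mu z <= 3 * (bessJ c n%:R z + bessJ c n.+1%:R z).
  move=> H; apply: (le_trans H).
  have -> : 12 * bessJ c 0 z = 3 * (2 * bessJ c 0 z + 2 * bessJ c 0 z) by ring.
  apply: ler_wpM2l; first exact: ler0n.
  by apply: lerD; exact: bessJ_nat.
apply: (le_sums _ (sums_bessJ cm z0)
  (sumsZ (k := 3) (sumsD (sums_bessJ (cn n) z0) (sums_bessJ (cn n.+1) z0)))) => k.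
set x := c + n%:R + k%:R.
have x1 : 1 <= x.
  have : 1 <= n%:R :> R by rewrite ler1n.
  by have : 0 <= k%:R :> R by []; rewrite /x; lra.
have x0 : 0 < x by exact: lt_le_trans x1.
have G0 := Gamma_gt0 x0.
have xth : 0 < x + th by case/andP: th01 => ? _; rewrite ltr_wpDr.
have Gt0 := Gamma_gt0 xth.
have z2 (e : R) m : z `^ (e + m%:R) = z `^ e * z ^+ m.
  by rewrite powRDp// powR_mulrn// ltW.
pose A := z ^+ n * z ^+ (2 * k) / k`!%:R.
have A0 : 0 <= A by rewrite divr_ge0// mulr_ge0 ?exprn_ge0 ?ltW.
have -> : bessT c mu z k = A * (z `^ th / Gamma (x + th)).
  rewrite /bessT /A muE /x.
  have -> : c + (n%:R + th) + k%:R = c + n%:R + k%:R + th by ring.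
  have -> : n%:R + th + (2 * k)%:R = th + (n + 2 * k)%:R by rewrite natrD; ring.
  rewrite z2 exprD; field; rewrite fact_neq0//=.
  by rewrite gt_eqF.
have -> : bessT c n%:R z k = A * (1 / Gamma x).
  rewrite /bessT /A -/x -natrD powR_mulrn ?(ltW z0)// exprD; field.
  by rewrite fact_neq0 gt_eqF.
have -> : bessT c n.+1%:R z k = A * (z / (x * Gamma x)).
  rewrite /bessT /A -[n.+1%:R]natr1.
  have -> : c + (n%:R + 1) + k%:R = x + 1 by rewrite /x; ring.
  rewrite GammaS// natr1 -natrD powR_mulrn ?(ltW z0)// exprD exprS; field.
  by rewrite fact_neq0 !gt_eqF.
rewrite -mulrDr [leRHS]mulrCA ler_wpM2l//.
have GI := Gamma_interp x1 th01; have xp : 0 < x `^ th by exact: powR_gt0.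
have H : (z / x) `^ th <= 1 + z / x.
  case/andP: th01 => th0 th1.
  have := @powR2_le_add (1 - th) th 1 (z / x).
  rewrite powR1 mul1r; apply; rewrite ?subr_ge0 ?subrK//.
  by rewrite divr_ge0 ?ltW.
have -> : z `^ th = (z / x) `^ th * x `^ th.
  by rewrite -powRM ?divfK ?gt_eqF// ?divr_ge0 ?ltW.
move: G0 Gt0 GI; move: (Gamma x) (Gamma (x + th)) => g g' g0 g'0 GI.
rewrite ler_pdivrMr//.
have -> : 3 * (1 / g + z / (x * g)) * g' = (1 + z / x) * (3 * g' / g).
  by field; rewrite !gt_eqF.
apply: ler_pM; [exact: powR_ge0|exact: powR_ge0|exact: H|].
by rewrite ler_pdivlMr.
Qed.

(** (c)_k k! >= (2k)!/4^k compares the series with that of cosh (2 z). *)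
Lemma bessK_le c z : 1 / 2 <= c -> bessK c (z ^+ 2) <= expR (2 * `|z|).
Proof.
move=> c12; have c0 : 0 < c by lra.
have P k : (2 * k)`!%:R <= 4 ^+ k * (poch c k * k`!%:R).
  elim: k => [|k IH]; first by rewrite poch0 fact0 expr0 !mulr1.
  have -> : (2 * k.+1 = (2 * k).+2)%N by rewrite mulnS.
  rewrite !factS !natrM pochS exprS.
  have F : 0 <= (2 * k)`!%:R :> R by [].
  have -> : 4 * 4 ^+ k * (poch c k * (c + k%:R) * (k.+1%:R * k`!%:R)) =
    (2 * (k.+1)%:R) * ((2 * c + 2 * k%:R) * (4 ^+ k * (poch c k * k`!%:R))) by ring.
  apply: ler_pM; [by []|by rewrite mulr_ge0| |].
    by rewrite -!nat1r !natrM; lra.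
  apply: ler_pM => //.
  by rewrite -nat1r natrM lerD2r; lra.
apply: (sums_le _ (@sums_bessK R c (z ^+ 2) c0)) => n.
set y := 2 * `|z|; have y0 : 0 <= y by rewrite mulr_ge0.
pose e m := y ^+ m / m`!%:R; have e0 m : 0 <= e m by rewrite divr_ge0 ?exprn_ge0.
apply: (@le_trans _ _ (\sum_(0 <= k < n) e (2 * k)%N)).
  apply: ler_sum => k _; rewrite /e.
  have -> : y ^+ (2 * k) = (z ^+ 2) ^+ k * 4 ^+ k.
    by rewrite exprM -exprMn; congr (_ ^+ _); rewrite /y exprMn real_normK ?num_real//; ring.
  rewrite ler_pdivrMr ?mulr_gt0 ?poch_gt0 ?fact_gt0R// mulrAC ler_pdivlMr ?fact_gt0R//.
  rewrite -mulrA; apply: ler_wpM2l (P k); by rewrite exprn_ge0// sqr_ge0.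
have le1 N : \sum_(0 <= k < N) e (2 * k)%N <= \sum_(0 <= k < (2 * N)%N) e k.
  elim: N => [|N IH]; first by rewrite !big_geq.
  have -> : (2 * N.+1 = (2 * N).+2)%N by rewrite mulnS.
  rewrite big_nat_recr//= [leRHS]big_nat_recr//= [X in _ <= X + _]big_nat_recr//=.
  by rewrite -addrA lerD// lerDl.
apply: (le_trans (le1 n)).
have S : sums e (expR y) by exact: sums_exp.
rewrite -(cvg_lim _ S)//; apply: (@nondecreasing_cvgn_le _ (series e)).
  apply/nondecreasing_seqP => m; rewrite /series/= big_nat_recr//= lerDl; exact: e0.
by apply/cvg_ex; eexists; exact: S.
Qed.

End bessel_bounds.

(** * The heat kernel: mass, bounds, measurability *)

Section kernel.
Context {R : realType}.
Implicit Types (b c t r s z u : R) (k m n i j : nat).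

Lemma bessK_ge1 c z : 0 < c -> 1 <= bessK c (z ^+ 2).
Proof.
move=> c0; have := sums_ge_term 0%N _ (@sums_bessK R c (z ^+ 2) c0).
rewrite expr0 poch0 fact0 !mul1r invr1; apply => k.
apply: divr_ge0; first by rewrite exprn_ge0// sqr_ge0.
by rewrite mulr_ge0// ltW// poch_gt0.
Qed.

Lemma Wker_ge0 c u r s : 0 < c -> 0 <= Wker c u r s.
Proof.
move=> c0; rewrite !mulr_ge0 ?expR_ge0 ?invr_ge0 ?(ltW (Gamma_gt0 c0))// ?powR_ge0//.
by apply: le_trans (bessK_ge1 _ c0).
Qed.

Lemma WkerC c u r s : Wker c u r s = Wker c u s r.
Proof. by rewrite /Wker [r ^+ 2 + _]addrC [r * s]mulrC. Qed.

Lemma Wker_ge c u r s : 0 < c -> 0 < u ->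
  2 / Gamma c * (2 * u) `^ (- c) * expR (- ((r ^+ 2 + s ^+ 2) / (2 * u))) <= Wker c u r s.
Proof.
move=> c0 u0; rewrite /Wker ler_peMr ?bessK_ge1//.
by rewrite !mulr_ge0 ?expR_ge0 ?invr_ge0 ?(ltW (Gamma_gt0 c0))// ?powR_ge0.
Qed.

Lemma Wker_le c u r s : 1 / 2 <= c -> 0 < u ->
  Wker c u r s <= 2 / Gamma c * (2 * u) `^ (- c).
Proof.
move=> c12 u0; have c0 : 0 < c by lra.
rewrite /Wker -[leRHS]mulr1 -mulrA ler_wpM2l//.
  by rewrite !mulr_ge0 ?invr_ge0 ?(ltW (Gamma_gt0 c0))// ?powR_ge0.
apply: (@le_trans _ _ (expR (- ((r ^+ 2 + s ^+ 2) / (2 * u))) * expR (2 * `|r * s / (2 * u)|))).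
  by rewrite ler_wpM2l ?expR_ge0// bessK_le.
rewrite -expRD -[leRHS]expR0 ler_expR.
rewrite normrM [`|(2 * u)^-1|]gtr0_norm ?invr_gt0 ?mulr_gt0// normrM mulrA -mulNr -mulrDl.
have -> : (- (r ^+ 2 + s ^+ 2) + 2 * (`|r| * `|s|)) / (2 * u) =
  - ((`|r| - `|s|) ^+ 2 / (2 * u)).
  rewrite -[r ^+ 2]real_normK ?num_real// -[s ^+ 2]real_normK ?num_real//; field.
  by rewrite gt_eqF.
by rewrite oppr_le0 divr_ge0 ?sqr_ge0// mulr_ge0 ?ltW.
Qed.

Section measurability.
Context d (T : measurableType d).
Implicit Types f g h : T -> R.

Lemma measurable_bessK c f : 0 < c -> measurable_fun setT f ->
  measurable_fun setT (fun x => bessK c (f x)).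
Proof.
move=> c0 mf; apply: (measurable_fun_cvg (h := fun n x =>
   series (fun k => f x ^+ k / (poch c k * k`!%:R)) n)).
  move=> n; rewrite /series/=; apply: measurable_sum => k.
  by apply: measurable_funM => //; exact: measurable_funX.
by move=> x _; exact: sums_bessK.
Qed.

Lemma measurable_inv_fun f : measurable_fun setT f -> measurable_fun setT (fun x => (f x)^-1).
Proof. move=> mf; rewrite (_ : (fun y => _) = fun y => f y * (f y ^+ 2) `^ (-1)).
  apply: measurable_funM => //; apply: (measurableT_comp (measurable_powR _)).
  exact: measurable_funX.
apply/funext => y; rewrite powR_inv1 ?sqr_ge0//.
by have [->|y0] := eqVneq (f y) 0; [rewrite invr0 mul0r|field]. Qed.

Lemma measurable_Wker c f g h : 0 < c -> measurable_fun setT f -> measurable_fun setT g ->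
  measurable_fun setT h -> measurable_fun setT (fun x => Wker c (f x) (g x) (h x)).
Proof.
move=> c0 mf mg mh.
have m2f : measurable_fun setT (fun x => (2 * f x)^-1).
  by apply: measurable_inv_fun; exact: measurable_funM.
apply: measurable_funM; last first.
  apply: measurable_bessK => //; apply: measurable_funX; apply: measurable_funM => //.
  exact: measurable_funM.
apply: measurable_funM.
  apply: measurable_funM => //.
  by apply: (measurableT_comp (measurable_powR _)); exact: measurable_funM.
apply: (measurableT_comp (@measurable_expR R)); apply: measurableT_comp => //.
by apply: measurable_funM => //; apply: measurable_funD; exact: measurable_funX.
Qed.

Let measurable_expR2 f (a : R) : measurable_fun setT f -> measurable_fun setT (fun x => expR (- (a * f x))).
Proof.
move=> mf; apply: (measurableT_comp (@measurable_expR R)); apply: measurableT_comp => //.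
exact: measurable_funM.
Qed.

Lemma measurable_tau f : measurable_fun setT f -> measurable_fun setT (fun x => tau (f x)).
Proof.
move=> mf; apply: measurable_funM => //; apply: measurable_funB; last exact: measurable_expR2.
by apply: (measurableT_comp (@measurable_expR R)); exact: measurable_funM.
Qed.

Lemma measurable_kap f : measurable_fun setT f -> measurable_fun setT (fun x => kap (f x)).
Proof.
move=> mf; apply: measurable_funM; first by apply: measurable_funB => //; exact: measurable_expR2.
apply: measurable_inv_fun; apply: measurable_funM => //.
by apply: measurable_funD => //; exact: measurable_expR2.
Qed.

(** Closed form of the heat kernel, by the Hille-Hardy formula. *)
Definition hker b t r s := Wker (b + 1) (tau t) r s * expR (- (kap t * (r ^+ 2 + s ^+ 2))).

Lemma measurable_hker b f g h : 0 < b + 1 -> measurable_fun setT f -> measurable_fun setT g ->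
  measurable_fun setT h -> measurable_fun setT (fun x => hker b (f x) (g x) (h x)).
Proof.
move=> c0 mf mg mh; apply: measurable_funM.
  by apply: measurable_Wker => //; exact: measurable_tau.
apply: (measurableT_comp (@measurable_expR R)); apply: measurableT_comp => //.
apply: measurable_funM; first exact: measurable_kap.
by apply: measurable_funD; exact: measurable_funX.
Qed.

End measurability.

Lemma hker_ge0 b t r s : 0 < b + 1 -> 0 <= hker b t r s.
Proof. by move=> c0; rewrite mulr_ge0 ?expR_ge0 ?Wker_ge0. Qed.

Lemma hkerC b t r s : hker b t r s = hker b t s r.
Proof. by rewrite /hker WkerC [r ^+ 2 + _]addrC. Qed.

Lemma hker_le_Wker b t r s : 0 < b + 1 -> 0 < t -> hker b t r s <= Wker (b + 1) (tau t) r s.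
Proof.
move=> c0 t0; rewrite /hker ler_piMr ?Wker_ge0// -[leRHS]expR0 ler_expR oppr_le0.
by rewrite mulr_ge0 ?(ltW (kap_gt0 t0))// addr_ge0 ?sqr_ge0.
Qed.

(** Termwise Gaussian moments: with x = r^2/(2u) the terms of the Bessel series
    integrate to Poisson weights. *)
Lemma integral_Wker_moment b n u r : 0 < b + 1 -> 0 < u ->
  (\int[mu_lag b]_s ((s ^+ 2) ^+ n * Wker (b + 1) u r s)%:E =
   \sum_(k <oo) (expR (- (r ^+ 2 / (2 * u))) * ((2 * u) ^+ n *
      (poch (b + 1) (k + n) / poch (b + 1) k) * ((r ^+ 2 / (2 * u)) ^+ k / k`!%:R)))%:E)%E.
Proof.
move=> c0 u0; set c := b + 1.
have u20 : 0 < 2 * u by rewrite mulr_gt0.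
have G0 := Gamma_gt0 c0.
pose A k := 2 / Gamma c * (2 * u) `^ (- c) * expR (- (r ^+ 2 / (2 * u))) *
   ((r / (2 * u)) ^+ (2 * k) / (poch c k * k`!%:R)).
have A0 k : 0 <= A k.
  rewrite !mulr_ge0 ?expR_ge0 ?powR_ge0 ?invr_ge0 ?(ltW G0)//.
    by rewrite exprM exprn_ge0// sqr_ge0.
  by rewrite mulr_ge0 ?ltW ?poch_gt0.
pose g k s := (s ^+ 2) ^+ (k + n) * expR (- (s ^+ 2 / (2 * u))).
have g0 k s : 0 <= g k s by rewrite mulr_ge0 ?expR_ge0// exprn_ge0 ?sqr_ge0.
have mg k : measurable_fun setT (fun s => (g k s)%:E).
  apply/measurable_EFinP; apply: measurable_funM; last exact: measurable_gauss.
  by apply: measurable_funX; exact: measurable_funX.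
transitivity (\int[mu_lag b]_s (\sum_(k <oo) ((A k)%:E * (g k s)%:E)))%E.
  apply: eq_integral => s _; apply/esym.
  under eq_eseriesr do rewrite -EFinM.
  apply: sums_nneseries; first by move=> k; rewrite mulr_ge0.
  have := sumsZ (k := (s ^+ 2) ^+ n * (2 / Gamma c * (2 * u) `^ (- c) *
     expR (- ((r ^+ 2 + s ^+ 2) / (2 * u))))) (@sums_bessK R c ((r * s / (2 * u)) ^+ 2) c0).
  have -> : (s ^+ 2) ^+ n * Wker (b + 1) u r s = (s ^+ 2) ^+ n * (2 / Gamma c * (2 * u) `^ (- c) *
     expR (- ((r ^+ 2 + s ^+ 2) / (2 * u)))) * bessK c ((r * s / (2 * u)) ^+ 2).
    by rewrite /Wker mulrA.
  apply: eq_sums => k; rewrite /A /g.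
  have -> : expR (- ((r ^+ 2 + s ^+ 2) / (2 * u))) =
      expR (- (r ^+ 2 / (2 * u))) * expR (- (s ^+ 2 / (2 * u))).
    by rewrite -expRD; congr expR; rewrite mulrDl opprD.
  have -> : ((r * s / (2 * u)) ^+ 2) ^+ k = (r / (2 * u)) ^+ (2 * k) * (s ^+ 2) ^+ k.
    by rewrite exprM -exprMn; congr (_ ^+ _); rewrite !exprMn; ring.
  by rewrite exprD; ring.
rewrite integral_nneseries//; last 2 first.
- by move=> k; exact: measurable_funeM.
- by move=> k s _; rewrite mule_ge0// lee_fin.
apply: eq_eseriesr => k _; rewrite ge0_integralZl// ?lee_fin//; last by move=> s _; rewrite lee_fin.
rewrite integral_gaussX// -EFinM; congr EFin; rewrite /A -/c.
have -> : (2 * u) `^ (c + (k + n)%:R) = (2 * u) `^ c * (2 * u) ^+ k * (2 * u) ^+ n.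
  by rewrite powRDp// powR_mulrn ?(ltW u20)// exprD mulrA.
have -> : (r / (2 * u)) ^+ (2 * k) = (r ^+ 2 / (2 * u)) ^+ k / (2 * u) ^+ k.
  rewrite exprM -expr_div_n; congr (_ ^+ _); field; by rewrite gt_eqF.
rewrite powRN; have p0 : (2 * u) `^ c != 0 by rewrite gt_eqF ?powR_gt0.
set x := (r ^+ 2 / _) ^+ k; set U := 2 * u in u20 p0 *; clearbody x U.
have Uk : U ^+ k != 0 by rewrite expf_neq0// gt_eqF.
by field; rewrite fact_neq0 poch_neq0// p0 Uk gt_eqF.
Qed.

(** The Poisson weights of [integral_Wker_moment] add up to 1. *)
Lemma integral_Wker b u r : 0 < b + 1 -> 0 < u ->
  (\int[mu_lag b]_s (Wker (b + 1) u r s)%:E = 1)%E.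
Proof.
move=> c0 u0; have := integral_Wker_moment 0 r c0 u0.
under eq_integral do rewrite expr0 mul1r.
move=> ->; set x := r ^+ 2 / _.
have x0 : 0 <= x by rewrite divr_ge0 ?sqr_ge0// mulr_ge0// ltW.
have u20 : 0 < 2 * u by rewrite mulr_gt0.
rewrite -[RHS]/(1%:E) -[1 in RHS](expR0) -(addNr x) expRD.
apply: sums_nneseries.
  move=> k; rewrite !mulr_ge0 ?expR_ge0 ?invr_ge0 ?exprn_ge0 ?(ltW (poch_gt0 _ c0)) ?(ltW u20) ?(ltW u0)//.
apply: eq_sums (sumsZ (k := expR (- x)) (@sums_exp R x)) => k.
by rewrite addn0 expr0 mul1r divff ?poch_neq0// mul1r.
Qed.

(** The mean of a Poisson law. *)
Lemma integral_Wker2 b u r : 0 < b + 1 -> 0 < u ->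
  (\int[mu_lag b]_s (s ^+ 2 * Wker (b + 1) u r s)%:E = (r ^+ 2 + 2 * u * (b + 1))%:E)%E.
Proof.
move=> c0 u0; have := integral_Wker_moment 1 r c0 u0.
under eq_integral do rewrite expr1.
move=> ->; set x := r ^+ 2 / _.
have x0 : 0 <= x by rewrite divr_ge0 ?sqr_ge0// mulr_ge0// ltW.
have u20 : 0 < 2 * u by rewrite mulr_gt0.
apply: sums_nneseries.
  move=> k; rewrite !mulr_ge0 ?expR_ge0 ?invr_ge0 ?exprn_ge0 ?(ltW (poch_gt0 _ c0)) ?(ltW u20) ?(ltW u0)//.
have -> : r ^+ 2 + 2 * u * (b + 1) = expR (- x) * (2 * u * (b + 1)) * expR x + expR (- x) * (2 * u) * (x * expR x).
  have -> : r ^+ 2 = x * (2 * u) by rewrite /x divfK// gt_eqF.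
  transitivity ((expR (- x) * expR x) * (2 * u * (b + 1) + x * (2 * u))); last by ring.
  by rewrite -expRD addNr expR0 mul1r addrC.
apply: eq_sums (sumsD (sumsZ (k := expR (- x) * (2 * u * (b + 1))) (@sums_exp R x))
   (sumsZ (k := expR (- x) * (2 * u)) (@sums_ifact R 1 x))) => k.
rewrite expr1 addn1 pochS.
have -> : poch (b + 1) k * (b + 1 + k%:R) / poch (b + 1) k = b + 1 + k%:R.
  by rewrite mulrAC divff ?mul1r// poch_neq0.
case: k => [|k]; first by rewrite ifact_gt//; ring.
rewrite /ifact/= subn1/= factS natrM; field; by rewrite fact_neq0 nat1r pnatr_eq0.
Qed.

Lemma tau_ge t : 0 < t -> t <= tau t.
Proof.
move=> t0; rewrite /tau ler_pdivlMr//.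
have := expR_ge1Dx (2 * t).
have : expR (- (2 * t)) <= 1 by rewrite -[leRHS]expR0 ler_expR; lra.
lra.
Qed.

Lemma tau_ge_exp t : 1 <= t -> expR (2 * t) / 4 <= tau t.
Proof.
move=> t1; rewrite /tau; set e := expR (2 * t).
have e3 : 3 <= e by apply: le_trans (expR_ge1Dx _); lra.
have -> : expR (- (2 * t)) = e^-1 by rewrite expRN.
have : e^-1 <= 1 by rewrite invf_le1; lra.
lra.
Qed.

Let one_sub_exp (x : R) : 1 - expR (- x) <= x.
Proof. by have := expR_ge1Dx (- x); lra. Qed.

Lemma tau_le t : 0 < t -> t <= 2 -> tau t <= 2 * expR 4 * t.
Proof.
move=> t0 t2; rewrite /tau ler_pdivrMr//.
have -> : expR (2 * t) - expR (- (2 * t)) = expR (2 * t) * (1 - expR (- (4 * t))).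
  by rewrite mulrBr mulr1 -expRD; congr (_ - expR _); ring.
have -> : 2 * expR 4 * t * 2 = expR 4 * (4 * t) by ring.
apply: ler_pM; rewrite ?expR_ge0 ?ler_expR//.
- by rewrite subr_ge0 -[leRHS]expR0 ler_expR; lra.
- by rewrite -[leRHS](mulr_natl) mulr_natl; lra.
Qed.

Lemma kap_le t : 0 < t -> kap t <= t.
Proof.
move=> t0; have q0 := expR_gt0 (- (2 * t)).
rewrite /kap ler_pdivrMr; last by lra.
have := one_sub_exp (2 * t); nra.
Qed.

Let kap_ge' t : 0 < t -> 2 * t / (4 * (1 + 2 * t)) <= kap t.
Proof.
move=> t0; rewrite /kap; have q0 := expR_gt0 (- (2 * t)).
have q1 : expR (- (2 * t)) * (1 + 2 * t) <= 1.
  by rewrite expRN ler_pdivrMl ?expR_gt0// mulr1 expR_ge1Dx.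
set q := expR _ in q0 q1 *.
have q1' : q <= 1 by nra.
rewrite ler_pdivrMr; last by lra.
rewrite mulrAC ler_pdivlMr; last by lra.
nra.
Qed.

Lemma kap_ge t : 0 < t -> t <= 1 -> t / 6 <= kap t.
Proof.
move=> t0 t1; apply: le_trans (kap_ge' t0).
rewrite ler_pdivlMr; last by lra.
nra.
Qed.

Lemma kap_ge1 t : 1 <= t -> 1 / 6 <= kap t.
Proof.
move=> t1; have t0 : 0 < t by lra.
apply: le_trans (kap_ge' t0).
rewrite ler_pdivlMr; last by lra.
lra.
Qed.

(** Up to a common factor both sides are the Bessel functions of [bessJ_dom], at
    z = r s / (2 tau t). *)
Lemma hker_dom b mu t r s : - (1 / 2) <= b -> mu = 0 \/ 1 <= mu -> 0 < t -> 0 < r -> 0 < s ->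
  (r * s) `^ mu * hker (b + mu) t r s <= 12 * hker b t r s.
Proof.
move=> b12 mu1 t0 r0 s0; have T0 := tau_gt0 t0.
have u20 : 0 < 2 * tau t by rewrite mulr_gt0.
have c0 : 0 < b + 1 by lra.
have cm : 0 < b + mu + 1 by case: mu1 => ?; lra.
rewrite /hker mulrA [X in X <= _]mulrA ler_wpM2r ?expR_ge0// /Wker.
have -> : b + mu + 1 = b + 1 + mu by ring.
move: (tau t) T0 u20 => T T0 u20; set z := r * s / (2 * T); have z0 : 0 < z by rewrite !mulr_gt0// invr_gt0.
have -> : r * s = z * (2 * T) by rewrite /z divfK// gt_eqF.
have := bessJ_dom (c := b + 1) _ mu1 z0; rewrite /bessJ addr0 powRr0 mul1r.
have -> : (z * (2 * T)) `^ mu = z `^ mu * (2 * T) `^ mu by rewrite powRM// ltW.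
have -> : (2 * T) `^ (- (b + 1 + mu)) = (2 * T) `^ (- (b + 1)) * ((2 * T) `^ mu)^-1.
  by rewrite opprD powRDp// [_ `^ (- mu)]powRN.
have p0 : (2 * T) `^ mu != 0 by rewrite gt_eqF ?powR_gt0.
set P := (2 * T) `^ mu in p0 *; set e := expR _; set Q := (2 * T) `^ _.
have eQ : 0 <= e * Q * 2 by rewrite !mulr_ge0 ?expR_ge0 ?powR_ge0.
have c12 : 2^-1 <= b + 1 by lra.
move=> /(_ c12) H; have {H} := ler_wpM2l eQ H; set G := Gamma _; set G' := Gamma _.
set K := bessK _ _; set K' := bessK _ _ => H.
have -> : z `^ mu * P * (2 / G * (Q / P) * e * K) = e * Q * 2 * (z `^ mu * K / G) * (P / P) by ring.
rewrite divff// mulr1; apply: (le_trans H); rewrite le_eqVlt; apply/orP; left; apply/eqP; ring.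
Qed.

End kernel.

(** * The potential kernel *)

Section double_integrals.
Context {R : realType}.
Variable b : R.
Implicit Types (f g : R -> R -> \bar R) (h k : R -> \bar R).

Definition meas2 f := measurable_fun setT (fun z : R * R => f z.1 z.2).

Definition dint f := (\int[mu_lag b]_r \int[mu_lag b]_s f r s)%E.

Lemma meas2_fst h : measurable_fun setT h -> meas2 (fun r _ => h r).
Proof. by move=> mh; exact: (measurableT_comp mh measurable_fst). Qed.

Lemma meas2_snd h : measurable_fun setT h -> meas2 (fun _ s => h s).
Proof. by move=> mh; exact: (measurableT_comp mh measurable_snd). Qed.

Lemma meas2M f g : meas2 f -> meas2 g -> meas2 (fun r s => f r s * g r s)%E.
Proof. by move=> mf mg; exact: emeasurable_funM. Qed.

Lemma meas2D f g : meas2 f -> meas2 g -> meas2 (fun r s => f r s + g r s)%E.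
Proof. by move=> mf mg; exact: emeasurable_funD. Qed.

Lemma dint_ge0 f : (forall r s, 0 <= f r s)%E -> (0 <= dint f)%E.
Proof. by move=> f0; apply: integral_ge0 => r _; exact: integral_ge0. Qed.

Lemma dint_le f g : (forall r s, 0 <= f r s)%E -> (forall r s, 0 <= g r s)%E ->
  meas2 f -> meas2 g -> (forall r s, 0 < r -> 0 < s -> (f r s <= g r s)%E) ->
  (dint f <= dint g)%E.
Proof.
move=> f0 g0 mf mg fg; apply: mu_lag_le => [r|r| | |r r0]; try exact: integral_ge0.
- exact: measurable_tonelli1.
- exact: measurable_tonelli1.
- apply: mu_lag_le => //.
  + exact: (measurable_slice1 mf r).
  + exact: (measurable_slice1 mg r).
  + by move=> s s0; exact: fg.
Qed.

Lemma dintD f g : (forall r s, 0 <= f r s)%E -> (forall r s, 0 <= g r s)%E ->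
  meas2 f -> meas2 g -> (dint (fun r s => f r s + g r s) = dint f + dint g)%E.
Proof.
move=> f0 g0 mf mg; rewrite /dint -ge0_integralD//; last 4 first.
- by move=> r _; exact: integral_ge0.
- exact: measurable_tonelli1.
- by move=> r _; exact: integral_ge0.
- exact: measurable_tonelli1.
apply: eq_integral => r _; rewrite ge0_integralD//.
- exact: (measurable_slice1 mf r).
- exact: (measurable_slice1 mg r).
Qed.

Lemma dintZ (x : R) f : 0 <= x -> (forall r s, 0 <= f r s)%E -> meas2 f ->
  (dint (fun r s => x%:E * f r s) = x%:E * dint f)%E.
Proof.
move=> x0 f0 mf; rewrite /dint -ge0_integralZl//; last 2 first.
- exact: measurable_tonelli1.
- by move=> r _; exact: integral_ge0.
apply: eq_integral => r _; rewrite ge0_integralZl//.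
exact: (measurable_slice1 mf r).
Qed.

Lemma dintC f : (forall r s, 0 <= f r s)%E -> meas2 f -> dint f = dint (fun r s => f s r).
Proof. by move=> f0 mf; exact: (tonelli (mu_lag b) (mu_lag b) mf f0). Qed.

Lemma dint_fst f h : (forall r s, 0 <= f r s)%E -> (forall r, 0 <= h r)%E -> meas2 f ->
  (dint (fun r s => f r s * h r) = \int[mu_lag b]_r (h r * \int[mu_lag b]_s f r s))%E.
Proof.
move=> f0 h0 mf; apply: eq_integral => r _.
transitivity (\int[mu_lag b]_s (h r * f r s))%E.
  by apply: eq_integral => s _; rewrite muleC.
by rewrite ge0_integralZl//; exact: (measurable_slice1 mf r).
Qed.

Lemma dint_prod h k : (forall r, 0 <= h r)%E -> (forall r, 0 <= k r)%E ->
  measurable_fun setT h -> measurable_fun setT k ->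
  (dint (fun r s => h r * k s) = \int[mu_lag b]_r h r * \int[mu_lag b]_s k s)%E.
Proof.
move=> h0 k0 mh mk; transitivity (dint (fun r s => k s * h r))%E.
  by apply: eq_integral => r _; apply: eq_integral => s _; rewrite muleC.
rewrite dint_fst//; last exact: meas2_snd.
transitivity (\int[mu_lag b]_r ((\int[mu_lag b]_s k s) * h r))%E.
  by apply: eq_integral => r _; rewrite muleC.
by rewrite ge0_integralZl// ?integral_ge0// muleC.
Qed.

End double_integrals.

Section kernel_averages.
Context {R : realType}.
Variable b : R.
Hypothesis c0 : 0 < b + 1.
Implicit Types (h : R -> \bar R) (u t : R).

Let W u (r s : R) : \bar R := (Wker (b + 1) u r s)%:E.

Lemma meas2_Wker u : meas2 (W u).
Proof.
apply/measurable_EFinP; apply: (measurable_Wker (f := fun=> u)) => //.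
Qed.

Lemma meas2_hker t : meas2 (fun r s => (hker b t r s)%:E).
Proof. by apply/measurable_EFinP; exact: (measurable_hker (f := fun=> t)). Qed.

Let W0 u r s : (0 <= W u r s)%E. Proof. by rewrite lee_fin Wker_ge0. Qed.

(** W is a symmetric Markov kernel. *)
Lemma dint_Wker1 u h : 0 < u -> (forall r, 0 <= h r)%E -> measurable_fun setT h ->
  (dint b (fun r s => W u r s * h r) = \int[mu_lag b]_r h r)%E.
Proof.
move=> u0 h0 mh; rewrite dint_fst//; last exact: meas2_Wker.
by apply: eq_integral => r _; rewrite integral_Wker// mule1.
Qed.

Lemma dint_Wker2 u h : 0 < u -> (forall r, 0 <= h r)%E -> measurable_fun setT h ->
  (dint b (fun r s => W u r s * h s) = \int[mu_lag b]_r h r)%E.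
Proof.
move=> u0 h0 mh; rewrite dintC; last 2 first.
- by move=> r s; rewrite mule_ge0.
- by apply: meas2M; [exact: meas2_Wker|exact: meas2_snd].
rewrite -(dint_Wker1 u0 h0 mh); apply: eq_integral => r _.
by apply: eq_integral => s _; rewrite /W WkerC.
Qed.

End kernel_averages.

Section potential_kernels.
Context {R : realType}.
Implicit Types (b sigma t r s : R).

(** The time integral is written with the measure t^(sigma-1) dt of the same family
    as the spatial ones, so that the same lemmas apply to both. *)
Definition pker b sigma r s : \bar R :=
  (((Gamma sigma)^-1)%:E * \int[mu_lag (sigma / 2 - 1)]_t (hker b t r s)%:E)%E.

Lemma potential_kernelE b sigma r s : 0 < b + 1 ->
  potential_kernel b sigma r s = pker b sigma r s.
Proof.
move=> c0; rewrite /potential_kernel /pker integral_pow; last 2 first.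
- by move=> t; rewrite lee_fin hker_ge0.
- by apply/measurable_EFinP; exact: (measurable_hker (g := fun=> r) (h := fun=> s)).
congr (_ * _)%E; apply: eq_integral => t; rewrite inE/= in_itv/= andbT => t0.
by rewrite heat_kernelE// EFinM.
Qed.

Lemma pker_ge0 b sigma r s : 0 < b + 1 -> 0 < sigma -> (0 <= pker b sigma r s)%E.
Proof.
move=> c0 s0; rewrite mule_ge0//; first by rewrite lee_fin invr_ge0 ltW// Gamma_gt0.
by apply: integral_ge0 => t _; rewrite lee_fin hker_ge0.
Qed.

Lemma pkerC b sigma r s : pker b sigma r s = pker b sigma s r.
Proof. by congr (_ * _)%E; apply: eq_integral => t _; rewrite hkerC. Qed.

Lemma measurable_hker3 b : 0 < b + 1 ->
  measurable_fun setT (fun z : (R * R) * R => (hker b z.2 z.1.1 z.1.2)%:E).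
Proof.
move=> c0; apply/measurable_EFinP; apply: (measurable_hker (f := fun z : (R * R) * R => z.2)
  (g := fun z : (R * R) * R => z.1.1) (h := fun z : (R * R) * R => z.1.2)) => //.
- exact: measurable_snd.
- exact: (measurableT_comp measurable_fst measurable_fst).
- exact: (measurableT_comp measurable_snd measurable_fst).
Qed.

Lemma meas2_pker b sigma : 0 < b + 1 -> meas2 (pker b sigma).
Proof.
move=> c0; apply: measurable_funeM.
apply: (@measurable_tonelli1 _ _ _ _ _ (mu_lag (sigma / 2 - 1)) (fun (z : R * R) t => (hker b t z.1 z.2)%:E)).
  exact: measurable_hker3.
by move=> z t; rewrite lee_fin hker_ge0.
Qed.

(** The potential of a positive density, with the time integral outermost. *)
Lemma dint_pker b sigma (f : R -> R -> \bar R) : 0 < b + 1 -> 0 < sigma ->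
  (forall r s, 0 <= f r s)%E -> meas2 f ->
  (dint b (fun r s => pker b sigma r s * f r s) =
   ((Gamma sigma)^-1)%:E * \int[mu_lag (sigma / 2 - 1)]_t
      dint b (fun r s => (hker b t r s)%:E * f r s))%E.
Proof.
move=> c0 s0 f0 mf; have G0 : 0 <= (Gamma sigma)^-1 by rewrite invr_ge0 ltW// Gamma_gt0.
pose F (z : R * R) t : \bar R := ((hker b t z.1 z.2)%:E * f z.1 z.2)%E.
have F0 z t : (0 <= F z t)%E by rewrite mule_ge0// lee_fin hker_ge0.
have mF : measurable_fun setT (fun y : (R * R) * R => F y.1 y.2).
  apply: emeasurable_funM; first exact: measurable_hker3.
  exact: (measurableT_comp mf measurable_fst).
have mFt : meas2 (fun r s => \int[mu_lag (sigma / 2 - 1)]_t F (r, s) t)%E by exact: (measurable_tonelli1 (mu_lag (sigma / 2 - 1)) mF F0).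
transitivity (dint b (fun r s => ((Gamma sigma)^-1)%:E * \int[mu_lag (sigma / 2 - 1)]_t F (r, s) t))%E.
  apply: eq_integral => r _; apply: eq_integral => s _.
  rewrite /pker -muleA; congr (_ * _)%E; rewrite /F/= muleC -ge0_integralZl//.
  - by apply: eq_integral => t _; rewrite muleC.
  - by apply/measurable_EFinP; exact: (measurable_hker (g := fun=> r) (h := fun=> s)).
  - by move=> t _; rewrite lee_fin hker_ge0.
pose g r s := (\int[mu_lag (sigma / 2 - 1)]_t F (r, s) t)%E.
have g0 r s : (0 <= g r s)%E by exact: integral_ge0.
apply: (etrans (@dintZ R b _ g G0 g0 mFt)).
suff -> : dint b g = (\int[mu_lag (sigma / 2 - 1)]_t
    dint b (fun r s => (hker b t r s)%:E * f r s))%E by [].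
pose mab (z : (R * R) * R) : (R * R) * R := ((z.1.1, z.2), z.1.2).
have mmab : measurable_fun setT mab.
  apply: measurable_fun_pair => /=; last exact: (measurableT_comp measurable_snd measurable_fst).
  apply: measurable_fun_pair => //=; exact: (measurableT_comp measurable_fst measurable_fst).
have mF' : measurable_fun setT (fun y : (R * R) * R => F (y.1.1, y.2) y.1.2).
  exact: (measurableT_comp mF mmab).
transitivity (\int[mu_lag b]_r \int[mu_lag (sigma / 2 - 1)]_t \int[mu_lag b]_s F (r, s) t)%E.
  apply: eq_integral => r _; apply: (tonelli (mu_lag b) (mu_lag (sigma / 2 - 1)) (f := fun s t => F (r, s) t)) => //.
  have mr : measurable_fun setT (fun z : R * R => ((r, z.1), z.2)).
    by apply: measurable_fun_pair => //=; exact: measurable_fun_pair.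
  exact: (measurableT_comp mF mr).
apply: (tonelli (mu_lag b) (mu_lag (sigma / 2 - 1)) (f := fun r t => \int[mu_lag b]_s F (r, s) t)%E).
  exact: (@measurable_tonelli1 _ _ _ _ _ (mu_lag b) (fun (z : R * R) s => F (z.1, s) z.2)).
by move=> r t; exact: integral_ge0.
Qed.

Lemma measurable_dint_hker b (f : R -> R -> \bar R) : 0 < b + 1 ->
  (forall r s, 0 <= f r s)%E -> meas2 f ->
  measurable_fun setT (fun t => dint b (fun r s => (hker b t r s)%:E * f r s)%E).
Proof.
move=> c0 f0 mf; pose F (z : R * R) s : \bar R := ((hker b z.1 z.2 s)%:E * f z.2 s)%E.
have F0 z t : (0 <= F z t)%E by rewrite mule_ge0// lee_fin hker_ge0.
have mF : measurable_fun setT (fun y : (R * R) * R => F y.1 y.2).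
  have m1 : measurable_fun setT (fun y : (R * R) * R => (y.1.2, y.2)).
    apply: measurable_fun_pair => //=; exact: (measurableT_comp measurable_snd measurable_fst).
  apply: emeasurable_funM; last exact: (measurableT_comp mf m1).
  apply/measurable_EFinP; apply: (measurable_hker (f := fun y : (R * R) * R => y.1.1)
    (g := fun y : (R * R) * R => y.1.2) (h := fun y : (R * R) * R => y.2)) => //.
  - exact: (measurableT_comp measurable_fst measurable_fst).
  - exact: (measurableT_comp measurable_snd measurable_fst).
  - exact: measurable_snd.
apply: (@measurable_tonelli1 _ _ _ _ _ (mu_lag b) (fun t r => \int[mu_lag b]_s F (t, r) s)%E).
  have := @measurable_tonelli1 _ _ _ _ _ (mu_lag b) F mF F0.
  rewrite (_ : (fun z : R * R => _) = (fun z : R * R => \int[mu_lag b]_s F (z.1, z.2) s)%E)//.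
by move=> t r; exact: integral_ge0.
Qed.

End potential_kernels.

(** * The bilinear estimate *)

Section weighted_means.
Context {R : realType}.
Implicit Types (a b c e x y z S : R).

Lemma powRD_ge0 x a b : 0 <= a -> 0 <= b -> x `^ (a + b) = x `^ a * x `^ b.
Proof.
move=> a0 b0; have [E|ab] := eqVneq (a + b) 0; last by rewrite powRD ?(negbTE ab).
have /eqP := E; rewrite paddr_eq0// => /andP[/eqP -> /eqP ->].
by rewrite addr0 !powRr0 mulr1.
Qed.

Lemma powR3_le_add a b c x y z : 0 <= a -> 0 <= b -> 0 <= c -> a + b + c = 1 ->
  0 <= x -> 0 <= y -> 0 <= z -> x `^ a * y `^ b * z `^ c <= x + y + z.
Proof.
move=> a0 b0 c0 abc x0 y0 z0.
have xy0 : 0 <= x + y by rewrite addr_ge0.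
have := @powR2_le_add _ (a + b) c (x + y) z (addr_ge0 a0 b0) c0 abc xy0 z0.
apply: le_trans; rewrite ler_wpM2r ?powR_ge0//.
by apply: powR_leD => //; rewrite ?x0 ?y0 ?lerDl ?lerDr.
Qed.

Lemma expR_powR x a : expR x `^ a = expR (a * x).
Proof. by rewrite /powR gt_eqF ?expR_gt0// expRK. Qed.

Lemma powR_le1 x a : 0 <= a -> 0 <= x <= 1 -> x `^ a <= 1.
Proof.
move=> a0 /andP[x0 x1]; apply: (@le_trans _ _ (1 `^ a)); last by rewrite powR1.
by rewrite ge0_ler_powR// nnegrE.
Qed.

Lemma ler_powRN x y a : 0 <= a -> 0 < x -> x <= y -> y `^ (- a) <= x `^ (- a).
Proof.
move=> a0 x0 xy; have y0 : 0 < y by exact: lt_le_trans xy.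
rewrite !powRN lef_pV2 ?posrE ?powR_gt0//.
by rewrite ge0_ler_powR// nnegrE ltW.
Qed.

(** Up to the factor k^e with e = a + b - 1, the left-hand side is the geometric mean
    of x y, k x and k y with weights e, 1 - b and 1 - a. For k = W (r, s), x = phi s and
    y = gam r, each of these three has a bounded integral. *)
Lemma mean_sub a b k x y : 0 <= a <= 1 -> 0 <= b <= 1 -> 1 <= a + b ->
  0 <= k -> 0 <= x -> 0 <= y ->
  k * (x `^ a * y `^ b) <= k `^ (a + b - 1) * (y * x + k * x + k * y).
Proof.
move=> /andP[a0 a1] /andP[b0 b1] ab k0 x0 y0; set e := a + b - 1.
have e0 : 0 <= e by rewrite subr_ge0.
have a1' : 0 <= 1 - a by rewrite subr_ge0.
have b1' : 0 <= 1 - b by rewrite subr_ge0.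
have ab' : 0 <= 1 - b + (1 - a) by rewrite addr_ge0.
have -> : x `^ a = x `^ e * x `^ (1 - b).
  by rewrite -powRD_ge0//; congr powR; rewrite /e; ring.
have -> : y `^ b = y `^ e * y `^ (1 - a).
  by rewrite -powRD_ge0//; congr powR; rewrite /e; ring.
have -> : k * (x `^ e * x `^ (1 - b) * (y `^ e * y `^ (1 - a))) =
   k `^ e * ((y * x) `^ e * (k * x) `^ (1 - b) * (k * y) `^ (1 - a)).
  rewrite !powRM//.
  have E : k = k `^ e * (k `^ (1 - b) * k `^ (1 - a)).
    rewrite -!powRD_ge0// [X in _ `^ X](_ : _ = 1) ?powRr1//.
    by rewrite /e; ring.
  by rewrite {1}E; ring.
rewrite ler_wpM2l ?powR_ge0//; apply: powR3_le_add; rewrite ?mulr_ge0//.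
by rewrite /e; ring.
Qed.

(** For a <= S this is x^S below 1 and x^a above. *)
Definition mixpow a S x := Num.min (x `^ a) (x `^ S).

Lemma mixpow_ge0 a S x : 0 <= mixpow a S x.
Proof. by rewrite le_min !powR_ge0. Qed.

Lemma mixpow_ge1 a S x : a <= S -> 1 <= x -> mixpow a S x = x `^ a.
Proof. by move=> aS x1; apply/min_idPl; exact: ler_powR. Qed.

Lemma mixpow_le1 a S x : 0 <= a -> a <= S -> 0 <= x -> x <= 1 -> mixpow a S x = x `^ S.
Proof.
move=> a0 aS x0 x1; apply/min_idPr; have [->|xn0] := eqVneq x 0.
  have [SE|S0] := eqVneq S 0; last by rewrite powR0// powR_ge0.
  rewrite SE in aS *.
  by have -> : a = 0 by apply/le_anti; rewrite a0 aS.
have x0' : 0 < x by rewrite lt_neqAle eq_sym xn0.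
have -> : S = a + (S - a) by ring.
rewrite powRD_ge0 ?subr_ge0// ler_piMr ?powR_ge0//.
by rewrite powR_le1 ?x0// subr_ge0.
Qed.

(** Split according to whether x and y exceed 1: the power above 1 is at most a,
    the power below 1 at least S > 1, so either factor is integrable in time. *)
Lemma mean_crit a b x y : 0 < a < 1 -> 0 < b < 1 -> 0 <= x -> 0 <= y ->
  x `^ a * y `^ b <= mixpow a (a + b) x * (1 + y) + mixpow b (a + b) y * (1 + x).
Proof.
move=> /andP[a0 a1] /andP[b0 b1] x0 y0; set S := a + b.
have aS : a <= S by rewrite lerDl ltW.
have bS : b <= S by rewrite lerDr ltW.
have M1 := mixpow_ge0 a S x; have M2 := mixpow_ge0 b S y.
have le1 (u e : R) : 0 <= e -> 0 <= u -> u <= 1 -> u `^ e <= 1.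
  by move=> e0 u0 u1; rewrite powR_le1// u0.
have P := powR_ge0 x a; have P' := powR_ge0 y b.
have [x1|x1] := leP 1 x.
  apply: (@le_trans _ _ (x `^ a * (1 + y))); last first.
    by rewrite (mixpow_ge1 aS x1) lerDl mulr_ge0// addr_ge0.
  rewrite ler_wpM2l//; have [y1|y1] := leP 1 y.
    apply: (@le_trans _ _ y); last by rewrite lerDr.
    by rewrite -[leRHS]powRr1// ler_powR// ltW.
  by apply: (@le_trans _ _ 1); [apply: le1 => //; exact: ltW|rewrite lerDl].
have [y1|y1] := leP 1 y.
  apply: (@le_trans _ _ (y `^ b * 1)).
    by rewrite mulrC ler_wpM2l//; apply: le1 => //; exact: ltW.
  apply: (@le_trans _ _ (mixpow b S y * (1 + x))).
    by rewrite (mixpow_ge1 bS y1) ler_wpM2l// lerDl.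
  by rewrite lerDr mulr_ge0// addr_ge0.
have Mx : mixpow a S x = x `^ S by rewrite mixpow_le1// ltW.
have My : mixpow b S y = y `^ S by rewrite mixpow_le1// ltW.
apply: (@le_trans _ _ (Num.max x y `^ S)).
  by apply: powR_leD; rewrite ?(ltW a0) ?(ltW b0)// ?x0 ?y0 le_max lexx ?orbT.
apply: (@le_trans _ _ (mixpow a S x + mixpow b S y)).
  rewrite Mx My; have [_|_] := leP x y; first by rewrite lerDr powR_ge0.
  by rewrite lerDl powR_ge0.
by apply: lerD; rewrite ler_peMr// lerDl.
Qed.

(** The measure is t^(-c-1) dt: S > 1 gives convergence at 0 and a < 1 at infinity,
    and by scaling the integral is a multiple of x. *)
Lemma integral_mixpow a S c x : 0 < a -> a < 1 -> 1 < S -> 0 < c -> 0 <= x ->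
  (\int[mu_lag ((- c) / 2 - 1)]_t (mixpow a S (x * t `^ c))%:E <=
   (((c * (S - 1))^-1 + (c * (1 - a))^-1) * x)%:E)%E.
Proof.
move=> a0 a1 S1 c0; rewrite le_eqVlt => /predU1P[<-|x0].
  rewrite mulr0 integral0_eq// => t _; rewrite mul0r /mixpow !powR0 ?gt_eqF//.
    by rewrite minxx.
  exact: lt_trans S1.
have aS : a <= S by rewrite ltW// (lt_trans a1).
have S0 : 0 < S by exact: lt_trans S1.
pose T := x `^ (- c^-1); have T0 : 0 < T by rewrite powR_gt0.
have Tc : T `^ c = x^-1 by rewrite -powRrM mulNr mulVf ?gt_eqF// powR_inv1 ?ltW.
pose A := `]-oo, T]%classic : set R; pose B := `[T, +oo[%classic : set R.
have mT (e : R) : measurable_fun setT (fun t : R => (t `^ e)%:E).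
  by apply/measurable_EFinP; exact: measurable_powR.
have mI (D : set R) : measurable D -> measurable_fun setT (fun t : R => (\1_D t : R)%:E).
  by move=> mD; apply/measurable_EFinP.
have mA : measurable A by exact: measurable_itv.
have mB : measurable B by exact: measurable_itv.
have i0 (D : set R) t : (0 <= (\1_D t : R)%:E)%E by rewrite lee_fin.
have p0 (t e : R) : (0 <= (t `^ e)%:E)%E by rewrite lee_fin powR_ge0.
have xS (e : R) : (0 <= (x `^ e)%:E)%E by rewrite lee_fin powR_ge0.
have piece (D : set R) (e : R) : measurable D ->
    (\int[mu_lag ((- c) / 2 - 1)]_t ((x `^ e)%:E * ((t `^ (2 * (c * e / 2)))%:E * (\1_D t)%:E)) =
     (x `^ e)%:E * mu_lag ((c * (e - 1)) / 2 - 1) D)%E.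
  move=> mD; rewrite ge0_integralZl//; last 2 first.
  - by apply: emeasurable_funM => //; exact: mI.
  - by move=> t _; rewrite mule_ge0.
  rewrite mu_lag_shiftp//; last exact: mI.
  rewrite integral_indic// setIT.
  by have -> : - c / 2 - 1 + c * e / 2 = c * (e - 1) / 2 - 1 by field.
apply: (@le_trans _ _ (\int[mu_lag ((- c) / 2 - 1)]_t
   ((x `^ S)%:E * ((t `^ (2 * (c * S / 2)))%:E * (\1_A t)%:E) +
    (x `^ a)%:E * ((t `^ (2 * (c * a / 2)))%:E * (\1_B t)%:E)))%E).
  apply: mu_lag_le.
  - by move=> t; rewrite lee_fin mixpow_ge0.
  - by move=> t; rewrite adde_ge0// mule_ge0// mule_ge0.
  - have mxt : measurable_fun setT (fun t : R => x * t `^ c).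
      by apply: measurable_funM => //; exact: measurable_powR.
    apply/measurable_EFinP; apply: measurable_minr.
      exact: (measurableT_comp (measurable_powR _) mxt).
    exact: (measurableT_comp (measurable_powR _) mxt).
  - by apply: emeasurable_funD; apply: measurable_funeM; apply: emeasurable_funM => //; exact: mI.
  - move=> t t0.
    have E e : x `^ e * t `^ (2 * (c * e / 2)) = (x * t `^ c) `^ e.
      rewrite powRM ?powR_ge0 ?ltW// -powRrM; congr (_ * _ `^ _); by field.
    rewrite !muleA -!EFinM -EFinD lee_fin !E.
    rewrite !indicE !mem_setE !in_itv/= andbT.
    have [tT|tT] := leP t T.
      rewrite mulr1; apply: (@le_trans _ _ ((x * t `^ c) `^ S)); first by rewrite ge_min lexx orbT.
      by rewrite lerDl mulr_ge0 ?powR_ge0.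
    rewrite (ltW tT) mulr0 add0r mulr1.
    by rewrite ge_min lexx.
rewrite ge0_integralD//; last 4 first.
- by move=> t _; rewrite mule_ge0// mule_ge0.
- by apply: measurable_funeM; apply: emeasurable_funM => //; exact: mI.
- by move=> t _; rewrite mule_ge0// mule_ge0.
- by apply: measurable_funeM; apply: emeasurable_funM => //; exact: mI.
rewrite !piece// mu_pow_below//; last by rewrite mulr_gt0// subr_gt0.
rewrite mu_pow_above//; last by rewrite pmulr_rlt0// subr_lt0.
rewrite -!EFinM -EFinD lee_fin le_eqVlt; apply/orP; left; apply/eqP.
have H e : x `^ e * T `^ (c * (e - 1)) = x.
  rewrite powRrM Tc -powR_inv1 ?(ltW x0)// -powRrM -powRDp//.
  by rewrite (_ : e + _ = 1) ?powRr1 ?(ltW x0)//; ring.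
have a1' : 1 - a != 0 by rewrite subr_eq0 gt_eqF.
have a1'' : a - 1 != 0 by rewrite subr_eq0 lt_eqF.
have S1' : S - 1 != 0 by rewrite subr_eq0 gt_eqF.
have cn0 : c != 0 by rewrite gt_eqF.
by rewrite !mulrA !H; field; rewrite ?a1' ?a1'' ?S1' ?cn0.
Qed.

End weighted_means.

Section fixed_time.
Context {R : realType}.
Variable b : R.
Hypothesis b12 : - (1 / 2) <= b.
Implicit Types (a d e t r s x y : R).

Let c12 : 1 / 2 <= b + 1. Proof. by move: b12; lra. Qed.
Let c0 : 0 < b + 1. Proof. by apply: lt_le_trans c12; rewrite divr_gt0. Qed.

Let A := 2 / Gamma (b + 1).
Let A0 : 0 < A. Proof. by rewrite divr_gt0// Gamma_gt0. Qed.

Lemma Wker_small t r s : 0 < t -> Wker (b + 1) (tau t) r s <= 2 / Gamma (b + 1) * t `^ (- (b + 1)).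
Proof.
move=> t0; apply: (le_trans (Wker_le _ _ c12 (tau_gt0 t0))).
rewrite ler_wpM2l ?(ltW A0)//; apply: ler_powRN; rewrite ?(ltW c0)//.
by have := tau_ge t0; lra.
Qed.

Lemma Wker_large t r s : 1 <= t ->
  Wker (b + 1) (tau t) r s <= 2 / Gamma (b + 1) * 2 `^ (b + 1) * expR (- (2 * (b + 1) * t)).
Proof.
move=> t1; have t0 : 0 < t by lra.
apply: (le_trans (Wker_le _ _ c12 (tau_gt0 t0))).
rewrite -[leRHS]mulrA ler_wpM2l ?(ltW A0)//.
apply: (@le_trans _ _ ((expR (2 * t) / 2) `^ (- (b + 1)))).
  apply: ler_powRN; rewrite ?(ltW c0)// ?divr_gt0 ?expR_gt0//.
  by have := tau_ge_exp t1; lra.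
rewrite powRM ?expR_ge0 ?invr_ge0// mulrC -[2^-1]powR_inv1// -powRrM mulN1r opprK.
by rewrite expR_powR ler_wpM2l ?powR_ge0// ler_expR mulNr; lra.
Qed.

Lemma integral_expN_sqr k : 0 < k ->
  (\int[mu_lag b]_r (expR (- (k * r ^+ 2)))%:E = (2^-1 * k `^ (- (b + 1)) * Gamma (b + 1))%:E)%E.
Proof.
move=> k0; have u0 : 0 < (2 * k)^-1 by rewrite invr_gt0 mulr_gt0.
have := integral_gaussX 0 c0 u0.
have E : 2 * (2 * k)^-1 = k^-1 by field; rewrite gt_eqF.
rewrite E poch0 mul1r addr0 -[k^-1](powR_inv1 (ltW k0)) -powRrM mulN1r => <-.
by apply: eq_integral => r _; rewrite mul1r powR_inv1 ?ltW// invrK mulrC.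
Qed.

Section densities.
Variables (phi gam : R -> R) (a a' : R).
Hypotheses (phi0 : forall s, 0 <= phi s) (gam0 : forall s, 0 <= gam s).
Hypotheses (mphi : measurable_fun setT phi) (mgam : measurable_fun setT gam).
Hypothesis iphi : (\int[mu_lag b]_s (phi s)%:E <= 1)%E.
Hypothesis igam : (\int[mu_lag b]_s (gam s)%:E <= 1)%E.
Hypotheses (a01 : 0 <= a <= 1) (a'01 : 0 <= a' <= 1).

Definition weight r s : \bar R := (phi s `^ a * gam r `^ a')%:E.

Lemma weight_ge0 r s : (0 <= weight r s)%E.
Proof. by rewrite lee_fin mulr_ge0 ?powR_ge0. Qed.

Lemma meas2_weight : meas2 weight.
Proof.
apply/measurable_EFinP; apply: measurable_funM.
  apply: (measurableT_comp (measurable_powR _)).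
  exact: (measurableT_comp mphi measurable_snd).
apply: (measurableT_comp (measurable_powR _)).
exact: (measurableT_comp mgam measurable_fst).
Qed.

Definition pairing t := dint b (fun r s => (hker b t r s)%:E * weight r s)%E.

Let mE (h : R -> R) : measurable_fun setT h -> measurable_fun setT (EFin \o h).
Proof. by move=> mh; apply/measurable_EFinP. Qed.

Let m1 (h : R -> R) : measurable_fun setT h -> meas2 (fun r _ => (h r)%:E).
Proof. by move=> mh; apply: (meas2_fst (h := EFin \o h)); exact: mE. Qed.

Let mc (x : R) : meas2 (fun _ _ => x%:E).
Proof. exact: measurable_cst. Qed.

Let m2 (h : R -> R) : measurable_fun setT h -> meas2 (fun _ s => (h s)%:E).
Proof. by move=> mh; apply: (meas2_snd (h := EFin \o h)); exact: mE. Qed.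

Let mpair t : meas2 (fun r s => (hker b t r s)%:E * weight r s)%E.
Proof. by apply: meas2M; [exact: meas2_hker|exact: meas2_weight]. Qed.

Let pair0 t r s : (0 <= (hker b t r s)%:E * weight r s)%E.
Proof. by rewrite mule_ge0 ?weight_ge0// lee_fin hker_ge0. Qed.

Let mgauss (k : R) : measurable_fun setT (fun r : R => expR (- (k * r ^+ 2))).
Proof.
apply: (measurableT_comp (@measurable_expR R)); apply: measurableT_comp => //.
by apply: measurable_funM => //; exact: measurable_funX.
Qed.

Let W t r s : \bar R := (Wker (b + 1) (tau t) r s)%:E.
Let W0 t r s : (0 <= W t r s)%E. Proof. by rewrite lee_fin Wker_ge0. Qed.
Let mW t : meas2 (W t). Proof. exact: meas2_Wker. Qed.

Let powR_le_add1 x e : 0 <= e <= 1 -> 0 <= x -> x `^ e <= 1 + x.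
Proof.
move=> /andP[e0 e1] x0; have := @powR2_le_add _ (1 - e) e 1 x.
by rewrite powR1 mul1r; apply; rewrite ?subr_ge0// subrK.
Qed.

Let dW2 (h : R -> R) t : 0 < t -> (forall r, 0 <= h r) -> measurable_fun setT h ->
  (dint b (fun r s => W t r s * (h s)%:E) = \int[mu_lag b]_r (h r)%:E)%E.
Proof.
move=> t0 h0 mh; apply: (dint_Wker2 c0 (tau_gt0 t0) (h := EFin \o h)); last exact: mE.
by move=> r; rewrite lee_fin.
Qed.

Let dW1 (h : R -> R) t : 0 < t -> (forall r, 0 <= h r) -> measurable_fun setT h ->
  (dint b (fun r s => W t r s * (h r)%:E) = \int[mu_lag b]_r (h r)%:E)%E.
Proof.
move=> t0 h0 mh; apply: (dint_Wker1 c0 (tau_gt0 t0) (h := EFin \o h)); last exact: mE.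
by move=> r; rewrite lee_fin.
Qed.

Let dP (h k : R -> R) : (forall r, 0 <= h r) -> (forall r, 0 <= k r) ->
  measurable_fun setT h -> measurable_fun setT k ->
  (dint b (fun r s => (h r)%:E * (k s)%:E) =
   \int[mu_lag b]_r (h r)%:E * \int[mu_lag b]_r (k r)%:E)%E.
Proof.
move=> h0 k0 mh mk; apply: (dint_prod b (h := EFin \o h) (k := EFin \o k)).
- by move=> r; rewrite lee_fin.
- by move=> r; rewrite lee_fin.
- exact: mE.
- exact: mE.
Qed.

Definition large_const : R :=
  2 / Gamma (b + 1) * 2 `^ (b + 1) * (2^-1 * (6^-1) `^ (- (b + 1)) * Gamma (b + 1) + 1) ^+ 2.

(** The powers are at most 1 + phi and 1 + gam; the constants 1 become integrable
    through the Gaussian factor, where kap t >= 1/6. *)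
Lemma pairing_large t : 1 <= t ->
  (pairing t <= (large_const * expR (- (2 * (b + 1) * t)))%:E)%E.
Proof.
move=> t1; have t0 : 0 < t by lra.
pose g (h : R -> R) r := (1 + h r) * expR (- (6^-1 * r ^+ 2)).
have g0 (h : R -> R) r : 0 <= h r -> 0 <= g h r by move=> h0; rewrite mulr_ge0 ?expR_ge0// addr_ge0.
have mg (h : R -> R) : measurable_fun setT h -> measurable_fun setT (g h).
  by move=> mh; apply: measurable_funM => //; exact: measurable_funD.
set B := 2^-1 * (6^-1) `^ (- (b + 1)) * Gamma (b + 1) + 1.
have B0 : 0 <= B by rewrite addr_ge0// !mulr_ge0 ?powR_ge0// ltW// Gamma_gt0.
have gB (h : R -> R) : measurable_fun setT h -> (forall r, 0 <= h r) ->
    (\int[mu_lag b]_r (h r)%:E <= 1)%E -> (\int[mu_lag b]_r (g h r)%:E <= B%:E)%E.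
  move=> mh h0 h1; apply: (@le_trans _ _ (\int[mu_lag b]_r ((expR (- (6^-1 * r ^+ 2)))%:E + (h r)%:E))%E).
    apply: mu_lag_le.
    - by move=> r; rewrite lee_fin g0.
    - by move=> r; rewrite adde_ge0// lee_fin// expR_ge0.
    - by apply/measurable_EFinP; exact: mg.
    - by apply: emeasurable_funD; apply/measurable_EFinP.
    - move=> r _; rewrite -EFinD lee_fin /g mulrDl mul1r lerD2l ler_piMr//.
      by rewrite -[leRHS]expR0 ler_expR oppr_le0 mulr_ge0// sqr_ge0.
  have -> : (\int[mu_lag b]_r ((expR (- (6^-1 * r ^+ 2)))%:E + (h r)%:E) =
      \int[mu_lag b]_r (expR (- (6^-1 * r ^+ 2)))%:E + \int[mu_lag b]_r (h r)%:E)%E.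
    apply: ge0_integralD => //; do ?[by apply/measurable_EFinP];
      by move=> r _; rewrite lee_fin ?expR_ge0.
  by rewrite integral_expN_sqr ?invr_gt0// EFinD; apply: leeD.
set K := 2 / Gamma (b + 1) * 2 `^ (b + 1) * expR (- (2 * (b + 1) * t)).
have K0 : 0 <= K by rewrite !mulr_ge0 ?expR_ge0 ?powR_ge0// invr_ge0 ltW// Gamma_gt0.
apply: (@le_trans _ _ (dint b (fun r s => K%:E * ((g gam r)%:E * (g phi s)%:E))%E)).
  apply: dint_le => //.
  - by move=> r s; rewrite !mule_ge0// lee_fin// g0.
  - by apply: (meas2M (mc _)); apply: meas2M; [apply: m1|apply: m2]; exact: mg.
  move=> r s r0 s0; rewrite /weight -!EFinM lee_fin /hker.
  have kp := kap_ge1 t1.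
  apply: (@le_trans _ _ (K * expR (- (6^-1 * r ^+ 2)) * expR (- (6^-1 * s ^+ 2)) *
     ((1 + phi s) * (1 + gam r)))); last by rewrite /g le_eqVlt; apply/orP; left; apply/eqP; ring.
  apply: ler_pM; [by rewrite mulr_ge0 ?expR_ge0 ?Wker_ge0|by rewrite mulr_ge0 ?powR_ge0| |].
    rewrite -[leRHS]mulrA -expRD; apply: ler_pM; rewrite ?expR_ge0 ?Wker_ge0//.
      exact: Wker_large.
    rewrite ler_expR -opprD -mulrDr lerN2 ler_wpM2r ?addr_ge0 ?sqr_ge0//; lra.
  by apply: ler_pM; rewrite ?powR_ge0//; exact: powR_le_add1.
rewrite dintZ//; last 2 first.
- by move=> r s; rewrite mule_ge0// lee_fin g0.
- by apply: meas2M; [apply: m1|apply: m2]; exact: mg.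
rewrite dP; [|by move=> r; rewrite g0|by move=> r; rewrite g0|exact: mg|exact: mg].
have -> : (large_const * expR (- (2 * (b + 1) * t)))%:E = (K%:E * (B%:E * B%:E))%E.
  by rewrite -!EFinM; congr EFin; rewrite /large_const /K -/B; ring.
rewrite lee_wpmul2l ?lee_fin//; apply: lee_pmul.
- by apply: integral_ge0 => r _; rewrite lee_fin g0.
- by apply: integral_ge0 => r _; rewrite lee_fin g0.
- exact: gB.
- exact: gB.
Qed.

Let hker_W t r s : 0 < t -> hker b t r s <= Wker (b + 1) (tau t) r s.
Proof. by move=> t0; exact: hker_le_Wker. Qed.

Let int3 (f1 f2 f3 : R -> R -> \bar R) (x : R) : 0 <= x ->
  (forall r s, 0 <= f1 r s)%E -> (forall r s, 0 <= f2 r s)%E -> (forall r s, 0 <= f3 r s)%E ->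
  meas2 f1 -> meas2 f2 -> meas2 f3 ->
  (dint b (fun r s => x%:E * (f1 r s + f2 r s + f3 r s)) =
   x%:E * (dint b f1 + dint b f2 + dint b f3))%E.
Proof.
move=> x0 p1 p2 p3 q1 q2 q3; rewrite dintZ//; last 2 first.
- by move=> r s; rewrite !adde_ge0.
- by apply: meas2D => //; exact: meas2D.
rewrite dintD//; last by apply: meas2D.
  by rewrite dintD.
by move=> r s; rewrite adde_ge0.
Qed.

(** By [mean_sub] with k = W: the mass of W is 1 in each variable, and its supremum,
    of order t^(-b-1), enters to the power a + a' - 1. *)
Lemma pairing_sub t : 0 < t -> 1 <= a + a' ->
  (pairing t <= (3 * (2 / Gamma (b + 1)) `^ (a + a' - 1) * t `^ (- (b + 1) * (a + a' - 1)))%:E)%E.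
Proof.
move=> t0 aa; set e := a + a' - 1; have e0 : 0 <= e by rewrite subr_ge0.
pose x := (2 / Gamma (b + 1) * t `^ (- (b + 1))) `^ e.
have x0 : 0 <= x by exact: powR_ge0.
have xE : x = (2 / Gamma (b + 1)) `^ e * t `^ (- (b + 1) * e).
  by rewrite /x powRM ?powR_ge0 ?(ltW A0)// powRrM.
have f10 r s : (0 <= (gam r)%:E * (phi s)%:E)%E by rewrite mule_ge0 ?lee_fin.
have f20 r s : (0 <= W t r s * (phi s)%:E)%E by rewrite mule_ge0// lee_fin.
have f30 r s : (0 <= W t r s * (gam r)%:E)%E by rewrite mule_ge0// lee_fin.
have mf1 : meas2 (fun r s => (gam r)%:E * (phi s)%:E)%E.
  by apply: meas2M; [exact: m1|exact: m2].
have mf2 : meas2 (fun r s => W t r s * (phi s)%:E)%E.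
  by apply: meas2M => //; exact: m2.
have mf3 : meas2 (fun r s => W t r s * (gam r)%:E)%E.
  by apply: meas2M => //; exact: m1.
apply: (@le_trans _ _ (dint b (fun r s => x%:E *
    ((gam r)%:E * (phi s)%:E + W t r s * (phi s)%:E + W t r s * (gam r)%:E))%E)).
  apply: dint_le => //.
  - by move=> r s; apply: mule_ge0; [rewrite lee_fin|rewrite !adde_ge0].
  - by apply: (meas2M (mc _)); apply: meas2D => //; exact: meas2D.
  move=> r s r0 s0; rewrite -[leLHS]/((hker b t r s * (phi s `^ a * gam r `^ a'))%:E) -[leRHS]/((x * (gam r * phi s +
    Wker (b + 1) (tau t) r s * phi s + Wker (b + 1) (tau t) r s * gam r))%:E) lee_fin.
  apply: (@le_trans _ _ (Wker (b + 1) (tau t) r s * (phi s `^ a * gam r `^ a'))).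
    by rewrite ler_wpM2r ?mulr_ge0 ?powR_ge0// hker_W.
  apply: (le_trans (mean_sub a01 a'01 aa (Wker_ge0 _ _ _ c0) (phi0 s) (gam0 r))).
  rewrite ler_wpM2r//.
    by rewrite !addr_ge0// mulr_ge0// Wker_ge0.
  have xA : 0 <= 2 / Gamma (b + 1) * t `^ (- (b + 1)).
    by rewrite mulr_ge0 ?powR_ge0 ?(ltW A0).
  by rewrite ge0_ler_powR ?nnegrE ?Wker_ge0// Wker_small.
rewrite int3// -mulrA [3 * _]mulrC -xE EFinM lee_wpmul2l ?lee_fin//.
have -> : 3%:E = (1 + 1 + 1)%E :> \bar R by rewrite -!EFinD; congr EFin; ring.
have T0 := tau_gt0 t0.
apply: leeD; first apply: leeD.
- rewrite dP// -[leRHS]mule1.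
  by apply: lee_pmul => //; apply: integral_ge0 => r _; rewrite lee_fin.
- by rewrite dW2.
- by rewrite dW1.
Qed.

(** The exponents add up to less than 1, and the Gaussian factor of the kernel
    provides the missing power of an integrable function. *)
Lemma pairing_neg t : 0 < t -> t <= 1 -> a + a' < 1 ->
  (pairing t <= ((2 + 2^-1 * ((1 - (a + a')) * 6) `^ (b + 1) * Gamma (b + 1)) *
     t `^ ((b + 1) * (a + a' - 1)))%:E)%E.
Proof.
move=> t0 t1 aa; set e := 1 - (a + a'); have e0 : 0 < e by rewrite subr_gt0.
have T0 := tau_gt0 t0; have K0 := kap_gt0 t0.
(* The mass of psi is of order 1, kap t being of order t, and psi^e is the Gaussian
   factor times a power of t. *)
pose psi r := t `^ (b + 1) * expR (- (kap t / e * r ^+ 2)).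
have psi0 r : 0 <= psi r by rewrite mulr_ge0 ?powR_ge0 ?expR_ge0.
have mpsi : measurable_fun setT psi by apply: measurable_funM.
have f20 r s : (0 <= W t r s * (phi s)%:E)%E by rewrite mule_ge0// lee_fin.
have f30 r s : (0 <= W t r s * (gam r)%:E)%E by rewrite mule_ge0// lee_fin.
have f40 r s : (0 <= W t r s * (psi r)%:E)%E by rewrite mule_ge0// lee_fin.
have mf2 : meas2 (fun r s => W t r s * (phi s)%:E)%E.
  by apply: meas2M => //; exact: m2.
have mf3 : meas2 (fun r s => W t r s * (gam r)%:E)%E.
  by apply: meas2M => //; exact: m1.
have mf4 : meas2 (fun r s => W t r s * (psi r)%:E)%E.
  by apply: meas2M => //; exact: m1.
have e0' := ltW e0.
have /andP[a0 _] := a01; have /andP[a'0 _] := a'01.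
pose y := t `^ ((b + 1) * (a + a' - 1)).
have y0 : 0 <= y by exact: powR_ge0.
apply: (@le_trans _ _ (dint b (fun r s => y%:E *
    (W t r s * (phi s)%:E + W t r s * (gam r)%:E + W t r s * (psi r)%:E))%E)).
  apply: dint_le => //.
  - by move=> r s; apply: mule_ge0; [rewrite lee_fin|rewrite !adde_ge0].
  - by apply: (meas2M (mc _)); apply: meas2D => //; exact: meas2D.
  move=> r s r0 s0; rewrite -[leLHS]/((hker b t r s * (phi s `^ a * gam r `^ a'))%:E) -[leRHS]/((y * (Wker (b + 1) (tau t) r s * phi s +
    Wker (b + 1) (tau t) r s * gam r + Wker (b + 1) (tau t) r s * psi r))%:E) lee_fin -!mulrDr.
  rewrite /hker -[X in X <= _]mulrA [leRHS]mulrCA ler_wpM2l ?Wker_ge0//.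
  apply: (@le_trans _ _ (y * (phi s `^ a * gam r `^ a' * psi r `^ e))).
    rewrite /psi powRM ?powR_ge0 ?expR_ge0// -powRrM.
    have -> : expR (- (kap t / e * r ^+ 2)) `^ e = expR (- (kap t * r ^+ 2)).
      rewrite expR_powR; congr expR; field.
      by rewrite gt_eqF.
    have yx' : y * t `^ ((b + 1) * e) = 1.
      rewrite /y -powRDp// [X in _ `^ X](_ : _ = 0) ?powRr0// /e; ring.
    rewrite [leRHS](_ : _ = y * t `^ ((b + 1) * e) * expR (- (kap t * r ^+ 2)) *
      (phi s `^ a * gam r `^ a')); last by ring.
    rewrite yx' mul1r ler_wpM2r ?mulr_ge0 ?powR_ge0//.
    by rewrite ler_expR lerN2 ler_wpM2l ?(ltW K0)// lerDl sqr_ge0.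
  rewrite ler_wpM2l//; apply: powR3_le_add => //.
  by rewrite /e; ring.
rewrite int3// [leRHS](_ : _ = y%:E * (1 + 1 + (2^-1 * (e * 6) `^ (b + 1) * Gamma (b + 1))%:E))%E; last first.
  by rewrite -!EFinD -EFinM mulrC; congr (_ * _)%:E; ring.
rewrite lee_wpmul2l ?lee_fin//; apply: leeD; first apply: leeD.
- by rewrite dW2.
- by rewrite dW1.
rewrite dW1// /psi.
under eq_integral do rewrite EFinM.
have -> : (\int[mu_lag b]_r ((t `^ (b + 1))%:E * (expR (- (kap t / e * r ^+ 2)))%:E) =
    (t `^ (b + 1))%:E * \int[mu_lag b]_r (expR (- (kap t / e * r ^+ 2)))%:E)%E.
  apply: ge0_integralZl => //.
  - by apply/measurable_EFinP.
  - by rewrite lee_fin powR_ge0.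
have ke : 0 < kap t / e by rewrite divr_gt0.
rewrite integral_expN_sqr// -EFinM lee_fin mulrA ler_wpM2r ?(ltW (Gamma_gt0 c0))//.
rewrite mulrCA ler_wpM2l//.
apply: (@le_trans _ _ (t `^ (b + 1) * (t / (6 * e)) `^ (- (b + 1)))).
  rewrite ler_wpM2l ?powR_ge0//; apply: ler_powRN; rewrite ?(ltW c0)//.
    by rewrite divr_gt0// mulr_gt0.
  rewrite invfM mulrA ler_wpM2r ?invr_ge0 ?(ltW e0)//.
  exact: kap_ge.
rewrite powRM ?(ltW t0)// ?invr_ge0 ?mulr_ge0// mulrA -powRDp// subrr powRr0 mul1r.
rewrite -[(6 * e)^-1]powR_inv1 ?mulr_ge0// -powRrM mulN1r opprK.
by rewrite [6 * e]mulrC.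
Qed.

(** [mean_crit] at x = phi t^(b+1) and y = gam t^(b+1): the summands 1 are integrated
    against W, of mass 1, and the summands x, y against W t^(b+1), which is bounded. *)
Lemma pairing_crit t : 0 < t -> 0 < a < 1 -> 0 < a' < 1 ->
  (pairing t <= (t `^ (- (b + 1) * (a + a')) * (1 + 2 / Gamma (b + 1)))%:E *
     (\int[mu_lag b]_s (mixpow a (a + a') (phi s * t `^ (b + 1)))%:E +
      \int[mu_lag b]_s (mixpow a' (a + a') (gam s * t `^ (b + 1)))%:E))%E.
Proof.
move=> t0 a0 a'0; set S := a + a'; set T := t `^ (b + 1).
have T0 := tau_gt0 t0.
have Tp : 0 < T by rewrite powR_gt0.
pose M (h : R -> R) e s := mixpow e S (h s * T).
have M0 h e s : 0 <= M h e s by exact: mixpow_ge0.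
have mM h e : measurable_fun setT h -> measurable_fun setT (M h e).
  move=> mh; apply: measurable_minr; apply: (measurableT_comp (measurable_powR _)); exact: measurable_funM.
pose x := t `^ (- (b + 1) * S).
have x0 : 0 <= x by exact: powR_ge0.
have xT : x * T `^ S = 1.
  by rewrite /x /T -powRrM -powRDp// [X in _ `^ X](_ : _ = 0) ?powRr0//; ring.
have A0' := ltW A0.
have WT r s : Wker (b + 1) (tau t) r s * T <= A.
  have := Wker_small r s t0; by rewrite powRN ler_pdivlMr.
have f1 r s : (0 <= (M gam a' r)%:E * (phi s)%:E)%E by rewrite mule_ge0 ?lee_fin.
have f2 r s : (0 <= (gam r)%:E * (M phi a s)%:E)%E by rewrite mule_ge0 ?lee_fin.
have f3 r s : (0 <= W t r s * (M phi a s)%:E)%E by rewrite mule_ge0// lee_fin.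
have f4 r s : (0 <= W t r s * (M gam a' r)%:E)%E by rewrite mule_ge0// lee_fin.
have g1 : meas2 (fun r s => (M gam a' r)%:E * (phi s)%:E)%E.
  by apply: meas2M; [apply: m1; exact: mM|exact: m2].
have g2 : meas2 (fun r s => (gam r)%:E * (M phi a s)%:E)%E.
  by apply: meas2M; [exact: m1|apply: m2; exact: mM].
have g3 : meas2 (fun r s => W t r s * (M phi a s)%:E)%E.
  by apply: meas2M => //; apply: m2; exact: mM.
have g4 : meas2 (fun r s => W t r s * (M gam a' r)%:E)%E.
  by apply: meas2M => //; apply: m1; exact: mM.
pose G r s := ((M gam a' r)%:E * (phi s)%:E + (gam r)%:E * (M phi a s)%:E)%E.
have G0 r s : (0 <= G r s)%E by rewrite adde_ge0.
have mG : meas2 G by exact: meas2D.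
have AG0 r s : (0 <= A%:E * G r s)%E by rewrite mule_ge0// lee_fin.
have mAG : meas2 (fun r s => A%:E * G r s)%E by exact: (meas2M (mc _)).
apply: (@le_trans _ _ (dint b (fun r s => x%:E *
    (W t r s * (M phi a s)%:E + W t r s * (M gam a' r)%:E + A%:E * G r s))%E)).
  apply: dint_le => //.
  - by move=> r s; apply: mule_ge0; [rewrite lee_fin|rewrite !adde_ge0].
  - by apply: (meas2M (mc _)); apply: meas2D => //; exact: meas2D.
  move=> r s r0 s0; rewrite -[leLHS]/((hker b t r s * (phi s `^ a * gam r `^ a'))%:E) -[leRHS]/((x * (Wker (b + 1) (tau t) r s * M phi a s +
    Wker (b + 1) (tau t) r s * M gam a' r + A * (M gam a' r * phi s + gam r * M phi a s)))%:E) lee_fin.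
  set w := Wker _ _ _ _; have w0 : 0 <= w by exact: Wker_ge0.
  apply: (@le_trans _ _ (w * (phi s `^ a * gam r `^ a'))).
    by rewrite ler_wpM2r ?mulr_ge0 ?powR_ge0// hker_W.
  have -> : phi s `^ a * gam r `^ a' = x * ((phi s * T) `^ a * (gam r * T) `^ a').
    rewrite !powRM ?(ltW Tp)//.
    rewrite [RHS](_ : _ = x * (T `^ a * T `^ a') * (phi s `^ a * gam r `^ a')); last by ring.
    rewrite -powRDp// xT mul1r//.
  rewrite mulrCA ler_wpM2l//.
  have := mean_crit a0 a'0 (mulr_ge0 (phi0 s) (ltW Tp)) (mulr_ge0 (gam0 r) (ltW Tp)).
  rewrite -/S -/(M phi a s) -/(M gam a' r) => H.
  apply: (le_trans (ler_wpM2l w0 H)).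
  rewrite [leLHS](_ : _ = w * M phi a s + w * M gam a' r +
     (w * T) * (M gam a' r * phi s + gam r * M phi a s)); last by ring.
  by rewrite lerD2l ler_wpM2r ?addr_ge0 ?mulr_ge0// WT.
rewrite int3//; set IM := (X in (_ <= _ * X)%E).
rewrite (_ : _%:E * IM = x%:E * ((1 + A)%:E * IM))%E; last by rewrite EFinM muleA.
rewrite lee_wpmul2l ?lee_fin// {}/IM.
have mMp := mM _ a mphi; have mMg := mM _ a' mgam.
rewrite (dW2 t0 (M0 phi a) mMp).
rewrite (dW1 t0 (M0 gam a') mMg).
have iM0 h e : (0 <= \int[mu_lag b]_s (M h e s)%:E)%E.
  by apply: integral_ge0 => s _; rewrite lee_fin.
rewrite dintZ// dintD//.
rewrite (dP (M0 gam a') phi0 mMg mphi).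
rewrite (dP gam0 (M0 phi a) mgam mMp).
set I1 := (\int[mu_lag b]_s (mixpow a S _)%:E)%E; set I2 := (\int[mu_lag b]_s (mixpow a' S _)%:E)%E.
have -> : ((1 + A)%:E * (I1 + I2) = (I1 + I2) + A%:E * (I1 + I2))%E.
  by rewrite EFinD ge0_muleDl ?lee_fin// mul1e.
apply: leeD; first by [].
rewrite lee_wpmul2l ?lee_fin// addeC; apply: leeD.
  rewrite -[leRHS]mul1e lee_wpmul2r//; exact: iM0.
rewrite -[leRHS]mule1 lee_wpmul2l//; exact: iM0.
Qed.

End densities.
End fixed_time.

Section bilinear.
Context {R : realType}.
Implicit Types (a d t : R).

Let int_pow_le1 (sigma d : R) : 0 < sigma + d ->
  (\int[mu_lag (sigma / 2 - 1)]_t ((t `^ d)%:E * (\1_(`]-oo, 1%R] : set R) t)%:E) =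
   ((sigma + d)^-1)%:E)%E.
Proof.
move=> sd; have mI : measurable (`]-oo, 1%R]%classic : set R) by exact: measurable_itv.
have -> : d = 2 * (d / 2) by field.
rewrite mu_lag_shiftp.
- rewrite integral_indic// setIT.
  have -> : sigma / 2 - 1 + d / 2 = (sigma + d) / 2 - 1 by field.
  by rewrite /= mu_pow_below// powR1 mul1r; congr (_^-1)%:E; field.
- by move=> x; rewrite lee_fin.
- by apply/measurable_EFinP.
Qed.

(** The bilinear form of the potential on L^(1/a) x L^(1/a'), the functions being
    powers of densities phi, gam. Inside the strip the bounds at fixed time are
    integrable in time. On the critical line they are not, and the time integral of
    [pairing_crit] is taken for each fixed s, where it is [integral_mixpow]. *)
Theorem bilinear_bound b sigma a a' : - (1 / 2) <= b -> 0 < sigma ->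
  0 <= a <= 1 -> 0 <= a' <= 1 -> - sigma < (b + 1) * (a + a' - 1) ->
  (b + 1) * (a + a' - 1) < sigma \/
    [/\ (b + 1) * (a + a' - 1) = sigma, a < 1 & a' < 1] ->
  exists C : R, 0 < C /\ forall phi gam : R -> R,
    (forall s, 0 <= phi s) -> (forall s, 0 <= gam s) ->
    measurable_fun setT phi -> measurable_fun setT gam ->
    (\int[mu_lag b]_s (phi s)%:E <= 1)%E -> (\int[mu_lag b]_s (gam s)%:E <= 1)%E ->
    (dint b (fun r s => pker b sigma r s * weight phi gam a a' r s) <= C%:E)%E.
Proof.
move=> b12 s0 a01 a'01 lo hi; have c0 : 0 < b + 1 by lra.
have Gs := Gamma_gt0 s0.
suff [C [C0 HC]] : exists C : R, 0 <= C /\ forall phi gam : R -> R,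
    (forall s, 0 <= phi s) -> (forall s, 0 <= gam s) ->
    measurable_fun setT phi -> measurable_fun setT gam ->
    (\int[mu_lag b]_s (phi s)%:E <= 1)%E -> (\int[mu_lag b]_s (gam s)%:E <= 1)%E ->
    (\int[mu_lag (sigma / 2 - 1)]_t pairing b phi gam a a' t <= C%:E)%E.
  exists ((Gamma sigma)^-1 * C + 1); split.
    by rewrite ltr_wpDl// mulr_ge0// invr_ge0 ltW.
  move=> phi gam p0 g0 mp mg ip ig.
  rewrite dint_pker//; [|exact: weight_ge0|exact: meas2_weight].
  apply: (@le_trans _ _ ((Gamma sigma)^-1 * C)%:E); last by rewrite lee_fin lerDl.
  by rewrite EFinM lee_wpmul2l ?lee_fin ?invr_ge0 ?(ltW Gs)// HC.
have mpair (phi gam : R -> R) : measurable_fun setT phi -> measurable_fun setT gam ->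
    (forall s, 0 <= phi s) -> (forall s, 0 <= gam s) ->
    measurable_fun setT (pairing b phi gam a a').
  move=> mp mg p0 g0; apply: measurable_dint_hker => //; first exact: weight_ge0.
  exact: meas2_weight.
have pair0 (phi gam : R -> R) t : (forall s, 0 <= phi s) -> (forall s, 0 <= gam s) ->
    (0 <= pairing b phi gam a a' t)%E.
  by move=> p0 g0; apply: dint_ge0 => r s; rewrite mule_ge0 ?weight_ge0// lee_fin hker_ge0.
pose L := large_const b.
have L0 : 0 <= L.
  apply: mulr_ge0; last exact: sqr_ge0.
  by rewrite !mulr_ge0 ?powR_ge0 ?invr_ge0 ?(ltW (Gamma_gt0 c0)).
case: hi => [hi|[hi a1 a'1]].
- pose d := - `|(b + 1) * (a + a' - 1)|.
  have sd : 0 < sigma + d by rewrite /d subr_gt0 ltr_norml lo.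
  have [B [B0 HB]] : exists B : R, 0 <= B /\ forall phi gam : R -> R,
      (forall s, 0 <= phi s) -> (forall s, 0 <= gam s) ->
      measurable_fun setT phi -> measurable_fun setT gam ->
      (\int[mu_lag b]_s (phi s)%:E <= 1)%E -> (\int[mu_lag b]_s (gam s)%:E <= 1)%E ->
      forall t, 0 < t -> t <= 1 -> (pairing b phi gam a a' t <= (B * t `^ d)%:E)%E.
    have [aa|aa] := leP 1 (a + a').
      eexists; split; last first.
        move=> phi gam p0 g0 mp mg ip ig t t0 t1.
        have := pairing_sub b12 p0 g0 mp mg ip ig a01 a'01 t0 aa.
        rewrite /d ger0_norm; last by rewrite mulr_ge0 ?subr_ge0// ltW.
        by rewrite mulNr; exact.
      by rewrite mulr_ge0// powR_ge0.
    eexists; split; last first.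
      move=> phi gam p0 g0 mp mg ip ig t t0 t1.
      have := pairing_neg b12 p0 g0 mp mg ip ig a01 a'01 t0 t1 aa.
      rewrite /d ler0_norm ?opprK; first exact.
      by rewrite mulr_ge0_le0 ?subr_le0 ?(ltW aa)// ltW.
    apply: addr_ge0; first exact: ler0n.
    apply: mulr_ge0; last exact/ltW/Gamma_gt0.
    by apply: mulr_ge0; [rewrite invr_ge0|exact: powR_ge0].
  exists (L * ((2 * (b + 1)) `^ (- sigma) * Gamma sigma) + B * (sigma + d)^-1); split.
    apply: addr_ge0; apply: mulr_ge0 => //; last by rewrite invr_ge0 ltW.
    by apply: mulr_ge0; [exact: powR_ge0|exact: ltW].
  move=> phi gam p0 g0 mp mg ip ig.
  have mI : measurable (`]-oo, 1%R]%classic : set R) by exact: measurable_itv.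
  have me : measurable_fun setT (fun t : R => (expR (- (2 * (b + 1) * t)))%:E).
    apply/measurable_EFinP; apply: (measurableT_comp (@measurable_expR R)).
    by apply: measurableT_comp => //; exact: measurable_funM.
  have mi : measurable_fun setT (fun t : R => (t `^ d)%:E * (\1_(`]-oo, 1%R] : set R) t)%:E)%E.
    apply: emeasurable_funM; apply/measurable_EFinP => //; exact: measurable_powR.
  have e0 t : (0 <= (expR (- (2 * (b + 1) * t)) : R)%:E)%E by rewrite lee_fin expR_ge0.
  have i0 (t : R) : (0 <= (t `^ d)%:E * (\1_(`]-oo, 1%R] : set R) t)%:E)%E.
    by rewrite mule_ge0// lee_fin ?powR_ge0.
  apply: (@le_trans _ _ (\int[mu_lag (sigma / 2 - 1)]_t (L%:E * (expR (- (2 * (b + 1) * t)))%:E +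
     B%:E * ((t `^ d)%:E * (\1_(`]-oo, 1%R] : set R) t)%:E)))%E).
    apply: mu_lag_le.
    + by move=> t; exact: pair0.
    + by move=> t; rewrite adde_ge0// mule_ge0// lee_fin.
    + exact: mpair.
    + by apply: emeasurable_funD; exact: measurable_funeM.
    + move=> t t0; have [t1|t1] := leP t 1.
        rewrite indicE mem_set/= ?in_itv//= mule1 -EFinM.
        apply: (le_trans (HB phi gam p0 g0 mp mg ip ig t t0 t1)).
        by rewrite leeDr// lee_fin; apply: mulr_ge0 => //; exact: expR_ge0.
      rewrite -EFinM.
      apply: (le_trans (pairing_large b12 p0 g0 mp mg ip ig a01 a'01 (ltW t1))).
      by rewrite leeDl// mule_ge0// lee_fin.
  have -> : (\int[mu_lag (sigma / 2 - 1)]_t (L%:E * (expR (- (2 * (b + 1) * t)))%:E +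
     B%:E * ((t `^ d)%:E * (\1_(`]-oo, 1%R] : set R) t)%:E)) =
     \int[mu_lag (sigma / 2 - 1)]_t (L%:E * (expR (- (2 * (b + 1) * t)))%:E) +
     \int[mu_lag (sigma / 2 - 1)]_t (B%:E * ((t `^ d)%:E * (\1_(`]-oo, 1%R] : set R) t)%:E)))%E.
    apply: ge0_integralD => //.
    + by move=> t _; rewrite mule_ge0// lee_fin.
    + exact: measurable_funeM.
    + by move=> t _; rewrite mule_ge0// lee_fin.
    + exact: measurable_funeM.
  rewrite (ge0_integralZl _ measurableT me) ?lee_fin//.
  rewrite (ge0_integralZl _ measurableT mi) ?lee_fin//.
  by rewrite int_pow_le1// integral_exp_pow ?mulr_gt0// -!EFinM -EFinD.
- have aa : 0 < a + a' - 1 by rewrite -(pmulr_rgt0 _ c0) hi.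
  have a0 : 0 < a < 1 by rewrite a1 andbT; lra.
  have a'0 : 0 < a' < 1 by rewrite a'1 andbT; lra.
  have S1 : 1 < a + a' by lra.
  pose K e := ((b + 1) * (a + a' - 1))^-1 + ((b + 1) * (1 - e))^-1.
  have K0 e : e < 1 -> 0 <= K e.
    by move=> e1; rewrite addr_ge0// invr_ge0 mulr_ge0 ?(ltW c0) ?subr_ge0 ?(ltW S1) ?(ltW e1).
  pose A := 1 + 2 / Gamma (b + 1).
  have A0 : 0 <= A by apply: addr_ge0 => //; apply: divr_ge0 => //; exact/ltW/Gamma_gt0.
  exists (A * (K a + K a')); split; first by rewrite mulr_ge0// addr_ge0 ?K0.
  move=> phi gam p0 g0 mp mg ip ig.
  pose F e (h : R -> R) t s : \bar R := (mixpow e (a + a') (h s * t `^ (b + 1)))%:E.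
  have F0 e h t s : (0 <= F e h t s)%E by rewrite lee_fin mixpow_ge0.
  have mF e (h : R -> R) : measurable_fun setT h -> measurable_fun setT (fun z : R * R => F e h z.1 z.2).
    move=> mh; have mz : measurable_fun setT (fun z : R * R => h z.2 * z.1 `^ (b + 1)).
      apply: measurable_funM; first exact: (measurableT_comp mh measurable_snd).
      exact: (measurableT_comp (measurable_powR _) measurable_fst).
    apply/measurable_EFinP; apply: measurable_minr; exact: (measurableT_comp (measurable_powR _) mz).
  have IF e (h : R -> R) : 0 < e < 1 -> measurable_fun setT h -> (forall s, 0 <= h s) ->
      (\int[mu_lag b]_s (h s)%:E <= 1)%E ->
      (\int[mu_lag ((- (b + 1)) / 2 - 1)]_t \int[mu_lag b]_s F e h t s <= (K e)%:E)%E.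
    move=> /andP[e0 e1] mh h0 ih.
    rewrite (tonelli (mu_lag ((- (b + 1)) / 2 - 1)) (mu_lag b) (mF e h mh) (F0 e h)).
    apply: (@le_trans _ _ (\int[mu_lag b]_s ((K e)%:E * (h s)%:E))%E).
      apply: ge0_le_integral => //.
      + by move=> s _; exact: integral_ge0.
      + exact: (measurable_tonelli2 (mu_lag ((- (b + 1)) / 2 - 1)) (mF e h mh) (F0 e h)).
      + by apply: measurable_funeM; apply/measurable_EFinP.
      + by move=> s _; rewrite -EFinM; exact: integral_mixpow.
    rewrite ge0_integralZl//.
    + by rewrite -[leRHS]mule1 lee_wpmul2l// lee_fin K0.
    + by apply/measurable_EFinP.
    + by move=> s _; rewrite lee_fin.
    + by rewrite lee_fin K0.
  pose G t : \bar R := (\int[mu_lag b]_s F a phi t s + \int[mu_lag b]_s F a' gam t s)%E.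
  have G0 t : (0 <= G t)%E by rewrite adde_ge0// integral_ge0.
  have m1 := measurable_tonelli1 (mu_lag b) (mF a phi mp) (F0 a phi).
  have m2 := measurable_tonelli1 (mu_lag b) (mF a' gam mg) (F0 a' gam).
  have mG : measurable_fun setT G by exact: (emeasurable_funD m1 m2).
  have AG0 t : (0 <= A%:E * G t)%E by rewrite mule_ge0// lee_fin.
  have mAG : measurable_fun setT (fun t => A%:E * G t)%E by exact: measurable_funeM.
  (* The weight t^(2 e) turns t^(sigma-1) dt into t^(-(b+1)-1) dt. *)
  pose e := - (b + 1 + sigma) / 2.
  apply: (@le_trans _ _ (\int[mu_lag (sigma / 2 - 1)]_t ((t `^ (2 * e))%:E * (A%:E * G t)))%E).
    apply: mu_lag_le.
    + by move=> t; exact: pair0.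
    + by move=> t; rewrite mule_ge0// lee_fin powR_ge0.
    + exact: mpair.
    + by apply: emeasurable_funM => //; apply/measurable_EFinP; exact: measurable_powR.
    + move=> t t0; apply: (le_trans (pairing_crit b12 p0 g0 mp mg ip ig t0 a0 a'0)).
      have -> : - (b + 1) * (a + a') = 2 * e.
        by rewrite /e -hi; field.
      by rewrite EFinM muleA.
  rewrite mu_lag_shiftp//.
  have -> : sigma / 2 - 1 + e = - (b + 1) / 2 - 1 by rewrite /e; field.
  rewrite (ge0_integralZl _ measurableT mG) ?lee_fin//.
  rewrite EFinM lee_wpmul2l ?lee_fin//.
  have -> : (\int[mu_lag (- (b + 1) / 2 - 1)]_t G t =
    \int[mu_lag (- (b + 1) / 2 - 1)]_t \int[mu_lag b]_s F a phi t s +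
    \int[mu_lag (- (b + 1) / 2 - 1)]_t \int[mu_lag b]_s F a' gam t s)%E.
    apply: (@ge0_integralD _ _ _ (mu_lag (- (b + 1) / 2 - 1)) _ measurableT
      (fun t => \int[mu_lag b]_s F a phi t s)%E (fun t => \int[mu_lag b]_s F a' gam t s)%E).
    + by move=> t _; apply: integral_ge0 => s _; exact: F0.
    + exact: m1.
    + by move=> t _; apply: integral_ge0 => s _; exact: F0.
    + exact: m2.
  by rewrite EFinD; apply: leeD; exact: IF.
Qed.

End bilinear.

(** * From bilinear estimates to Lebesgue norms *)

Section duality.
Context {R : realType}.
Variables (b C : R) (G : R -> \bar R).
Hypotheses (c0 : 0 < b + 1) (C0 : 0 <= C).
Hypotheses (G0 : forall r, (0 <= G r)%E) (mG : measurable_fun setT G).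

Let mbelow (n : nat) : (mu_lag b `]-oo, n.+1%:R] < +oo)%E.
Proof.
have -> : b = (2 * (b + 1)) / 2 - 1 by field.
by rewrite mu_pow_below ?ltry// mulr_gt0.
Qed.

Let mI (n : nat) : measurable_fun setT (\1_(`]-oo, n.+1%:R] : set R) : R -> R).
Proof. by []. Qed.

(** Testing against the (q - 1)-st powers of bounded truncations of G. *)
Lemma dual_fin (q : R) : 1 <= q ->
  (forall gam : R -> R, (forall s, 0 <= gam s) -> measurable_fun setT gam ->
    (\int[mu_lag b]_s (gam s)%:E <= 1)%E ->
    (\int[mu_lag b]_r (G r * (gam r `^ (1 - q^-1))%:E) <= C%:E)%E) ->
  (\int[mu_lag b]_r (G r `^ q) <= (C `^ q)%:E)%E.
Proof.
move=> q1 H; have q0 : 0 < q by exact: lt_le_trans q1.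
have qn0 : q != 0 by rewrite gt_eqF.
pose u (n : nat) r : \bar R := mine (G r) n.+1%:R%:E.
have u0 n r : (0 <= u n r)%E by rewrite /u le_min; apply/andP; split; [exact: G0|rewrite lee_fin ler0n].
have ufin n r : u n r \is a fin_num.
  by rewrite ge0_fin_numE// (le_lt_trans _ (ltry n.+1%:R))// ge_min lexx orbT.
pose v n r : R := fine (u n r) * \1_(`]-oo, n.+1%:R] : set R) r.
have v0 n r : 0 <= v n r by rewrite mulr_ge0// fine_ge0.
have mv n : measurable_fun setT (v n).
  apply: measurable_funM => //; apply: (measurableT_comp (@fine_measurable R setT measurableT)).
  by apply: measurable_mine.
have vG n r : ((v n r)%:E <= G r)%E.
  rewrite /v indicE; case: (_ \in _); last by rewrite mulr0.
  by rewrite mulr1 fineK// ge_min lexx.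
have vn n r : v n r <= n.+1%:R * \1_(`]-oo, n.+1%:R] : set R) r.
  by rewrite ler_wpM2r// -lee_fin fineK// ge_min lexx orbT.
pose g n r : \bar R := (v n r `^ q)%:E.
have g0 n r : (0 <= g n r)%E by rewrite lee_fin powR_ge0.
have mg n : measurable_fun setT (g n).
  by apply/measurable_EFinP; exact: (measurableT_comp (measurable_powR _) (mv n)).
have intg n : (\int[mu_lag b]_r g n r <= (C `^ q)%:E)%E.
  have gy : (\int[mu_lag b]_r g n r < +oo)%E.
    apply: (@le_lt_trans _ _ (\int[mu_lag b]_r ((n.+1%:R `^ q)%:E * (\1_(`]-oo, n.+1%:R] : set R) r)%:E))%E).
      apply: ge0_le_integral => //.
      - by apply: measurable_funeM; apply/measurable_EFinP.
      - move=> r _; rewrite -EFinM lee_fin.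
        apply: (@le_trans _ _ ((n.+1%:R * \1_(`]-oo, n.+1%:R] : set R) r) `^ q)).
          apply: ge0_ler_powR; rewrite ?nnegrE; [exact: ltW|exact: v0|by rewrite mulr_ge0|exact: vn].
        rewrite indicE; case: (_ \in _); first by rewrite !mulr1.
        by rewrite !mulr0 powR0.
    rewrite ge0_integralZl// ?lee_fin ?powR_ge0//; last by apply/measurable_EFinP.
    by rewrite integral_indic// setIT lte_mul_pinfty ?lee_fin ?powR_ge0//= mbelow.
  have gI0 : (0 <= \int[mu_lag b]_r g n r)%E by apply: integral_ge0.
  have gE : (\int[mu_lag b]_r g n r = (fine (\int[mu_lag b]_r g n r))%:E)%E.
    by rewrite fineK// (ge0_fin_numE gI0); exact: gy.
  have x0 : 0 <= fine (\int[mu_lag b]_r g n r)%E by rewrite fine_ge0// integral_ge0.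
  rewrite {}gE lee_fin; move: x0; set x := fine _; rewrite le_eqVlt => /predU1P[<-|x0].
    exact: powR_ge0.
  have xE : (\int[mu_lag b]_r g n r = x%:E)%E by rewrite /x fineK// ge0_fin_numE.
  clearbody x.
  pose gam r := v n r `^ q / x.
  have gam0 r : 0 <= gam r by rewrite divr_ge0 ?powR_ge0// ltW.
  have mgam : measurable_fun setT gam.
    by apply: measurable_funM => //; exact: (measurableT_comp (measurable_powR _) (mv n)).
  have igam : (\int[mu_lag b]_s (gam s)%:E <= 1)%E.
    rewrite (eq_integral (fun s => (x^-1)%:E * g n s)%E); last first.
      by move=> s _; rewrite /gam mulrC EFinM.
    by rewrite ge0_integralZl// ?lee_fin ?invr_ge0 ?(ltW x0)// xE -EFinM mulVf ?gt_eqF.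
  have := H gam gam0 mgam igam.
  set e := 1 - q^-1; have xe : 0 < x `^ (- e) by rewrite powR_gt0.
  have gE r : gam r `^ e = v n r `^ (q - 1) * x `^ (- e).
    rewrite /gam powRM ?powR_ge0 ?invr_ge0 ?(ltW x0)// -powRrM.
    rewrite -[x^-1]powR_inv1 ?(ltW x0)// -powRrM mulN1r; congr (_ `^ _ * _).
    by rewrite /e mulrBr mulr1 divff.
  have : ((x `^ q^-1)%:E <= \int[mu_lag b]_r (G r * (gam r `^ e)%:E))%E.
    apply: (@le_trans _ _ (\int[mu_lag b]_r ((x `^ (- e))%:E * g n r))%E).
      rewrite ge0_integralZl// ?lee_fin ?(ltW xe)// xE -EFinM lee_fin.
      rewrite -{3}[x]powRr1 ?(ltW x0)// -powRDp// /e.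
      by rewrite (_ : - (1 - q^-1) + 1 = q^-1)//; ring.
    apply: ge0_le_integral => //.
    - by move=> r _; rewrite mule_ge0// lee_fin ltW.
    - by apply: measurable_funeM.
    - apply: emeasurable_funM => //; apply/measurable_EFinP.
      exact: (measurableT_comp (measurable_powR _) mgam).
    - move=> r _; rewrite gE /g -(mulr_powRB1 (v0 n r) q0).
      rewrite [leLHS](_ : _ = (v n r)%:E * (v n r `^ (q - 1) * x `^ (- e))%:E)%E; last first.
        by rewrite -!EFinM; congr EFin; ring.
      by rewrite lee_wpmul2r// lee_fin mulr_ge0 ?powR_ge0.
  move=> /le_trans /[apply]; rewrite lee_fin => xC.
  have -> : x = (x `^ q^-1) `^ q by rewrite -powRrM mulVf// powRr1// ltW.
  by rewrite ge0_ler_powR ?nnegrE ?powR_ge0// ltW.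
have cvgg r : g n r @[n --> \oo] --> (G r `^ q)%E.
  have vE n : r <= n.+1%:R -> v n r = fine (u n r).
    by move=> rn; rewrite /v indicE mem_set ?mulr1//= in_itv.
  have := G0 r; case Gr : (G r) => [x| |]//= x0; last first.
    rewrite (negbTE qn0); apply/cvgeyPge => A.
    exists (maxn (Num.truncn r) (Num.truncn A)) => // n /=; rewrite geq_max => /andP[rn An].
    have rn' : r <= n.+1%:R.
      by apply/ltW/(lt_le_trans (Num.Theory.truncnS_gt _)); rewrite ler_nat ltnS.
    have An' : A <= n.+1%:R.
      by apply/ltW/(lt_le_trans (Num.Theory.truncnS_gt _)); rewrite ler_nat ltnS.
    rewrite /g vE// /u Gr min_r ?leey//= lee_fin; apply: (le_trans An').
    by rewrite -[leLHS]powRr1// ler_powR// ler1n.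
  apply: cvg_near_cst; exists (maxn (Num.truncn r) (Num.truncn x)) => // n /=.
  rewrite geq_max => /andP[rn xn].
  have rn' : r <= n.+1%:R.
    by apply/ltW/(lt_le_trans (Num.Theory.truncnS_gt _)); rewrite ler_nat ltnS.
  have xn' : x <= n.+1%:R.
    by apply/ltW/(lt_le_trans (Num.Theory.truncnS_gt _)); rewrite ler_nat ltnS.
  by rewrite /g vE// /u Gr min_l ?lee_fin.
have ndg r : {homo (g ^~ r) : m n / (m <= n)%N >-> (m <= n)%E}.
  move=> m n mn; rewrite lee_fin ge0_ler_powR ?nnegrE ?(ltW q0)//.
  apply: ler_pM; rewrite ?fine_ge0//.
    rewrite -lee_fin !fineK// le_min ge_min lexx/= ge_min lee_fin ler_nat ltnS mn orbT//.
  rewrite !indicE ler_nat; case: (boolP (r \in _)) => //; rewrite inE/= in_itv/= => rm.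
  by rewrite mem_set//= in_itv/= (le_trans rm)// ler_nat.
have := @monotone_convergence _ _ _ (mu_lag b) setT measurableT g mg (fun n r _ => g0 n r)
  (fun r _ => ndg r).
have -> : (fun r => limn (g ^~ r)) = (fun r => G r `^ q)%E.
  by apply/funext => r; exact/cvg_lim.
move=> ->; apply: lime_le; last exact: nearW.
apply: ereal_nondecreasing_is_cvgn => m n mn.
by apply: ge0_le_integral => // r _; exact: ndg.
Qed.

(** Testing against normalised indicators of the sets where G exceeds C + 1/(n+1). *)
Lemma dual_infty :
  (forall gam : R -> R, (forall s, 0 <= gam s) -> measurable_fun setT gam ->
    (\int[mu_lag b]_s (gam s)%:E <= 1)%E ->
    (\int[mu_lag b]_r (G r * (gam r)%:E) <= C%:E)%E) ->
  {ae mu_lag b, forall r, (G r <= C%:E)%E}.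
Proof.
move=> H; pose x (n : nat) := C + n.+1%:R^-1.
pose B n := [set r | ((x n)%:E <= G r)%E] `&` `]-oo, n.+1%:R]%classic.
have mB n : measurable (B n).
  apply: measurableI => //; rewrite -[X in measurable X]setTI.
  exact: emeasurable_fun_c_infty.
have Bfin n : (mu_lag b (B n) < +oo)%E.
  apply: le_lt_trans (mbelow n); apply: le_measure; rewrite ?inE//; exact: subIsetr.
have B0 n : mu_lag b (B n) = 0%E.
  have BE : mu_lag b (B n) = (fine (mu_lag b (B n)))%:E by rewrite fineK// ge0_fin_numE.
  have m0 : 0 <= fine (mu_lag b (B n)) by rewrite fine_ge0.
  move: BE m0; move: (fine _) => m BE; rewrite le_eqVlt => /predU1P[m0|m0]; first by rewrite BE -m0.
  exfalso; pose gam r := m^-1 * \1_(B n) r.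
  have gam0 r : 0 <= gam r by rewrite mulr_ge0// invr_ge0 ltW.
  have mgam : measurable_fun setT gam by apply: measurable_funM.
  have ig (k : R) : 0 <= k -> (\int[mu_lag b]_s (k%:E * (\1_(B n) s)%:E) = (k * m)%:E)%E.
    move=> k0; rewrite ge0_integralZl//; last by apply/measurable_EFinP.
    by rewrite integral_indic// setIT EFinM -BE.
  have igam : (\int[mu_lag b]_s (gam s)%:E <= 1)%E.
    under eq_integral do rewrite EFinM.
    by rewrite ig ?invr_ge0 ?(ltW m0)// mulVf ?gt_eqF.
  have := H gam gam0 mgam igam; apply/negP; rewrite -ltNge.
  apply: (@lt_le_trans _ _ (x n)%:E); first by rewrite lte_fin ltrDl.
  have xn0 : 0 <= x n by rewrite addr_ge0.
  have -> : (x n)%:E = (\int[mu_lag b]_s ((x n / m)%:E * (\1_(B n) s)%:E))%E.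
    by rewrite ig ?divr_ge0 ?(ltW m0)// divfK ?gt_eqF.
  apply: ge0_le_integral => //.
  - by move=> s _; rewrite mule_ge0// lee_fin// divr_ge0// ltW.
  - by apply: measurable_funeM; apply/measurable_EFinP.
  - by apply: emeasurable_funM => //; apply/measurable_EFinP.
  - move=> s _; rewrite /gam indicE; case: (boolP (s \in B n)) => [|_]; last by rewrite !mulr0 !mule0.
    rewrite inE => -[/= xG _]; rewrite mule1 mulr1 EFinM lee_wpmul2r//.
    by rewrite lee_fin invr_ge0 ltW.
have : (mu_lag b).-negligible (\bigcup_n B n).
  apply: negligible_bigcup => n; exists (B n); split; [exact: mB|exact: B0|by []].
apply: negligibleS => r /= /negP; rewrite -ltNge => CG.
have [y Cy yG] : exists2 y : R, C < y & (y%:E <= G r)%E.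
  move: CG; case: (G r) => [g| |]//; last by exists (C + 1); rewrite ?ltrDl// leey.
  by rewrite lte_fin => Cg; exists g.
exists (maxn (Num.truncn r) (Num.truncn (y - C)^-1)) => //; split => /=.
  apply: le_trans yG; rewrite lee_fin /x -lerBrDl.
  rewrite -[leRHS]invrK lef_pV2 ?posrE ?invr_gt0 ?subr_gt0//.
  apply/ltW/(lt_le_trans (Num.Theory.truncnS_gt _)); rewrite ler_nat ltnS; exact: leq_maxr.
rewrite in_itv/=; apply/ltW/(lt_le_trans (Num.Theory.truncnS_gt _)); rewrite ler_nat ltnS.
exact: leq_maxl.
Qed.

End duality.

Section mapping.
Context {R : realType}.
Implicit Types (b sigma r s a : R) (p q : \bar R) (F : R -> \bar R).

(** The potential of a positive function; infinite values are allowed. *)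
Definition potential b sigma F r := (\int[mu_lag b]_s (pker b sigma r s * F s))%E.

Lemma mu_lag_ge0_le b F F' : (forall s, 0 <= F s)%E -> (forall s, 0 <= F' s)%E ->
  measurable_fun setT F -> measurable_fun setT F' -> {ae mu_lag b, forall s, (F s <= F' s)%E} ->
  (\int[mu_lag b]_s F s <= \int[mu_lag b]_s F' s)%E.
Proof.
move=> F0 F'0 mF mF' FF'; apply: ae_ge0_le_integral => //.
by apply: filterS FF' => s Fs _.
Qed.

Section potential_operator.
Variables b sigma : R.
Hypotheses (c0 : 0 < b + 1) (s0 : 0 < sigma).

Lemma meas2_potentialK F : measurable_fun setT F -> meas2 (fun r s => pker b sigma r s * F s)%E.
Proof. by move=> mF; apply: meas2M; [exact: meas2_pker|exact: meas2_snd]. Qed.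

Lemma potentialK_ge0 F r s : (forall s, 0 <= F s)%E -> (0 <= pker b sigma r s * F s)%E.
Proof. by move=> F0; rewrite mule_ge0// pker_ge0. Qed.

Lemma potential_ge0 F r : (forall s, 0 <= F s)%E -> (0 <= potential b sigma F r)%E.
Proof. by move=> F0; apply: integral_ge0 => s _; exact: potentialK_ge0. Qed.

Lemma measurable_potentialK F r : measurable_fun setT F ->
  measurable_fun setT (fun s => pker b sigma r s * F s)%E.
Proof. by move=> mF; exact: (measurable_slice1 (meas2_potentialK mF) r). Qed.

Lemma measurable_potential F : (forall s, 0 <= F s)%E -> measurable_fun setT F ->
  measurable_fun setT (potential b sigma F).
Proof.
move=> F0 mF; apply: (measurable_tonelli1 (mu_lag b) (meas2_potentialK mF)) => r s.
exact: potentialK_ge0.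
Qed.

Lemma potential_le F F' r : (forall s, 0 <= F s)%E -> (forall s, 0 <= F' s)%E ->
  measurable_fun setT F -> measurable_fun setT F' -> {ae mu_lag b, forall s, (F s <= F' s)%E} ->
  (potential b sigma F r <= potential b sigma F' r)%E.
Proof.
move=> F0 F'0 mF mF' FF'; apply: mu_lag_ge0_le.
- by move=> s; exact: potentialK_ge0.
- by move=> s; exact: potentialK_ge0.
- exact: measurable_potentialK.
- exact: measurable_potentialK.
- by apply: filterS FF' => s Fs; rewrite lee_wpmul2l// pker_ge0.
Qed.

Lemma potentialZ (k : R) F r : 0 <= k -> (forall s, 0 <= F s)%E -> measurable_fun setT F ->
  potential b sigma (fun s => k%:E * F s)%E r = (k%:E * potential b sigma F r)%E.
Proof.
move=> k0 F0 mF; rewrite /potential -ge0_integralZl ?lee_fin//.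
- by apply: eq_integral => s _; rewrite muleCA.
- exact: measurable_potentialK.
- by move=> s _; exact: potentialK_ge0.
Qed.

End potential_operator.

Lemma fine_inve p : (1 <= p)%E -> (p^-1 = (fine p^-1)%:E)%E /\ 0 <= fine p^-1%E <= 1.
Proof.
case: p => [p| |]//; last by rewrite invey/= lexx ler01.
rewrite lee_fin => p1; have p0 : 0 < p by exact: lt_le_trans p1.
by rewrite inver gt_eqF//= invr_ge0 invf_le1// p1 ltW.
Qed.

(** A function of norm at most m lies below m phi^(1/p) for a sub-probability
    density phi; for p = +oo the exponent is 0 and phi^0 = 1. *)
Lemma Lnorm_density b p (m : R) F : (1 <= p)%E -> 0 < m ->
  (forall s, 0 <= F s)%E -> measurable_fun setT F -> ('N[mu_lag b]_p[F] <= m%:E)%E ->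
  exists phi : R -> R, [/\ forall s, 0 <= phi s, measurable_fun setT phi,
    (\int[mu_lag b]_s (phi s)%:E <= 1)%E &
    {ae mu_lag b, forall s, (F s <= m%:E * (phi s `^ (fine p^-1%E))%:E)%E}].
Proof.
case: p => [p| |]// p1 m0 F0 mF Fm; last first.
  exists (cst 0); split => //.
    by rewrite integral0_eq.
  move: Fm; rewrite unlock /Lnorm mu_lag_setT_gt0 => /ess_supP.
  apply: filterS => s /=; rewrite gee0_abs// => Fs.
  by rewrite powRr0 mule1.
move: p1; rewrite lee_fin => p1; have p0 : 0 < p by exact: lt_le_trans p1.
have pn0 : p != 0 by rewrite gt_eqF.
have mp0 : 0 < m `^ p by rewrite powR_gt0.
have IFp : (\int[mu_lag b]_s (F s `^ p) <= (m `^ p)%:E)%E.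
  have := @poweR_Lnorm _ _ _ (mu_lag b) F p pn0.
  under [X in _ = X -> _]eq_integral do rewrite gee0_abs//.
  move=> <-; rewrite -poweR_EFin gt0_ler_poweR ?(ltW p0)// in_itv/= ?leey ?andbT//.
    exact: Lnorm_ge0.
  by rewrite lee_fin ltW.
have mFp : measurable_fun setT (fun s => F s `^ p)%E.
  exact: (measurableT_comp (measurable_poweR _) mF).
have Ffin : {ae mu_lag b, forall s, F s \is a fin_num}.
  have : (mu_lag b).-integrable setT (fun s => F s `^ p)%E.
    apply/integrableP; split => //.
    under eq_integral do rewrite gee0_abs ?poweR_ge0//.
    exact: le_lt_trans IFp (ltry _).
  move/(integrable_ae measurableT); apply: filterS => s /(_ I) Fs.
  rewrite ge0_fin_numE//; apply: (@lty_poweRy _ _ p) => //.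
  by rewrite -ge0_fin_numE// poweR_ge0.
have mfF : measurable_fun setT (fine \o F).
  exact: (measurableT_comp (@fine_measurable R setT measurableT)).
exists (fun s => fine (F s) `^ p / m `^ p); split.
- by move=> s; rewrite divr_ge0 ?powR_ge0.
- by apply: measurable_funM => //; exact: (measurableT_comp (measurable_powR _) mfF).
- apply: (@le_trans _ _ (\int[mu_lag b]_s (((m `^ p)^-1)%:E * (F s `^ p)))%E).
    apply: mu_lag_ge0_le.
    + by move=> s; rewrite lee_fin divr_ge0 ?powR_ge0.
    + by move=> s; rewrite mule_ge0 ?poweR_ge0// lee_fin invr_ge0 powR_ge0.
    + by apply/measurable_EFinP; apply: measurable_funM => //; exact: (measurableT_comp (measurable_powR _) mfF).
    + exact: measurable_funeM.
    + by apply: filterS Ffin => s Fs; rewrite -{2}(fineK Fs) poweR_EFin -EFinM mulrC.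
  rewrite ge0_integralZl ?lee_fin ?invr_ge0 ?(ltW mp0)//; last by move=> s _; rewrite poweR_ge0.
  apply: (@le_trans _ _ (((m `^ p)^-1)%:E * (m `^ p)%:E)%E).
    by rewrite lee_wpmul2l// lee_fin invr_ge0 ltW.
  by rewrite -EFinM mulVf// gt_eqF.
- apply: filterS Ffin => s Fs; rewrite -{1}(fineK Fs) inver (negbTE pn0)/=.
  rewrite -EFinM lee_fin powRM ?powR_ge0 ?invr_ge0 ?(ltW mp0)//.
  rewrite -powRrM mulfV// powRr1 ?fine_ge0//.
  rewrite -powRN -powRrM mulNr mulfV// powR_inv1 ?(ltW m0)//.
  by rewrite mulrCA divff ?mulr1// gt_eqF.
Qed.

(** By homogeneity F lies below m phi^(1/p); testing the potential against
    gam^(1-1/q) is then [bilinear_bound] with a = 1/p, a' = 1 - 1/q. *)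
Theorem potential_Lp_Lq b sigma p q : - (1 / 2) <= b -> 0 < sigma -> (1 <= p)%E -> (1 <= q)%E ->
  - sigma < (b + 1) * (fine p^-1%E - fine q^-1%E) ->
  (b + 1) * (fine p^-1%E - fine q^-1%E) < sigma \/
    [/\ (b + 1) * (fine p^-1%E - fine q^-1%E) = sigma, fine p^-1%E < 1 & 0 < fine q^-1%E] ->
  exists C : R, 0 < C /\ forall F, (forall s, 0 <= F s)%E -> measurable_fun setT F ->
    ('N[mu_lag b]_q[potential b sigma F] <= C%:E * 'N[mu_lag b]_p[F])%E.
Proof.
move=> b12 s0 p1 q1; have c0 : 0 < b + 1 by move: b12; lra.
have [pE a01] := fine_inve p1; have [qE q01] := fine_inve q1.
set a := fine p^-1%E in a01 *; set y := fine q^-1%E in q01 *.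
pose a' := 1 - y.
have a'01 : 0 <= a' <= 1 by rewrite /a'; case/andP: q01; lra.
have -> : a - y = a + a' - 1 by rewrite /a'; ring.
have -> : (0 < y) = (a' < 1) by rewrite /a' ltrBlDr ltrDl.
move=> lo hi; have [C [C0 HC]] := bilinear_bound b12 s0 a01 a'01 lo hi.
exists C; split => // F F0 mF.
suff H (m : R) : 0 < m -> ('N[mu_lag b]_p[F] <= m%:E)%E -> ('N[mu_lag b]_q[potential b sigma F] <= (C * m)%:E)%E.
  have := Lnorm_ge0 (mu_lag b) p F; case NF : ('N[mu_lag b]_p[F])%E => [x| |]// x0.
    apply/lee_addgt0Pr => e e0; have eC : 0 < e / C by rewrite divr_gt0.
    have := H (x + e / C); rewrite ltr_wpDl// NF lee_fin lerDl ltW// => /(_ isT isT).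
    by move=> /le_trans; apply; rewrite -EFinM -EFinD lee_fin mulrDr mulrCA divff ?mulr1// gt_eqF.
  by rewrite gt0_muley ?lte_fin// leey.
move=> m0 Fm; have [phi [phi0 mphi iphi Fphi]] := Lnorm_density p1 m0 F0 mF Fm.
have Cm0 : 0 <= C * m by rewrite mulr_ge0 ?ltW.
pose P s : \bar R := (phi s `^ a)%:E.
have P0 s : (0 <= P s)%E by rewrite lee_fin powR_ge0.
have mP : measurable_fun setT P.
  by apply/measurable_EFinP; exact: (measurableT_comp (measurable_powR _) mphi).
have TF0 r : (0 <= potential b sigma F r)%E by exact: potential_ge0.
have mTF : measurable_fun setT (potential b sigma F) by exact: measurable_potential.
have TF r : (potential b sigma F r <= m%:E * potential b sigma P r)%E.
  rewrite -potentialZ ?(ltW m0)//; apply: potential_le => //.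
  - by move=> s; rewrite mule_ge0// lee_fin ltW.
  - exact: measurable_funeM.
have test (gam : R -> R) : (forall s, 0 <= gam s) -> measurable_fun setT gam ->
    (\int[mu_lag b]_s (gam s)%:E <= 1)%E ->
    (\int[mu_lag b]_r (potential b sigma F r * (gam r `^ a')%:E) <= (C * m)%:E)%E.
  move=> gam0 mgam igam.
  have mga : measurable_fun setT (fun r => (gam r `^ a')%:E).
    by apply/measurable_EFinP; exact: (measurableT_comp (measurable_powR _) mgam).
  have ga0 r : (0 <= (gam r `^ a')%:E)%E by rewrite lee_fin powR_ge0.
  have mTP : measurable_fun setT (potential b sigma P) by exact: measurable_potential.
  have TP0 r : (0 <= potential b sigma P r)%E by exact: potential_ge0.
  apply: (@le_trans _ _ (\int[mu_lag b]_r (m%:E * ((gam r `^ a')%:E * potential b sigma P r)))%E).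
    apply: ge0_le_integral => //.
    - by move=> r _; rewrite mule_ge0.
    - exact: emeasurable_funM.
    - by apply: measurable_funeM; exact: emeasurable_funM.
    - by move=> r _; rewrite [X in (_ <= m%:E * X)%E]muleC muleA lee_wpmul2r.
  rewrite ge0_integralZl ?lee_fin ?(ltW m0)//; last 2 first.
  - exact: emeasurable_funM.
  - by move=> r _; rewrite mule_ge0.
  rewrite mulrC EFinM lee_wpmul2l ?lee_fin ?(ltW m0)//.
  have := HC phi gam phi0 gam0 mphi mgam iphi igam.
  apply: le_trans; rewrite -(dint_fst b (f := fun r s => pker b sigma r s * P s)%E)//.
  - rewrite le_eqVlt; apply/orP; left; apply/eqP.
    apply: eq_integral => r _; apply: eq_integral => s _.
    by rewrite /weight /P EFinM muleA.
  - by move=> r s; exact: potentialK_ge0.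
  - exact: meas2_potentialK.
rewrite /a' in test; move: test; rewrite /y; clear -c0 TF0 mTF Cm0 q1.
case: q q1 => [q| |]// q1 test; rewrite unlock /Lnorm.
  move: q1; rewrite lee_fin => q1; have q0 : 0 < q by exact: lt_le_trans q1.
  have := dual_fin c0 Cm0 TF0 mTF q1 _.
  move: test; rewrite inver gt_eqF//= => test /(_ test) H.
  under eq_integral do rewrite gee0_abs//.
  have -> : (C * m)%:E = (((C * m) `^ q)%:E `^ q^-1)%E.
    by rewrite poweR_EFin -powRrM mulfV ?gt_eqF// powRr1.
  rewrite gt0_ler_poweR ?invr_ge0 ?(ltW q0)// in_itv/= leey andbT//.
    by apply: integral_ge0 => r _; exact: poweR_ge0.
  by rewrite lee_fin powR_ge0.
rewrite mu_lag_setT_gt0; apply/ess_supP.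
have := dual_infty c0 Cm0 mTF _.
move=> /(_ _)[].
  move=> gam g0 mg ig; have := test gam g0 mg ig.
  rewrite invey/= subr0; apply: le_trans; rewrite le_eqVlt; apply/orP; left; apply/eqP.
  by apply: eq_integral => r _; rewrite powRr1.
move=> N [mN N0 sN]; exists N; split => // r /= rN; apply: sN => /= H; apply: rN.
by rewrite gee0_abs.
Qed.

End mapping.

(** * The spectral series in L^2 *)

Section square_integrable.
Context {R : realType}.
Variable b : R.
Implicit Types (f g h k : R -> R) (x y : R) (m n : nat).

(** Membership in L^2 unbundled, for real functions; see [L2_Lfun]. *)
Definition L2 f := measurable_fun setT f /\
  (mu_lag b).-integrable setT (fun r => (f r ^+ 2)%:E).

Lemma L2_mul f k : L2 f -> L2 k -> (mu_lag b).-integrable setT (fun r => (f r * k r)%:E).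
Proof.
move=> [mf jf] [mk jk].
have := integrableD measurableT jf jk; apply: le_integrable => //.
  by apply/measurable_EFinP; exact: measurable_funM.
move=> r _; rewrite -[leLHS]/(`|f r * k r|%:E) -[leRHS]/(`|f r ^+ 2 + k r ^+ 2|%:E).
rewrite lee_fin [leRHS]ger0_norm ?addr_ge0 ?sqr_ge0// normrM.
rewrite -[f r ^+ 2]real_normK ?num_real// -[k r ^+ 2]real_normK ?num_real//.
have := sqr_ge0 (`|f r| - `|k r|); have : 0 <= `|f r| * `|k r| by rewrite mulr_ge0.
by nra.
Qed.

Lemma L2_dom f g : measurable_fun setT f -> (forall r, `|f r| <= `|g r|) -> L2 g -> L2 f.
Proof.
move=> mf fg [mg jg]; split => //; move: jg; apply: le_integrable => //.
  by apply/measurable_EFinP; exact: measurable_funX.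
by move=> r _; rewrite /= lee_fin !normrX lerXn2r ?nnegrE.
Qed.

Lemma L2D f k : L2 f -> L2 k -> L2 (fun r => f r + k r).
Proof.
move=> Lf Lk; have [mf jf] := Lf; have [mk jk] := Lk; split; first exact: measurable_funD.
have := integrableD measurableT (integrableD measurableT jf jk)
  (integrableZl measurableT 2 (L2_mul Lf Lk)).
apply: eq_integrable => // r _ /=; rewrite -!EFinD; congr EFin; ring.
Qed.

Lemma L2Z x f : L2 f -> L2 (fun r => x * f r).
Proof.
move=> [mf jf]; split; first exact: measurable_funM.
have := integrableZl measurableT (x ^+ 2) jf.
by apply: eq_integrable => // r _ /=; rewrite exprMn.
Qed.

Lemma L2B f k : L2 f -> L2 k -> L2 (fun r => f r - k r).
Proof.
move=> Lf Lk; have := L2D Lf (L2Z (-1) Lk); congr L2.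
by apply/funext => r; rewrite mulN1r.
Qed.

Lemma L2_0 : L2 (fun=> 0).
Proof.
split => //; under eq_fun do rewrite expr0n/=; exact: integrable0.
Qed.

Lemma L2_sum (I : Type) (s : seq I) (F : I -> R -> R) : (forall i, L2 (F i)) ->
  L2 (fun r => \sum_(i <- s) F i r).
Proof.
move=> LF; elim: s => [|i s IH].
  by under eq_fun do rewrite big_nil; exact: L2_0.
by under eq_fun do rewrite big_cons; exact: L2D.
Qed.

Lemma L2_Lfun f : f \in Lfun (mu_lag b) 2%:E <-> L2 f.
Proof.
split=> [Lf|[mf jf]].
  split; last exact: Lfun2_integrable_sqr.
  by move: Lf; rewrite inE => /andP[+ _]; rewrite inE.
rewrite inE; apply/andP; split; rewrite inE//= /finite_norm unlock /Lnorm.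
apply: poweR_lty; have /integrableP[_] := jf; apply: le_lt_trans.
apply: ge0_le_integral => //.
- by move=> r _; exact: poweR_ge0.
- apply: (measurableT_comp (measurable_poweR _)).
  by apply: measurableT_comp => //; apply/measurable_EFinP.
- by apply: measurableT_comp => //; apply/measurable_EFinP; exact: measurable_funX.
- by move=> r _ /=; rewrite lee_fin powR_mulrn// normrX.
Qed.

Definition ip f k := \int[mu_lag b]_r (f r * k r).

Lemma ipE f k : L2 f -> L2 k -> ((ip f k)%:E = \int[mu_lag b]_r (f r * k r)%:E)%E.
Proof. by move=> Lf Lk; rewrite /ip /Rintegral fineK//; apply: integrable_fin_num => //; exact: L2_mul. Qed.

Lemma ipC f k : ip f k = ip k f.
Proof. by apply: eq_Rintegral => r _; rewrite mulrC. Qed.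

Lemma ipD f g k : L2 f -> L2 g -> L2 k -> ip (fun r => f r + g r) k = ip f k + ip g k.
Proof.
move=> Lf Lg Lk; rewrite -RintegralD//; [|exact: L2_mul|exact: L2_mul].
by apply: eq_Rintegral => r _; rewrite mulrDl.
Qed.

Lemma ipZ x f k : L2 f -> L2 k -> ip (fun r => x * f r) k = x * ip f k.
Proof.
move=> Lf Lk; rewrite -RintegralZl//; last exact: L2_mul.
by apply: eq_Rintegral => r _; rewrite mulrA.
Qed.

Lemma ipB f g k : L2 f -> L2 g -> L2 k -> ip (fun r => f r - g r) k = ip f k - ip g k.
Proof.
move=> Lf Lg Lk; rewrite -RintegralB//; [|exact: L2_mul|exact: L2_mul].
by apply: eq_Rintegral => r _; rewrite mulrBl.
Qed.

Lemma ip_sum (I : Type) (s : seq I) (F : I -> R -> R) k : (forall i, L2 (F i)) -> L2 k ->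
  ip (fun r => \sum_(i <- s) F i r) k = \sum_(i <- s) ip (F i) k.
Proof.
move=> LF Lk; elim: s => [|i s IH].
  transitivity (0 * ip k k); last by rewrite big_nil mul0r.
  by rewrite -ipZ//; apply: eq_Rintegral => r _; rewrite big_nil !mul0r.
rewrite big_cons -IH -ipD//; last exact: L2_sum.
by apply: eq_Rintegral => r _; rewrite big_cons.
Qed.

Lemma ip_ge0 f : 0 <= ip f f.
Proof. by apply: Rintegral_ge0 => r _; rewrite -expr2 sqr_ge0. Qed.

Hypothesis c0 : 0 < b + 1.

Lemma L2_psi m : L2 (psi b m).
Proof.
split; first exact: measurable_psi.
by under eq_fun do rewrite expr2; exact: psi_integrable.
Qed.

Definition cf m f := ip f (psi b m).

Lemma cf_psi m n : cf m (psi b n) = (n == m)%:R.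
Proof. by apply: EFin_inj; rewrite ipE; [rewrite psi_orthonormal|exact: L2_psi|exact: L2_psi]. Qed.

(** Bessel's inequality: the square of the remainder is positive. *)
Lemma bessel f n : L2 f -> \sum_(m < n) cf m f ^+ 2 <= ip f f.
Proof.
move=> Lf; pose S r := \sum_(m < n) cf m f * psi b m r.
have Lm (m : 'I_n) : L2 (fun r => cf m f * psi b m r) by apply: L2Z; exact: L2_psi.
have LS : L2 S by exact: L2_sum.
have SS k : L2 k -> ip S k = \sum_(m < n) cf m f * cf m k.
  move=> Lk; rewrite /S ip_sum//; apply: eq_bigr => m _.
  rewrite ipZ//; last exact: L2_psi.
  by rewrite ipC.
have cS (m : 'I_n) : cf m S = cf m f.
  rewrite /cf SS; last exact: L2_psi.
  rewrite (bigD1 m)//= cf_psi eqxx mulr1 big1 ?addr0// => i im.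
  by rewrite cf_psi -(inj_eq val_inj) eq_sym in im *; rewrite (negbTE im) mulr0.
have := ip_ge0 (fun r => f r - S r); rewrite ipB//; last exact: L2B.
rewrite ipC ipB// [ip S f]SS// SS; last exact: L2B.
have -> : \sum_(m < n) cf m f * cf m (fun r => f r - S r) = 0.
  apply: big1 => m _; rewrite /cf ipB//; last exact: L2_psi.
  by rewrite -/(cf m f) -/(cf m S) cS subrr mulr0.
by rewrite subr0 subr_ge0.
Qed.

End square_integrable.

Section heat_expansion.
Context {R : realType}.
Variable b : R.
Hypothesis c0 : 0 < b + 1.
Implicit Types (f g h k : R -> R) (x y t : R) (m n : nat).

Lemma eigen_gt0 m : 0 < eigen b m.
Proof.
rewrite /eigen; have := ler0n R m; move: c0; set x := m%:R; clearbody x; lra.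
Qed.

Lemma eigen_le m n : (m <= n)%N -> eigen b m <= eigen b n.
Proof. by move=> mn; rewrite /eigen !lerD2r ler_wpM2l// ler_nat. Qed.

Let w t m : R := expR (- t * eigen b m).

Let w_ge0 t m : 0 <= w t m. Proof. exact: expR_ge0. Qed.

Lemma sums_exp_eigen t : 0 < t -> exists S : R, sums (w t) S.
Proof.
move=> t0; pose q := expR (- (4 * t)).
have q0 : 0 <= q by exact: expR_ge0.
have q1 : q < 1 by rewrite -[ltRHS]expR0 ltr_expR; lra.
have := sumsZ (k := expR (- (t * (2 * b + 2)))) (sums_binomial ltr01 q0 q1).
move=> H; eexists; apply: eq_sums H => m.
rewrite poch1 divff ?fact_neq0// mul1r -expRM_natl -expRD /w; congr expR.
by rewrite /eigen; ring.
Qed.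

(** Expansion of the heat semigroup's quadratic form. The double integrals of the
    terms are split by sign, so that only integrals of positive functions are
    interchanged with the sum. *)
Lemma hker_quadratic f t : L2 b f -> (forall r, 0 <= f r) -> 0 < t ->
  (dint b (fun r s => (hker b t r s)%:E * (f s * f r)%:E) =
   \sum_(m <oo) (w t m * cf b m f ^+ 2)%:E)%E.
Proof.
move=> Lf f0 t0; have [mf jf] := Lf.
pose p m r := Num.max (psi b m r * f r) 0; pose p' m r := Num.max (- (psi b m r * f r)) 0.
have p0 m r : 0 <= p m r by rewrite le_max lexx orbT.
have p'0 m r : 0 <= p' m r by rewrite le_max lexx orbT.
have pp' m r : p m r - p' m r = psi b m r * f r.
  rewrite /p /p'; have [x0|x0] := leP 0 (psi b m r * f r).
    by rewrite max_r ?oppr_le0// subr0.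
  by rewrite max_l ?oppr_ge0 ?ltW// sub0r opprK.
have pDp' m r : p m r + p' m r = `|psi b m r * f r|.
  rewrite /p /p'; have [x0|x0] := leP 0 (psi b m r * f r).
    by rewrite max_r ?oppr_le0// addr0 ger0_norm.
  by rewrite max_l ?oppr_ge0 ?ltW// add0r ltr0_norm.
have mpf m : measurable_fun setT (fun r => psi b m r * f r).
  by apply: measurable_funM => //; exact: measurable_psi.
have mp m : measurable_fun setT (p m) by exact: measurable_maxr.
have mp' m : measurable_fun setT (p' m).
  by apply: measurable_maxr => //; exact: measurableT_comp.
have ipf m := L2_mul (L2_psi c0 m) Lf.
have jp m : (mu_lag b).-integrable setT (fun r => (p m r)%:E).
  apply: le_integrable (ipf m) => //; first by apply/measurable_EFinP.
  by move=> r _; rewrite /= lee_fin -pDp' ger0_norm// lerDl.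
have jp' m : (mu_lag b).-integrable setT (fun r => (p' m r)%:E).
  apply: le_integrable (ipf m) => //; first by apply/measurable_EFinP.
  by move=> r _; rewrite /= lee_fin -pDp' ger0_norm// lerDr.
pose P m := \int[mu_lag b]_r p m r; pose P' m := \int[mu_lag b]_r p' m r.
have PE m : (\int[mu_lag b]_r (p m r)%:E = (P m)%:E)%E.
  by rewrite /P /Rintegral fineK//; exact: integrable_fin_num.
have P'E m : (\int[mu_lag b]_r (p' m r)%:E = (P' m)%:E)%E.
  by rewrite /P' /Rintegral fineK//; exact: integrable_fin_num.
have P0 m : 0 <= P m by exact: Rintegral_ge0.
have P'0 m : 0 <= P' m by exact: Rintegral_ge0.
have cfE m : cf b m f = P m - P' m.
  rewrite /P /P' -RintegralB; [|by []|exact: jp|exact: jp'].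
  apply: eq_Rintegral => r _.
  by rewrite pp' mulrC.
have Pub m : P m + P' m <= 1 + ip b f f.
  rewrite /P /P' -RintegralD; [|by []|exact: jp|exact: jp'].
  have -> : 1 + ip b f f = \int[mu_lag b]_r (psi b m r * psi b m r + f r * f r).
    rewrite RintegralD//; last exact: psi_integrable.
    by congr (_ + _); have := cf_psi c0 m m; rewrite eqxx.
  apply: le_Rintegral => //.
  - exact: (integrableD measurableT (jp m) (jp' m)).
  - exact: (integrableD measurableT (psi_integrable m m c0) (L2_mul Lf Lf)).
  - move=> r _; rewrite pDp' normrM (ger0_norm (f0 r)).
    rewrite -[psi b m r * psi b m r]expr2 -[psi b m r ^+ 2]real_normK ?num_real//.
    have := sqr_ge0 (`|psi b m r| - f r).
    have := mulr_ge0 (normr_ge0 (psi b m r)) (f0 r); nra.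
pose A m r s := w t m * ((p m r + p' m r) * (p m s + p' m s)).
pose B m r s := w t m * (2 * (p m r * p m s + p' m r * p' m s)).
have A0 m r s : 0 <= A m r s by rewrite mulr_ge0// mulr_ge0// addr_ge0.
have B0 m r s : 0 <= B m r s by rewrite mulr_ge0// mulr_ge0// addr_ge0// mulr_ge0.
have BA m r s : B m r s = A m r s + (w t m * psi b m r * psi b m s) * (f s * f r).
  have -> : w t m * psi b m r * psi b m s * (f s * f r) =
     w t m * ((psi b m r * f r) * (psi b m s * f s)) by ring.
  by rewrite -!pp' /A /B; ring.
have mA m : meas2 (fun r s => (A m r s)%:E).
  apply/measurable_EFinP; apply: measurable_funM => //; apply: measurable_funM;
    apply: measurable_funD; by [exact: (measurableT_comp (mp m) measurable_fst)|
      exact: (measurableT_comp (mp' m) measurable_fst)|exact: (measurableT_comp (mp m) measurable_snd)|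
      exact: (measurableT_comp (mp' m) measurable_snd)].
have mB m : meas2 (fun r s => (B m r s)%:E).
  apply/measurable_EFinP; apply: measurable_funM => //; apply: measurable_funM => //.
  apply: measurable_funD; apply: measurable_funM; by [exact: (measurableT_comp (mp m) measurable_fst)|
      exact: (measurableT_comp (mp' m) measurable_fst)|exact: (measurableT_comp (mp m) measurable_snd)|
      exact: (measurableT_comp (mp' m) measurable_snd)].
have prod (h k : R -> R) (x y : R) : (forall r, 0 <= h r) -> (forall r, 0 <= k r) ->
    measurable_fun setT h -> measurable_fun setT k ->
    (\int[mu_lag b]_r (h r)%:E = x%:E)%E -> (\int[mu_lag b]_r (k r)%:E = y%:E)%E ->
    (dint b (fun r s => (h r)%:E * (k s)%:E) = (x * y)%:E)%E.
  move=> h0 k0 mh mk hx ky; rewrite EFinM -hx -ky.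
  by apply: (dint_prod b (h := EFin \o h) (k := EFin \o k)) => [r|r| |];
    rewrite ?lee_fin//; apply/measurable_EFinP.
have m2 (h k : R -> R) : measurable_fun setT h -> measurable_fun setT k ->
    meas2 (fun r s => (h r)%:E * (k s)%:E)%E.
  move=> mh mk; apply: meas2M.
    by apply: (meas2_fst (h := EFin \o h)); apply/measurable_EFinP.
  by apply: (meas2_snd (h := EFin \o k)); apply/measurable_EFinP.
have dA m : dint b (fun r s => (A m r s)%:E) = (w t m * (P m + P' m) ^+ 2)%:E.
  transitivity (dint b (fun r s => (w t m)%:E * ((p m r + p' m r)%:E * (p m s + p' m s)%:E)))%E.
    by apply: eq_integral => r _; apply: eq_integral => s _.
  rewrite dintZ//; last 2 first.
  - by move=> r s; rewrite mule_ge0// lee_fin addr_ge0.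
  - by apply: (m2 (fun r => p m r + p' m r) (fun r => p m r + p' m r)); exact: measurable_funD.
  have S : (\int[mu_lag b]_r (p m r + p' m r)%:E = (P m + P' m)%:E)%E.
    under eq_integral do rewrite EFinD.
    by rewrite integralD// PE P'E.
  rewrite (prod (fun r => p m r + p' m r) (fun r => p m r + p' m r) _ _ _ _ _ _ S S) -?EFinM ?expr2//.
  - by move=> r; rewrite addr_ge0.
  - by move=> r; rewrite addr_ge0.
  - exact: measurable_funD.
  - exact: measurable_funD.
have dB m : dint b (fun r s => (B m r s)%:E) = (w t m * (2 * (P m ^+ 2 + P' m ^+ 2)))%:E.
  transitivity (dint b (fun r s => (w t m * 2)%:E * ((p m r)%:E * (p m s)%:E + (p' m r)%:E * (p' m s)%:E)))%E.
    apply: eq_integral => r _; apply: eq_integral => s _.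
    rewrite -[RHS]/((w t m * 2 * (p m r * p m s + p' m r * p' m s))%:E).
    by rewrite /B mulrA.
  have w20 : 0 <= w t m * 2 by rewrite mulr_ge0.
  rewrite dintZ//; last 2 first.
  - by move=> r s; rewrite adde_ge0// mule_ge0// lee_fin.
  - by apply: meas2D; exact: m2.
  rewrite dintD; [|by move=> r s; rewrite mule_ge0// lee_fin|by move=> r s; rewrite mule_ge0// lee_fin|exact: m2|exact: m2].
  rewrite (prod _ _ _ _ (p0 m) (p0 m) (mp m) (mp m) (PE m) (PE m)).
  rewrite (prod _ _ _ _ (p'0 m) (p'0 m) (mp' m) (mp' m) (P'E m) (P'E m)).
  by rewrite -EFinD -EFinM; congr EFin; ring.
have [S HS] := sums_exp_eigen t0.
have dser (D : nat -> R -> R -> R) : (forall m r s, 0 <= D m r s) ->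
    (forall m, meas2 (fun r s => (D m r s)%:E)) ->
    (dint b (fun r s => \sum_(m <oo) (D m r s)%:E) = \sum_(m <oo) dint b (fun r s => (D m r s)%:E))%E.
  move=> D0 mD; rewrite /dint -integral_nneseries//; last 2 first.
  - by move=> m; apply: (measurable_tonelli1 (mu_lag b) (mD m)) => r s; rewrite lee_fin.
  - by move=> m r _; apply: integral_ge0 => s _; rewrite lee_fin.
  apply: eq_integral => r _; rewrite integral_nneseries//.
  - by move=> m; exact: (measurable_slice1 (mD m) r).
  - by move=> m s _; rewrite lee_fin.
have pt r s : (\sum_(m <oo) (B m r s)%:E = \sum_(m <oo) (A m r s)%:E + (hker b t r s)%:E * (f s * f r)%:E)%E.
  have [SA HA] : exists SA, sums (fun m => A m r s) SA.
    have d1 := @sums_heat_kernel R b t r r c0 t0; have d2 := @sums_heat_kernel R b t s s c0 t0.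
    have /nneseries_sums H : (\sum_(m <oo) (A m r s)%:E < +oo)%E.
      pose U m := (f r * f s) * (w t m * psi b m r * psi b m r + w t m * psi b m s * psi b m s).
      have U0 m : 0 <= U m.
        rewrite /U; apply: mulr_ge0; first exact: mulr_ge0.
        by apply: addr_ge0; rewrite -mulrA; apply: mulr_ge0 => //; rewrite -expr2; exact: sqr_ge0.
      apply: (@le_lt_trans _ _ (\sum_(m <oo) (U m)%:E)%E).
        apply: lee_nneseries => m _; rewrite lee_fin// /A /U !pDp'.
        rewrite [`|psi b m r * f r|]normrM [`|psi b m s * f s|]normrM.
        rewrite (ger0_norm (f0 r)) (ger0_norm (f0 s)).
        have -> : w t m * (`|psi b m r| * f r * (`|psi b m s| * f s)) =
          f r * f s * (w t m * (`|psi b m r| * `|psi b m s|)) by ring.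
        move: (psi b m r) (psi b m s) => y y'.
        rewrite ler_wpM2l ?mulr_ge0// -!mulrA -mulrDr ler_wpM2l//.
        rewrite -!expr2 -[y ^+ 2]real_normK ?num_real// -[y' ^+ 2]real_normK ?num_real//.
        have := sqr_ge0 (`|y| - `|y'|); have := mulr_ge0 (normr_ge0 y) (normr_ge0 y'); nra.
      by rewrite (sums_nneseries U0 (sumsZ (k := f r * f s) (sumsD d1 d2))) ltry.
    by eexists; apply: H => m.
  have HB := sumsD HA (sumsZ (k := f s * f r) (@sums_heat_kernel R b t r s c0 t0)).
  rewrite (sums_nneseries _ HA)// -EFinM -EFinD; apply: sums_nneseries => //.
  rewrite [hker b t r s * _]mulrC; apply: eq_sums HB => m.
  by rewrite BA [f s * f r * _]mulrC.
have mff : meas2 (fun r s => (hker b t r s)%:E * (f s * f r)%:E)%E.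
  apply: meas2M; first exact: meas2_hker.
  apply/measurable_EFinP; apply: measurable_funM; first exact: (measurableT_comp mf measurable_snd).
  exact: (measurableT_comp mf measurable_fst).
have : (dint b (fun r s => \sum_(m <oo) (B m r s)%:E) =
    dint b (fun r s => \sum_(m <oo) (A m r s)%:E) +
    dint b (fun r s => (hker b t r s)%:E * (f s * f r)%:E))%E.
  rewrite -dintD; [|by move=> r s; apply: nneseries_ge0 => m _ _; rewrite lee_fin
    |by move=> r s; rewrite mule_ge0// lee_fin ?hker_ge0// mulr_ge0| |exact: mff]; last first.
  - by apply: ge0_emeasurable_sum => [m z _ _|m _]; [rewrite lee_fin|exact: mA].
  by apply: eq_integral => r _; apply: eq_integral => s _; rewrite pt.
rewrite (dser B B0 mB) (dser A A0 mA).
pose V m := w t m * (P m + P' m) ^+ 2; pose Z m := w t m * cf b m f ^+ 2.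
have V0 m : 0 <= V m by rewrite mulr_ge0// sqr_ge0.
have Z0 m : 0 <= Z m by rewrite mulr_ge0// sqr_ge0.
have M0 : 0 <= 1 + ip b f f by rewrite addr_ge0// ip_ge0.
have HV : sums V (fine (\sum_(m <oo) (V m)%:E)%E).
  apply: nneseries_sums => //.
  apply: (@le_lt_trans _ _ (\sum_(m <oo) ((1 + ip b f f) ^+ 2 * w t m)%:E)%E).
    apply: lee_nneseries => m _; rewrite lee_fin// /V mulrC ler_wpM2r//.
    by apply: lerXn2r; [rewrite nnegrE; exact: addr_ge0|rewrite nnegrE|exact: Pub].
  rewrite (sums_nneseries _ (sumsZ (k := (1 + ip b f f) ^+ 2) HS)) ?ltry// => m.
  by rewrite mulr_ge0// sqr_ge0.
have HZ : sums Z (fine (\sum_(m <oo) (Z m)%:E)%E).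
  apply: nneseries_sums => //.
  apply: (@le_lt_trans _ _ (\sum_(m <oo) (V m)%:E)%E).
    apply: lee_nneseries => m _; rewrite lee_fin// /V /Z ler_wpM2l// cfE.
    rewrite -subr_ge0 (_ : _ - _ = 4 * (P m * P' m)); last by ring.
    by rewrite mulr_ge0// mulr_ge0.
  by rewrite (sums_nneseries V0 HV) ltry.
have EB : (\sum_(m <oo) dint b (fun r s => (B m r s)%:E) =
    \sum_(m <oo) (V m)%:E + \sum_(m <oo) (Z m)%:E)%E.
  rewrite (sums_nneseries V0 HV) (sums_nneseries Z0 HZ) -EFinD.
  have VZ0 m : 0 <= V m + Z m by rewrite addr_ge0.
  rewrite -(sums_nneseries VZ0 (sumsD HV HZ)); apply: eq_eseriesr => m _.
  by rewrite dB; congr EFin; rewrite /V /Z cfE; ring.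
have EA : (\sum_(m <oo) dint b (fun r s => (A m r s)%:E) = \sum_(m <oo) (V m)%:E)%E.
  by apply: eq_eseriesr => m _; exact: dA.
move=> H; have := etrans (esym EB) (etrans H (congr1 (fun u => u + _)%E EA)); move: H => _.
rewrite (sums_nneseries V0 HV) (sums_nneseries Z0 HZ).
move: (fine _) (fine _) (dint b _) => v z [d|//|//].
by rewrite -!EFinD => -[/addrI ->].
Qed.

End heat_expansion.

Section spectral.
Context {R : realType}.
Variables b sigma : R.
Hypotheses (b12 : - (1 / 2) <= b) (s0 : 0 < sigma).
Implicit Types (f g h k : R -> R) (x y t : R) (m n : nat).

Let c0 : 0 < b + 1. Proof. by move: b12; lra. Qed.

Let lam m : R := eigen b m `^ (- sigma).

Let lam_gt0 m : 0 < lam m. Proof. by rewrite powR_gt0// eigen_gt0. Qed.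

Let lam_le m n : (m <= n)%N -> lam n <= lam m.
Proof. by move=> mn; apply: ler_powRN; rewrite ?eigen_gt0 ?eigen_le// ltW. Qed.

Let D f k := dint b (fun r s => pker b sigma r s * (f s * k r)%:E)%E.

Let meas2_prod f k : measurable_fun setT f -> measurable_fun setT k ->
  meas2 (fun r s => (f s * k r)%:E).
Proof.
move=> mf mk; apply/measurable_EFinP; apply: measurable_funM.
  exact: (measurableT_comp mf measurable_snd).
exact: (measurableT_comp mk measurable_fst).
Qed.

(** Integrating exp (- t lambda) against t^(sigma-1) gives lambda^(-sigma). *)
Lemma pker_quadratic f : L2 b f -> (forall r, 0 <= f r) ->
  (D f f = \sum_(m <oo) (lam m * cf b m f ^+ 2)%:E)%E.
Proof.
move=> Lf f0; have [mf jf] := Lf; have G0 := Gamma_gt0 s0.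
rewrite /D dint_pker//; [|by move=> r s; rewrite lee_fin mulr_ge0|exact: meas2_prod].
pose g m t : \bar R := ((cf b m f ^+ 2)%:E * (expR (- (eigen b m * t)))%:E)%E.
have g0 m t : (0 <= g m t)%E by rewrite mule_ge0// lee_fin ?sqr_ge0 ?expR_ge0.
have me m : measurable_fun setT (fun t : R => (expR (- (eigen b m * t)))%:E).
  apply/measurable_EFinP; apply: (measurableT_comp (@measurable_expR R)).
  by apply: measurableT_comp => //; exact: measurable_funM.
have mg m : measurable_fun setT (g m) by exact: measurable_funeM.
transitivity (((Gamma sigma)^-1)%:E * \int[mu_lag (sigma / 2 - 1)]_t \sum_(m <oo) g m t)%E.
  congr (_ * _)%E; apply: mu_lag_eq.
  - by move=> t; apply: dint_ge0 => r s; rewrite mule_ge0// lee_fin ?hker_ge0// mulr_ge0.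
  - by move=> t; apply: nneseries_ge0.
  - apply: measurable_dint_hker => //; last exact: meas2_prod.
    by move=> r s; rewrite lee_fin mulr_ge0.
  - exact: ge0_emeasurable_sum.
  - move=> t t0; rewrite hker_quadratic//; apply: eq_eseriesr => m _.
    by rewrite /g mulrC EFinM mulNr [t * _]mulrC.
rewrite integral_nneseries// -nneseriesZl; last by move=> m _; exact: integral_ge0.
apply: eq_eseriesr => m _.
rewrite (ge0_integralZl _ measurableT (me m)); [|by move=> t _; rewrite lee_fin expR_ge0
  |by rewrite lee_fin sqr_ge0].
rewrite integral_exp_pow ?eigen_gt0// -!EFinM; congr EFin; rewrite -/(lam m).
by field; rewrite gt_eqF.
Qed.

Let D_ge0 f k : (forall r, 0 <= f r) -> (forall r, 0 <= k r) -> (0 <= D f k)%E.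
Proof.
by move=> f0 k0; apply: dint_ge0 => r s; rewrite mule_ge0 ?pker_ge0// lee_fin mulr_ge0.
Qed.

Let D_sums f : L2 b f -> (forall r, 0 <= f r) ->
  exists S : R, D f f = S%:E /\ sums (fun m => lam m * cf b m f ^+ 2) S.
Proof.
move=> Lf f0; have u0 m : 0 <= lam m * cf b m f ^+ 2 by rewrite mulr_ge0 ?sqr_ge0// ltW.
rewrite pker_quadratic//.
have H : (\sum_(m <oo) (lam m * cf b m f ^+ 2)%:E <= (lam 0%N * ip b f f)%:E)%E.
  apply: lime_le; first by apply: is_cvg_nneseries => m _ _; rewrite lee_fin.
  apply: nearW => n; rewrite sumEFin lee_fin big_mkord.
  apply: (@le_trans _ _ (lam 0%N * \sum_(m < n) cf b m f ^+ 2)).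
    by rewrite mulr_sumr; apply: ler_sum => m _; rewrite ler_wpM2r ?sqr_ge0// lam_le.
  by rewrite ler_wpM2l ?(ltW (lam_gt0 _))// bessel.
have Hy := le_lt_trans H (ltry _).
exists (fine (\sum_(m <oo) (lam m * cf b m f ^+ 2)%:E)%E); split; last exact: nneseries_sums.
by rewrite fineK// ge0_fin_numE//; apply: nneseries_ge0 => m _ _; rewrite lee_fin.
Qed.

(** Polarisation, within positive functions. *)
Let D_bilinear f k : L2 b f -> L2 b k -> (forall r, 0 <= f r) -> (forall r, 0 <= k r) ->
  exists S : R, D f k = S%:E /\ sums (fun m => lam m * (cf b m f * cf b m k)) S.
Proof.
move=> Lf Lk f0 k0; have [mf _] := Lf; have [mk _] := Lk.
pose fk r := f r + k r.
have Lfk : L2 b fk by exact: L2D.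
have fk0 r : 0 <= fk r by rewrite addr_ge0.
have [S [SE HS]] := D_sums Lfk fk0.
have [S1 [S1E HS1]] := D_sums Lf f0; have [S2 [S2E HS2]] := D_sums Lk k0.
have DC : D k f = D f k.
  rewrite /D dintC.
  - apply: eq_integral => r _; apply: eq_integral => s _.
    by rewrite pkerC mulrC.
  - by move=> r s; rewrite mule_ge0 ?pker_ge0// lee_fin mulr_ge0.
  - by apply: meas2M; [exact: meas2_pker|exact: meas2_prod].
have p0 h h' r s : (forall r, 0 <= h r) -> (forall r, 0 <= h' r) ->
    (0 <= pker b sigma r s * (h s * h' r)%:E)%E.
  move=> h0 h'0; apply: mule_ge0; first exact: (pker_ge0 r s c0 s0).
  by rewrite lee_fin; exact: mulr_ge0.
have mp h h' : measurable_fun setT h -> measurable_fun setT h' ->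
    meas2 (fun r s => pker b sigma r s * (h s * h' r)%:E)%E.
  by move=> ? ?; apply: meas2M; [exact: meas2_pker|exact: meas2_prod].
have DE : D fk fk = (D f f + D f k + (D k f + D k k))%E.
  pose K h h' r s := (pker b sigma r s * (h s * h' r)%:E)%E.
  have K0 h h' : (forall r, 0 <= h r) -> (forall r, 0 <= h' r) -> forall r s, (0 <= K h h' r s)%E.
    by move=> h0 h'0 r s; exact: p0.
  have mK h h' : measurable_fun setT h -> measurable_fun setT h' -> meas2 (K h h') by exact: mp.
  have -> : D fk fk = dint b (fun r s => (K f f r s + K f k r s) + (K k f r s + K k k r s))%E.
    apply: eq_integral => r _; apply: eq_integral => s _; rewrite /K.
    have e0 h h' : (forall r, 0 <= h r) -> (forall r, 0 <= h' r) -> (0 <= (h s * h' r)%:E)%E.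
      by move=> h0 h'0; rewrite lee_fin; exact: mulr_ge0.
    rewrite -ge0_muleDr; [|exact: e0..]; rewrite -ge0_muleDr; [|exact: e0..].
    rewrite -ge0_muleDr; [|by apply: adde_ge0; exact: e0..].
    by rewrite -!EFinD; congr (_ * _%:E)%E; rewrite /fk; ring.
  have K2 h h' g g' : (forall r, 0 <= h r) -> (forall r, 0 <= h' r) -> (forall r, 0 <= g r) ->
     (forall r, 0 <= g' r) -> forall r s, (0 <= K h h' r s + K g g' r s)%E.
    by move=> h0 h'0 g0 g'0 r s; apply: adde_ge0; exact: K0.
  rewrite dintD; [|exact: K2|exact: K2|by apply: meas2D; exact: mK..].
  by rewrite dintD; [rewrite dintD; [|exact: K0|exact: K0|exact: mK..]|exact: K0|exact: K0|exact: mK..].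
have Dfin : D f k \is a fin_num.
  rewrite (ge0_fin_numE (D_ge0 f0 k0)); apply: le_lt_trans (ltry S); rewrite -SE DE.
  apply: (le_trans (leeDr (D f k) (D_ge0 f0 f0))).
  exact: leeDl (adde_ge0 (D_ge0 k0 f0) (D_ge0 k0 k0)).
move: DE; rewrite DC SE S1E S2E; have [d ->] : exists d, (D f k = d%:E)%E.
  by exists (fine (D f k)); exact: (esym (fineK Dfin)).
rewrite -!EFinD => -[Sd]; exists d; split; first by [].
have -> : d = 2^-1 * (S - S1 - S2) by rewrite Sd; field.
apply: eq_sums (sumsZ (k := 2^-1) (sumsB (sumsB HS HS1) HS2)) => m.
have -> : cf b m fk = cf b m f + cf b m k by exact: ipD Lf Lk (L2_psi c0 m).
by move: (lam m) (cf b m f) (cf b m k) => l x y; field.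
Qed.

Let T f r := fine (potential b sigma (EFin \o f) r).

Let mE f : measurable_fun setT f -> measurable_fun setT (EFin \o f).
Proof. by move=> mf; apply/measurable_EFinP. Qed.

(** The scalar estimate at p = q = 2 shows that potentials of positive functions of
    L^2 are in L^2, so that [fine] only changes them on a null set. *)
Let potential_L2 f : L2 b f -> (forall r, 0 <= f r) ->
  L2 b (T f) /\ {ae mu_lag b, forall r, potential b sigma (EFin \o f) r = (T f r)%:E}.
Proof.
move=> Lf f0; have [mf jf] := Lf; have f0' r : (0 <= (EFin \o f) r)%E by rewrite lee_fin.
have mEf := mE mf.
have [C [C0 HC]] : exists C : R, 0 < C /\ forall F : R -> \bar R, (forall s, 0 <= F s)%E -> measurable_fun setT F ->
    ('N[mu_lag b]_2%:E[potential b sigma F] <= C%:E * 'N[mu_lag b]_2%:E[F])%E.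
  have e2 : (1 <= 2%:E :> \bar R)%E by rewrite lee_fin ler1n.
  by apply: potential_Lp_Lq => //; rewrite subrr mulr0; [rewrite oppr_lt0|left].
have := HC _ f0' mEf; set G := potential b sigma _.
have G0 r : (0 <= G r)%E by exact: potential_ge0.
have mG : measurable_fun setT G by exact: measurable_potential.
have Nf : ('N[mu_lag b]_2%:E[EFin \o f] < +oo)%E.
  by move: Lf => /L2_Lfun; rewrite inE => /andP[_]; rewrite inE.
move=> NG; have NGy : ('N[mu_lag b]_2%:E[G] < +oo)%E.
  by apply: (le_lt_trans NG); rewrite lte_mul_pinfty// lee_fin ltW.
have IG : (\int[mu_lag b]_r (G r `^ 2) < +oo)%E.
  have := poweR_lty 2 NGy; rewrite poweR_Lnorm//.
  by under eq_integral do rewrite gee0_abs//.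
have mG2 : measurable_fun setT (fun r => G r `^ 2)%E.
  exact: (measurableT_comp (measurable_poweR _) mG).
have jG : (mu_lag b).-integrable setT (fun r => G r `^ 2)%E.
  by apply/integrableP; split => //; under eq_integral do rewrite gee0_abs ?poweR_ge0//.
have aeG : {ae mu_lag b, forall r, G r = (T f r)%:E}.
  move: (integrable_ae measurableT jG); apply: filterS => r /(_ I) Gr.
  rewrite /T fineK// ge0_fin_numE//; apply: (@lty_poweRy _ _ 2) => //.
  by rewrite -ge0_fin_numE// poweR_ge0.
split => //; have mT : measurable_fun setT (T f).
  exact: (measurableT_comp (@fine_measurable R setT measurableT) mG).
split => //; apply/integrableP; split.
  by apply/measurable_EFinP; exact: measurable_funX.
apply: le_lt_trans IG; apply: mu_lag_ge0_le => //.
- by move=> r; exact: poweR_ge0.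
- by apply: measurableT_comp => //; apply/measurable_EFinP; exact: measurable_funX.
- apply: filterS aeG => r ->; rewrite /= lee_fin ger0_norm ?sqr_ge0//.
  by rewrite powR_mulrn// /T fine_ge0.
Qed.

Let ip_T f k : L2 b f -> L2 b k -> (forall r, 0 <= f r) -> (forall r, 0 <= k r) ->
  (D f k = (ip b (T f) k)%:E)%E.
Proof.
move=> Lf Lk f0 k0; have [LT aeT] := potential_L2 Lf f0.
have [mf _] := Lf; have [mk _] := Lk; have [mT _] := LT.
have f0' r : (0 <= (EFin \o f) r)%E by rewrite lee_fin.
have mP : measurable_fun setT (potential b sigma (EFin \o f)) by apply: measurable_potential => //; exact: mE.
have mK := mE mk.
rewrite ipE//; transitivity (dint b (fun r s => (pker b sigma r s * (f s)%:E) * (k r)%:E))%E.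
  by apply: eq_integral => r _; apply: eq_integral => s _; rewrite EFinM muleA.
rewrite (dint_fst b (f := fun r s => (pker b sigma r s * (f s)%:E)%E) (h := EFin \o k)); last 3 first.
- by move=> r s; exact: (potentialK_ge0 c0 s0 r s f0').
- by move=> r; rewrite lee_fin.
- by apply: (meas2_potentialK sigma c0); exact: mE.
apply: ge0_ae_eq_integral => //.
- by apply: emeasurable_funM => //; exact: mP.
- by apply/measurable_EFinP; exact: measurable_funM.
- by move=> r _; rewrite mule_ge0 ?lee_fin// (potential_ge0 c0 s0 r f0').
- by move=> r _; rewrite lee_fin mulr_ge0// fine_ge0// (potential_ge0 c0 s0 r f0').
- by apply: filterS aeT => r Tr _; rewrite -[X in (_ * X)%E]/(potential b sigma (EFin \o f) r) Tr -EFinM mulrC.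
Qed.

Let pos f r := Num.max (f r) 0.
Let neg f r := Num.max (- f r) 0.

Let pos_ge0 f r : 0 <= pos f r. Proof. by rewrite le_max lexx orbT. Qed.
Let neg_ge0 f r : 0 <= neg f r. Proof. by rewrite le_max lexx orbT. Qed.

Let pos_neg f r : f r = pos f r - neg f r.
Proof.
rewrite /pos /neg; have [x0|x0] := leP 0 (f r); first by rewrite max_r ?oppr_le0// subr0.
by rewrite max_l ?oppr_ge0 ?ltW// sub0r opprK.
Qed.

Let L2_pos f : L2 b f -> L2 b (pos f).
Proof.
move=> Lf; have [mf _] := Lf; apply: L2_dom Lf; first exact: measurable_maxr.
move=> r; rewrite (ger0_norm (pos_ge0 f r)) ge_max normr_ge0 andbT; exact: ler_norm.
Qed.

Let L2_neg f : L2 b f -> L2 b (neg f).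
Proof.
move=> Lf; have [mf _] := Lf; apply: L2_dom Lf.
  by apply: measurable_maxr => //; exact: measurableT_comp.
by move=> r; rewrite (ger0_norm (neg_ge0 f r)) ge_max normr_ge0 andbT -normrN ler_norm.
Qed.

(** The potential of a function of either sign, as a difference of real functions. *)
Definition potential_fun f r := T (pos f) r - T (neg f) r.

Lemma L2_potential_fun f : L2 b f -> L2 b (potential_fun f).
Proof.
move=> Lf; have [L1 _] := potential_L2 (L2_pos Lf) (pos_ge0 f).
by have [L2' _] := potential_L2 (L2_neg Lf) (neg_ge0 f); exact: L2B.
Qed.

Lemma potential_opE f : L2 b f ->
  {ae mu_lag b, forall r, potential_op b sigma f r = (potential_fun f r)%:E}.
Proof.
move=> Lf; have [_ a1] := potential_L2 (L2_pos Lf) (pos_ge0 f).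
have [_ a2] := potential_L2 (L2_neg Lf) (neg_ge0 f).
apply: filterS2 a1 a2 => r E1 E2; rewrite /potential_fun EFinB -E1 -E2 /potential_op integralE.
congr (_ - _)%E; apply: eq_integral => s _.
- rewrite funeposE/= potential_kernelE// /pos; have K0 := pker_ge0 r s c0 s0; have [x0|x0] := leP 0 (f s).
    by rewrite max_l// mule_ge0.
  by rewrite mule0 max_r// mule_ge0_le0// lee_fin ltW.
- rewrite funenegE/= potential_kernelE// /neg; have K0 := pker_ge0 r s c0 s0; have [x0|x0] := leP (- f s) 0.
    by rewrite mule0 max_r// oppe_le0 mule_ge0// lee_fin -oppr_le0.
  by rewrite max_l -?muleN// mule_ge0// lee_fin ltW.
Qed.

Lemma potential_fun_sums f k : L2 b f -> L2 b k ->
  sums (fun m => lam m * (cf b m f * cf b m k)) (ip b (potential_fun f) k).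
Proof.
move=> Lf Lk.
have pp h h' : L2 b h -> L2 b h' -> (forall r, 0 <= h r) -> (forall r, 0 <= h' r) ->
    sums (fun m => lam m * (cf b m h * cf b m h')) (ip b (T h) h').
  move=> Lh Lh' h0 h'0; have [S [SE HS]] := D_bilinear Lh Lh' h0 h'0.
  by move: SE HS; rewrite ip_T// => -[<-].
have [Lp Ln] := (L2_pos Lf, L2_neg Lf); have [Lp' Ln'] := (L2_pos Lk, L2_neg Lk).
have [T1 _] := potential_L2 Lp (pos_ge0 f); have [T2 _] := potential_L2 Ln (neg_ge0 f).
have cB h m : L2 b h -> cf b m h = cf b m (pos h) - cf b m (neg h).
  move=> Lh; rewrite -(ipB (L2_pos Lh) (L2_neg Lh) (L2_psi c0 m)) /cf.
  by congr (ip b _ _); apply/funext => r; exact: pos_neg.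
have -> : ip b (potential_fun f) k =
   (ip b (T (pos f)) (pos k) - ip b (T (pos f)) (neg k)) -
   (ip b (T (neg f)) (pos k) - ip b (T (neg f)) (neg k)).
  have sp h : L2 b h -> ip b h k = ip b h (pos k) - ip b h (neg k).
    move=> Lh; rewrite ![ip b h _]ipC -ipB//.
    by congr (ip b _ _); apply/funext => r; exact: pos_neg.
  by rewrite /potential_fun ipB// !sp.
have H := sumsB (sumsB (pp _ _ Lp Lp' (pos_ge0 f) (pos_ge0 k)) (pp _ _ Lp Ln' (pos_ge0 f) (neg_ge0 k)))
  (sumsB (pp _ _ Ln Lp' (neg_ge0 f) (pos_ge0 k)) (pp _ _ Ln Ln' (neg_ge0 f) (neg_ge0 k))).
apply: eq_sums H => m; rewrite (cB f)// (cB k)//; ring.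
Qed.

Lemma L2_spectral_sum f n : L2 b (spectral_sum b sigma f n).
Proof. by apply: L2_sum => m; apply: L2Z; exact: L2_psi. Qed.

(** The remainder k after n terms satisfies
    |k|^2 = sum_(m >= n) lam_m c_m(f) c_m(k) <= (lam_n^2 |f|^2 + |k|^2) / 2. *)
Lemma spectral_remainder f n : L2 b f ->
  ip b (fun r => potential_fun f r - spectral_sum b sigma f n r)
       (fun r => potential_fun f r - spectral_sum b sigma f n r) <= lam n ^+ 2 * ip b f f.
Proof.
move=> Lf; set S := spectral_sum b sigma f n; have LS : L2 b S by exact: L2_spectral_sum.
have LP := L2_potential_fun Lf; set k := fun r => _; have Lk : L2 b k by exact: L2B.
have kk : sums (fun m => if (m < n)%N then 0 else lam m * (cf b m f * cf b m k)) (ip b k k).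
  have -> : ip b k k = ip b (potential_fun f) k - \sum_(m < n) lam m * (cf b m f * cf b m k).
    rewrite [LHS]ipB//; congr (_ - _).
    rewrite [LHS]ip_sum//; last by move=> m; apply: L2Z; exact: L2_psi.
    apply: eq_bigr => m _; rewrite ipZ//; last exact: L2_psi.
    by rewrite -/(lam m) -/(cf b m f) mulrA [ip b (psi b m) k]ipC.
  pose u m := if (m < n)%N then lam m * (cf b m f * cf b m k) else 0.
  have -> : \sum_(m < n) lam m * (cf b m f * cf b m k) = \sum_(m < n) u m.
    by apply: eq_bigr => m _; rewrite /u ltn_ord.
  apply: eq_sums (sumsB (potential_fun_sums Lf Lk) (@sums_fin _ n u _)).
    by move=> m; rewrite /u; case: ifP => _; rewrite ?subrr ?subr0.
  by move=> m nm; rewrite /u ltnNge nm.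
suff : ip b k k <= 2^-1 * (lam n ^+ 2 * ip b f f + ip b k k) by lra.
apply: (sums_le _ kk) => N; rewrite /series/= big_mkord.
apply: (@le_trans _ _ (\sum_(m < N) 2^-1 * (lam n ^+ 2 * cf b m f ^+ 2 + cf b m k ^+ 2))).
  apply: ler_sum => m _; case: ltnP => nm.
    apply: mulr_ge0; first by rewrite invr_ge0 ler0n.
    exact: addr_ge0 (mulr_ge0 (sqr_ge0 _) (sqr_ge0 _)) (sqr_ge0 _).
  have ln : 0 <= lam m <= lam n by rewrite (ltW (lam_gt0 _)) lam_le.
  apply: (@le_trans _ _ (lam n * `|cf b m f| * `|cf b m k|)).
    apply: (le_trans (ler_norm _)); rewrite !normrM mulrA.
    by rewrite !ler_wpM2r// ger0_norm; case/andP: ln.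
  rewrite -[cf b m f ^+ 2]real_normK ?num_real// -[cf b m k ^+ 2]real_normK ?num_real//.
  have := sqr_ge0 (lam n * `|cf b m f| - `|cf b m k|).
  by move: (lam n) `|cf b m f| `|cf b m k| => x y z H; nra.
rewrite -mulr_sumr ler_wpM2l// big_split/= -mulr_sumr.
apply: lerD; last exact: bessel.
by rewrite ler_wpM2l ?sqr_ge0// bessel.
Qed.

Lemma lam_cvg0 : lam n @[n --> \oo] --> (0 : R).
Proof.
apply/cvgrPdist_lt => e e0.
have e1 : 0 < e `^ (- sigma^-1) by rewrite powR_gt0.
exists (Num.truncn (e `^ (- sigma^-1))).+1 => // n /= tn.
rewrite sub0r normrN gtr0_norm//.
have en : e `^ (- sigma^-1) < eigen b n.
  apply: (lt_le_trans (Num.Theory.truncnS_gt _)).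
  apply: (@le_trans _ _ n%:R); first by rewrite ler_nat.
  rewrite /eigen; have := ler0n R n; move: c0; move: (n%:R : R) => x; lra.
have -> : e = (e `^ (- sigma^-1)) `^ (- sigma).
  by rewrite -powRrM mulrNN mulVf ?gt_eqF// powRr1// ltW.
rewrite /lam !powRN ltf_pV2 ?posrE ?powR_gt0 ?(eigen_gt0 c0)//.
rewrite -powRN; apply: gt0_ltr_powR; rewrite ?nnegrE ?powR_ge0//.
  exact: ltW (eigen_gt0 c0 n).
by rewrite invr_gt0 powR_gt0.
Qed.

Let Lnorm2 k : L2 b k -> ('N[mu_lag b]_2%:E[EFin \o k] = (Num.sqrt (ip b k k))%:E)%E.
Proof.
move=> Lk; rewrite unlock /Lnorm.
have -> : (\int[mu_lag b]_x (`|(EFin \o k) x| `^ 2) = (ip b k k)%:E)%E.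
  rewrite ipE//; apply: eq_integral => r _.
  by rewrite [(EFin \o k) r]/= abse_EFin poweR_EFin powR_mulrn// real_normK ?num_real// expr2.
by rewrite poweR_EFin powR12_sqrt// ip_ge0.
Qed.

(** The partial sums converge to [potential_fun f] in L^2 by [spectral_remainder],
    and the limit in L^2 is unique almost everywhere. *)
Theorem spectral_op_potential f : f \in Lfun (mu_lag b) 2%:E ->
  {ae mu_lag b, forall r, (spectral_op b sigma f r)%:E = potential_op b sigma f r}.
Proof.
move=> /L2_Lfun Lf; have LP := L2_potential_fun Lf.
pose N2 (k : R -> R) := ('N[mu_lag b]_2%:E[EFin \o k])%E.
pose E := [set g | g \in Lfun (mu_lag b) 2%:E /\
    N2 (fun r => g r - spectral_sum b sigma f n r) @[n --> \oo] --> 0%E].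
have EP : E (potential_fun f).
  split; first exact/L2_Lfun.
  have LB n : L2 b (fun r => potential_fun f r - spectral_sum b sigma f n r).
    by apply: L2B => //; exact: L2_spectral_sum.
  have -> : (fun n => N2 (fun r => potential_fun f r - spectral_sum b sigma f n r)) =
     EFin \o (fun n => Num.sqrt (ip b (fun r => potential_fun f r - spectral_sum b sigma f n r)
       (fun r => potential_fun f r - spectral_sum b sigma f n r))).
    by apply/funext => n; rewrite /N2 Lnorm2.
  apply: cvg_EFin; first exact: nearW.
  apply: (@squeeze_cvgr _ _ _ _ (fun=> 0) (fun n => lam n * Num.sqrt (ip b f f))).
  - apply: nearW => n; rewrite sqrtr_ge0/=.
    have -> : lam n * Num.sqrt (ip b f f) = Num.sqrt (lam n ^+ 2 * ip b f f).
      by rewrite sqrtrM ?sqr_ge0// sqrtr_sqr ger0_norm// ltW.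
    by rewrite ler_wsqrtr// spectral_remainder.
  - exact: cvg_cst.
  - by rewrite -(mul0r (Num.sqrt (ip b f f))); apply: cvgMl; exact: lam_cvg0.
have [/L2_Lfun LG cG] : E (spectral_op b sigma f) by apply: (xgetPex (cst 0)); exists (potential_fun f).
have [_ cP] := EP; set G := spectral_op b sigma f in LG cG *.
have LD : L2 b (fun r => G r - potential_fun f r) by exact: L2B.
have N0 : N2 (fun r => G r - potential_fun f r) = 0%E.
  apply/eqP; rewrite eq_le Lnorm_ge0 andbT.
  pose u n := N2 (fun r => G r - spectral_sum b sigma f n r).
  pose v n := N2 (fun r => potential_fun f r - spectral_sum b sigma f n r).
  have cs : (u n + v n)%E @[n --> \oo] --> (0 + 0)%E.
    by apply: cvgeD; [exact: (fin_num_adde_defl _ (erefl : (0%E : \bar R) \is a fin_num))|exact: cG|exact: cP].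
  rewrite -[leRHS]adde0 -(cvg_lim (@ereal_hausdorff R) cs).
  apply: lime_ge; first by apply/cvg_ex; eexists; exact: cs.
  apply: nearW => n.
  have LS := L2_spectral_sum f n; rewrite /u /v.
  have [mG _] := LG; have [mP _] := LP; have [mS _] := LS.
  have -> : N2 (fun r => potential_fun f r - spectral_sum b sigma f n r) =
     N2 (fun r => - (potential_fun f r - spectral_sum b sigma f n r)).
    by rewrite /N2 -oppe_Lnorm.
  have -> : N2 (fun r => G r - potential_fun f r) =
    N2 ((fun r => G r - spectral_sum b sigma f n r) \+
        (fun r => - (potential_fun f r - spectral_sum b sigma f n r))).
    by congr N2; apply/funext => r /=; ring.
  apply: eminkowski; rewrite ?lee_fin ?ler1n//; first exact: measurable_funB.
  by apply: measurableT_comp => //; exact: measurable_funB.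
have mD : measurable_fun setT (EFin \o (fun r => G r - potential_fun f r)).
  by case: LD => mD _; apply/measurable_EFinP.
have := Lnorm_eq0_eq0 mD _ N0; rewrite lte_fin ltr0n => /(_ isT) aeD.
apply: filterS2 aeD (potential_opE Lf) => r Gr ->; congr EFin.
by move: (Gr I) => [] /eqP; rewrite subr_eq0 => /eqP.
Qed.

End spectral.

(** * Minkowski's inequality in l^s *)

Section lnorm.
Context {R : realType}.
Implicit Types (x y : nat -> \bar R) (s : \bar R).

Lemma powR_div (x y s : R) : 0 <= x -> 0 < y -> (x / y) `^ s = x `^ s / y `^ s.
Proof.
move=> x0 y0; rewrite powRM ?invr_ge0 ?(ltW y0)//; congr (_ * _).
by rewrite -(powR_inv1 (ltW y0)) -powRrM mulN1r powRN.
Qed.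

(** Young's inequality in the form used for the triangle inequality in l^s. *)
Lemma young_powR (w x s : R) : 0 <= w -> 0 <= x -> 1 <= s ->
  w `^ (s - 1) * x <= (1 - s^-1) * w `^ s + s^-1 * x `^ s.
Proof.
move=> w0 x0; rewrite le_eqVlt => /predU1P[<-|s1].
  by rewrite subrr powRr0 invr1 subrr mul0r add0r !mul1r powRr1.
have s0 : 0 < s by apply: lt_trans s1.
have s10 : 0 < s - 1 by rewrite subr_gt0.
have := @conjugate_powR _ (w `^ (s - 1)) x (s / (s - 1)) s (powR_ge0 _ _) x0.
rewrite divr_gt0// => /(_ isT s0) H.
have /H : (s / (s - 1))^-1 + s^-1 = 1.
  by field; rewrite !gt_eqF.
rewrite -powRrM (_ : (s - 1) * (s / (s - 1)) = s); last by field; rewrite gt_eqF.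
rewrite [X in _ <= X + _]mulrC [X in _ <= _ + X]mulrC.
by rewrite (_ : (s / (s - 1))^-1 = 1 - s^-1)//; field; rewrite !gt_eqF.
Qed.

Lemma lnorm_ge0 s x : (0 <= lnorm s x)%E.
Proof.
case: s => [s| |]; first exact: poweR_ge0.
- by apply: le_trans (ereal_sup_ubound _); last by exists 0%N.
- by apply: le_trans (ereal_sup_ubound _); last by exists 0%N.
Qed.

Lemma lnorm_ge s x j : (1 <= s)%E -> (`|x j| <= lnorm s x)%E.
Proof.
case: s => [s| |] //; last by move=> _; apply: ereal_sup_ubound; exists j.
rewrite lee_fin => s1; have s0 : 0 < s by apply: lt_le_trans s1.
rewrite /lnorm -[leLHS](@poweRe1 R)// -(@divff _ s) ?gt_eqF// poweRrM.
apply: gt0_ler_poweR; rewrite ?invr_ge0 ?(ltW s0)// ?in_itv/= ?leey ?andbT ?poweR_ge0//.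
- by apply: nneseries_ge0 => *; exact: poweR_ge0.
- rewrite (nneseries_split 0 j.+1) ?add0n//; last by move=> *; exact: poweR_ge0.
  rewrite big_nat_recr//= -addeA addeCA; apply: leeDl; apply: adde_ge0.
    by apply: sume_ge0 => *; exact: poweR_ge0.
  by apply: nneseries_ge0 => *; exact: poweR_ge0.
Qed.

Lemma lnorm1 s x : (forall j, x j.+1 = 0%E) -> (1 <= s)%E -> lnorm s x = `|x 0%N|%E.
Proof.
move=> x0; case: s => [s| |] //.
  rewrite lee_fin => s1; have s0 : 0 < s by apply: lt_le_trans s1.
  rewrite /lnorm nneseries_recl; [|by move=> *; exact: poweR_ge0|by []].
  rewrite eseries0; last by move=> [|k]// _ _; rewrite x0 abse0 poweR0r// gt_eqF.
  by rewrite adde0 -poweRrM divff ?gt_eqF// poweRe1.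
move=> _; apply/eqP; rewrite eq_le; apply/andP; split.
  by apply: ge_ereal_sup => _ [[|j] _ <-]; rewrite ?x0 ?abse0.
by apply: ereal_sup_ubound; exists 0%N.
Qed.

Lemma measurable_lnorm s (x : nat -> R -> \bar R) : (forall j, measurable_fun setT (x j)) ->
  measurable_fun setT (fun r => lnorm s (x ^~ r)).
Proof.
move=> mx; have mabs j : measurable_fun setT (fun r => `|x j r|%E) by exact: measurableT_comp.
have msup : measurable_fun setT (fun r => ereal_sup (range (fun j => `|x j r|%E))).
  have -> : (fun r => ereal_sup (range (fun j => `|x j r|%E))) =
      (fun r => esups ((fun j r => `|x j r|%E) ^~ r) 0%N).
    by apply/funext => r; congr ereal_sup; apply/seteqP; split=> z [j jj <-]; exists j.
  exact: measurable_fun_esups.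
case: s => [s| |] //; apply: (measurableT_comp (measurable_poweR _)).
apply: ge0_emeasurable_sum; first by move=> *; exact: poweR_ge0.
by move=> k _; exact: (measurableT_comp (measurable_poweR _)).
Qed.

(** Minkowski's integral inequality in l^s: with w_j = x_j / |x|_s, one has
    |x|_s = sum_j w_j^(s-1) x_j <= int K sum_j w_j^(s-1) |h_j|, and the inner
    sum is at most the l^s norm of h, by Young's inequality. *)
Lemma lnorm_integral d (T : measurableType d) (mu : {measure set T -> \bar R})
    (K : T -> \bar R) (h : nat -> T -> R) s x : (1 <= s)%E ->
  (forall t, 0 <= K t)%E -> measurable_fun setT K -> (forall j, measurable_fun setT (h j)) ->
  measurable_fun setT (fun t => lnorm s (fun j => (h j t)%:E)) ->
  (forall j, `|x j| <= \int[mu]_t (K t * `|(h j t)%:E|))%E ->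
  (lnorm s x <= \int[mu]_t (K t * lnorm s (fun j => (h j t)%:E)))%E.
Proof.
move=> s1 K0 mK mh mH xh; set H := (fun t => lnorm s (fun j => (h j t)%:E)); set M := (\int[mu]_t _)%E.
have mKh j : measurable_fun setT (fun t => K t * `|(h j t)%:E|)%E.
  apply: emeasurable_funM => //; apply: measurableT_comp => //.
  by apply/measurable_EFinP.
have H0 t : (0 <= H t)%E by exact: lnorm_ge0.
have M0 : (0 <= M)%E by apply: integral_ge0 => t _; exact: mule_ge0 (K0 t) (H0 t).
have xM j : (`|x j| <= M)%E.
  apply: (le_trans (xh j)); apply: ge0_le_integral => //.
  - by move=> t _; exact: mule_ge0.
  - exact: emeasurable_funM.
  - by move=> t _; rewrite lee_wpmul2l//; exact: (lnorm_ge (fun j => (h j t)%:E)).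
case: s s1 @H @M mH H0 M0 xM => [s| |] // s1 H M mH H0 M0 xM; last first.
  by apply: ge_ereal_sup => _ [j _ <-].
move: s1; rewrite lee_fin => s1; have s0 : 0 < s by apply: lt_le_trans s1.
have [My|Mfin] := eqVneq M +oo%E; first by rewrite My leey.
have Mf : M \is a fin_num by rewrite ge0_fin_numE// lt_neqAle Mfin leey.
have xfin j : `|x j|%E \is a fin_num by rewrite ge0_fin_numE// (le_lt_trans (xM j))// -ge0_fin_numE.
pose y j := fine `|x j|%E; have yE j : `|x j|%E = (y j)%:E by rewrite fineK.
have y0 j : 0 <= y j by rewrite fine_ge0.
suff PM n : (\sum_(0 <= j < n) `|x j| `^ s <= M `^ s)%E.
  rewrite /lnorm -[leRHS](@poweRe1 R)// -(@divff _ s) ?gt_eqF// poweRrM.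
  apply: gt0_ler_poweR; rewrite ?invr_ge0 ?(ltW s0)// ?in_itv/= ?leey ?andbT ?poweR_ge0//.
    by apply: nneseries_ge0 => *; exact: poweR_ge0.
  apply: lime_le; first by apply: is_cvg_nneseries => *; exact: poweR_ge0.
  exact: nearW.
pose S := \sum_(j < n) y j `^ s.
have -> : (\sum_(0 <= j < n) `|x j| `^ s = S%:E)%E.
  by rewrite big_mkord -sumEFin; apply: eq_bigr => j _; rewrite yE poweR_EFin.
have S0 : 0 <= S by apply: sumr_ge0 => j _; exact: powR_ge0.
have [->|Sn] := eqVneq S 0; first exact: poweR_ge0.
have Sp : 0 < S by rewrite lt_neqAle eq_sym Sn.
pose N := S `^ s^-1; have N0 : 0 < N by rewrite powR_gt0.
have NS : N `^ s = S by rewrite -powRrM mulVf ?gt_eqF// powRr1.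
rewrite -(fineK Mf) poweR_EFin lee_fin -NS.
apply: ge0_ler_powR; rewrite ?nnegrE ?fine_ge0 ?(ltW N0) ?(ltW s0)//.
rewrite -lee_fin (fineK Mf).
pose w j := y j / N; have w0 j : 0 <= w j by rewrite divr_ge0// ltW.
have w1 : \sum_(j < n) w j `^ s = 1.
  have -> : \sum_(j < n) w j `^ s = \sum_(j < n) y j `^ s * (N `^ s)^-1.
    by apply: eq_bigr => j _; rewrite powR_div.
  by rewrite -mulr_suml NS divff.
have NE : N = \sum_(j < n) w j `^ (s - 1) * y j.
  rewrite [LHS](_ : _ = N * \sum_(j < n) w j `^ s); last by rewrite w1 mulr1.
  rewrite mulr_sumr; apply: eq_bigr => j _.
  have [yz|yz] := eqVneq (y j) 0.
    by rewrite /w yz mul0r mulr0 powR0 ?mulr0// gt_eqF.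
  have wp : 0 < w j by rewrite divr_gt0// lt_neqAle eq_sym yz y0.
  have -> : w j `^ s = w j `^ (s - 1) * w j.
    by rewrite -[X in _ = _ * X]powRr1// -powRD ?subrK// (gt_eqF wp) implybT.
  by rewrite mulrCA; congr (_ * _); rewrite /w mulrCA divff ?mulr1// gt_eqF.
have -> : (N%:E = \sum_(j < n) (w j `^ (s - 1))%:E * (y j)%:E)%E.
  by rewrite {1}NE -sumEFin.
apply: (@le_trans _ _ (\sum_(j < n) (w j `^ (s - 1))%:E * \int[mu]_t (K t * `|(h j t)%:E|))%E).
  by apply: lee_sum => j _; rewrite lee_wpmul2l ?lee_fin ?powR_ge0// -yE.
have Kh0 j t : (0 <= K t * `|(h j t)%:E|)%E by exact: mule_ge0.
have -> : (\sum_(j < n) (w j `^ (s - 1))%:E * \int[mu]_t (K t * `|(h j t)%:E|) =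
   \int[mu]_t \sum_(j < n) ((w j `^ (s - 1))%:E * (K t * `|(h j t)%:E|)))%E.
  rewrite ge0_integral_sum//.
  - apply: eq_bigr => j _; rewrite ge0_integralZl// lee_fin powR_ge0//.
  - by move=> j; exact: measurable_funeM.
  - by move=> j t _; rewrite mule_ge0// lee_fin powR_ge0.
apply: ge0_le_integral => //.
- by move=> t _; apply: sume_ge0 => j _; rewrite mule_ge0// lee_fin powR_ge0.
- by apply: emeasurable_sum => j; exact: measurable_funeM.
- exact: emeasurable_funM.
move=> t _; have -> : (\sum_(j < n) ((w j `^ (s - 1))%:E * (K t * `|(h j t)%:E|)) =
    K t * (\sum_(j < n) w j `^ (s - 1) * `|h j t|)%:E)%E.
  rewrite -sumEFin ge0_sume_distrr; last by move=> j _; rewrite lee_fin mulr_ge0// powR_ge0.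
  by apply: eq_bigr => j _; rewrite muleCA EFinM.
apply: lee_wpmul2l => //.
have hH j : (`|h j t|%:E <= H t)%E.
  by apply: (@lnorm_ge s%:E (fun j => (h j t)%:E) j); rewrite lee_fin.
have Hs : (\sum_(j < n) (`|h j t| `^ s)%:E <= H t `^ s)%E.
  rewrite /H /lnorm -poweRrM mulVf ?gt_eqF// poweRe1; last first.
    by apply: nneseries_ge0 => *; exact: poweR_ge0.
  rewrite (nneseries_split 0 n) ?add0n; last by move=> *; exact: poweR_ge0.
  rewrite big_mkord; apply: (@le_trans _ _ (\sum_(j < n) `|(h j t)%:E| `^ s)%E); first exact: lee_sum.
  apply: leeDl.
  by apply: nneseries_ge0 => *; exact: poweR_ge0.
rewrite -/(H t); case: (H t) (H0 t) hH Hs => [e||]; [|by move=> *; rewrite leey|by []].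
rewrite lee_fin => e0 hH; rewrite poweR_EFin sumEFin lee_fin => Hs; rewrite lee_fin.
have [ez|en] := eqVneq e 0.
  rewrite big1 ?ez// => j _; have := hH j; rewrite lee_fin ez => h0.
  by rewrite (_ : `|h j t| = 0) ?mulr0//; apply/eqP; rewrite eq_le h0 normr_ge0.
have ep : 0 < e by rewrite lt_neqAle eq_sym en.
have he j : `|h j t| = (`|h j t| / e) * e by rewrite divfK.
have -> : \sum_(j < n) w j `^ (s - 1) * `|h j t| = (\sum_(j < n) w j `^ (s - 1) * (`|h j t| / e)) * e.
  by rewrite mulr_suml; apply: eq_bigr => j _; rewrite -mulrA divfK.
rewrite -[leRHS]mul1r; apply: ler_wpM2r => //.
apply: (@le_trans _ _ (\sum_(j < n) ((1 - s^-1) * w j `^ s + s^-1 * (`|h j t| / e) `^ s))).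
  by apply: ler_sum => j _; apply: young_powR => //; rewrite divr_ge0.
rewrite big_split/= -!mulr_sumr w1 mulr1.
have : \sum_(j < n) (`|h j t| / e) `^ s <= 1.
  have -> : \sum_(j < n) (`|h j t| / e) `^ s = \sum_(j < n) `|h j t| `^ s * (e `^ s)^-1.
    by apply: eq_bigr => j _; rewrite powR_div.
  by rewrite -mulr_suml ler_pdivrMr ?powR_gt0// mul1r.
move=> /(ler_wpM2l (_ : 0 <= s^-1)); rewrite invr_ge0 mulr1 => /(_ (ltW s0)).
by move: (s^-1) => z; lra.
Qed.

End lnorm.

Section Lnorm_monotone.
Context {R : realType}.
Implicit Types (b : R) (q : \bar R) (X Y : R -> \bar R).

(** The integral of a positive function is a supremum over the simple functions
    below it. *)
Lemma integral_mono_sup d (T : measurableType d) (mu : {measure set T -> \bar R})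
    (X Y : T -> \bar R) : (forall t, 0 <= X t)%E -> (forall t, X t <= Y t)%E ->
  (\int[mu]_t X t <= \int[mu]_t Y t)%E.
Proof.
move=> X0 XY; have Y0 t : (0 <= Y t)%E := le_trans (X0 t) (XY t).
rewrite !ge0_integralTE//; apply: le_ereal_sup => _ [h hX <-].
by exists h => // t; exact: le_trans (hX t) (XY t).
Qed.

(** Raising Y to +oo on the exceptional null set leaves its integrals unchanged and
    makes the comparison hold everywhere. *)
Lemma Lnorm_le_ae b q X Y : (1 <= q)%E -> (forall r, 0 <= X r)%E -> (forall r, 0 <= Y r)%E ->
  measurable_fun setT Y -> {ae mu_lag b, forall r, X r <= Y r}%E ->
  ('N[mu_lag b]_q[X] <= 'N[mu_lag b]_q[Y])%E.
Proof.
move=> q1 X0 Y0 mY XY; rewrite unlock /Lnorm; case: q q1 => [q| |] //.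
  rewrite lee_fin => q1; have q0 : 0 < q by apply: lt_le_trans q1.
  apply: gt0_ler_poweR; rewrite ?invr_ge0 ?(ltW q0)// ?in_itv/= ?leey ?andbT//.
  - by apply: integral_ge0 => r _; exact: poweR_ge0.
  - by apply: integral_ge0 => r _; exact: poweR_ge0.
  have [N [mN N0 XN]] := XY.
  pose Z r := if r \in N then +oo%E else (`|Y r| `^ q)%E.
  have mYq : measurable_fun setT (fun r => `|Y r| `^ q)%E.
    by apply: (measurableT_comp (measurable_poweR _)); exact: measurableT_comp.
  have mZ : measurable_fun setT Z.
    apply: measurable_fun_if => //.
    - apply: (measurable_fun_bool true); rewrite setTI (_ : _ @^-1` _ = N)//.
      by apply/seteqP; split=> r /=; [move/set_mem|move/mem_set].
    - exact: measurable_funTS.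
  have -> : (\int[mu_lag b]_r (`|Y r| `^ q) = \int[mu_lag b]_r Z r)%E.
    apply: ge0_ae_eq_integral => //.
    - by move=> r _; exact: poweR_ge0.
    - by move=> r _; rewrite /Z; case: ifP => _; [exact: leey|exact: poweR_ge0].
    exists N; split => // r /= H; apply: contrapT => Nr; apply: H => _.
    by rewrite /Z memNset.
  apply: integral_mono_sup; first by move=> r; exact: poweR_ge0.
  move=> r; rewrite /Z; case: ifPn => [_|rN]; first exact: leey.
  have XYr : (X r <= Y r)%E by apply: contrapT => H; move/negP: rN; apply; rewrite inE; exact: XN.
  apply: gt0_ler_poweR; rewrite ?in_itv/= ?leey ?andbT ?abse_ge0// ?(ltW q0)//.
  by rewrite !gee0_abs.
move=> _; rewrite mu_lag_setT_gt0; apply: le_ess_sup.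
by apply: filterS XY => r; rewrite /= !gee0_abs.
Qed.

Lemma LnormeZ b q (k : R) Y : (1 <= q)%E -> 0 < k -> (forall r, 0 <= Y r)%E -> measurable_fun setT Y ->
  ('N[mu_lag b]_q[(fun r => k%:E * Y r)%E] = k%:E * 'N[mu_lag b]_q[Y])%E.
Proof.
move=> q1 k0 Y0 mY; rewrite unlock /Lnorm; case: q q1 => [q| |] //.
  rewrite lee_fin => q1; have q0 : 0 < q by apply: lt_le_trans q1.
  have mYq : measurable_fun setT (fun r => `|Y r| `^ q)%E.
    by apply: (measurableT_comp (measurable_poweR _)); exact: measurableT_comp.
  have -> : (\int[mu_lag b]_r (`|k%:E * Y r| `^ q) = (k `^ q)%:E * \int[mu_lag b]_r (`|Y r| `^ q))%E.
    rewrite -ge0_integralZl//; last 2 first.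
    - by move=> r _; exact: poweR_ge0.
    - by rewrite lee_fin powR_ge0.
    apply: eq_integral => r _; rewrite abseM poweRM ?abse_ge0//.
    by rewrite abse_EFin gtr0_norm.
  rewrite poweRM ?lee_fin ?powR_ge0//; last by apply: integral_ge0 => r _; exact: poweR_ge0.
  by rewrite poweR_EFin -powRrM divff ?gt_eqF// powRr1// ltW.
move=> _; rewrite mu_lag_setT_gt0.
rewrite -ess_supZl ?mu_lag_setT_gt0 ?ltW//; apply: eq_ess_sup; apply: nearW => r.
by rewrite /= abseM abse_EFin gtr0_norm.
Qed.

End Lnorm_monotone.

(** * Domination by one scalar potential, and sufficiency *)

Section domination.
Context {R : realType}.
Variables alpha sigma : R.
Hypotheses (a12 : - (1 / 2) <= alpha) (s0 : 0 < sigma).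
Implicit Types (mu r s : R) (f : R -> R).

Let c0 : 0 < alpha + 1. Proof. by move: a12; lra. Qed.

Let shift12 mu : mu = 0 \/ 1 <= mu -> - (1 / 2) <= alpha + mu.
Proof. by move: a12 => ? [->|]; lra. Qed.

Let measurable_hker_t b r s : 0 < b + 1 ->
  measurable_fun setT (fun t : R => (hker b t r s)%:E).
Proof.
move=> b0; have mp : measurable_fun setT (fun t : R => (((r, s) : R * R), t)).
  by apply/measurable_fun_pairP; split; [exact: measurable_cst|exact: measurable_id].
exact: (measurableT_comp (measurable_hker3 b0) mp).
Qed.

(** Integrate [hker_dom] in time. *)
Lemma pker_dom mu r s : mu = 0 \/ 1 <= mu -> 0 < r -> 0 < s ->
  (((r * s) `^ mu)%:E * pker (alpha + mu) sigma r s <= 12%:E * pker alpha sigma r s)%E.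
Proof.
move=> mu01 r0 s'0; have c1 : 0 < alpha + mu + 1 by move: (shift12 mu01); lra.
have G0 : 0 <= (Gamma sigma)^-1 by rewrite invr_ge0 ltW// Gamma_gt0.
rewrite /pker muleCA [leRHS]muleCA; apply: lee_wpmul2l; first by rewrite lee_fin.
have h0 b t : 0 < b + 1 -> (0 <= (hker b t r s)%:E)%E by move=> b0; rewrite lee_fin hker_ge0.
rewrite -!ge0_integralZl//; do ?[exact: measurable_hker_t]; do ?[by move=> t _; exact: h0];
  do ?[by rewrite lee_fin powR_ge0]; do ?by rewrite lee_fin.
apply: mu_lag_le.
- by move=> t; rewrite mule_ge0 ?h0// lee_fin powR_ge0.
- by move=> t; rewrite mule_ge0 ?h0// lee_fin.
- by apply: measurable_funeM; exact: measurable_hker_t.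
- by apply: measurable_funeM; exact: measurable_hker_t.
- by move=> t t0; rewrite -!EFinM lee_fin; exact: hker_dom.
Qed.

Lemma frac_int_potential b f : - (1 / 2) <= b ->
  {ae mu_lag alpha, forall r, frac_int b sigma f r = potential_op b sigma f r}.
Proof.
move=> b12; rewrite /frac_int; case: ifPn => [Lf|_]; last exact: aeW.
exact: (mu_lag_ae _ (spectral_op_potential b12 s0 Lf)).
Qed.

(** All the operators conjugated by powers of r are dominated by the one for
    alpha, since r^mu s^mu times the kernel for alpha + mu is. *)
Lemma conjugated_potential_le mu f : mu = 0 \/ 1 <= mu -> measurable_fun setT f ->
  {ae mu_lag alpha, forall r,
    `|(r `^ mu)%:E * frac_int (alpha + mu) sigma (fun t => (t `^ mu)^-1 * f t)%R r|
    <= \int[mu_lag alpha]_s (12%:E * pker alpha sigma r s * `|(f s)%:E|)}%E.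
Proof.
move=> mu01 mf; have b12 := shift12 mu01; have c1 : 0 < alpha + mu + 1 by move: b12; lra.
have mg : measurable_fun setT (fun t => (t `^ mu)^-1 * f t).
  by apply: measurable_funM => //; apply: measurable_inv_fun; exact: measurable_powR.
set g := fun t => _ in mg *.
apply: filterS2 (frac_int_potential g b12) (ae_mu_lag_gt0 alpha) => r -> r0.
have mpg : measurable_fun setT (fun s => pker (alpha + mu) sigma r s * (g s)%:E)%E.
  by apply: measurable_potentialK => //; apply/measurable_EFinP.
rewrite abseM gee0_abs ?lee_fin ?powR_ge0//.
have -> : potential_op (alpha + mu) sigma g r =
    (\int[mu_lag (alpha + mu)]_s (pker (alpha + mu) sigma r s * (g s)%:E))%E.
  by apply: eq_integral => s _; rewrite potential_kernelE.
apply: (@le_trans _ _ ((r `^ mu)%:E * \int[mu_lag (alpha + mu)]_s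
     `|pker (alpha + mu) sigma r s * (g s)%:E|)%E).
  by rewrite lee_wpmul2l ?lee_fin ?powR_ge0//; exact: le_abse_integral.
have mab : measurable_fun setT (fun s => `|pker (alpha + mu) sigma r s * (g s)%:E|)%E.
  exact: measurableT_comp.
rewrite -mu_lag_shiftp; [|by move=> s; exact: abse_ge0|exact: mab].
have mab' : measurable_fun setT (fun s => (s `^ (2 * mu))%:E * `|pker (alpha + mu) sigma r s * (g s)%:E|)%E.
  apply: emeasurable_funM; last exact: mab.
  by apply/measurable_EFinP; exact: measurable_powR.
rewrite -ge0_integralZl; [|exact: measurableT|exact: mab'|
  by move=> s _; apply: mule_ge0; rewrite ?lee_fin ?powR_ge0|by rewrite lee_fin powR_ge0].
apply: mu_lag_le.
- by move=> s; apply: mule_ge0; [|apply: mule_ge0]; rewrite ?lee_fin ?powR_ge0// abse_ge0.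
- by move=> s; apply: mule_ge0; [apply: mule_ge0; [|exact: pker_ge0]|exact: abse_ge0].
- exact: measurable_funeM.
- have mpf : measurable_fun setT (fun s => pker alpha sigma r s * `|(f s)%:E|)%E.
    by apply: measurable_potentialK => //; apply: measurableT_comp => //; apply/measurable_EFinP.
  under eq_fun do rewrite -muleA.
  exact: measurable_funeM.
move=> s s'0; have K0 := pker_ge0 r s c1 s0.
have sm : 0 < s `^ mu by rewrite powR_gt0.
rewrite abseM (gee0_abs K0) !abse_EFin /g normrM ger0_norm ?invr_ge0 ?powR_ge0//.
have H : (((r * s) `^ mu)%:E * pker (alpha + mu) sigma r s <= 12%:E * pker alpha sigma r s)%E.
  exact: pker_dom.
have := lee_wpmul2r (_ : (0 <= `|f s|%:E)%E) H; rewrite lee_fin normr_ge0 => /(_ isT).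
apply: le_trans; rewrite powRM ?(ltW r0) ?(ltW s'0)//.
have -> : s `^ (2 * mu) = s `^ mu * s `^ mu by rewrite mulrDl mul1r powRD// (gt_eqF s'0) implybT.
case: (pker _ _ _ _) K0 => [k| |] k0.
- rewrite -[leLHS]/((r `^ mu * (s `^ mu * s `^ mu * (k * ((s `^ mu)^-1 * `|f s|))))%:E).
  rewrite -[leRHS]/((r `^ mu * s `^ mu * k * `|f s|)%:E) lee_fin.
  rewrite (_ : _ * _ = r `^ mu * s `^ mu * k * `|f s|)//.
  by field; rewrite gt_eqF.
- have rs : (0 < (r `^ mu * s `^ mu)%:E :> \bar R)%E by rewrite lte_fin mulr_gt0 ?powR_gt0.
  have [->|fs] := eqVneq (f s) 0; first by rewrite normr0 !mulr0 !mule0.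
  have fp : 0 < `|f s| by rewrite normr_gt0.
  rewrite (gt0_muley rs) (@gt0_mulye _ `|f s|%:E)//; exact: leey.
- by [].
Qed.

End domination.

Section sufficiency.
Context {R : realType}.
Implicit Types (sigma alpha a : R) (p q s : \bar R).

(** On the line 1/p - 1/q = sigma / (alpha + 1), p = 1 and q = +oo are the two
    excluded pairs. *)
Lemma admissible_fine sigma alpha p q : 0 < sigma -> sigma < alpha + 1 ->
  (1 <= p)%E -> (1 <= q)%E -> admissible sigma alpha p q ->
  [/\ - sigma < (alpha + 1) * (fine p^-1 - fine q^-1) &
    ((alpha + 1) * (fine p^-1 - fine q^-1) < sigma)%R \/
    [/\ ((alpha + 1) * (fine p^-1 - fine q^-1))%R = sigma, (fine p^-1 < 1)%R & (0 < fine q^-1)%R]].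
Proof.
move=> s0 sN p1 q1 []; have [pE /andP[x0 x1]] := fine_inve p1.
have [qE /andP[y0 y1]] := fine_inve q1; have N0 : 0 < alpha + 1 by apply: lt_trans sN.
move: pE qE x0 x1 y0 y1; set x := fine p^-1; set y := fine q^-1 => pE qE x0 x1 y0 y1.
rewrite pE qE -EFinB -EFinD !(lee_fin, lte_fin) => up low e1 e2.
have up' : (alpha + 1) * (x - y) <= sigma.
  by rewrite mulrC -ler_pdivlMr//; move: up; lra.
split; first by rewrite -ltr_pdivrMl// mulrC mulNr; move: low; lra.
have [E|E] := eqVneq ((alpha + 1) * (x - y)) sigma; last by left; rewrite lt_neqAle E.
have yE : y = x - sigma / (alpha + 1) by rewrite -E; field; rewrite gt_eqF.
right; split=> //.
- rewrite lt_neqAle x1 andbT; apply/eqP => xE; apply: e1; split.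
    by rewrite -(inveK p) pE xE inve1.
  have Ns : 0 < alpha + 1 - sigma by rewrite subr_gt0.
  have -> : q = (y%:E^-1)%E by rewrite -qE inveK.
  have yE' : y = (alpha + 1 - sigma) / (alpha + 1) by rewrite yE xE; field; rewrite gt_eqF.
  by rewrite inver yE' gt_eqF ?divr_gt0// invf_div.
- rewrite lt_neqAle y0 andbT; apply/eqP => yz; apply: e2; split.
    have -> : p = (x%:E^-1)%E by rewrite -pE inveK.
    have xE : x = sigma / (alpha + 1) by move: yE; rewrite -yz => /esym/subr0_eq.
    by rewrite inver xE gt_eqF ?divr_gt0// invf_div.
  by rewrite -(inveK q) qE -yz inve0.
Qed.

(** The pointwise domination by the potential of order alpha has a constant that
    depends neither on a nor on j, and Minkowski's inequality moves the l^s norm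
    inside the potential. *)
Theorem vector_bound_of_admissible sigma alpha p q : 0 < sigma -> sigma < alpha + 1 ->
  - (1 / 2) <= alpha -> (1 <= p)%E -> (1 <= q)%E -> admissible sigma alpha p q ->
  exists C : R, 0 < C /\ forall a s, 1 <= a -> (1 <= s)%E -> vector_bound sigma alpha a p q s C.
Proof.
move=> s0 sN a12 p1 q1 /(admissible_fine s0 sN p1 q1)[low up].
have c0 : 0 < alpha + 1 by apply: lt_trans sN.
have [C [C0 HC]] := potential_Lp_Lq a12 s0 p1 q1 low up.
exists (12 * C); split; first by rewrite mulr_gt0.
move=> a s a1 s1 f Lf; set H := (fun r => lnorm s (fun j => (f j r)%:E)).
have mf j : measurable_fun setT (f j).
  by move: (Lf j); rewrite inE => /andP[+ _]; rewrite inE.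
have mH : measurable_fun setT H.
  by apply: (@measurable_lnorm _ s (fun j r => (f j r)%:E)) => j; apply/measurable_EFinP.
have H0 r : (0 <= H r)%E by exact: lnorm_ge0.
have mpH := measurable_potential c0 s0 H0 mH.
have mp12 : measurable_fun setT (fun r => 12%:E * potential alpha sigma H r)%E by exact: measurable_funeM.
have NH : ('N[mu_lag alpha]_q[(fun r => 12%:E * potential alpha sigma H r)%E] <=
     (12 * C)%:E * 'N[mu_lag alpha]_p[H])%E.
  have H12 r : (0 <= 12%:E * H r)%E by rewrite mule_ge0// lee_fin.
  have := HC (fun r => 12%:E * H r)%E H12 (measurable_funeM _ mH).
  have -> : potential alpha sigma (fun r => 12%:E * H r)%E = (fun r => 12%:E * potential alpha sigma H r)%E.
    by apply/funext => r; rewrite potentialZ.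
  have -> : ('N[mu_lag alpha]_p[(fun r => 12%:E * H r)%E] = 12%:E * 'N[mu_lag alpha]_p[H])%E.
    exact: LnormeZ.
  by rewrite muleCA muleA -EFinM.
apply: le_trans NH; apply: Lnorm_le_ae => //.
- by move=> r; exact: lnorm_ge0.
- by move=> r; rewrite mule_ge0 ?lee_fin// potential_ge0.
have mu01 j : a * j%:R = 0 \/ 1 <= a * j%:R.
  case: j => [|j]; first by left; rewrite mulr0.
  by right; rewrite -[leLHS](mulr1 1); apply: ler_pM => //; rewrite ler1n.
have ae : {ae mu_lag alpha, forall r j,
    (`|(upow a j r)%:E * frac_int (alpha + a * j%:R) sigma (fun t => (upow a j t)^-1 * f j t)%R r|
    <= \int[mu_lag alpha]_s (12%:E * pker alpha sigma r s * `|(f j s)%:E|))%E}.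
  by apply: ae_foralln => j; exact: (conjugated_potential_le a12 s0 (mu01 j) (mf j)).
apply: filterS ae => r Hr.
rewrite /potential -ge0_integralZl; [|exact: measurableT|exact: measurable_potentialK|
  by move=> t _; exact: potentialK_ge0|by rewrite lee_fin].
under eq_integral do rewrite muleA.
apply: lnorm_integral => //.
- by move=> t; rewrite mule_ge0 ?lee_fin// pker_ge0.
- apply: measurable_funeM.
  have := @measurable_potentialK _ alpha sigma c0 (cst 1%E) r (measurable_cst _).
  by apply: eq_measurable_fun => t _; rewrite mule1.
Qed.

End sufficiency.

(** * Lower bounds for the potential *)

Section logarithm.
Context {R : realType}.
Implicit Types (b e S M a c x : R) (A : set R).

Let mI A : measurable A -> measurable_fun setT (fun r : R => (\1_A r : R)%:E).
Proof. by move=> mA; apply/measurable_EFinP; exact: measurable_indic. Qed.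

Let I0 A r : (0 <= (\1_A r : R)%:E)%E. Proof. by rewrite lee_fin indicE ler0n. Qed.

Lemma mu_lag_indic b A : measurable A -> (\int[mu_lag b]_r (\1_A r : R)%:E = mu_lag b A)%E.
Proof. by move=> mA; rewrite integral_indic// setIT. Qed.

Lemma mu_ball b S : 0 < b + 1 -> 0 < S ->
  mu_lag b `]-oo, S] = (S `^ (2 * (b + 1)) / (2 * (b + 1)))%:E.
Proof.
move=> b0 S0; have -> : b = (2 * (b + 1)) / 2 - 1 by field.
rewrite mu_pow_below// ?mulr_gt0//; last by rewrite (_ : _ / 2 - 1 = b)//; field.
Qed.

Lemma mu_pow_annulus x a c : 0 < x -> 0 < a -> a <= c ->
  mu_lag (x / 2 - 1) `]a, c] = ((c `^ x - a `^ x) / x)%:E.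
Proof.
move=> x0 a0 ac; have cp : 0 < c by apply: lt_le_trans ac.
have := mu_pow_below x0 cp.
have -> : `]-oo, c]%classic = `]-oo, a] `|` `]a, c].
  apply/seteqP; split=> r /=; rewrite !in_itv/=; last by case=> [/le_trans->//|/andP[]].
  by move=> rc; case: (leP r a) => ra; [left|right].
pose nu := x / 2 - 1; rewrite -/nu.
have -> : (mu_lag nu (`]-oo, a] `|` `]a, c]) = mu_lag nu `]-oo, a] + mu_lag nu `]a, c])%E.
  apply: measureU => //; apply/seteqP; split=> r //=; rewrite !in_itv/= => -[ra /andP[ar _]].
  by move: (lt_le_trans ar ra); rewrite ltxx.
rewrite mu_pow_below//; case: (mu_lag _ `]a, c]) => [m|//|//].
by rewrite -EFinD => -[H]; congr EFin; rewrite mulrBl -H; ring.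
Qed.

Lemma powR_gt1 a x : 1 < a -> 0 < x -> 1 < a `^ x.
Proof.
move=> a1 x0; rewrite (_ : 1 = 1 `^ x); last by rewrite powR1.
apply: gt0_ltr_powR => //; rewrite nnegrE//.
by rewrite (le_trans ler01)// ltW.
Qed.

Lemma mu_lag_le_power b e k A : measurable A ->
  (forall r, A r -> 0 < r -> r `^ (2 * e) <= k) -> 0 <= k ->
  (mu_lag (b + e) A <= k%:E * mu_lag b A)%E.
Proof.
move=> mA Ak k0; rewrite -(mu_lag_indic (b + e) mA) -(mu_lag_indic b mA).
have -> : (k%:E * \int[mu_lag b]_r (\1_A r : R)%:E = \int[mu_lag b]_r (k%:E * (\1_A r : R)%:E))%E.
  by apply/esym/ge0_integralZl; [exact: measurableT|exact: mI|move=> r _; exact: I0|rewrite lee_fin].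
rewrite -(mu_lag_shiftp b e (I0 A) (mI mA)).
apply: mu_lag_le.
- by move=> r; rewrite mule_ge0// lee_fin powR_ge0.
- by move=> r; rewrite mule_ge0// lee_fin.
- by apply: emeasurable_funM; [apply/measurable_EFinP; exact: measurable_powR|exact: mI].
- by apply: measurable_funeM; exact: mI.
- move=> r r0; rewrite indicE; case: (boolP (r \in A)) => [|_]; last by rewrite !mule0.
  by rewrite inE => Ar; rewrite !mule1 lee_fin Ak.
Qed.

(** On (0, 1], 1/r dominates r^(d-1), whose integral over (e, 1] is 1 / (2 d) when
    e^d = 1/2; let d tend to 0. *)
Lemma mu_log_small M : exists e, [/\ 0 < e, e < 1 & (M%:E <= mu_lag (-1) `]e, 1%R])%E].
Proof.
pose M' := Num.max M 1; have M'1 : 1 <= M' by rewrite le_max lexx orbT.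
have M'0 : 0 < M' by apply: lt_le_trans M'1.
pose d := (2 * M')^-1; have d0 : 0 < d by rewrite invr_gt0 mulr_gt0.
pose e : R := 2 `^ (- (2 * M')).
have e0 : 0 < e by rewrite powR_gt0.
have ed : e `^ d = 2^-1.
  by rewrite -powRrM mulNr divff ?powR_inv1// gt_eqF// mulr_gt0.
have e1 : e < 1.
  by rewrite /e powRN invf_lt1 ?powR_gt0// powR_gt1 ?ltr1n// mulr_gt0.
have mA : measurable `]e, 1%R] by [].
exists e; split=> //.
apply: (@le_trans _ _ (mu_lag (d / 2 - 1) `]e, 1%R])).
  rewrite (mu_pow_annulus d0 e0 (ltW e1)) powR1 ed lee_fin /d invrK.
  rewrite (_ : (1 - 2^-1) * (2 * M') = M'); last by field.
  by rewrite le_max lexx.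
rewrite addrC -[leRHS]mul1e; apply: mu_lag_le_power => // r /=.
rewrite in_itv/= => /andP[er r1] r0.
by rewrite (_ : 2 * (d / 2) = d) ?powR_le1//; [exact: ltW|rewrite (ltW r0)|field].
Qed.

(** On [1, +oo), 1/r dominates r^(-d-1), whose integral over [1, S) is 1 / (2 d) when
    S^d = 2; let d tend to 0. *)
Lemma mu_log_large M : exists S, 1 < S /\ (M%:E <= mu_lag (-1) `[1%R, S[)%E.
Proof.
pose M' := Num.max M 1; have M'1 : 1 <= M' by rewrite le_max lexx orbT.
have M'0 : 0 < M' by apply: lt_le_trans M'1.
pose d := (2 * M')^-1; have d0 : 0 < d by rewrite invr_gt0 mulr_gt0.
pose S : R := 2 `^ (2 * M').
have S0 : 0 < S by rewrite powR_gt0.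
have Sd : S `^ (- d) = 2^-1.
  by rewrite -powRrM mulrN divff ?powR_inv1// gt_eqF// mulr_gt0.
have S1 : 1 < S.
  by rewrite powR_gt1 ?ltr1n// mulr_gt0.
have mA : measurable `[1%R, S[ by [].
exists S; split=> //.
have Nd : - d < 0 by rewrite oppr_lt0.
apply: (@le_trans _ _ (mu_lag (- d / 2 - 1) `[1%R, S[)).
  have := mu_pow_above Nd ltr01; rewrite powR1.
  have -> : (`[1%R, +oo[%classic : set R) = `[1%R, S[ `|` `[S, +oo[.
    apply/seteqP; split=> r /=; rewrite !in_itv/= ?andbT; last by case=> [/andP[]//|]; exact/le_trans/ltW.
    by move=> rc; case: (ltP r S) => ra; [left; rewrite rc|right].
  pose nu := - d / 2 - 1; rewrite -/nu.
  have -> : (mu_lag nu (`[1%R, S[ `|` `[S, +oo[) = mu_lag nu `[1%R, S[ + mu_lag nu `[S, +oo[)%E.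
    apply: measureU => //; apply/seteqP; split=> r //=; rewrite !in_itv/= => -[/andP[_ re]].
    by rewrite andbT => /le_lt_trans/(_ re); rewrite ltxx.
  rewrite mu_pow_above// Sd.
  case: (mu_lag _ `[1, S[) => [m|//|//].
  rewrite -EFinD => -[H]; rewrite lee_fin.
  have : m = M' by move: H; rewrite /d !opprK !invrK => H; lra.
  by move=> ->; rewrite le_max lexx.
rewrite addrC -[leRHS]mul1e; apply: mu_lag_le_power => // r /=.
rewrite in_itv/= => /andP[r1 _] r0.
rewrite (_ : 2 * (- d / 2) = - d); last by field.
have := @ler_powRN _ 1 r d (ltW d0) ltr01 r1; by rewrite powR1.
Qed.

Lemma mu_log_fin e : 0 < e -> e < 1 -> (mu_lag (-1) `]e, 1%R] < +oo)%E.
Proof.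
move=> e0 e1; have mA : measurable `]e, 1%R] by [].
have H : (mu_lag (0 + -1) `]e, 1%R] <= (e `^ (- 2))%:E * mu_lag 0 `]e, 1%R])%E.
  apply: mu_lag_le_power => //; last exact: powR_ge0.
  move=> r /=; rewrite in_itv/= => /andP[er _] r0.
  by rewrite mulrN1; apply: ler_powRN => //; exact: ltW.
rewrite add0r in H; apply: (le_lt_trans H).
apply: (@le_lt_trans _ _ ((e `^ (- 2))%:E * mu_lag 0 `]-oo, 1%R])%E).
  apply: lee_wpmul2l; first by rewrite lee_fin powR_ge0.
  by apply: le_measure; rewrite ?inE//= => r /=; rewrite !in_itv/= => /andP[].
by rewrite mu_ball ?add0r// -EFinM ltry.
Qed.

End logarithm.

Section lower_bounds.
Context {R : realType}.
Variables b sigma : R.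
Hypotheses (b12 : - (1 / 2) <= b) (s0 : 0 < sigma).
Implicit Types (r s t : R) (g : R -> R).

Let c0 : 0 < b + 1. Proof. by move: b12; lra. Qed.

Let measurable_hker_ts r :
  measurable_fun setT (fun z : R * R => (hker b z.2 r z.1)%:E).
Proof.
have mp : measurable_fun setT (fun z : R * R => (((r, z.1) : R * R), z.2)).
  apply/measurable_fun_pairP; split; last exact: measurable_snd.
  by apply/measurable_fun_pairP; split; [exact: measurable_cst|exact: measurable_fst].
exact: (measurableT_comp (measurable_hker3 c0) mp).
Qed.

Let T1 T : 0 < T -> mu_lag (sigma / 2 - 1) `]-oo, T] = (T `^ sigma / sigma)%:E.
Proof. exact: mu_pow_below. Qed.

(** Already the times t in [rho^2, 2 rho^2] give the singularity of the kernel. *)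
Lemma pker_ge_local : exists k : R, 0 < k /\ forall rho r s, 0 < rho -> rho <= 1 ->
  0 < r -> r <= rho -> 0 < s -> s <= rho ->
  ((k * rho `^ (2 * sigma - 2 * (b + 1)))%:E <= pker b sigma r s)%E.
Proof.
have G0 := Gamma_gt0 s0; have GN := Gamma_gt0 c0.
(* In this range of times 2 tau t <= 8 e^4 rho^2, and the two Gaussian exponents are
   at most 1 and 4. *)
pose k1 : R := 2 / Gamma (b + 1) * (8 * expR 4) `^ (- (b + 1)) * expR (- 1) * expR (- 4).
have k10 : 0 < k1.
  by apply: mulr_gt0; [apply: mulr_gt0; [apply: mulr_gt0; [apply: divr_gt0|rewrite powR_gt0// mulr_gt0 ?expR_gt0]|]|]; rewrite ?expR_gt0.
pose k2 : R := (2 `^ sigma - 1) / sigma.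
have k20 : 0 < k2.
  by apply: divr_gt0 => //; rewrite subr_gt0 powR_gt1 ?ltr1n.
exists ((Gamma sigma)^-1 * (k1 * k2)); split; first by rewrite mulr_gt0 ?invr_gt0// mulr_gt0.
move=> rho r s rho0 rho1 r0 rr s'0 sr.
have rho2 : rho ^+ 2 <= 1 by rewrite expr_le1// ltW.
have rho20 : 0 < rho ^+ 2 by rewrite exprn_gt0.
have r2 : r ^+ 2 <= rho ^+ 2 by rewrite ler_pXn2r// nnegrE ltW.
have s2 : s ^+ 2 <= rho ^+ 2 by rewrite ler_pXn2r// nnegrE ltW.
have low t : rho ^+ 2 < t -> t <= 2 * rho ^+ 2 -> k1 * rho `^ (- (2 * (b + 1))) <= hker b t r s.
  move=> rt tr; have t0 : 0 < t by apply: lt_trans rt.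
  have t2 : t <= 2 by apply: (le_trans tr); rewrite -[leRHS]mulr1 ler_wpM2l.
  have tt := tau_ge t0; have tt' := tau_le t0 t2; have tau0 : 0 < tau t by apply: lt_le_trans tt.
  have kt := kap_le t0.
  have W0 : 0 <= 2 / Gamma (b + 1) by rewrite divr_ge0// ltW.
  have t2tau : t * 2 <= tau t * 2 by rewrite ler_wpM2r.
  rewrite /hker (_ : k1 * _ = 2 / Gamma (b + 1) * ((8 * expR 4) `^ (- (b + 1)) *
    rho `^ (- (2 * (b + 1)))) * expR (- 1) * expR (- 4)); last by rewrite /k1; ring.
  apply: ler_pM; rewrite ?expR_ge0//.
  - by rewrite !mulr_ge0 ?powR_ge0 ?expR_ge0// invr_ge0 ltW.
  - apply: le_trans (Wker_ge r s c0 tau0); apply: ler_pM; rewrite ?expR_ge0//.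
    + by rewrite !mulr_ge0 ?powR_ge0 ?expR_ge0// invr_ge0 ltW.
    + apply: ler_wpM2l => //.
      have -> : rho `^ (- (2 * (b + 1))) = (rho ^+ 2) `^ (- (b + 1)).
        by rewrite -powR_mulrn ?(ltW rho0)// -powRrM mulrN.
      have e40 : 0 < expR 4 :> R by exact: expR_gt0.
      rewrite -powRM; [|by rewrite mulr_ge0 ?expR_ge0|exact: sqr_ge0].
      apply: ler_powRN; [exact: ltW|by rewrite mulr_gt0|].
      by move: tt' tr e40; move: (expR 4) (tau t) (rho ^+ 2) => e w q; nra.
    + have tt2 : 0 < 2 * tau t by rewrite mulr_gt0.
      rewrite ler_expR lerN2 (ler_pdivrMr _ _ tt2) mul1r.
      by move: r2 s2 rt tt; move: (r ^+ 2) (s ^+ 2) (rho ^+ 2) (tau t) => ? ? ? ?; lra.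
  - rewrite ler_expR lerN2.
    have x0 : 0 <= r ^+ 2 + s ^+ 2 by rewrite addr_ge0 ?sqr_ge0.
    apply: (@le_trans _ _ (2 * (r ^+ 2 + s ^+ 2))).
      by rewrite ler_wpM2r// (le_trans kt).
    by move: r2 s2 rho2; move: (r ^+ 2) (s ^+ 2) (rho ^+ 2) => ? ? ?; lra.
have mA : measurable `]rho ^+ 2, 2 * rho ^+ 2] by [].
have -> : (Gamma sigma)^-1 * (k1 * k2) * rho `^ (2 * sigma - 2 * (b + 1)) =
   (Gamma sigma)^-1 * (k1 * rho `^ (- (2 * (b + 1))) * (k2 * rho `^ (2 * sigma))).
  rewrite powRD ?(gt_eqF rho0) ?implybT//; ring.
rewrite EFinM /pker; apply: lee_wpmul2l; first by rewrite lee_fin invr_ge0 ltW.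
have <- : (\int[mu_lag (sigma / 2 - 1)]_t ((k1 * rho `^ (- (2 * (b + 1))))%:E *
     (\1_`]rho ^+ 2, 2 * rho ^+ 2] t : R)%:E))%E = (k1 * rho `^ (- (2 * (b + 1))) * (k2 * rho `^ (2 * sigma)))%:E.
  rewrite ge0_integralZl; [|exact: measurableT|by apply/measurable_EFinP; exact: measurable_indic
    |by move=> t _; rewrite lee_fin indicE ler0n
    |by rewrite lee_fin; apply: mulr_ge0; [exact: ltW|exact: powR_ge0]].
  rewrite mu_lag_indic// mu_pow_annulus//; last by rewrite -[leLHS]mul1r ler_wpM2r ?(ltW rho20)// ler1n.
  rewrite [RHS]EFinM; congr (_ * _%:E)%E.
  have -> : rho `^ (2 * sigma) = (rho ^+ 2) `^ sigma by rewrite -powR_mulrn ?(ltW rho0)// -powRrM.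
  by rewrite powRM ?sqr_ge0// /k2; field; rewrite gt_eqF.
apply: mu_lag_le.
- move=> t; apply: mule_ge0; last by rewrite lee_fin indicE ler0n.
  by rewrite lee_fin; apply: mulr_ge0; [exact: ltW|exact: powR_ge0].
- by move=> t; rewrite lee_fin hker_ge0.
- by apply: measurable_funeM; apply/measurable_EFinP; exact: measurable_indic.
- exact: (measurable_slice1 (f := fun s t : R => (hker b t r s)%:E) (measurable_hker_ts r) s).
- move=> t t0; rewrite indicE; case: (boolP (_ \in _)) => [|_]; last by rewrite mule0 lee_fin hker_ge0.
  by rewrite inE/= in_itv/= mule1 => /andP[t1 t2]; rewrite lee_fin low.
Qed.

(** The potential as a superposition of heat semigroups. *)
Lemma potentialE F r : (forall s, 0 <= F s)%E -> measurable_fun setT F ->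
  (potential b sigma F r = ((Gamma sigma)^-1)%:E *
    \int[mu_lag (sigma / 2 - 1)]_t \int[mu_lag b]_s ((hker b t r s)%:E * F s))%E.
Proof.
move=> F0 mF; have G0 := Gamma_gt0 s0.
have h0 t s : (0 <= (hker b t r s)%:E)%E by rewrite lee_fin hker_ge0.
have mh := measurable_hker_ts r.
have mhF : measurable_fun setT (fun z : R * R => (hker b z.2 r z.1)%:E * F z.1)%E.
  by apply: emeasurable_funM => //; exact: (measurableT_comp mF measurable_fst).
have mhs s : measurable_fun setT (fun t : R => (hker b t r s)%:E).
  exact: (measurable_slice1 (f := fun s t : R => (hker b t r s)%:E) mh s).
have mhFs s : measurable_fun setT (fun t : R => (hker b t r s)%:E * F s)%E.
  exact: (measurable_slice1 (f := fun s t : R => ((hker b t r s)%:E * F s)%E) mhF s).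
have hF0 s t : (0 <= (hker b t r s)%:E * F s)%E by exact: mule_ge0.
rewrite -(@tonelli _ _ _ _ _ (mu_lag b) (mu_lag (sigma / 2 - 1))
  (fun s t => (hker b t r s)%:E * F s)%E mhF hF0).
rewrite -ge0_integralZl//.
- apply: eq_integral => s _; rewrite /pker -muleA; congr (_ * _)%E.
  rewrite [RHS](_ : _ = \int[mu_lag (sigma / 2 - 1)]_t (F s * (hker b t r s)%:E))%E.
    by rewrite ge0_integralZl// muleC.
  by apply: eq_integral => t _; rewrite muleC.
- exact: (@measurable_tonelli1 _ _ _ _ _ (mu_lag (sigma / 2 - 1))
    (fun s t => (hker b t r s)%:E * F s)%E mhF hF0).
- by move=> s _; exact: integral_ge0.
- by rewrite lee_fin invr_ge0 ltW.
Qed.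

Let measurable_heat_t F r : (forall s, 0 <= F s)%E -> measurable_fun setT F ->
  measurable_fun setT (fun t : R => \int[mu_lag b]_s ((hker b t r s)%:E * F s))%E.
Proof.
move=> F0 mF; have mh := measurable_hker_ts r.
have mhF : measurable_fun setT (fun z : R * R => (hker b z.2 r z.1)%:E * F z.1)%E.
  by apply: emeasurable_funM => //; exact: (measurableT_comp mF measurable_fst).
have hF0 s t : (0 <= (hker b t r s)%:E * F s)%E by rewrite mule_ge0// lee_fin hker_ge0.
exact: (@measurable_tonelli2 _ _ _ _ _ (mu_lag b) (fun s t => (hker b t r s)%:E * F s)%E mhF hF0).
Qed.

(** Markov's inequality for the probability density W: since its second moment
    is r^2 + 2 u (b + 1), half of its mass lies where s^2 is at most twice that. *)
Lemma Wker_markov u r : 0 < u ->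
  ((1 / 2)%:E <= \int[mu_lag b]_s
     ((\1_[set s : R | s ^+ 2 <= 2 * (r ^+ 2 + 2 * u * (b + 1))] s : R) * Wker (b + 1) u r s)%:E)%E.
Proof.
move=> u0; set R2 := 2 * _; set A := [set s : R | _].
have Q0 : 0 < r ^+ 2 + 2 * u * (b + 1).
  by apply: ltr_wpDl; [exact: sqr_ge0|apply: mulr_gt0 => //; apply: mulr_gt0].
have R20 : 0 < R2 by exact: mulr_gt0.
have mA : measurable A.
  rewrite (_ : A = setT `&` [set s : R | s ^+ 2 <= R2]); last by rewrite setTI.
  by apply: measurable_fun_le => //; exact: measurable_funX.
have mW : measurable_fun setT (fun s : R => Wker (b + 1) u r s).
  exact: measurable_Wker c0 (measurable_cst u) (measurable_cst r) (@measurable_id _ R setT).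
have mIW : measurable_fun setT (fun s : R => ((\1_A s : R) * Wker (b + 1) u r s)%:E).
  by apply/measurable_EFinP; apply: measurable_funM => //; exact: measurable_indic.
have W0 s : 0 <= Wker (b + 1) u r s by exact: Wker_ge0.
have IW0 s : (0 <= ((\1_A s : R) * Wker (b + 1) u r s)%:E)%E.
  by rewrite lee_fin mulr_ge0// indicE ler0n.
have m2 : measurable_fun setT (fun s : R => (s ^+ 2 * Wker (b + 1) u r s)%:E).
  by apply/measurable_EFinP; apply: measurable_funM => //; exact: measurable_funX.
have P0 s : (0 <= (s ^+ 2 * Wker (b + 1) u r s)%:E)%E by rewrite lee_fin mulr_ge0// sqr_ge0.
have E2 : (\int[mu_lag b]_s ((R2^-1)%:E * (s ^+ 2 * Wker (b + 1) u r s)%:E) = (1 / 2)%:E)%E.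
  rewrite ge0_integralZl//; last by rewrite lee_fin invr_ge0 ltW.
  rewrite integral_Wker2// -EFinM; congr EFin; rewrite /R2.
  by move: (r ^+ 2 + _) Q0 => Q Q0; field; rewrite gt_eqF.
have : ((1 : \bar R) <= \int[mu_lag b]_s ((\1_A s : R) * Wker (b + 1) u r s)%:E + (1 / 2)%:E)%E.
  rewrite -[leLHS](integral_Wker r c0 u0) -E2 -ge0_integralD//; first last.
  - by apply: measurable_funeM.
  - by move=> s _; rewrite mule_ge0// lee_fin invr_ge0 ltW.
  apply: ge0_le_integral => //.
  - by move=> s _; rewrite lee_fin.
  - by apply/measurable_EFinP.
  - by apply: emeasurable_funD => //; exact: measurable_funeM.
  move=> s _; rewrite -EFinM -EFinD lee_fin indicE.
  case: (boolP (s \in A)) => [_|].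
    by rewrite mul1r lerDl mulr_ge0 ?invr_ge0 ?(ltW R20)// mulr_ge0// sqr_ge0.
  move=> /negP sA; have {}sA : R2 < s ^+ 2 by rewrite ltNge; apply/negP => H; apply: sA; rewrite inE.
  rewrite mul0r add0r mulrA -[leLHS]mul1r ler_wpM2r//.
  by rewrite mulrC ler_pdivlMr// mul1r ltW.
by case: (\int[mu_lag b]_s _)%E => [x||] //; [rewrite -EFinD !lee_fin; lra|move=> _; exact: leey].
Qed.

(** Half of the mass of W sits where 1 + s^2 <= A (1 + r^2), by [Wker_markov], and
    the other Gaussian factor is bounded below there as long as t (1 + r^2) <= 1. *)
Lemma heat_ge_far : exists A, 1 <= A /\ forall g (ga : R) r t,
  (forall s, 0 <= g s) -> measurable_fun setT g -> 0 <= ga -> 0 < r ->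
  (forall s, 0 < s -> 1 + s ^+ 2 <= A * (1 + r ^+ 2) -> ga <= g s) ->
  0 < t -> t * (1 + r ^+ 2) <= 1 ->
  ((expR (- (A + 1)) / 2 * ga)%:E <= \int[mu_lag b]_s ((hker b t r s)%:E * (g s)%:E))%E.
Proof.
(* Since t <= 1, tau t is at most 2 e^4. *)
pose A : R := 2 + 8 * expR 4 * (b + 1).
have e40 : 0 < expR 4 :> R by exact: expR_gt0.
have A1 : 1 <= A.
  by have : 0 <= expR 4 * (b + 1) by [apply: mulr_ge0; exact: ltW]; rewrite /A; lra.
exists A; split=> // g ga r t g0 mg ga0 r0 H t0 tr.
have r20 : 0 <= r ^+ 2 by exact: sqr_ge0.
have t1 : t <= 1 by move: tr t0 r20; move: (r ^+ 2) => q; nra.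
have tt := tau_ge t0; have tau0 : 0 < tau t by apply: lt_le_trans tt.
have t2 : tau t <= 2 * expR 4.
  by apply: (le_trans (tau_le t0 _)); [lra|rewrite -[leRHS]mulr1 ler_wpM2l// mulr_ge0// ltW].
have kt := kap_le t0; have M := Wker_markov r tau0.
set R2 := 2 * _ in M; set B := [set s : R | _] in M.
have R2A : 1 + R2 <= A * (1 + r ^+ 2).
  have : tau t * (b + 1) <= 2 * expR 4 * (b + 1) by rewrite ler_wpM2r// ltW.
  have : 0 <= expR 4 * (b + 1) * r ^+ 2 by rewrite mulr_ge0// mulr_ge0// ltW.
  by rewrite /A /R2; move: (r ^+ 2) (expR 4) (tau t) (b + 1) => *; nra.
have mB : measurable B.
  rewrite (_ : B = setT `&` [set s : R | s ^+ 2 <= R2]); last by rewrite setTI.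
  by apply: measurable_fun_le => //; exact: measurable_funX.
have W0 s : 0 <= Wker (b + 1) (tau t) r s by exact: Wker_ge0.
have mW : measurable_fun setT (fun s : R => Wker (b + 1) (tau t) r s).
  exact: measurable_Wker c0 (measurable_cst (tau t)) (measurable_cst r) (@measurable_id _ R setT).
have mIW : measurable_fun setT (fun s : R => ((\1_B s : R) * Wker (b + 1) (tau t) r s)%:E).
  by apply/measurable_EFinP; apply: measurable_funM => //; exact: measurable_indic.
have IW0 s : (0 <= ((\1_B s : R) * Wker (b + 1) (tau t) r s)%:E)%E.
  by rewrite lee_fin mulr_ge0// indicE ler0n.
have K0 : 0 <= expR (- (A + 1)) * ga by rewrite mulr_ge0// expR_ge0.
apply: (@le_trans _ _ (\int[mu_lag b]_s ((expR (- (A + 1)) * ga)%:E *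
    ((\1_B s : R) * Wker (b + 1) (tau t) r s)%:E))%E).
  rewrite ge0_integralZl//; apply: le_trans (lee_wpmul2l _ M); last by rewrite lee_fin.
  by rewrite -[leRHS]/((expR (- (A + 1)) * ga * (1 / 2))%:E) lee_fin; lra.
apply: mu_lag_le.
- by move=> s; rewrite mule_ge0// lee_fin.
- by move=> s; rewrite mule_ge0// lee_fin ?hker_ge0.
- exact: measurable_funeM.
- apply: emeasurable_funM; last by apply/measurable_EFinP.
  exact: (measurable_slice2 (f := fun s t : R => (hker b t r s)%:E) (measurable_hker_ts r) t).
move=> s s'0; rewrite -[leLHS]/((expR (- (A + 1)) * ga * ((\1_B s : R) * Wker (b + 1) (tau t) r s))%:E).
rewrite -[leRHS]/((hker b t r s * g s)%:E) lee_fin indicE.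
case: (boolP (s \in B)) => [|_]; last by rewrite mul0r mulr0 mulr_ge0// hker_ge0.
rewrite inE /B /= => sR; rewrite mul1r /hker.
have gs : ga <= g s by apply: H => //; apply: le_trans R2A; rewrite lerD2l.
rewrite [leLHS]mulrC -[leRHS]mulrA ler_wpM2l//; apply: ler_pM; rewrite ?expR_ge0//.
rewrite ler_expR lerN2; apply: (@le_trans _ _ (t * (r ^+ 2 + s ^+ 2))).
  by rewrite ler_wpM2r// addr_ge0// sqr_ge0.
have rs : r ^+ 2 + s ^+ 2 <= (A + 1) * (1 + r ^+ 2) by lra.
apply: le_trans (ler_wpM2l (ltW t0) rs) _.
by rewrite mulrCA -[leRHS]mulr1 ler_wpM2l//; lra.
Qed.

(** Integrate [heat_ge_far] over the times up to 1 / (1 + r^2). *)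
Lemma potential_ge_far : exists A k, [/\ 1 <= A, 0 < k & forall g (ga : R) r,
  (forall s, 0 <= g s) -> measurable_fun setT g -> 0 <= ga -> 0 < r ->
  (forall s, 0 < s -> 1 + s ^+ 2 <= A * (1 + r ^+ 2) -> ga <= g s) ->
  ((k * ga * (1 + r ^+ 2) `^ (- sigma))%:E <= potential b sigma (EFin \o g) r)%E].
Proof.
have G0 := Gamma_gt0 s0.
have [A [A1 HA]] := heat_ge_far; pose e := expR (- (A + 1)) / 2.
have e0 : 0 < e by rewrite divr_gt0// expR_gt0.
exists A, ((Gamma sigma)^-1 * (e / sigma)); split => //.
  by rewrite mulr_gt0 ?invr_gt0// divr_gt0.
move=> g ga r g0 mg ga0 r0 H.
have g0' s : (0 <= (EFin \o g) s)%E by rewrite lee_fin.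
have mg' : measurable_fun setT (EFin \o g) by apply/measurable_EFinP.
have q0 : 0 < 1 + r ^+ 2 by rewrite ltr_wpDr ?sqr_ge0.
pose T := (1 + r ^+ 2)^-1; have T0 : 0 < T by rewrite invr_gt0.
have mA : measurable `]-oo, T] by [].
rewrite potentialE// (_ : (Gamma sigma)^-1 * (e / sigma) * ga * (1 + r ^+ 2) `^ (- sigma) =
   (Gamma sigma)^-1 * (e * ga * (T `^ sigma / sigma))); last first.
  have -> : T `^ sigma = (1 + r ^+ 2) `^ (- sigma).
    by rewrite /T -div1r powR_div// powR1 div1r powRN.
  by ring.
rewrite EFinM; apply: lee_wpmul2l; first by rewrite lee_fin invr_ge0 ltW.
rewrite [leLHS]EFinM -(T1 T0) -(mu_lag_indic _ mA).
have E0 : (0 <= (e * ga)%:E)%E by rewrite lee_fin mulr_ge0// ltW.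
have mI : measurable_fun setT (fun t : R => (\1_`]-oo, T] t : R)%:E).
  by apply/measurable_EFinP; exact: measurable_indic.
have I0 t : (0 <= (\1_`]-oo, T] t : R)%:E)%E by rewrite lee_fin indicE ler0n.
have -> : ((e * ga)%:E * \int[mu_lag (sigma / 2 - 1)]_t (\1_`]-oo, T] t : R)%:E =
    \int[mu_lag (sigma / 2 - 1)]_t ((e * ga)%:E * (\1_`]-oo, T] t : R)%:E))%E.
  by apply/esym/ge0_integralZl.
apply: mu_lag_le.
- by move=> t; exact: mule_ge0.
- by move=> t; apply: integral_ge0 => s _; rewrite mule_ge0// lee_fin hker_ge0.
- exact: measurable_funeM.
- exact: measurable_heat_t.
move=> t t0; rewrite indicE; case: (boolP (t \in _)) => [|_]; last first.
  by rewrite mule0; apply: integral_ge0 => s _; rewrite mule_ge0// lee_fin hker_ge0.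
rewrite inE/= in_itv/= => tT; rewrite mule1; apply: HA => //.
by move: tT; rewrite /T -div1r ler_pdivlMr.
Qed.

End lower_bounds.

(** * Test functions, and necessity *)

Section Lnorm_tests.
Context {R : realType}.
Implicit Types (b k m : R) (p q : \bar R) (f phi psi : R -> R) (G : R -> \bar R) (A : set R).

Lemma powR_ge_root (z l d : R) : 0 <= z -> 0 < d -> z `^ d^-1 <= l -> z <= l `^ d.
Proof.
move=> z0 d0 zl; have -> : z = (z `^ d^-1) `^ d by rewrite -powRrM mulVf ?gt_eqF// powRr1.
apply: ge0_ler_powR => //; rewrite ?nnegrE ?powR_ge0 ?(ltW d0)//.
exact: le_trans (powR_ge0 _ _) zl.
Qed.

(** Functions below the power 1/p of a density, the form that covers p = +oo too:
    then the exponent is 0 and the function is at most 1. *)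
Lemma Lnorm_le_power b p f phi m : (1 <= p)%E -> (forall s, 0 <= f s) -> measurable_fun setT f ->
  (forall s, 0 <= phi s) -> measurable_fun setT phi ->
  (forall s, f s <= phi s `^ fine p^-1) -> (\int[mu_lag b]_s (phi s)%:E <= m%:E)%E -> 0 <= m ->
  ('N[mu_lag b]_p[EFin \o f] <= (m `^ fine p^-1)%:E)%E.
Proof.
move=> p1 f0 mf phi0 mphi; rewrite unlock /Lnorm; case: p p1 => [p| |] //.
  rewrite lee_fin => p1; have p0 : 0 < p by apply: lt_le_trans p1.
  rewrite (_ : fine p%:E^-1 = p^-1); last by rewrite inver gt_eqF.
  move=> fphi im m0; rewrite -poweR_EFin.
  have im' : (\int[mu_lag b]_s (`|(EFin \o f) s| `^ p) <= m%:E)%E.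
    apply: le_trans im; apply: ge0_le_integral => //.
    - by move=> s _; exact: poweR_ge0.
    - apply: (measurableT_comp (measurable_poweR _)); apply: measurableT_comp => //.
      by apply/measurable_EFinP.
    - by apply/measurable_EFinP.
    move=> s _; rewrite [(EFin \o f) s]/= abse_EFin poweR_EFin lee_fin ger0_norm//.
    rewrite -[leRHS]powRr1// -(@mulVf _ p) ?gt_eqF// powRrM.
    by apply: ge0_ler_powR; rewrite ?nnegrE ?powR_ge0 ?(ltW p0).
  apply: gt0_ler_poweR; rewrite ?invr_ge0 ?(ltW p0)// ?in_itv/= ?leey ?andbT//.
  by apply: integral_ge0 => s _; rewrite lee_fin powR_ge0.
rewrite invey => _ fphi _ _; rewrite mu_lag_setT_gt0 powRr0; apply/ess_supP; apply: nearW => s.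
by have := fphi s; rewrite powRr0 /= ger0_norm// lee_fin.
Qed.

(** For q = +oo the exponent is 0, and psi^0 is 1 even where psi vanishes; the lower
    bound is therefore asked on a set A of positive measure that carries psi. *)
Lemma Lnorm_ge_power b q G psi A k m : (1 <= q)%E -> (forall r, 0 <= G r)%E -> measurable_fun setT G ->
  (forall s, 0 <= psi s) -> measurable_fun setT psi -> measurable A -> (0 < mu_lag b A)%E ->
  (forall s, ~ A s -> psi s = 0) -> 0 <= k ->
  (forall r, A r -> 0 < r -> ((k * psi r `^ fine q^-1)%:E <= G r)%E) ->
  (m%:E <= \int[mu_lag b]_s (psi s)%:E)%E -> 0 <= m ->
  ((k * m `^ fine q^-1)%:E <= 'N[mu_lag b]_q[G])%E.
Proof.
move=> q1 G0 mG psi0 mpsi mA A0 psiA k0; rewrite unlock /Lnorm; case: q q1 => [q| |] //.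
  rewrite lee_fin => q1; have q0 : 0 < q by apply: lt_le_trans q1.
  rewrite (_ : fine q%:E^-1 = q^-1); last by rewrite inver gt_eqF.
  move=> Gpsi im m0.
  have -> : (k * m `^ q^-1)%:E = (((k `^ q * m)%:E) `^ q^-1)%E.
    by rewrite poweR_EFin powRM ?powR_ge0// -powRrM divff ?gt_eqF// powRr1.
  apply: gt0_ler_poweR; rewrite ?invr_ge0 ?(ltW q0)// ?in_itv/= ?leey ?andbT//.
  - by rewrite lee_fin mulr_ge0// powR_ge0.
  - by apply: integral_ge0 => s _; exact: poweR_ge0.
  have kq0 : (0 <= (k `^ q)%:E)%E by rewrite lee_fin powR_ge0.
  rewrite EFinM; apply: le_trans (lee_wpmul2l kq0 im) _.
  have mp : measurable_fun setT (EFin \o psi) by apply/measurable_EFinP.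
  have p0 s : (0 <= (EFin \o psi) s)%E by rewrite lee_fin.
  rewrite -(ge0_integralZl (mu_lag b) measurableT mp (fun s _ => p0 s) kq0).
  apply: mu_lag_le.
  - by move=> s; exact: mule_ge0.
  - by move=> s; exact: poweR_ge0.
  - exact: measurable_funeM.
  - by apply: (measurableT_comp (measurable_poweR _)); exact: measurableT_comp.
  move=> s s0; have [As|As] := pselect (A s); last by rewrite /= psiA// mule0 poweR_ge0.
  rewrite gee0_abs// -[leLHS]/((k `^ q * psi s)%:E).
  have -> : (k `^ q * psi s)%:E = (((k * psi s `^ q^-1)%:E) `^ q)%E.
    by rewrite poweR_EFin powRM ?powR_ge0// -powRrM mulVf ?gt_eqF// powRr1.
  apply: gt0_ler_poweR; rewrite ?(ltW q0)// ?in_itv/= ?leey ?andbT//; last exact: Gpsi.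
  by rewrite lee_fin mulr_ge0// powR_ge0.
rewrite invey => _ Gpsi _ _; rewrite mu_lag_setT_gt0 powRr0 mulr1 leNgt; apply/negP => H.
move: A0; rewrite lt0e => /andP[/eqP + _]; apply.
apply/negligibleP => //.
have : {ae mu_lag b, forall r, ~ A r}.
  apply: filterS2 (ess_sup_ge (mu_lag b) (abse \o G)) (ae_mu_lag_gt0 b) => r Gr r0 Ar.
  have := Gpsi r Ar r0; rewrite powRr0 mulr1 => kG.
  have := le_lt_trans (le_trans kG (le_trans _ Gr)) H.
  by rewrite /= gee0_abs// lexx ltxx => /(_ isT).
by apply: negligibleS => r /= Ar; apply.
Qed.

(** Dually to [Lnorm_le_ae], X is lowered to 0 on the exceptional null set. *)
Lemma Lnorm_ae_le b q (X Y : R -> \bar R) : (1 <= q)%E ->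
  (forall r, 0 <= X r)%E -> (forall r, 0 <= Y r)%E ->
  measurable_fun setT X -> {ae mu_lag b, forall r, X r <= Y r}%E ->
  ('N[mu_lag b]_q[X] <= 'N[mu_lag b]_q[Y])%E.
Proof.
move=> q1 X0 Y0 mX XY; have [N [mN N0 XN]] := XY.
pose Z r := if r \in N then 0%E else X r.
have mZ : measurable_fun setT Z.
  apply: measurable_fun_if => //; last exact: measurable_funTS.
  apply: (measurable_fun_bool true); rewrite setTI (_ : _ @^-1` _ = N)//.
  by apply/seteqP; split=> r /=; [move/set_mem|move/mem_set].
have Z0 r : (0 <= Z r)%E by rewrite /Z; case: ifP.
have ZY r : (Z r <= Y r)%E.
  rewrite /Z; case: ifPn => [_|rN]; first exact: Y0.
  by apply: contrapT => H; move/negP: rN; apply; rewrite inE; exact: XN.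
apply: (@le_trans _ _ ('N[mu_lag b]_q[Z])%E).
  apply: Lnorm_le_ae => //; exists N; split => // r /= H; apply: contrapT => Nr; apply: H.
  by rewrite /Z memNset.
rewrite unlock /Lnorm; case: q q1 => [q| |] //.
  rewrite lee_fin => q1; have q0 : 0 < q by apply: lt_le_trans q1.
  apply: gt0_ler_poweR; rewrite ?invr_ge0 ?(ltW q0)// ?in_itv/= ?leey ?andbT//.
  - by apply: integral_ge0 => r _; exact: poweR_ge0.
  - by apply: integral_ge0 => r _; exact: poweR_ge0.
  apply: integral_mono_sup => r; first exact: poweR_ge0.
  apply: gt0_ler_poweR; rewrite ?(ltW q0)// ?in_itv/= ?leey ?andbT ?abse_ge0//.
  by rewrite !gee0_abs.
by move=> _; rewrite mu_lag_setT_gt0; apply: le_ess_sup; apply: nearW => r; rewrite /= !gee0_abs.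
Qed.

End Lnorm_tests.

Section necessity.
Context {R : realType}.
Variables (sigma alpha a C : R) (p q s : \bar R).
Hypotheses (s0 : 0 < sigma) (sN : sigma < alpha + 1) (a12 : - (1 / 2) <= alpha).
Hypotheses (p1 : (1 <= p)%E) (q1 : (1 <= q)%E) (s1 : (1 <= s)%E).
Hypotheses (C0 : 0 < C) (HC : vector_bound sigma alpha a p q s C).
Implicit Types (f phi psi : R -> R) (r t k m e : R) (A : set R).

Let c0 : 0 < alpha + 1. Proof. by move: a12; lra. Qed.

(** The vector bound applied to families with a single nonzero entry. *)
Let potential_bound f : (forall t, 0 <= f t) -> f \in Lfun (mu_lag alpha) p ->
  ('N[mu_lag alpha]_q[potential alpha sigma (EFin \o f)] <= C%:E * 'N[mu_lag alpha]_p[EFin \o f])%E.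
Proof.
move=> f0 Lf; have mf : measurable_fun setT f.
  by move: Lf; rewrite inE => /andP[+ _]; rewrite inE.
have mEf : measurable_fun setT (EFin \o f) by apply/measurable_EFinP.
have Ef0 t : (0 <= (EFin \o f) t)%E by rewrite lee_fin.
pose F (j : nat) := if j is 0%N then f else cst 0.
have LF j : F j \in Lfun (mu_lag alpha) p.
  case: j => //= _; rewrite inE; apply/andP; split; rewrite inE//= /finite_norm.
  rewrite (_ : _ \o _ = cst 0%E)// Lnorm0//.
  by rewrite gt_eqF// (lt_le_trans _ p1).
have := HC LF; set X := fun r => lnorm s _; set Y := fun r => lnorm s _.
have -> : ('N[mu_lag alpha]_p[Y] = 'N[mu_lag alpha]_p[EFin \o f])%E.
  by congr ('N[_]_p[_])%E; apply/funext => r; rewrite /Y lnorm1//= ger0_norm.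
apply: le_trans; apply: Lnorm_ae_le => //.
- by move=> r; exact: potential_ge0.
- by move=> r; exact: lnorm_ge0.
- exact: measurable_potential.
apply: filterS (@frac_int_potential _ alpha sigma s0 alpha f a12) => r Hr.
apply: le_trans (lnorm_ge _ 0%N s1).
rewrite /upow mulr0 powRr0 mul1e addr0.
rewrite (_ : (fun t => (t `^ 0)^-1 * F 0%N t) = f); last first.
  by apply/funext => t; rewrite powRr0 invr1 mul1r.
rewrite Hr (_ : potential_op alpha sigma f r = potential alpha sigma (EFin \o f) r); last first.
  by apply: eq_integral => t _; rewrite potential_kernelE.
by rewrite gee0_abs// potential_ge0.
Qed.

Let x := fine p^-1. Let y := fine q^-1.

(** All the tests have this shape: f below the power x = 1/p of a density of mass m,
    its potential above k times the power y = 1/q of a density of mass m'. *)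
Let potential_test f phi psi A k m m' :
  (forall t, 0 <= f t) -> measurable_fun setT f ->
  (forall t, 0 <= phi t) -> measurable_fun setT phi -> (forall t, f t <= phi t `^ x) ->
  (\int[mu_lag alpha]_t (phi t)%:E <= m%:E)%E -> 0 <= m ->
  (forall t, 0 <= psi t) -> measurable_fun setT psi -> measurable A -> (0 < mu_lag alpha A)%E ->
  (forall t, ~ A t -> psi t = 0) -> 0 <= k ->
  (forall r, A r -> 0 < r -> ((k * psi r `^ y)%:E <= potential alpha sigma (EFin \o f) r)%E) ->
  (m'%:E <= \int[mu_lag alpha]_t (psi t)%:E)%E -> 0 <= m' ->
  k * m' `^ y <= C * m `^ x.
Proof.
move=> f0 mf phi0 mphi fphi im m0 psi0 mpsi mA A0 psiA k0 Gpsi im' m'0.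
have mEf : measurable_fun setT (EFin \o f) by apply/measurable_EFinP.
have Ef0 t : (0 <= (EFin \o f) t)%E by rewrite lee_fin.
have Nf := Lnorm_le_power p1 f0 mf phi0 mphi fphi im m0.
have Lf : f \in Lfun (mu_lag alpha) p.
  rewrite inE; apply/andP; split; rewrite inE//= /finite_norm.
  exact: le_lt_trans Nf (ltry _).
have NG := Lnorm_ge_power q1 (fun r => potential_ge0 c0 s0 r Ef0) (measurable_potential c0 s0 Ef0 mEf)
  psi0 mpsi mA A0 psiA k0 Gpsi im' m'0.
have := le_trans NG (le_trans (potential_bound f0 Lf) (lee_wpmul2l _ Nf)).
by rewrite lee_fin ltW// => /(_ isT); rewrite -EFinM lee_fin.
Qed.

Let xy1 : [/\ 0 <= x, x <= 1, 0 <= y & y <= 1].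
Proof.
by have [_ /andP[? ?]] := fine_inve p1; have [_ /andP[? ?]] := fine_inve q1; split.
Qed.

Let ball e : 0 < e -> mu_lag alpha `]-oo, e] = (e `^ (2 * (alpha + 1)) / (2 * (alpha + 1)))%:E.
Proof. exact: mu_ball. Qed.

Let m e : R := e `^ (2 * (alpha + 1)) / (2 * (alpha + 1)).

Let m_gt0 e : 0 < e -> 0 < m e.
Proof. by move=> e0; rewrite divr_gt0 ?powR_gt0// mulr_gt0. Qed.

Let ind e t : R := \1_`]-oo, e] t.

Let ind_ge0 e t : 0 <= ind e t. Proof. by rewrite /ind indicE ler0n. Qed.

Let measurable_ind e : measurable_fun setT (ind e).
Proof. exact: measurable_indic. Qed.

Let ind1 e t : t <= e -> ind e t = 1.
Proof. by move=> te; rewrite /ind indicE mem_set//= in_itv/=. Qed.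

Let ind0 e t : ~ (`]-oo, e]%classic : set R) t -> ind e t = 0.
Proof. by move=> te; rewrite /ind indicE memNset. Qed.

Let ind_le e t z : ind e t <= ind e t `^ z.
Proof.
by rewrite /ind indicE; case: (_ \in _); rewrite /= ?powR1// powR_ge0.
Qed.

Let int_ind e : 0 < e -> (\int[mu_lag alpha]_t (ind e t)%:E = (m e)%:E)%E.
Proof. by move=> e0; rewrite mu_lag_indic// ball. Qed.

Let ball_gt0 e : 0 < e -> (0 < mu_lag alpha `]-oo, e])%E.
Proof. by move=> e0; rewrite ball// lte_fin m_gt0. Qed.

Let potential_ind : exists k, 0 < k /\ forall e rho r, 0 < e -> e <= rho -> rho <= 1 -> 0 < r -> r <= rho ->
  ((k * rho `^ (2 * sigma - 2 * (alpha + 1)) * m e)%:E <= potential alpha sigma (EFin \o ind e) r)%E.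
Proof.
have [k [k0 Hk]] := pker_ge_local a12 s0; exists k; split => // e rho r e0 er rho1 r0 rrho.
have K0 : (0 <= (k * rho `^ (2 * sigma - 2 * (alpha + 1)))%:E)%E.
  by rewrite lee_fin mulr_ge0 ?powR_ge0// ltW.
have mEi : measurable_fun setT (EFin \o ind e) by apply/measurable_EFinP; exact: measurable_ind.
have Ei0 t : (0 <= (EFin \o ind e) t)%E by rewrite lee_fin ind_ge0.
rewrite EFinM -int_ind// -(ge0_integralZl (mu_lag alpha) measurableT mEi (fun s _ => Ei0 s) K0).
apply: mu_lag_le.
- by move=> t; exact: mule_ge0.
- by move=> t; exact: potentialK_ge0.
- exact: measurable_funeM.
- exact: measurable_potentialK.
move=> t t0; rewrite /= /ind indicE; case: (boolP (t \in _)) => [|_]; last by rewrite !mule0.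
rewrite inE/= in_itv/= => te; rewrite !mule1; apply: Hk => //.
- exact: lt_le_trans er.
- exact: le_trans er.
Qed.

(** Testing on the indicator of (0, e]: its potential is of order e^(2 sigma) there,
    and e tends to 0. *)
Lemma necessary_ball : (alpha + 1) * (x - y) <= sigma.
Proof.
have [x0 x1 y0 y1] := xy1; rewrite leNgt; apply/negP => H.
have [k [k0 Hk]] := potential_ind.
pose d := 2 * (alpha + 1) * (x - y) - 2 * sigma; have d0 : 0 < d by rewrite /d; lra.
pose n := (2 * (alpha + 1)) `^ (x - y); have n0 : 0 < n by rewrite powR_gt0// mulr_gt0.
pose k' := k / (2 * (alpha + 1)) * n; have k'0 : 0 < k' by rewrite mulr_gt0// divr_gt0// mulr_gt0.
have bd e : 0 < e -> e <= 1 -> k' * e `^ (- d) <= C.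
  move=> e0 e1; have me := m_gt0 e0.
  have K0 : 0 <= k * e `^ (2 * sigma - 2 * (alpha + 1)) * m e.
    by rewrite mulr_ge0 ?(ltW me)// mulr_ge0 ?powR_ge0// ltW.
  have T : k * e `^ (2 * sigma - 2 * (alpha + 1)) * m e * m e `^ y <= C * m e `^ x.
    apply: (@potential_test (ind e) (ind e) (ind e) `]-oo, e]%classic) => //.
    - by rewrite int_ind.
    - exact: ltW.
    - exact: ball_gt0.
    - by move=> t; exact: ind0.
    - move=> r /=; rewrite in_itv/= => re r0; rewrite ind1// powR1 mulr1.
      exact: Hk.
    - by rewrite int_ind.
    - exact: ltW.
  have mx : 0 < m e `^ x by rewrite powR_gt0.
  rewrite -(ler_pM2r mx); apply: le_trans T; rewrite le_eqVlt; apply/orP; left; apply/eqP.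
  have -> : m e `^ y = m e `^ x * m e `^ (y - x) by rewrite -powRDp// addrC subrK.
  have -> : m e `^ (y - x) = e `^ (2 * (alpha + 1) * (y - x)) * n.
    rewrite /m powR_div ?powR_ge0 ?mulr_gt0// -powRrM /n; congr (_ * _).
    by rewrite -powRN opprB.
  have -> : m e = e `^ (2 * (alpha + 1)) / (2 * (alpha + 1)) by [].
  have -> : - d = (2 * sigma - 2 * (alpha + 1)) + (2 * (alpha + 1)) + 2 * (alpha + 1) * (y - x).
    by rewrite /d; ring.
  by rewrite !powRDp// /k'; ring.
pose M := Num.max 1 (C / k' + 1); have M1 : 1 <= M by rewrite le_max lexx.
have M0 : 0 < M by apply: lt_le_trans M1.
have := bd (M `^ (- d^-1)).
rewrite powR_gt0// -powRrM mulrNN mulVf ?gt_eqF// powRr1 ?(ltW M0)// => /(_ isT).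
have -> : M `^ (- d^-1) <= 1.
  by rewrite powRN invf_le1 ?powR_gt0// -[leLHS](powRr0 M) ler_powR// invr_ge0 ltW.
move=> /(_ isT); rewrite mulrC -ler_pdivlMr// => MC.
have : C / k' + 1 <= M by rewrite le_max lexx orbT.
by lra.
Qed.

Let ann e : set R := `]e, 1%R]%classic.

Let measurable_ann e : measurable (ann e). Proof. exact: measurable_itv. Qed.

Let annphi e t : R := t `^ (- (2 * (alpha + 1))) * \1_(ann e) t.

Let annphi_ge0 e t : 0 <= annphi e t.
Proof. by rewrite mulr_ge0 ?powR_ge0// indicE ler0n. Qed.

Let measurable_annphi e : measurable_fun setT (annphi e).
Proof. by apply: measurable_funM; [exact: measurable_powR|exact: (measurable_indic (measurable_ann e))]. Qed.

Let int_annphi e : (\int[mu_lag alpha]_t (annphi e t)%:E = mu_lag (-1) (ann e))%E.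
Proof.
have mA := measurable_ann e.
have -> : (-1 : R) = alpha + - (alpha + 1) by ring.
rewrite -(mu_lag_indic _ mA) -mu_lag_shiftp.
- by apply: eq_integral => t _; rewrite -EFinM mulrN.
- by move=> t; rewrite lee_fin indicE ler0n.
- by apply/measurable_EFinP; exact: measurable_indic.
Qed.

(** Testing on the indicator of (0, e] again; for r in (e, 1] the potential is of the
    order of the mass times r^(2 sigma - 2 (alpha + 1)), and the q-th power of the
    latter has a logarithmically divergent integral. *)
Lemma necessary_p1 : x = 1 -> (alpha + 1) * (x - y) = sigma -> False.
Proof.
move=> x1 E; have [_ _ y0 _] := xy1; have [k [k0 Hk]] := potential_ind.
have yE : y = (alpha + 1 - sigma) / (alpha + 1).
  by rewrite -E x1; field; rewrite gt_eqF.
have yp : 0 < y by rewrite yE divr_gt0// subr_gt0.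
pose M := (C / k + 1) `^ y^-1.
have Ck : 0 < C / k + 1 by rewrite addr_gt0// divr_gt0.
have M0 : 0 <= M by exact: powR_ge0.
have [e [e0 e1 He]] := mu_log_small M.
have me := m_gt0 e0.
have mA := measurable_ann e.
have K0 : 0 <= k * m e by rewrite mulr_ge0// ltW.
have A0 : (0 < mu_lag alpha (ann e))%E.
  have -> : alpha = (2 * (alpha + 1)) / 2 - 1 by field.
  have N20 : 0 < 2 * (alpha + 1) by rewrite mulr_gt0.
  rewrite mu_pow_annulus ?(ltW e1)// lte_fin divr_gt0// subr_gt0.
  by apply: gt0_ltr_powR => //; rewrite nnegrE// ltW.
have T : k * m e * M `^ y <= C * m e `^ x.
  apply: (@potential_test (ind e) (ind e) (annphi e) (ann e)) => //.
  - by rewrite int_ind.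
  - exact: ltW.
  - by move=> t At; rewrite /annphi indicE memNset// mulr0.
  - move=> r Ar r0; have := Ar; rewrite /ann/= in_itv/= => /andP[er r1].
    have := Hk e r r e0 (ltW er) r1 r0 (lexx r); apply: le_trans; rewrite lee_fin.
    rewrite /annphi indicE mem_set// mulr1 -powRrM.
    rewrite (_ : - (2 * (alpha + 1)) * y = 2 * sigma - 2 * (alpha + 1)).
      by rewrite le_eqVlt; apply/orP; left; apply/eqP; ring.
    by rewrite yE; field; rewrite gt_eqF.
  - by rewrite int_annphi.
move: T; rewrite x1 powRr1 ?(ltW me)// mulrAC ler_pM2r// /M -powRrM mulVf ?gt_eqF// powRr1 ?(ltW Ck)//.
by rewrite mulrDr mulr1 mulrCA divff ?gt_eqF// mulr1; lra.
Qed.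

(** Dually, testing on r^(-2 sigma) on (e, 1]: its norm to the power p and its
    potential near 0 are both of the order of the diverging integral L of dr/r, and
    1/p < 1. *)
Lemma necessary_qoo : y = 0 -> (alpha + 1) * x = sigma -> False.
Proof.
move=> y0 E; have [k [k0 Hk]] := pker_ge_local a12 s0.
have xE : x = sigma / (alpha + 1) by rewrite -E; field; rewrite gt_eqF.
have xp : 0 < x by rewrite xE divr_gt0.
have x1 : x < 1 by rewrite xE ltr_pdivrMr// mul1r.
have x10 : 0 < 1 - x by rewrite subr_gt0.
have Ck : 0 < C / k + 1 by rewrite addr_gt0// divr_gt0.
pose M := Num.max 1 ((C / k + 1) `^ (1 - x)^-1).
have M1 : 1 <= M by rewrite le_max lexx.
have M0 : 0 < M by apply: lt_le_trans M1.
have [e [e0 e1 He]] := mu_log_small M.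
have mA := measurable_ann e.
have [L LE] : exists L, mu_lag (-1) (ann e) = L%:E.
  exists (fine (mu_lag (-1) (ann e))); rewrite fineK// ge0_fin_numE//; exact: mu_log_fin.
have ML : M <= L by rewrite -lee_fin -LE.
have L0 : 0 < L by apply: lt_le_trans ML.
pose f t : R := t `^ (- (2 * sigma)) * \1_(ann e) t.
have f0 t : 0 <= f t by rewrite mulr_ge0 ?powR_ge0// indicE ler0n.
have mf : measurable_fun setT f by apply: measurable_funM; [exact: measurable_powR|exact: (measurable_indic (measurable_ann e))].
have Ef0 t : (0 <= (EFin \o f) t)%E by rewrite lee_fin.
have mEf : measurable_fun setT (EFin \o f) by apply/measurable_EFinP.
have kL : 0 <= k * L by rewrite mulr_ge0// ltW.
have T : k * L * m e `^ y <= C * L `^ x.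
  apply: (@potential_test f (annphi e) (ind e) `]-oo, e]%classic) => //.
  - move=> t; rewrite /f /annphi indicE; case: (_ \in _); rewrite ?mulr1 ?mulr0 ?powR_ge0//.
    rewrite -powRrM (_ : - (2 * (alpha + 1)) * x = - (2 * sigma))//.
    by rewrite -E; ring.
  - by rewrite int_annphi LE.
  - exact: ltW.
  - exact: ball_gt0.
  - by move=> t; exact: ind0.
  - move=> r /=; rewrite in_itv/= => re r0; rewrite y0 powRr0 mulr1.
    rewrite EFinM -LE -int_annphi.
    have mEa : measurable_fun setT (EFin \o annphi e) by apply/measurable_EFinP; exact: measurable_annphi.
    have k0' : (0 <= k%:E)%E by rewrite lee_fin ltW.
    rewrite -(ge0_integralZl (mu_lag alpha) measurableT mEa (fun s _ => annphi_ge0 e s) k0').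
    apply: mu_lag_le.
    + by move=> t; rewrite mule_ge0// lee_fin.
    + by move=> t; exact: potentialK_ge0.
    + exact: measurable_funeM.
    + exact: measurable_potentialK.
    move=> t t0; rewrite /= /f /annphi indicE; case: (boolP (t \in _)) => [|_]; last first.
      by rewrite !mulr0 !mule0.
    rewrite inE /ann /= in_itv/= => /andP[et t1]; rewrite !mulr1.
    have rt : r <= t by apply: (le_trans re); exact: ltW.
    have := Hk t r t t0 t1 r0 rt t0 (lexx t) => H.
    have tt : (0 <= (t `^ (- (2 * sigma)))%:E)%E by rewrite lee_fin powR_ge0.
    have := lee_wpmul2r tt H; apply: le_trans.
    rewrite -[leLHS]/((k * t `^ (- (2 * (alpha + 1))))%:E) -EFinM lee_fin.
    rewrite -mulrA -powRDp// (_ : 2 * sigma - 2 * (alpha + 1) + - (2 * sigma) = - (2 * (alpha + 1)))//; ring.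
  - by rewrite int_ind.
  - exact: ltW (m_gt0 e0).
move: T; rewrite y0 powRr0 mulr1.
have Lx : 0 < L `^ x by rewrite powR_gt0.
have LE' : L = L `^ (1 - x) * L `^ x by rewrite -powRDp// subrK powRr1// ltW.
rewrite [in k * _]LE' mulrA ler_pM2r// => T.
have : C / k + 1 <= L `^ (1 - x).
  apply: powR_ge_root (ltW Ck) x10 _.
  by apply: le_trans ML; rewrite le_max lexx orbT.
move=> /(ler_wpM2l (ltW k0)); rewrite mulrDr mulr1 mulrCA divff ?gt_eqF// mulr1; lra.
Qed.

Let far S t : R := (1 + t ^+ 2) `^ (- (alpha + 1)) * ind S t.

Let far_ge0 S t : 0 <= far S t. Proof. exact: mulr_ge0 (powR_ge0 _ _) (ind_ge0 _ _). Qed.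

Let sq1 t : 1 <= 1 + t ^+ 2. Proof. by rewrite lerDl sqr_ge0. Qed.

Let sq_gt0 t : 0 < 1 + t ^+ 2. Proof. exact: lt_le_trans (sq1 t). Qed.

Let measurable_sq (z : R) : measurable_fun setT (fun t : R => (1 + t ^+ 2) `^ z).
Proof.
apply: (measurableT_comp (measurable_powR _)).
by apply: measurable_funD => //; exact: measurable_funX.
Qed.

Let measurable_far S : measurable_fun setT (far S).
Proof. exact: measurable_funM (measurable_sq _) (measurable_ind S). Qed.

Let measurable_farE S : measurable_fun setT (EFin \o far S).
Proof. by apply/measurable_EFinP; exact: measurable_far. Qed.

Let farE0 S t : (0 <= (EFin \o far S) t)%E. Proof. by rewrite lee_fin. Qed.

Let far_fin S : 0 < S -> exists l, 0 <= l /\ (\int[mu_lag alpha]_t (far S t)%:E = l%:E)%E.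
Proof.
move=> S0; have I0 : (0 <= \int[mu_lag alpha]_t (far S t)%:E)%E.
  by apply: integral_ge0 => t _; rewrite lee_fin.
exists (fine (\int[mu_lag alpha]_t (far S t)%:E)%E); split; first exact: fine_ge0.
rewrite fineK// ge0_fin_numE//; apply: (@le_lt_trans _ _ (m S)%:E); last exact: ltry.
rewrite -int_ind//; apply: ge0_le_integral => //.
- by move=> t _; rewrite lee_fin.
- exact: measurable_farE.
- by apply/measurable_EFinP; exact: measurable_ind.
move=> t _; rewrite lee_fin /far -[leRHS]mul1r ler_wpM2r//.
by have := ler_powRN (ltW c0) ltr01 (sq1 t); rewrite powR1.
Qed.

Let far_large M : exists S, 1 < S /\ (M%:E <= \int[mu_lag alpha]_t (far S t)%:E)%E.
Proof.
pose n : R := 2 `^ (alpha + 1); have n0 : 0 < n by rewrite powR_gt0.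
have [S [S1 HS]] := mu_log_large (n * M); exists S; split => //.
have S0 : 0 < S by apply: lt_trans S1.
have mA : measurable (`[1%R, S[%classic : set R) by [].
have K0 : (0 <= n%:E)%E by rewrite lee_fin ltW.
have : ((n * M)%:E <= n%:E * \int[mu_lag alpha]_t (far S t)%:E)%E.
  apply: (le_trans HS).
  rewrite -(ge0_integralZl (mu_lag alpha) measurableT (measurable_farE S) (fun t _ => farE0 S t) K0).
  have -> : (-1 : R) = alpha + - (alpha + 1) by ring.
  have mI : measurable_fun setT (fun t : R => (\1_(`[1%R, S[%classic : set R) t : R)%:E).
    by apply/measurable_EFinP; exact: measurable_indic.
  have I0 t : (0 <= (\1_(`[1%R, S[%classic : set R) t : R)%:E)%E by rewrite lee_fin indicE ler0n.
  rewrite -(mu_lag_indic _ mA) -mu_lag_shiftp//; apply: mu_lag_le.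
  - by move=> t; rewrite mule_ge0// lee_fin powR_ge0.
  - by move=> t; rewrite mule_ge0.
  - by apply: emeasurable_funM => //; apply/measurable_EFinP; exact: measurable_powR.
  - exact: measurable_funeM (measurable_farE S).
  move=> t t0; rewrite indicE; case: (boolP (t \in _)) => [|_]; last by rewrite mule0 mule_ge0.
  rewrite inE/= in_itv/= => /andP[t1 tS]; rewrite mule1 -EFinM lee_fin.
  rewrite /far ind1 ?(ltW tS)// mulr1.
  have -> : t `^ (2 * - (alpha + 1)) = n * (2 * t ^+ 2) `^ (- (alpha + 1)).
    rewrite powRM ?sqr_ge0// mulrA /n -powRDp// subrr powRr0 mul1r.
    by rewrite -powR_mulrn ?(ltW t0)// -powRrM.
  rewrite ler_wpM2l ?(ltW n0)//; apply: ler_powRN; rewrite ?(ltW c0)//.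
  by have : 1 <= t ^+ 2; [rewrite expr_ge1// ltW|move: (t ^+ 2) => z; lra].
by rewrite EFinM lee_pmul2l// lte_fin.
Qed.

(** Shrinking 1 + S^2 by a fixed factor A costs a bounded amount. *)
Let far_shrink (A S S' : R) : 1 <= A -> 0 < S -> A * (1 + S' ^+ 2) = 1 + S ^+ 2 -> 0 < S' ->
  (\int[mu_lag alpha]_t (far S t)%:E <=
   \int[mu_lag alpha]_t (far S' t)%:E + (A `^ (alpha + 1) / (2 * (alpha + 1)))%:E)%E.
Proof.
move=> A1 S0 E S'0; have A0 : 0 < A by apply: lt_le_trans A1.
pose k := (1 + S' ^+ 2) `^ (- (alpha + 1)); have k0 : 0 < k by rewrite powR_gt0.
have K0 : (0 <= k%:E)%E by rewrite lee_fin ltW.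
have mI : measurable_fun setT (EFin \o ind S) by apply/measurable_EFinP; exact: measurable_ind.
have I0 t : (0 <= (EFin \o ind S) t)%E by rewrite lee_fin.
apply: (@le_trans _ _ (\int[mu_lag alpha]_t (far S' t)%:E + k%:E * \int[mu_lag alpha]_t (ind S t)%:E)%E).
  rewrite -(ge0_integralZl (mu_lag alpha) measurableT mI (fun t _ => I0 t) K0).
  have mkI : measurable_fun setT (fun t => k%:E * (EFin \o ind S) t)%E by exact: measurable_funeM.
  have kI0 t : (0 <= k%:E * (EFin \o ind S) t)%E by exact: mule_ge0.
  rewrite -(ge0_integralD (mu_lag alpha) measurableT (fun t _ => farE0 S' t) (measurable_farE S')
    (fun t _ => kI0 t) mkI).
  apply: mu_lag_le.
  - by move=> t; rewrite lee_fin.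
  - by move=> t; apply: adde_ge0.
  - exact: measurable_farE.
  - by apply: emeasurable_funD => //; exact: measurable_farE.
  move=> t t0; rewrite -[leRHS]/((far S' t + k * ind S t)%:E) lee_fin.
  have [tS'|S't] := leP t S'.
    rewrite /far (ind1 tS') mulr1 ler_wpDr ?mulr_ge0 ?(ltW k0)//.
    rewrite -[leRHS]mulr1 ler_wpM2l ?powR_ge0// /ind indicE.
    by case: (_ \in _); rewrite ?ler01 ?lexx.
  apply: ler_wpDl => //; rewrite /far ler_wpM2r//; apply: ler_powRN; rewrite ?(ltW c0)//.
  by rewrite lerD2l ler_pXn2r// ?nnegrE ltW.
rewrite int_ind// leeD2l// -EFinM lee_fin /m mulrA ler_wpM2r ?invr_ge0 ?mulr_ge0 ?(ltW c0)//.
have -> : S `^ (2 * (alpha + 1)) = (S ^+ 2) `^ (alpha + 1).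
  by rewrite -powR_mulrn ?(ltW S0)// -powRrM.
rewrite /k powRN mulrC ler_pdivrMr ?powR_gt0// -powRM ?(ltW A0) ?(ltW (sq_gt0 S'))// E.
by apply: ge0_ler_powR; rewrite ?nnegrE ?sqr_ge0 ?(ltW c0) ?(ltW (sq_gt0 _))// lerDr.
Qed.

(** Testing on the power 1/p of the density (1 + r^2)^-(alpha+1) cut off at S: up to a
    constant its potential is at least (1 + r^2)^(-sigma - (alpha+1)/p), hence at least
    the power 1/q of the same density cut off at S'. The mass l of the density tends to
    infinity with S, and by [far_shrink] the second cut-off costs a bounded part of it;
    so l^(1/q) would be at most a constant times l^(1/p), against 1/p < 1/q. *)
Lemma necessary_far : (alpha + 1) * (y - x) < sigma.
Proof.
have [x0 x1 y0 y1] := xy1; rewrite ltNge; apply/negP => H.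
have [A [k [A1 k0 Hk]]] := potential_ge_far a12 s0.
have A0 : 0 < A by apply: lt_le_trans A1.
have xy : 0 < y - x by rewrite -(pmulr_rgt0 _ c0); apply: lt_le_trans H.
pose k' := k * A `^ (- ((alpha + 1) * x)); have k'0 : 0 < k' by rewrite mulr_gt0// powR_gt0.
pose D := A `^ (alpha + 1) / (2 * (alpha + 1)).
have D0 : 0 < D by rewrite divr_gt0 ?powR_gt0// mulr_gt0.
pose z := C / k' * 2 `^ y + 1.
have z0 : 0 < z by rewrite addr_gt0// mulr_gt0 ?powR_gt0// divr_gt0.
(* The mass l has to exceed twice the loss D, to beat the constants, and to force
   A < S. *)
pose M := Num.max (2 * D) (Num.max (z `^ (y - x)^-1) (m A + 1)).
have [S [S1 HS]] := far_large M; have S0 : 0 < S by apply: lt_trans S1.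
have [l [l0 lE]] := far_fin S0.
have Ml : M <= l by rewrite -lee_fin -lE.
have lD : 2 * D <= l by apply: le_trans Ml; rewrite le_max lexx.
have lz : z `^ (y - x)^-1 <= l by apply: le_trans Ml; rewrite !le_max lexx orbT.
have lp : 0 < l by apply: lt_le_trans lD; rewrite mulr_gt0.
have AS : A < S.
  rewrite ltNge; apply/negP => SA.
  have : m A + 1 <= m A; last by rewrite gerDl ler10.
  apply: (@le_trans _ _ l); first by apply: le_trans Ml; rewrite !le_max lexx !orbT.
  rewrite -lee_fin -lE -int_ind//; apply: ge0_le_integral => //.
  - by move=> t _; rewrite lee_fin.
  - exact: measurable_farE.
  - by apply/measurable_EFinP; exact: measurable_ind.
  move=> t _; rewrite lee_fin /far -[leRHS]mul1r; apply: ler_pM => //.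
  + exact: powR_ge0.
  + by have := ler_powRN (ltW c0) ltr01 (sq1 t); rewrite powR1.
  rewrite /ind !indicE ler_nat; case: (boolP (t \in `]-oo, S]%classic)) => //.
  by rewrite inE/= in_itv/= => tS; rewrite mem_set//= in_itv/= (le_trans tS SA).
have AS2 : A < 1 + S ^+ 2.
  by apply: (lt_le_trans AS); rewrite expr2; nra.
pose S' := Num.sqrt ((1 + S ^+ 2) / A - 1).
have S'E : S' ^+ 2 = (1 + S ^+ 2) / A - 1.
  by rewrite sqr_sqrtr// subr_ge0 ler_pdivlMr// mul1r ltW.
have S'0 : 0 < S' by rewrite sqrtr_gt0 subr_gt0 ltr_pdivlMr// mul1r.
have E : A * (1 + S' ^+ 2) = 1 + S ^+ 2.
  by rewrite S'E addrC subrK mulrC divfK// gt_eqF.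
have [l' [l'0 l'E]] := far_fin S'0.
have ll' : l / 2 <= l'.
  by have := far_shrink A1 S0 E S'0; rewrite lE l'E -/D -EFinD lee_fin; lra.
pose f t := (1 + t ^+ 2) `^ (- ((alpha + 1) * x)) * ind S t.
have f0 t : 0 <= f t by exact: mulr_ge0 (powR_ge0 _ _) (ind_ge0 _ _).
have mf : measurable_fun setT f by exact: measurable_funM (measurable_sq _) (measurable_ind S).
have T : k' * l' `^ y <= C * l `^ x.
  apply: (@potential_test f (far S) (far S') `]-oo, S']%classic) => //.
  - move=> t; rewrite /f /far powRM ?powR_ge0// -powRrM mulNr.
    by rewrite ler_wpM2l ?powR_ge0.
  - by rewrite lE.
  - exact: ball_gt0.
  - by move=> t At; rewrite /far ind0// mulr0.
  - exact: ltW.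
  - move=> r /=; rewrite in_itv/= => rS' r0.
    have rr2 : r ^+ 2 <= S' ^+ 2 by rewrite ler_pXn2r// nnegrE ltW.
    have Ar : A * (1 + r ^+ 2) <= 1 + S ^+ 2 by rewrite -E ler_wpM2l ?(ltW A0)// lerD2l.
    have A0r : 0 < A * (1 + r ^+ 2) by rewrite mulr_gt0.
    have Nx0 : 0 <= (alpha + 1) * x by rewrite mulr_ge0// ltW.
    have := Hk f ((A * (1 + r ^+ 2)) `^ (- ((alpha + 1) * x))) r f0 mf (powR_ge0 _ _) r0.
    have far_f t : 0 < t -> 1 + t ^+ 2 <= A * (1 + r ^+ 2) ->
        (A * (1 + r ^+ 2)) `^ (- ((alpha + 1) * x)) <= f t.
      move=> t0 tr; rewrite /f ind1 ?mulr1; first exact: ler_powRN.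
      rewrite -(@ler_pXn2r _ 2) ?nnegrE ?(ltW t0) ?(ltW S0)//.
      by rewrite -(lerD2l 1); exact: le_trans Ar.
    move=> /(_ far_f); apply: le_trans; rewrite lee_fin.
    rewrite /far ind1// mulr1 -powRrM powRM ?(ltW A0) ?(ltW (sq_gt0 r))//.
    rewrite /k' -!mulrA ler_wpM2l ?(ltW k0)// ler_wpM2l ?powR_ge0// -powRDp//.
    by apply: ler_powR => //; rewrite mulNr; move: H; rewrite mulrBr; lra.
  - by rewrite l'E.
have Tl : k' * (l / 2) `^ y <= C * l `^ x.
  apply: le_trans T; rewrite ler_wpM2l ?(ltW k'0)//.
  by apply: ge0_ler_powR; rewrite ?nnegrE ?divr_ge0 ?(ltW lp).
have lx : 0 < l `^ x by rewrite powR_gt0.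
move: Tl; rewrite powR_div ?(ltW lp)//.
rewrite (_ : l `^ y = l `^ (y - x) * l `^ x); last by rewrite -powRDp// subrK.
rewrite (_ : k' * _ = k' * l `^ (y - x) / 2 `^ y * l `^ x); last by ring.
rewrite ler_pM2r// ler_pdivrMr ?powR_gt0// mulrC -ler_pdivlMr// => Tl.
have : z <= l `^ (y - x).
  exact: powR_ge_root (ltW z0) xy lz.
rewrite leNgt; move/negP; apply; apply: (le_lt_trans Tl); rewrite /z mulrAC.
by rewrite ltrDl.
Qed.

Theorem admissible_of_vector_bound : admissible sigma alpha p q.
Proof.
have [pE _] := fine_inve p1; have [qE _] := fine_inve q1.
have ub := necessary_ball; have lb := necessary_far.
split.
- rewrite pE qE -EFinB lee_fin -/x -/y; move: ub; rewrite mulrC -ler_pdivlMr//; lra.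
- rewrite pE qE -EFinD lte_fin -/x -/y; move: lb; rewrite mulrC -ltr_pdivlMr//; lra.
- move=> [p1' q1']; apply: necessary_p1; first by rewrite /x p1' inve1.
  have Ns : 0 < alpha + 1 - sigma by rewrite subr_gt0.
  rewrite /x /y p1' q1' inve1 inver gt_eqF ?divr_gt0//= invf_div.
  by field; rewrite gt_eqF.
- move=> [pE' qE']; apply: necessary_qoo; first by rewrite /y qE' invey.
  rewrite /x pE' inver gt_eqF ?divr_gt0//= invf_div.
  by field; rewrite gt_eqF.
Qed.

End necessity.


Theorem theorem2p3 (R : realType) (sigma alpha : R) (p q : \bar R)
  (hsigma : 0 < sigma) (hsigma_alpha : sigma < alpha + 1)
  (halpha : - (1 / 2) <= alpha) (hp : (1 <= p)%E) (hq : (1 <= q)%E) :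
  exists C : R, 0 < C /\
    forall (a : R) (s : \bar R), 1 <= a -> (1 <= s)%E ->
      ((exists C' : R, 0 < C' /\ vector_bound sigma alpha a p q s C') <->
         admissible sigma alpha p q) /\
      (admissible sigma alpha p q -> vector_bound sigma alpha a p q s C).
Proof.
have nec a s : (1 <= s)%E ->
    (exists C' : R, 0 < C' /\ vector_bound sigma alpha a p q s C') -> admissible sigma alpha p q.
  by move=> s1 [C' [C'0 H]]; exact: admissible_of_vector_bound H.
have [adm|nadm] := pselect (admissible sigma alpha p q).
  have [C [C0 HC]] := vector_bound_of_admissible hsigma hsigma_alpha halpha hp hq adm.
  exists C; split=> // a s a1 s1; split; last by move=> _; exact: HC.
  by split=> [|_]; [exact: nec|exists C; split=> //; exact: HC].
exists 1; split=> // a s a1 s1; split; last by [].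
by split=> [|//]; exact: nec.
Qed.
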